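(* Fix an integer $p\ge 2$ and $\boldsymbol\theta\in\mathcal{S}^{p-1}$. Let $(\kappa_n)$ be a positive real sequence that diverges to infinity. Let $(\boldsymbol\tau_n)$ be a bounded sequence in $\mathbb{R}^p$ such that $\boldsymbol\theta_n=\boldsymbol\theta+\nu_n\boldsymbol\tau_n\in\mathcal{S}^{p-1}$ for all $n$, with $\nu_n:=1/\sqrt{n\kappa_n\varphi_f(\kappa_n)}$. Assume that $f$ belongs to $\mathcal{F}_{\rm LAN}(p,\kappa_n,\|\boldsymbol\tau_n\|)$. Then, as $n\to\infty$ under ${\rm P}^{(n)}_{\boldsymbol\theta,\kappa_n,f}$, $$\Lambda_{\boldsymbol\theta+\nu_n\boldsymbol\tau_n/\boldsymbol\theta,\kappa_n,f}:=\log\frac{d{\rm P}^{(n)}_{\boldsymbol\theta+\nu_n\boldsymbol\tau_n,\kappa_n,f}}{d{\rm P}^{(n)}_{\boldsymbol\theta,\kappa_n,f}}=\boldsymbol\tau_n'\boldsymbol\Delta^{(n)}_{\boldsymbol\theta,f}-\frac12\boldsymbol\tau_n'\boldsymbol\Gamma_{\boldsymbol\theta}\boldsymbol\tau_n+o_{\rm P}(1),$$ where the central sequence $\boldsymbol\Delta^{(n)}_{\boldsymbol\theta,f}:=\nu_n^{-1}(\mathbf{I}_p-\boldsymbol\theta\boldsymbol\theta')\bar{\mathbf{X}}_n$, still under ${\rm P}^{(n)}_{\boldsymbol\theta,\kappa_n,f}$, is asymptotically normal with mean zero and covariance matrix $\boldsymbol\Gamma_{\boldsymbol\theta}:=\m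athbf{I}_p-\boldsymbol\theta\boldsymbol\theta'$.
   Context: $\mathcal{S}^{p-1}$ is the unit sphere of $\mathbb{R}^p$ and a prime denotes transposition of vectors. For a function $f$, $\varphi_f:=f'/f$ wherever $f$ is differentiable. The class $\mathcal{F}$ is the collection of functions $f:\mathbb{R}\to\mathbb{R}^+$ that (i) are monotone non-decreasing on $(-\infty,0]$ and monotone increasing on $[0,\infty)$; (ii) are differentiable in a neighborhood of $\infty$ (i.e., over $(M,\infty)$ for some $M$); (iii) are such that $\kappa\varphi_f(\kappa)$ diverges to infinity as $\kappa\to\infty$ and $\kappa\mapsto\kappa\varphi_f(\kappa)$ is monotone non-decreasing over $(M,\infty)$ for some $M$; and (iv) satisfy, for any $\xi,\zeta>-1$, $$\int_{-1}^1(1-s)^\xi(1+s)^\zeta\,\big|e^{\log f(\kappa s)-\log f(\kappa)}-e^{(s-1)\kappa\varphi_f(\kappa)}\big|\,ds=o\bigg(\frac{1}{(\kappa\varphi_f(\kappa))^{\xi+1}}\bigg)\quad\text{as }\kappa\to\infty.$$ For an integer $p\ge2$, a positive sequence $(\kappa_n)$ diverging to infinity and a bounded nonnegative sequence $(t_n)$, $\mathcal{F}_{\rm LAN}(p,\kappa_n,t_n)$ is the collection of functions $f\in\mathcal{F}$ such that, as $\kappa\to\infty$, $$\frac{1}{f(\kappa)}\int_{-1}^1\big(\varphi_f(\kappa s)-\varphi_f(\kappa)\big)^2(1-s^2)^{(p-3)/2}f(\kappa s)\,ds=o\bigg(\frac{1}{\kappa^{(p+1)/2}(\varphi_f(\kappa))^{(p-3)/2}}\bigg)$$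 and such that, letting $\nu_n:=1/\sqrt{n\kappa_n\varphi_f(\kappa_n)}$, $c_n:=(1-\frac14\nu_n^2t_n^2)^{1/2}$ and $h_n^\pm(s,w):=-\frac12t_n^2\kappa_n\nu_n^2s\pm c_nt_n\kappa_n\nu_n(1-s^2)^{1/2}w^{1/2}$, one has, for each choice of the sign $\pm$, $$\frac{1}{f(\kappa_n)}\int_{-1}^1\int_0^1\big|\log f(\kappa_ns+h_n^\pm(s,w))-\log f(\kappa_ns)-h_n^\pm(s,w)\varphi_f(\kappa_ns)\big|\,f(\kappa_ns)(1-s^2)^{(p-3)/2}\,dG_p(w)\,ds=o\bigg(\frac{1}{n(\kappa_n\varphi_f(\kappa_n))^{(p-1)/2}}\bigg)$$ as $n\to\infty$. Here, for $p\ge3$, $G_p$ is the cumulative distribution function of the ${\rm Beta}(\frac12,\frac{p-2}{2})$ distribution, and for $p=2$, $G_p$ is the cumulative distribution function of the Dirac distribution at $1$. (These conditions presuppose that the integrands are well defined almost everywhere; $\nu_n$ and $c_n$ are well defined for $n$ large enough.) For $\boldsymbol\vartheta\in\mathcal{S}^{p-1}$, ${\rm P}^{(n)}_{\boldsymbol\vartheta,\kappa_n,f}$ is the hypothesis (joint distribution) under which $\mathbf{X}_{n1},\ldots,\mathbf{X}_{nn}$ are mutually independent random vectors on $\mathcal{S}^{p-1}$ with common density, with respect to the surface area measure, $\mathbf{x}\mapsto\frac{c_{p,\kappa_n,f}\Gamma((p-1)/2)}{2\pi^{(p-1)/2}}f(\kappa_n\mathbf{x}'\boldsymbol\vartheta)$,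 where $c_{p,\kappa,f}:=1\big/\int_{-1}^1(1-s^2)^{(p-3)/2}f(\kappa s)\,ds$. Finally, $\bar{\mathbf{X}}_n:=\frac1n\sum_{i=1}^n\mathbf{X}_{ni}$. *)

(* Defs.v *)
From HB Require Import structures.
From mathcomp Require Import all_boot all_order all_algebra.
From mathcomp Require Import all_classical all_reals all_analysis.

Set Implicit Arguments.
Unset Strict Implicit.
Unset Printing Implicit Defensive.

Import Order.TTheory GRing.Theory Num.Theory.
Import numFieldNormedType.Exports.

Local Open Scope classical_set_scope.
Local Open Scope ring_scope.

(* Real matrices carry the sigma-algebra generated by their entries; on R^p it
   is the Borel one. *)
Section matrix_measurable.
Context (R : realType) (m n : nat).

Definition entries : set_system 'M[R]_(m, n) :=
  <<s \bigcup_(ij in [set: 'I_m * 'I_n])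
        preimage_set_system setT (fun M : 'M[R]_(m, n) => M ij.1 ij.2)
          (@measurable _ (measurableTypeR R)) >>.

Let entries0 : entries set0.
Proof. exact: sigma_algebra0. Qed.

Let entriesC A : entries A -> entries (~` A).
Proof. exact: sigma_algebraC. Qed.

Let entries_bigcup (F : (set 'M[R]_(m, n))^nat) :
  (forall i, entries (F i)) -> entries (\bigcup_i F i).
Proof. exact: sigma_algebra_bigcup. Qed.

HB.instance Definition _ := @isMeasurable.Build default_measure_display
  'M[R]_(m, n) entries entries0 entriesC entries_bigcup.

End matrix_measurable.

Section euclidean.
Context (R : realType) (p : nat).

Definition dot (x y : 'cV[R]_p) : R := (x^T *m y) 0 0.

Definition cnorm (x : 'cV[R]_p) : R := Num.sqrt (dot x x).

Definition unit_sphere : set 'cV[R]_p := [set x | cnorm x = 1].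

End euclidean.

Section tuple_measure.
Context d (T : measurableType d) (R : realType) (m : set T -> \bar R).

(* The n-fold product measure of m with itself, for m sigma-finite. *)
Fixpoint tuple_measure (n : nat) : set (n.-tuple T) -> \bar R :=
  match n with
  | 0 => \d_([tuple] : 0.-tuple T)
  | n'.+1 => pushforward (product_measure1 m (@tuple_measure n'))
               (fun z : T * n'.-tuple T => [tuple of z.1 :: z.2])
  end.

End tuple_measure.

Definition lebesgue_cV (R : realType) (p : nat) : set 'cV[R]_p -> \bar R :=
  pushforward (@tuple_measure _ _ _ (@lebesgue_measure R) p)
    (fun t : p.-tuple (measurableTypeR R) => \col_(i < p) (tnth t i : R)).

(* The surface area of A is p times the volume of the part of the unit ball
   lying in the cone over A (polar coordinates). It is a measure on R^p carried
   by the unit sphere. *)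
Definition surface_area (R : realType) (p : nat) (A : set 'cV[R]_p) : \bar R :=
  ((p%:R)%:E * lebesgue_cV
     [set x : 'cV[R]_p | (0 < cnorm x <= 1)%R /\ A ((cnorm x)^-1 *: x)%R])%E.

Section special_functions.
Context (R : realType).

Definition gamma_fun (a : R) : R :=
  \int[lebesgue_measure]_(x in `[0, +oo[) (x `^ (a - 1) * expR (- x)).

(* The library beta functions and distributions only have natural
   parameters. *)
Definition rbeta_fun (a b : R) : R :=
  \int[lebesgue_measure]_(x in `[0, 1]) (x `^ (a - 1) * (1 - x) `^ (b - 1)).

Definition rbeta_prob (a b : R) (A : set (measurableTypeR R)) : \bar R :=
  (\int[lebesgue_measure]_(x in A `&` `[0%R, 1%R])
     (x `^ (a - 1) * (1 - x) `^ (b - 1) / rbeta_fun a b)%:E)%E.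

(* The law with cumulative distribution function G_p. *)
Definition G_law (p : nat) : set (measurableTypeR R) -> \bar R :=
  if p == 2%N then \d_(1 : measurableTypeR R)
  else rbeta_prob 2^-1 ((p%:R - 2) / 2).

End special_functions.

(* u = o(v) along F, for an extended-real u: in the conditions below u is an
   integral whose finiteness is part of what is asserted. *)
Definition elittleo (R : realType) (T : Type) (F : set_system T)
    (u : T -> \bar R) (v : T -> R) : Prop :=
  forall e : R, 0 < e -> \forall x \near F, (`|u x| <= (e * `|v x|)%:E)%E.

Section angular_functions.
Context (R : realType).
Implicit Types (f : R -> R) (p : nat).

(* A monotone f is differentiable almost everywhere, so the arbitrary value of
   the derivative elsewhere does not affect the integrals below. *)
Definition varphi f (x : R) : R := (f^`()%classic) x / f x.

Definition class_F f : Prop :=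
  [/\ forall x, 0 < f x,
      {in `]-oo, 0] &, {homo f : x y / x <= y}} /\
        {in `[0, +oo[ &, {homo f : x y / x < y}},
      exists M, forall x, M < x -> derivable f x 1,
      (k * varphi f k @[k --> +oo] --> +oo) /\
        (exists M, {in `]M, +oo[ &,
           {homo (fun k => k * varphi f k) : x y / x <= y}}) &
      forall xi zeta : R, -1 < xi -> -1 < zeta ->
        elittleo +oo
          (fun k => (\int[lebesgue_measure]_(s in `[(-1)%R, 1%R])
             ((1 - s) `^ xi * (1 + s) `^ zeta *
              `|expR (ln (f (k * s)) - ln (f k))
                - expR ((s - 1) * (k * varphi f k))|)%:E)%E)
          (fun k => ((k * varphi f k) `^ (xi + 1))^-1)].

Definition nu f (kappa : nat -> R) (n : nat) : R :=
  (Num.sqrt (n%:R * kappa n * varphi f (kappa n)))^-1.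

Definition c_lan f (kappa t : nat -> R) (n : nat) : R :=
  Num.sqrt (1 - 4^-1 * nu f kappa n ^+ 2 * t n ^+ 2).

Definition h_lan f (kappa t : nat -> R) (minus : bool) (n : nat) (s w : R) : R :=
  - (2^-1 * t n ^+ 2 * kappa n * nu f kappa n ^+ 2 * s)
  + (-1) ^+ minus * (c_lan f kappa t n * t n * kappa n * nu f kappa n
                     * Num.sqrt (1 - s ^+ 2) * Num.sqrt w).

Definition class_F_LAN p (kappa t : nat -> R) f : Prop :=
  [/\ class_F f,
      elittleo +oo
        (fun k => (((f k)^-1)%:E *
           \int[lebesgue_measure]_(s in `[(-1)%R, 1%R])
             ((varphi f (k * s) - varphi f k) ^+ 2
              * (1 - s ^+ 2) `^ ((p%:R - 3) / 2) * f (k * s))%:E)%E)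
        (fun k => (k `^ ((p%:R + 1) / 2)
                   * varphi f k `^ ((p%:R - 3) / 2))^-1) &
      forall minus : bool,
        elittleo \oo
          (fun n => (((f (kappa n))^-1)%:E *
             \int[lebesgue_measure]_(s in `[(-1)%R, 1%R])
             \int[@G_law R p]_(w in `[0%R, 1%R])
               (`|ln (f (kappa n * s + h_lan f kappa t minus n s w))
                  - ln (f (kappa n * s))
                  - h_lan f kappa t minus n s w * varphi f (kappa n * s)|
                * f (kappa n * s) * (1 - s ^+ 2) `^ ((p%:R - 3) / 2))%:E)%E)
          (fun n => (n%:R * (kappa n * varphi f (kappa n))
                              `^ ((p%:R - 1) / 2))^-1)].

Definition c_norm p (k : R) f : R :=
  (\int[lebesgue_measure]_(s in `[(-1)%R, 1%R])
     ((1 - s ^+ 2) `^ ((p%:R - 3) / 2) * f (k * s)))^-1.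

Definition rot_density p (vartheta : 'cV[R]_p) (k : R) f (x : 'cV[R]_p) : R :=
  c_norm p k f * gamma_fun ((p%:R - 1) / 2) / (2 * pi `^ ((p%:R - 1) / 2))
  * f (k * dot x vartheta).

End angular_functions.

Section probability_notions.
Context (R : realType).

Definition mutually_independent d d' (T : measurableType d)
    (T' : measurableType d') (I : finType) (P : probability T R)
    (X : I -> T -> T') : Prop :=
  forall (J : {set I}) (A : I -> set T'),
    (forall i, measurable (A i)) ->
    P (\bigcap_(i in [set` J]) (X i @^-1` A i)) =
    (\prod_(i in J) P (X i @^-1` A i))%E.

Definition has_density d d' (T : measurableType d) (T' : measurableType d')
    (P : probability T R) (X : T -> T') (m : set T' -> \bar R) (g : T' -> R) :
    Prop :=
  forall A, measurable A -> P (X @^-1` A) = (\int[m]_(x in A) (g x)%:E)%E.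

(* P is the joint distribution of the sample, on the canonical space whose
   coordinates are the observations. *)
Definition hypothesis_law (p n : nat) (vartheta : 'cV[R]_p) (k : R)
    (f : R -> R) (P : probability (n.-tuple 'cV[R]_p) R) : Prop :=
  mutually_independent P (fun (i : 'I_n) (x : n.-tuple 'cV[R]_p) => tnth x i) /\
  forall i : 'I_n, has_density P (fun x : n.-tuple 'cV[R]_p => tnth x i)
                     (@surface_area R p) (rot_density vartheta k f).

Definition cvg_prob0 (d : nat -> measure_display)
    (T : forall n, measurableType (d n)) (P : forall n, probability (T n) R)
    (Y : forall n, T n -> \bar R) : Prop :=
  forall e : R, 0 < e ->
    P n [set x | (e%:E < `|Y n x|)%E] @[n --> \oo] --> 0%E.

Definition cvg_in_law (p : nat) (d : nat -> measure_display)
    (T : forall n, measurableType (d n)) (P : forall n, probability (T n) R)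
    (X : forall n, T n -> 'cV[R]_p) (mu : probability 'cV[R]_p R) : Prop :=
  forall g : 'cV[R]_p -> R, continuous g ->
    (exists M : R, forall x, `|g x| <= M) ->
    \int[P n]_x g (X n x) @[n --> \oo] --> \int[mu]_x g x.

(* The library normal_prob takes a standard deviation, and is not a point mass
   when it vanishes. *)
Definition normal_law (m v : R) : set (measurableTypeR R) -> \bar R :=
  if v == 0 then \d_(m : measurableTypeR R) else normal_prob m (Num.sqrt v).

(* The law N_p(m, Sigma), Sigma possibly singular: every linear form u'X is
   N(u'm, u' Sigma u). *)
Definition multinormal (p : nat) (m : 'cV[R]_p) (Sigma : 'M[R]_p)
    (mu : probability 'cV[R]_p R) : Prop :=
  forall (u : 'cV[R]_p) (A : set (measurableTypeR R)), measurable A ->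
    mu ((fun x => dot u x) @^-1` A) =
    normal_law (dot u m) (dot u (Sigma *m u)) A.

Definition log_lik_ratio d (T : measurableType d) (Q P : probability T R)
    (x : T) : \bar R :=
  lne (Radon_Nikodym (charge_of_finite_measure Q) P x).

End probability_notions.

Section central_sequence.
Context (R : realType) (p : nat).

Definition Gamma_mx (theta : 'cV[R]_p) : 'M[R]_p := 1%:M - theta *m theta^T.

Definition sample_mean (n : nat) (x : n.-tuple 'cV[R]_p) : 'cV[R]_p :=
  n%:R^-1 *: \sum_(i < n) tnth x i.

Definition Delta (f : R -> R) (kappa : nat -> R) (theta : 'cV[R]_p) (n : nat)
    (x : n.-tuple 'cV[R]_p) : 'cV[R]_p :=
  (nu f kappa n)^-1 *: (Gamma_mx theta *m sample_mean x).

End central_sequence.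

(* Main.v *)
(* Write an observation as [X = U theta + (1 - U^2)^(1/2) S], with [U = X'theta]
   and [S] a unit vector orthogonal to [theta]. Polar coordinates for the cone
   measure [surface_area] give the joint law of [U] and of one coordinate of
   [S]; the latter is symmetric given [U] and its square has law [G_p].
   Condition (iv) of class_F compares [f (kappa s) / f kappa] with an
   exponential, so moments of [1 - U^2] follow from a Gamma integral: with
   [lam = kappa varphi(kappa)], [lam E(1 - U^2) -> p - 1].

   Likelihood: expanding the log-likelihood ratio to first order, the remainders
   vanish in L1 by the last condition of class_F_LAN, the replacement of
   [varphi(kappa U)] by [varphi(kappa)] costs a centered sum that vanishes in L2
   by the other condition, and what is left is the central sequence plus a term
   converging to the quadratic form because [U -> 1] in L1.

   Central sequence: linear forms [z'Delta] are sums of i.i.d. symmetric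
   variables, so [E cos (z'Delta + a) = (E cos Y)^n cos a], and the second and
   fourth moments of [Y] make this converge to the transform of [Gamma Z], [Z]
   standard Gaussian. Smoothing a law by a small Gaussian gives it a density
   that is an integral of such cosines; convergence of these densities, followed
   by Lipschitz approximation from below, gives weak convergence. *)
From HB Require Import structures.
Require Import Defs.
From mathcomp Require Import all_boot all_order all_algebra.
From mathcomp Require Import all_classical all_reals all_analysis.
From mathcomp Require Import measurable_realfun ring lra.

Set Implicit Arguments.
Unset Strict Implicit.
Unset Printing Implicit Defensive.

Import Order.TTheory GRing.Theory Num.Theory.
Import numFieldNormedType.Exports.

Local Open Scope classical_set_scope.
Local Open Scope ring_scope.

(** * Densities and change of variables *)

(** Nearly every integrand is nonnegative and extended-real valued, so that Tonelli and monotone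
    convergence apply before any finiteness is known. This dictates several forms: cosine transforms
    are carried as integrals of [1 + cos], the phase [a] in [cos (a + z'x)] stands in for the sine
    part, and odd parts are removed by averaging over a symmetry. The constants of polar
    coordinates, the Gamma factor of the density and the Beta constant are never evaluated: total
    mass one makes what is left of them finite and positive, and they cancel. Directions are moved
    by Householder reflections, so the only invariance of Lebesgue measure used beyond translations
    and dilations is under linear isometric involutions. Limits are taken along [n.+1]: the empty
    sample has no marginal, and at [n = 0] the rate [nu] is 0 through [0^-1 = 0]. The score
    [varphi f] must be measurable on the whole line although differentiability is assumed near
    infinity only; this is extracted from the monotonicity of [f]. *)

Section density.
Local Open Scope ereal_scope.
Context d (T : measurableType d) (R : realType).
Variables (m mu : {measure set T -> \bar R}) (g : T -> R).
Hypothesis g0 : forall x, (0 <= g x)%R.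
Hypothesis mg : measurable_fun setT g.
Hypothesis mE : forall A, measurable A -> m A = \int[mu]_(x in A) (g x)%:E.

Import HBNNSimple.

(** Simple functions increasing to [h] reduce the formula, by monotone convergence on both sides, to
    indicators, where it is [mE]. It starts from the values of [m] on measurable sets, the form in
    which [has_density] is given. *)
Lemma ge0_integral_density (h : T -> \bar R) : (forall x, 0 <= h x) ->
  measurable_fun setT h -> \int[m]_x h x = \int[mu]_x (h x * (g x)%:E).
Proof.
move=> h0 mh; pose k := nnsfun_approx measurableT mh.
have kh x : (EFin \o k n) x @[n --> \oo] --> h x.
  by apply: cvg_nnsfun_approx => //.
transitivity (limn (fun n => \int[m]_x (k n x)%:E)).
  rewrite -monotone_convergence//.
  - by apply: eq_integral => x _; apply/esym/cvg_lim => //; exact: kh.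
  - by move=> n; exact/measurable_EFinP.
  - by move=> n x _; rewrite lee_fin.
  - by move=> x _ a b ab; rewrite lee_fin; exact/lefP/nd_nnsfun_approx.
transitivity (limn (fun n => \int[mu]_x ((k n x)%:E * (g x)%:E))); last first.
  rewrite -monotone_convergence//.
  - apply: eq_integral => x _; apply/cvg_lim => //.
    by apply: cvgeZr => //; exact: kh.
  - by move=> n; apply: emeasurable_funM; exact/measurable_EFinP.
  - by move=> n x _; rewrite mule_ge0 ?lee_fin.
  - move=> x _ a b ab; rewrite lee_wpmul2r ?lee_fin//.
    exact/lefP/nd_nnsfun_approx.
congr (limn _); apply/funext => n.
under eq_integral do rewrite fimfunE -fsumEFin//.
rewrite ge0_integral_fsum//; last 2 first.
  - by move=> r; exact/measurable_EFinP/measurableT_comp.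
  - by move=> r x _; rewrite nnfun_muleindic_ge0.
under [RHS]eq_integral => x _.
  rewrite fimfunE -fsumEFin// ge0_mule_fsuml; last first.
    by move=> r; rewrite nnfun_muleindic_ge0.
  over.
rewrite ge0_integral_fsum//; last 2 first.
  - move=> r; apply: emeasurable_funM; last exact/measurable_EFinP.
    exact/measurable_EFinP/measurableT_comp.
  - by move=> r x _; apply: mule_ge0; [exact: nnfun_muleindic_ge0|rewrite lee_fin].
apply: eq_fsbigr => r /[!inE] -[x _ rE].
have r0 : (0 <= r)%R by rewrite -rE.
under eq_integral do rewrite EFinM.
under [RHS]eq_integral do rewrite EFinM -muleA.
rewrite ge0_integralZl//; last first.
- by exact/measurable_EFinP/measurable_indic/measurable_sfunP.
rewrite ge0_integralZl//; last 2 first.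
- apply: emeasurable_funM; last exact/measurable_EFinP.
  apply/measurable_EFinP; exact/measurable_indic/measurable_sfunP.
- by move=> y _; rewrite mule_ge0 ?lee_fin.
congr *%E; rewrite integral_indic// setIT mE; last exact: measurable_sfunP.
rewrite [RHS](_ : _ = \int[mu]_x (((EFin \o g) \_ (k n @^-1` [set r])) x)).
  by rewrite -integral_mkcond.
apply: eq_integral => y _; rewrite muleC epatch_indic//.
Qed.

End density.

Lemma measure_of_density d (T : measurableType d) (R : realType)
    (mu : {measure set T -> \bar R}) (g : T -> R) :
  (forall x, 0 <= g x) -> measurable_fun setT g ->
  exists m : {measure set T -> \bar R},
    forall A, m A = (\int[mu]_(x in A) (g x)%:E)%E.
Proof.
move=> g0 mg; pose nu A := (\int[mu]_(x in A) (g x)%:E)%E.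
have nu0 : nu set0 = 0%E by rewrite /nu integral_set0.
have nu_ge0 A : (0 <= nu A)%E by apply: integral_ge0 => x _; rewrite lee_fin.
have nusa : semi_sigma_additive nu.
  move=> F mF tF mUF; rewrite [X in _ --> X](_ : _ = (\sum_(i <oo) nu (F i))%E).
    by apply: is_cvg_ereal_nneg_natsum_cond => n _ _; exact: nu_ge0.
  rewrite /nu ge0_integral_bigcup//.
    by apply/measurable_EFinP; exact: measurable_funTS.
  by move=> x _; rewrite lee_fin.
pose nuM := isMeasure.Build _ _ _ nu nu0 nu_ge0 nusa.
by exists (HB.pack_for {measure set T -> \bar R} nu nuM).
Qed.

(** Here [m] is a bare set function, which is how laws such as [G_law] are defined. *)
Lemma ge0_integral_densityE d (T : measurableType d) (R : realType)
    (m : set T -> \bar R) (mu : {measure set T -> \bar R}) (g : T -> R) :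
  (forall x, 0 <= g x) -> measurable_fun setT g ->
  (forall A, m A = (\int[mu]_(x in A) (g x)%:E)%E) ->
  forall h : T -> \bar R, (forall x, 0 <= h x)%E -> measurable_fun setT h ->
  (\int[m]_x h x = \int[mu]_x (h x * (g x)%:E))%E.
Proof.
move=> g0 mg mE h h0 mh; have [m' m'E] := measure_of_density mu g0 mg.
rewrite -(ge0_integral_density g0 mg (m := m'))//.
by rewrite (_ : m = m')//; apply/funext => A; rewrite mE m'E.
Qed.

Lemma measure_of_pushforward d d' (T1 : measurableType d)
    (T2 : measurableType d') (R : realType) (mu : {measure set T1 -> \bar R})
    (f : T1 -> T2) : measurable_fun setT f ->
  exists m : {measure set T2 -> \bar R},
    m = pushforward mu f :> (set T2 -> \bar R).
Proof.
move=> mf.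
by unshelve refine (ex_intro _ (pushforward mu f : {measure set T2 -> \bar R}) _).
Qed.

Section substitution.
Context (R : realType).
Notation leb := (@lebesgue_measure R).
Variables (I : interval R) (F F' K : R -> R).
Hypothesis oI : open [set` I].
Hypothesis mF : measurable_fun setT F.
Hypothesis dF : {in I, forall x : R, is_derive x 1 F (F' x)}.
Hypothesis cF' : {in I, forall x : R, {for x, continuous F'}}.
Hypothesis F'0 : {in I, forall x, 0 <= F' x}.
Hypothesis KI : forall y, K y \in I.
Hypothesis FK : cancel K F.
Hypothesis KF : {in I, cancel F K}.
Hypothesis Kinc : {homo K : x y / x < y}.

Let w x := if x \in I then F' x else 0.

Let w0 x : 0 <= w x.
Proof. by rewrite /w; case: ifPn => // /F'0. Qed.

Let mI : measurable [set` I]. Proof. exact: measurable_itv. Qed.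

Let mw : measurable_fun setT w.
Proof.
rewrite (_ : w = F' \_ [set` I]); last first.
  by apply/funext => x; rewrite /w patchE mem_setE.
apply/(measurable_restrictT _ mI).
by apply: (open_continuous_measurable_fun oI) => x; rewrite inE => /cF'.
Qed.

Let Kmono : {mono K : x y / x <= y}.
Proof. exact: le_mono. Qed.

Let subI x y u : u \in `[K x, K y] -> u \in I.
Proof. by rewrite in_itv/= => /andP[xu uy]; apply: (@interval_is_interval R I (K x) (K y)) => //=; rewrite ?KI// xu uy. Qed.

(** Inside [I] the preimage of []x, y]] is []K x, K y]], where the fundamental theorem of calculus
    applies; outside [I] the weight [w] vanishes. *)
Let leb_sub x y : x < y ->
  (\int[leb]_(u in F @^-1` `]x, y]) (w u)%:E = (y - x)%:E)%E.
Proof.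
move=> xy; have Kxy := Kinc xy.
transitivity (\int[leb]_(u in `[K x, K y]) (F' u)%:E)%E.
  rewrite -integral_itv_obnd_cbnd; last first.
    apply/measurable_EFinP.
    have sub : `]K x, K y] `<=` [set` I].
      by move=> u /= /subset_itv_oc_cc; apply: subI.
    apply: (measurable_funS _ sub) => //.
    by apply: (open_continuous_measurable_fun oI) => u; rewrite inE => /cF'.
  rewrite integral_mkcond [RHS]integral_mkcond; apply: eq_integral => u _.
  rewrite !patchE /w.
  have -> : (u \in F @^-1` `]x, y]) = (x < F u <= y).
    by apply/idP/idP; rewrite inE/= in_itv.
  have -> : (u \in [set` `]K x, K y]]) = (u \in I) && (x < F u <= y).
    apply/idP/idP.
      rewrite inE/= => uK; have uI := subI (subset_itv_oc_cc uK).
      rewrite uI/=; move: uK; rewrite in_itv/= -{1 2}(KF uI).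
      by rewrite (leW_mono Kmono) Kmono.
    move=> /andP[uI] uK; rewrite inE/= in_itv/= -{1 2}(KF uI).
    by rewrite (leW_mono Kmono) Kmono.
  by case: (u \in I); case: (x < F u <= y).
rewrite (@continuous_FTC2 R F' F (K x) (K y))// ?FK//.
- apply: continuous_in_subspaceT => u; rewrite inE => /subI; exact: cF'.
- split.
  + by move=> u /subset_itv_oo_cc/subI/dF [].
  + apply: cvg_at_right_filter; apply: differentiable_continuous.
    by apply/derivable1_diffP; have [] := dF (KI x).
  + apply: cvg_at_left_filter; apply: differentiable_continuous.
    by apply/derivable1_diffP; have [] := dF (KI y).
- by move=> u /subset_itv_oo_cc/subI/dF duF; rewrite derive1E; apply: derive_val.
Qed.

(** The image under [F] of the measure with density [F'] on [I] gives every interval []x, y]] its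
    length, hence is Lebesgue measure by uniqueness. [F] maps [I] onto the whole line, with inverse
    [K], and [I] may be unbounded. *)
Lemma ge0_integral_substitution (G : R -> \bar R) :
  measurable_fun setT G -> (forall y, 0 <= G y)%E ->
  (\int[leb]_y G y = \int[leb]_(u in [set` I]) (G (F u) * (F' u)%:E))%E.
Proof.
move=> mG G0.
have [nu nuE] := measure_of_density leb w0 mw.
have [nuF nuFE] := measure_of_pushforward (T2 := measurableTypeR R) nu mF.
have lebE A : measurable A -> leb A = nuF A.
  apply: (@lebesgue_measure_unique R nuF) => X; rewrite ocitvP => -[->|[[x y]/= xy ->]].
    by rewrite !measure0.
  rewrite nuFE /pushforward nuE leb_sub//.
  by rewrite lebesgue_measure_itv/= lte_fin xy.
transitivity (\int[nuF]_y G y)%E.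
  by apply: eq_measure_integral => A mA _; exact: lebE.
rewrite nuFE ge0_integral_pushforward//=.
rewrite preimage_setT.
have -> : (\int[nu]_x G (F x) = \int[leb]_x (G (F x) * (w x)%:E))%E.
  apply: (@ge0_integral_density _ _ _ nu leb w w0 mw) => //.
  exact: measurableT_comp.
rewrite [RHS]integral_mkcond; apply: eq_integral => u _ /=.
rewrite patchE /w; have -> : (u \in [set` I]) = (u \in I).
  by apply/idP/idP => [/set_mem//|uI]; exact: mem_set.
by case: ifPn => // _; rewrite mule0.
Qed.

End substitution.

(** * Lebesgue measure on column vectors *)

Section matrix_measurability.
Context (R : realType) (m n : nat).

Lemma measurable_entry (i : 'I_m) (j : 'I_n) :
  measurable_fun setT (fun M : 'M[R]_(m, n) => M i j).
Proof.
move=> _ A mA; rewrite setTI; apply: sub_sigma_algebra.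
by exists (i, j) => //; exists A => //; rewrite setTI.
Qed.

Lemma measurable_fun_mx d (T : measurableType d) (f : T -> 'M[R]_(m, n)) :
  (forall i j, measurable_fun setT (fun x => f x i j)) -> measurable_fun setT f.
Proof.
move=> mf; apply: (@measurability _ _ T 'M[R]_(m, n) setT f
  (\bigcup_(ij in [set: 'I_m * 'I_n])
        preimage_set_system setT (fun M : 'M[R]_(m, n) => M ij.1 ij.2)
          (@measurable _ (measurableTypeR R)))) => //.
move=> _ [_ [[i j] _ [A mA <-]] <-].
rewrite setTI setTI; rewrite -[X in measurable X]setTI; exact: (mf i j measurableT A mA).
Qed.

End matrix_measurability.

Section sigma_finite_measure_of.
Context d (T : measurableType d) (R : realType).
Variable mu : {measure set T -> \bar R}.

(** An alias of [mu] depending on the proof [sf], so that the sigma-finite structure can be inferred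
    from it. *)
Definition sigma_finite_measure_of (sf : sigma_finite setT mu) :
  set T -> \bar R := mu.

HB.instance Definition _ sf := isMeasure.Build _ _ _
  (sigma_finite_measure_of sf) (measure0 mu) (measure_ge0 mu)
  (@measure_semi_sigma_additive _ _ _ mu).

HB.instance Definition _ sf := Measure_isSigmaFinite.Build _ _ _
  (sigma_finite_measure_of sf) sf.

End sigma_finite_measure_of.

Section tuple_measure_theory.
Context d (T : measurableType d) (R : realType).
Variable m : {sigma_finite_measure set T -> \bar R}.
Notation tm n := (@tuple_measure _ _ _ m n).

Definition cons_pair n (z : T * n.-tuple T) : n.+1.-tuple T :=
  [tuple of z.1 :: z.2].

Definition uncons n (t : n.+1.-tuple T) : T * n.-tuple T :=
  (thead t, [tuple of behead t]).

Lemma measurable_cons_pair n : measurable_fun setT (@cons_pair n).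
Proof. exact: measurable_cons. Qed.

Lemma measurable_uncons n : measurable_fun setT (@uncons n).
Proof.
apply: measurable_fun_pair; last exact: measurable_behead.
exact: measurable_tnth.
Qed.

Lemma cons_pairK n : cancel (@cons_pair n) (@uncons n).
Proof.
by move=> [x t]; rewrite /uncons /cons_pair/= theadE; congr (_, _); apply: val_inj.
Qed.

(** The induction needs the lower-dimensional factor as a sigma-finite measure before any instance
    on [tuple_measure] exists, hence the existential. Products of two increasing exhaustions exhaust
    the product. *)
Lemma tuple_measure_sigma_finite n :
  exists M : {sigma_finite_measure set (n.-tuple T) -> \bar R},
    M = tm n :> (set (n.-tuple T) -> \bar R).
Proof.
elim: n => [|n [M ME]]; first by exists (dirac ([tuple] : 0.-tuple T)).
have [N NE] := measure_of_pushforward (m \x M)%E (@measurable_cons_pair n).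
have Nfin : sigma_finite setT N.
  have [F FT Foo] : sigma_finite setT (m \x M)%E.
    have /sigma_finiteP[F [TF ndF Foo]] := sigma_finiteT m.
    have /sigma_finiteP[G [TG ndG Goo]] := sigma_finiteT M.
    exists (fun i => F i `*` G i).
      rewrite -setXTT TF TG predeqE => -[x y]; split => [[[i _ Fi] [j _ Gj]]|].
        exists (maxn i j) => //; split => /=.
          by move: Fi => /=; move: x {Gj}; apply/subsetPset/ndF; rewrite leq_maxl.
        by move: Gj => /=; move: y {Fi}; apply/subsetPset/ndG; rewrite leq_maxr.
      by move=> [i _ [Fi Gi]]; split; exists i.
    move=> i; have [mF Fi] := Foo i; have [mG Gi] := Goo i; split.
      exact: measurableX.
    by rewrite product_measure1E// lte_mul_pinfty// ge0_fin_numE.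
  exists (fun i => @uncons n @^-1` F i).
    by rewrite -preimage_bigcup -FT.
  move=> i; have [mFi Fi] := Foo i; split.
    by rewrite -[X in measurable X]setTI; exact: measurable_uncons.
  rewrite NE /pushforward -comp_preimage (_ : _ \o _ = id)//.
  by apply/funext => z /=; rewrite cons_pairK.
exists (sigma_finite_measure_of Nfin).
by rewrite /sigma_finite_measure_of NE /= -ME.
Qed.

Let tm0 n : tm n set0 = 0%E.
Proof. by have [M <-] := tuple_measure_sigma_finite n; rewrite measure0. Qed.

Let tm_ge0 n A : (0 <= tm n A)%E.
Proof. by have [M <-] := tuple_measure_sigma_finite n; exact: measure_ge0. Qed.

Let tm_sa n : semi_sigma_additive (tm n).
Proof.
have [M <-] := tuple_measure_sigma_finite n.
exact: measure_semi_sigma_additive.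
Qed.

HB.instance Definition _ n := isMeasure.Build _ _ _ (tm n)
  (@tm0 n) (@tm_ge0 n) (@tm_sa n).

Let tm_sf n : sigma_finite setT (tm n).
Proof.
by have [M <-] := tuple_measure_sigma_finite n; exact: sigma_finiteT.
Qed.

HB.instance Definition _ n :=
  Measure_isSigmaFinite.Build _ _ _ (tm n) (@tm_sf n).

Lemma ge0_integral_tuple_measureS n (F : n.+1.-tuple T -> \bar R) :
  measurable_fun setT F -> (forall t, 0 <= F t)%E ->
  (\int[tm n.+1]_t F t =
   \int[m]_x \int[tm n]_t F [tuple of x :: t])%E.
Proof.
move=> mF F0; rewrite /= -/(@cons_pair n) ge0_integral_pushforward//; last first.
  exact: measurable_cons_pair.
rewrite preimage_setT (@fubini_tonelli1 _ _ _ _ _ m (tm n))//=.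
by apply: measurableT_comp => //; exact: measurable_cons_pair.
Qed.

End tuple_measure_theory.

Section euclidean_lebesgue.
Context (R : realType).
Notation leb := (@lebesgue_measure R).

Definition colt p (t : p.-tuple (measurableTypeR R)) : 'cV[R]_p :=
  \col_(i < p) (tnth t i : R).

Definition tcol p (x : 'cV[R]_p) : p.-tuple (measurableTypeR R) :=
  [tuple x i 0 | i < p].

Lemma measurable_colt p : measurable_fun setT (@colt p).
Proof.
apply: measurable_fun_mx => i j.
rewrite (_ : (fun _ => _) = (fun t => tnth t i)); first exact: measurable_tnth.
by apply/funext => t; rewrite mxE.
Qed.

Lemma measurable_tcol p : measurable_fun setT (@tcol p).
Proof.
apply/measurable_fun_tnthP => i.
rewrite (_ : _ \o _ = (fun x : 'cV[R]_p => x i 0)); first exact: measurable_entry.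
by apply/funext => x /=; rewrite tnth_mktuple.
Qed.

Lemma coltK p : cancel (@colt p) (@tcol p).
Proof. by move=> t; apply: eq_from_tnth => i; rewrite tnth_mktuple mxE. Qed.

Lemma lebesgue_cV_exists p : exists2 N : {measure set 'cV[R]_p -> \bar R},
   N = @lebesgue_cV R p :> (set _ -> \bar R) & sigma_finite setT N.
Proof.
have [N NE] := measure_of_pushforward (@tuple_measure _ _ _ leb p) (@measurable_colt p).
exists N => //.
have [F FT Foo] := sigma_finiteT (@tuple_measure _ _ _ leb p).
exists (fun i => @tcol p @^-1` F i); first by rewrite -preimage_bigcup -FT.
move=> i; have [mFi Fi] := Foo i; split.
  by rewrite -[X in measurable X]setTI; exact: measurable_tcol.
rewrite NE /pushforward -comp_preimage (_ : _ \o _ = id)//.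
by apply/funext => z /=; rewrite coltK.
Qed.

Let lc0 p : @lebesgue_cV R p set0 = 0%E.
Proof. by have [N <- _] := lebesgue_cV_exists p; rewrite measure0. Qed.

Let lc_ge0 p A : (0 <= @lebesgue_cV R p A)%E.
Proof. by have [N <- _] := lebesgue_cV_exists p; exact: measure_ge0. Qed.

Let lc_sa p : semi_sigma_additive (@lebesgue_cV R p).
Proof.
have [N <- _] := lebesgue_cV_exists p; exact: measure_semi_sigma_additive.
Qed.

HB.instance Definition _ p := isMeasure.Build _ _ _ (@lebesgue_cV R p)
  (@lc0 p) (@lc_ge0 p) (@lc_sa p).

Let lc_sf p : sigma_finite setT (@lebesgue_cV R p).
Proof. by have [N <-] := lebesgue_cV_exists p. Qed.

HB.instance Definition _ p :=
  Measure_isSigmaFinite.Build _ _ _ (@lebesgue_cV R p) (@lc_sf p).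

Definition consV p (x : R) (z : 'cV[R]_p) : 'cV[R]_p.+1 :=
  \col_i oapp (fun j => z j 0) x (unlift ord0 i).

Lemma consV0 p x (z : 'cV[R]_p) : consV x z ord0 0 = x.
Proof. by rewrite mxE unlift_none. Qed.

Lemma consVS p x (z : 'cV[R]_p) j : consV x z (lift ord0 j) 0 = z j 0.
Proof. by rewrite mxE liftK. Qed.

Lemma measurable_consV d (T : measurableType d) p (f : T -> R)
    (g : T -> 'cV[R]_p) : measurable_fun setT f -> measurable_fun setT g ->
  measurable_fun setT (fun x => consV (f x) (g x)).
Proof.
move=> mf mg; apply: measurable_fun_mx => i j; rewrite (ord1 j).
have [k ->|->] := unliftP ord0 i.
  rewrite (_ : (fun _ => _) = (fun x => (g x) k 0)); last first.
    by apply/funext => x; rewrite consVS.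
  by apply: (measurableT_comp (f := fun M : 'cV[R]_p => M k 0)) => //; exact: measurable_entry.
by rewrite (_ : (fun _ => _) = f)//; apply/funext => x; rewrite consV0.
Qed.

Lemma consV_eta p (x : 'cV[R]_p.+1) :
  x = consV (x ord0 0) (\col_j x (lift ord0 j) 0).
Proof.
apply/colP => i; have [k ->|->] := unliftP ord0 i; last by rewrite consV0.
by rewrite consVS mxE.
Qed.

Lemma ge0_integral_lebesgue_cVS p (F : 'cV[R]_p.+1 -> \bar R) :
  measurable_fun setT F -> (forall x, 0 <= F x)%E ->
  (\int[@lebesgue_cV R p.+1]_x F x =
   \int[leb]_x \int[@lebesgue_cV R p]_z F (consV x z))%E.
Proof.
move=> mF F0; have mc := @measurable_colt; have mFc := measurableT_comp mF (mc _).
rewrite /lebesgue_cV ge0_integral_pushforward//; last exact: mc.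
have -> := ge0_integral_tuple_measureS leb mFc (fun t => F0 _).
apply: eq_integral => x _.
have mFx : measurable_fun setT (fun z : 'cV[R]_p => F (consV x z)).
  by apply: (measurableT_comp mF); apply: measurable_consV; [exact: measurable_cst|exact: measurable_id].
rewrite ge0_integral_pushforward//; last exact: mc.
rewrite preimage_setT; apply: eq_integral => t _ /=; congr (F _).
apply/colP => i; rewrite mxE; have [k ->|->] := unliftP ord0 i.
  by rewrite consVS mxE tnthS.
by rewrite consV0 tnth0.
Qed.

Lemma ge0_integral_lebesgue_cV0 (F : 'cV[R]_0 -> \bar R) :
  measurable_fun setT F -> (forall x, 0 <= F x)%E ->
  (\int[@lebesgue_cV R 0]_x F x = F 0%R)%E.
Proof.
move=> mF F0; have mFc := measurableT_comp mF (@measurable_colt 0).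
rewrite /lebesgue_cV ge0_integral_pushforward//; last exact: measurable_colt.
transitivity (\int[\d_([tuple] : 0.-tuple (measurableTypeR R))]_x
  (F \o @colt 0) x)%E; first by [].
rewrite integral_dirac//.
by rewrite diracT mul1e; congr F; apply/colP => -[].
Qed.

Lemma ge0_integral_lebesgue_cV1 (F : 'cV[R]_1 -> \bar R) :
  measurable_fun setT F -> (forall x, 0 <= F x)%E ->
  (\int[@lebesgue_cV R 1]_x F x = \int[leb]_x F (consV x 0%R))%E.
Proof.
move=> mF F0; rewrite ge0_integral_lebesgue_cVS//; apply: eq_integral => x _.
rewrite ge0_integral_lebesgue_cV0//.
by apply: (measurableT_comp mF); apply: measurable_consV; [exact: measurable_cst|exact: measurable_id].
Qed.

End euclidean_lebesgue.

(** Inversion is written as [x] times the power [-1] of [x ^+ 2], so that measurability of [powR]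
    applies; at 0 both sides are 0. *)
Lemma measurable_funV d (T : measurableType d) (R : realType) (f : T -> R) :
  measurable_fun setT f -> measurable_fun setT (fun x => (f x)^-1).
Proof.
move=> mf; rewrite (_ : (fun _ => _) = (fun x => f x * (f x ^+ 2) `^ (-1))).
  apply: measurable_funM => //.
  apply: (measurableT_comp (measurable_powR (-1))); exact: measurable_funX.
apply/funext => x; rewrite powR_inv1 ?sqr_ge0//.
have [->|fx0] := eqVneq (f x) 0; first by rewrite invr0 mul0r.
by rewrite expr2 invfM mulVKf.
Qed.

Lemma measurable_fun_sqrt d (T : measurableType d) (R : realType) (f : T -> R) :
  measurable_fun setT f -> measurable_fun setT (fun x => Num.sqrt (f x)).
Proof.
move=> mf; apply: (measurableT_comp (f := @Num.sqrt R)) => //.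
by apply: continuous_measurable_fun; exact: sqrt_continuous.
Qed.

(** * Affine changes of variable on the line *)

Section line.
Context (R : realType).
Notation leb := (@lebesgue_measure R).
Variables (G : R -> \bar R).
Hypotheses (mG : measurable_fun setT G) (G0 : forall x, (0 <= G x)%E).

Lemma ge0_integral_affine (c a : R) : 0 < c ->
  (\int[leb]_x G x = \int[leb]_x (G (c * x + a)%R * c%:E))%E.
Proof.
move=> c0; rewrite (@ge0_integral_substitution R `]-oo, +oo[
  (fun x => c * x + a) (fun=> c) (fun y => (y - a) / c))//.
- by rewrite set_itvNyy.
- by apply: measurable_funD => //; exact: measurable_funM.
- move=> x _; apply: is_derive_eq; rewrite ?addr0 ?scaler0 /GRing.scale/= ?mulr1 ?mulr0 ?addr0//.
- by move=> x _; exact: cst_continuous.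
- by move=> x _; exact: ltW.
- by move=> y; rewrite mulrCA divff ?gt_eqF// mulr1 subrK.
- by move=> x _; rewrite addrK mulrC mulKf// gt_eqF.
- by move=> x y xy; rewrite ltr_pM2r ?invr_gt0// ltrD2r.
Qed.

Lemma ge0_integral_shift (a : R) :
  (\int[leb]_x G (x + a)%R = \int[leb]_x G x)%E.
Proof.
rewrite (ge0_integral_affine a ltr01); apply: eq_integral => x _.
by rewrite mule1 mul1r.
Qed.

Lemma ge0_integral_opp : (\int[leb]_x G (- x)%R = \int[leb]_x G x)%E.
Proof.
have mN : measurable_fun setT (-%R : R -> measurableTypeR R).
  exact: oppr_measurable.
rewrite [RHS](_ : _ = \int[pushforward leb (-%R : R -> measurableTypeR R)]_x G x)%E.
  by rewrite ge0_integral_pushforward//= preimage_setT.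
have [N NE] := measure_of_pushforward leb mN.
rewrite -NE; apply: eq_measure_integral => A mA _.
rewrite NE; exact/esym/lebesgue_measureN.
Qed.

End line.

(** * Inner product, reflections and isometry invariance of Lebesgue measure *)

Section vectors.
Context (R : realType).

Section algebra.
Context (p : nat).
Implicit Types x y z : 'cV[R]_p.

Lemma dotE x y : dot x y = \sum_i x i 0 * y i 0.
Proof. by rewrite /dot mxE; apply: eq_bigr => i _; rewrite mxE. Qed.

Lemma dotC x y : dot x y = dot y x.
Proof. by rewrite !dotE; apply: eq_bigr => i _; rewrite mulrC. Qed.

Lemma dotDl x y z : dot (x + y) z = dot x z + dot y z.
Proof. by rewrite /dot linearD/= mulmxDl mxE. Qed.

Lemma dotDr x y z : dot x (y + z) = dot x y + dot x z.
Proof. by rewrite dotC dotDl !(dotC x). Qed.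

Lemma dotZl c x y : dot (c *: x) y = c * dot x y.
Proof. by rewrite /dot linearZ/= -scalemxAl mxE. Qed.

Lemma dotZr c x y : dot x (c *: y) = c * dot x y.
Proof. by rewrite dotC dotZl dotC. Qed.

Lemma dotNl x y : dot (- x) y = - dot x y.
Proof. by rewrite -scaleN1r dotZl mulN1r. Qed.

Lemma dotNr x y : dot x (- y) = - dot x y.
Proof. by rewrite dotC dotNl dotC. Qed.

Lemma dotBl x y z : dot (x - y) z = dot x z - dot y z.
Proof. by rewrite dotDl dotNl. Qed.

Lemma dotBr x y z : dot x (y - z) = dot x y - dot x z.
Proof. by rewrite dotDr dotNr. Qed.

Lemma dot0l x : dot 0 x = 0.
Proof. by rewrite -(scale0r 0) dotZl mul0r. Qed.

Lemma dot0r x : dot x 0 = 0.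
Proof. by rewrite dotC dot0l. Qed.

Lemma dot_suml (I : Type) (s : seq I) (F : I -> 'cV[R]_p) y :
  dot (\sum_(i <- s) F i) y = \sum_(i <- s) dot (F i) y.
Proof.
by apply: (big_morph (fun x => dot x y)) => [u v|]; rewrite ?dotDl ?dot0l.
Qed.

Lemma dot_sumr (I : Type) (s : seq I) (F : I -> 'cV[R]_p) y :
  dot y (\sum_(i <- s) F i) = \sum_(i <- s) dot y (F i).
Proof. by rewrite dotC dot_suml; apply: eq_bigr => i _; rewrite dotC. Qed.

Lemma dot_ge0 x : 0 <= dot x x.
Proof. by rewrite dotE sumr_ge0// => i _; rewrite -expr2 sqr_ge0. Qed.

Lemma dot_eq0 x : (dot x x == 0) = (x == 0).
Proof.
apply/eqP/eqP => [|->]; last exact: dot0l.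
rewrite dotE => /eqP; rewrite psumr_eq0; last first.
  by move=> i _; rewrite -expr2 sqr_ge0.
move=> /allP xx; apply/colP => i; rewrite mxE.
by have := xx i (mem_index_enum _); rewrite mulf_eq0 orbb => /eqP.
Qed.

Lemma cnorm_ge0 x : 0 <= cnorm x.
Proof. exact: sqrtr_ge0. Qed.

Lemma sqr_cnorm x : cnorm x ^+ 2 = dot x x.
Proof. by rewrite sqr_sqrtr// dot_ge0. Qed.

Lemma cnorm_eq0 x : (cnorm x == 0) = (x == 0).
Proof. by rewrite -dot_eq0 -sqr_cnorm sqrf_eq0. Qed.

Lemma cnorm0 : cnorm (0 : 'cV[R]_p) = 0.
Proof. by apply/eqP; rewrite cnorm_eq0. Qed.

(** Cauchy-Schwarz, from the nonnegative squared length of [x] minus its projection on [y]. *)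
Lemma dot_sqr_le x y : dot x y ^+ 2 <= dot x x * dot y y.
Proof.
have [->|y0] := eqVneq y 0; first by rewrite !dot0r expr0n mulr0.
have yy : 0 < dot y y by rewrite lt_def dot_eq0 y0 dot_ge0.
have := dot_ge0 (x - (dot x y / dot y y) *: y).
rewrite dotBl !dotBr !dotZl !dotZr (dotC y x) => h.
rewrite -subr_ge0 -(pmulr_rge0 _ (x := (dot y y)^-1)) ?invr_gt0//.
move: h; congr (_ <= _); field; exact: lt0r_neq0.
Qed.

Lemma unit_sphereE x : unit_sphere x -> dot x x = 1.
Proof. by rewrite /unit_sphere/= -sqr_cnorm => ->; rewrite expr1n. Qed.

(* Householder reflection; for [a = 0] it is the identity, as [0^-1 = 0]. *)
Definition reflect_along a x := x - (2 * dot a x / dot a a) *: a.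

Lemma reflect_alongD a x y :
  reflect_along a (x + y) = reflect_along a x + reflect_along a y.
Proof.
by rewrite /reflect_along dotDr mulrDr mulrDl scalerDl opprD addrACA.
Qed.

Lemma dot_reflect_along a x y :
  dot (reflect_along a x) (reflect_along a y) = dot x y.
Proof.
rewrite /reflect_along; have [->|a0] := eqVneq a 0.
  by rewrite !scaler0 !subr0.
rewrite dotBl !dotBr !dotZl !dotZr (dotC x a); field.
by rewrite dot_eq0.
Qed.

Lemma reflect_along_dot_a a x : dot a (reflect_along a x) = - dot a x.
Proof.
rewrite /reflect_along; have [->|a0] := eqVneq a 0.
  by rewrite !dot0l oppr0.
rewrite dotBr dotZr; field; by rewrite dot_eq0.
Qed.

Lemma reflect_alongK a : involutive (reflect_along a).
Proof.
move=> x; rewrite {1}/reflect_along reflect_along_dot_a mulrN mulNr scaleNr opprK.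
by rewrite /reflect_along subrK.
Qed.

Lemma reflect_along_orth a x : dot a x = 0 -> reflect_along a x = x.
Proof. by move=> ax; rewrite /reflect_along ax mulr0 mul0r scale0r subr0. Qed.

(** For vectors of equal length the coefficient of the reflection along [x - y] is 1 at [x]. This is
    the device that carries a given direction to a coordinate axis. *)
Lemma reflect_along_sub x y : dot x x = dot y y -> reflect_along (x - y) x = y.
Proof.
move=> xy; have [/eqP|d0] := eqVneq (x - y) 0.
  by rewrite subr_eq0 => /eqP ->; rewrite subrr /reflect_along scaler0 subr0.
rewrite /reflect_along; have E : dot (x - y) (x - y) = 2 * dot (x - y) x.
  by rewrite !dotBl !dotBr (dotC y x) -xy; ring.
rewrite -E divff ?dot_eq0// scale1r opprB addrC subrK//.
Qed.

End algebra.

Lemma dot_consV p (a b : R) (x y : 'cV[R]_p) :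
  dot (consV a x) (consV b y) = a * b + dot x y.
Proof.
rewrite !dotE big_ord_recl !consV0; congr (_ + _).
by apply: eq_bigr => i _; rewrite !consVS.
Qed.

Lemma consVD p (a b : R) (x y : 'cV[R]_p) :
  consV a x + consV b y = consV (a + b) (x + y).
Proof.
by apply/colP => i; rewrite /consV !mxE; case: unlift => [k|]//=; rewrite mxE.
Qed.

Lemma consVZ p c (a : R) (x : 'cV[R]_p) :
  c *: consV a x = consV (c * a) (c *: x).
Proof.
by apply/colP => i; rewrite /consV !mxE; case: unlift => [k|]//=; rewrite mxE.
Qed.

Lemma consVN p (a : R) (x : 'cV[R]_p) : - consV a x = consV (- a) (- x).
Proof. by rewrite -scaleN1r consVZ mulN1r scaleN1r. Qed.

Section measurability.
Context (p : nat) d (T : measurableType d).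
Implicit Types (f g : T -> 'cV[R]_p) (c : T -> R).

Lemma measurable_fun_entry f i : measurable_fun setT f ->
  measurable_fun setT (fun x => f x i 0).
Proof.
move=> mf; apply: (measurableT_comp (f := fun M : 'cV[R]_p => M i 0)) => //.
exact: measurable_entry.
Qed.

Lemma measurable_fun_dot f g : measurable_fun setT f -> measurable_fun setT g ->
  measurable_fun setT (fun x => dot (f x) (g x)).
Proof.
move=> mf mg; rewrite (_ : (fun _ => _) =
  (fun x => \sum_i f x i 0 * g x i 0)); last first.
  by apply/funext => x; rewrite dotE.
by apply: measurable_sum => i; apply: measurable_funM; exact: measurable_fun_entry.
Qed.

Lemma measurable_fun_cnorm f : measurable_fun setT f ->
  measurable_fun setT (fun x => cnorm (f x)).
Proof. by move=> mf; apply: measurable_fun_sqrt; exact: measurable_fun_dot. Qed.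

Lemma measurable_fun_addV f g : measurable_fun setT f -> measurable_fun setT g ->
  measurable_fun setT (fun x => f x + g x).
Proof.
move=> mf mg; apply: measurable_fun_mx => i j; rewrite (ord1 j).
rewrite (_ : (fun _ => _) = (fun x => f x i 0 + g x i 0)).
  by apply: measurable_funD; exact: measurable_fun_entry.
by apply/funext => x; rewrite mxE.
Qed.

Lemma measurable_fun_scaleV c f : measurable_fun setT c -> measurable_fun setT f ->
  measurable_fun setT (fun x => c x *: f x).
Proof.
move=> mc mf; apply: measurable_fun_mx => i j; rewrite (ord1 j).
rewrite (_ : (fun _ => _) = (fun x => c x * f x i 0)).
  by apply: measurable_funM => //; exact: measurable_fun_entry.
by apply/funext => x; rewrite mxE.
Qed.

Lemma measurable_fun_oppV f : measurable_fun setT f ->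
  measurable_fun setT (fun x => - f x).
Proof.
move=> mf; rewrite (_ : (fun _ => _) = (fun x => -1 *: f x)).
  by apply: measurable_fun_scaleV => //; exact: measurable_cst.
by apply/funext => x; rewrite scaleN1r.
Qed.

Lemma measurable_fun_reflect a f : measurable_fun setT f ->
  measurable_fun setT (fun x => reflect_along a (f x)).
Proof.
move=> mf; apply: measurable_fun_addV => //; apply: measurable_fun_oppV.
apply: measurable_fun_scaleV; last exact: measurable_cst.
apply: measurable_funM; last exact: measurable_cst.
apply: measurable_funM; first exact: measurable_cst.
by apply: measurable_fun_dot => //; exact: measurable_cst.
Qed.

End measurability.

Notation leb := (@lebesgue_measure R).
Notation L p := (@lebesgue_cV R p).

Lemma measurable_integral_cV d (T : measurableType d) p
    (F : T * 'cV[R]_p -> \bar R) : measurable_fun setT F ->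
  (forall z, 0 <= F z)%E -> measurable_fun setT (fun x => \int[L p]_z F (x, z))%E.
Proof. by move=> mF F0; exact: (measurable_fun_fubini_tonelli_F (m2 := L p)). Qed.

Lemma ge0_integral_cV_shift p (F : 'cV[R]_p -> \bar R) a :
  measurable_fun setT F -> (forall x, 0 <= F x)%E ->
  (\int[L p]_x F (x + a)%R = \int[L p]_x F x)%E.
Proof.
elim: p F a => [|p IH] F a mF F0.
  have -> // : a = 0 by apply/colP => -[].
  by apply: eq_integral => x _; rewrite addr0.
have mFa : measurable_fun setT (fun x : 'cV[R]_p.+1 => F (x + a)).
  apply: (measurableT_comp mF); apply: measurable_fun_addV => //; exact: measurable_cst.
rewrite (ge0_integral_lebesgue_cVS mFa)// (ge0_integral_lebesgue_cVS mF F0).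
have mG : measurable_fun setT (fun x => \int[L p]_z F (consV x z))%E.
  apply: (measurable_integral_cV (F := fun w => F (consV w.1 w.2))) => //.
  by apply: (measurableT_comp mF); exact: measurable_consV.
rewrite -(ge0_integral_shift mG _ (a ord0 0)); last first.
  by move=> x; exact: integral_ge0.
apply: eq_integral => x _.
have mz : measurable_fun setT (fun z => F (consV (x + a ord0 0) z)).
  by apply: (measurableT_comp mF); apply: measurable_consV => //; exact: measurable_cst.
rewrite -(IH (fun z => F (consV (x + a ord0 0) z)) (\col_j a (lift ord0 j) 0))//.
apply: eq_integral => z _; congr F.
by rewrite {1}[a]consV_eta consVD.
Qed.

Lemma ge0_integral_cV_scale p (F : 'cV[R]_p -> \bar R) c : 0 < c ->
  measurable_fun setT F -> (forall x, 0 <= F x)%E ->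
  (\int[L p]_x F x = \int[L p]_x (F (c *: x)%R * (c ^+ p)%:E))%E.
Proof.
move=> c0; elim: p F => [|p IH] F mF F0.
  have E : (fun x => F (c *: x)%R * (c ^+ 0)%:E)%E = F.
    by apply/funext => x; rewrite expr0 mule1; congr F; apply/colP => -[].
  by rewrite E.
have mFc : measurable_fun setT (fun x : 'cV[R]_p.+1 => F (c *: x)).
  apply: (measurableT_comp mF); apply: measurable_fun_scaleV => //; exact: measurable_cst.
have mFx (x : R) : measurable_fun setT (fun z => F (consV x z)).
  by apply: (measurableT_comp mF); apply: measurable_consV => //; exact: measurable_cst.
rewrite !ge0_integral_lebesgue_cVS//; last 2 first.
- by apply: emeasurable_funM => //; exact: measurable_cst.
- by move=> x; rewrite mule_ge0// lee_fin exprn_ge0// ltW.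
have mG : measurable_fun setT (fun x => \int[L p]_z F (consV x z))%E.
  apply: (measurable_integral_cV (F := fun w => F (consV w.1 w.2))) => //.
  by apply: (measurableT_comp mF); exact: measurable_consV.
rewrite (ge0_integral_affine mG _ 0 c0); last first.
  by move=> x; exact: integral_ge0.
apply: eq_integral => x _; rewrite addr0 (IH _ (mFx _))//.
rewrite -ge0_integralZr//; last 3 first.
- apply: emeasurable_funM; last exact: measurable_cst.
  apply: (measurableT_comp (mFx _)); apply: measurable_fun_scaleV => //; exact: measurable_cst.
- by move=> z _; rewrite mule_ge0// lee_fin exprn_ge0// ltW.
- by rewrite lee_fin ltW.
apply: eq_integral => z _; rewrite -muleA -EFinM -exprSr; congr (F _ * _)%E.
by rewrite consVZ.
Qed.

Lemma ge0_integral_cV_opp p (F : 'cV[R]_p -> \bar R) :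
  measurable_fun setT F -> (forall x, 0 <= F x)%E ->
  (\int[L p]_x F (- x)%R = \int[L p]_x F x)%E.
Proof.
elim: p F => [|p IH] F mF F0.
  by apply: eq_integral => x _; congr F; apply/colP => -[].
have mFa : measurable_fun setT (fun x : 'cV[R]_p.+1 => F (- x)).
  by apply: (measurableT_comp mF); exact: measurable_fun_oppV.
rewrite (ge0_integral_lebesgue_cVS mFa)// (ge0_integral_lebesgue_cVS mF F0).
have mG : measurable_fun setT (fun x => \int[L p]_z F (consV x z))%E.
  apply: (measurable_integral_cV (F := fun w => F (consV w.1 w.2))) => //.
  by apply: (measurableT_comp mF); exact: measurable_consV.
rewrite -(ge0_integral_opp mG); last by move=> x; exact: integral_ge0.
apply: eq_integral => x _; rewrite -(IH (fun z => F (consV (- x) z)))//; last first.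
  by apply: (measurableT_comp mF); apply: measurable_consV => //; exact: measurable_cst.
by apply: eq_integral => z _; rewrite consVN.
Qed.

Definition gauss_density p (x : 'cV[R]_p) : R := \prod_i normal_pdf 0 1 (x i 0).

Lemma gauss_densityE p (x : 'cV[R]_p) :
  gauss_density x = normal_peak 1 ^+ p * expR (- dot x x / 2).
Proof.
rewrite /gauss_density; under eq_bigr do rewrite normal_pdfE ?oner_neq0//.
rewrite big_split/= prodr_const card_ord; congr (_ * _).
rewrite /normal_fun -expR_sum; congr expR; rewrite dotE mulNr mulr_suml -sumrN.
by apply: eq_bigr => i _; rewrite subr0 expr1n mulNr expr2.
Qed.

Lemma gauss_density_ge0 p (x : 'cV[R]_p) : 0 <= gauss_density x.
Proof. by apply: prodr_ge0 => i _; exact: normal_pdf_ge0. Qed.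

Lemma measurable_gauss_density p : measurable_fun setT (@gauss_density p).
Proof.
apply: measurable_prod => i _.
by apply: (measurableT_comp (measurable_normal_pdf 0 1)); exact: measurable_fun_entry.
Qed.

Lemma integral_gauss_density p : (\int[L p]_x (gauss_density x)%:E = 1)%E.
Proof.
have mg q : measurable_fun setT (EFin \o @gauss_density q).
  by apply/measurable_EFinP; exact: measurable_gauss_density.
elim: p => [|p IH].
  rewrite ge0_integral_lebesgue_cV0//; first by rewrite /gauss_density big_ord0.
  by move=> x; rewrite lee_fin gauss_density_ge0.
rewrite ge0_integral_lebesgue_cVS; last 2 first.
- exact: mg.
- by move=> x; rewrite lee_fin gauss_density_ge0.
rewrite -(integral_normal_pdf 0 1); apply: eq_integral => x _.
rewrite -[RHS]mule1 -IH -ge0_integralZl//; last 3 first.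
- exact: mg.
- by move=> z _; rewrite lee_fin gauss_density_ge0.
- by rewrite lee_fin normal_pdf_ge0.
apply: eq_integral => z _; rewrite -EFinM /gauss_density big_ord_recl consV0.
by congr (_ * _)%:E; apply: eq_bigr => i _; rewrite consVS.
Qed.

(* Uniqueness of Haar measure, proved by comparing two iterated integrals of
   [F (H x) * g (y + H x)], where [g] is the standard Gaussian density. *)
Lemma ge0_integral_cV_isometry p (H : 'cV[R]_p -> 'cV[R]_p)
    (F : 'cV[R]_p -> \bar R) :
  measurable_fun setT H -> involutive H -> {morph H : x y / x + y} ->
  (forall x, dot (H x) (H x) = dot x x) ->
  measurable_fun setT F -> (forall x, 0 <= F x)%E ->
  (\int[L p]_x F (H x) = \int[L p]_x F x)%E.
Proof.
move=> mH HK HD Hd mF F0; pose g := EFin \o @gauss_density p.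
have mg : measurable_fun setT g by apply/measurable_EFinP; exact: measurable_gauss_density.
have g0 x : (0 <= g x)%E by rewrite lee_fin gauss_density_ge0.
have gH x : g (H x) = g x by rewrite /g/= !gauss_densityE Hd.
have g1 : (\int[L p]_x g x = 1)%E := integral_gauss_density p.
have mFH : measurable_fun setT (fun x => F (H x)) by exact: measurableT_comp.
transitivity (\int[L p]_x \int[L p]_y (F (H x) * g (y + H x)%R))%E.
  apply: eq_integral => x _; rewrite ge0_integralZl//; last first.
    apply: (measurableT_comp mg); apply: measurable_fun_addV => //; exact: measurable_cst.
  by rewrite (ge0_integral_cV_shift (H x) mg g0) g1 mule1.
rewrite (fubini_tonelli (m1 := L p) (m2 := L p)
  (fun w => F (H w.1) * g (w.2 + H w.1)%R)%E)/=; last 2 first.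
- apply: emeasurable_funM; first exact: (measurableT_comp mFH).
  apply: (measurableT_comp mg); apply: measurable_fun_addV => //.
  exact: measurableT_comp.
- by move=> w; exact: mule_ge0.
transitivity (\int[L p]_y \int[L p]_x (F (H x - y)%R * g x))%E.
  apply: eq_integral => y _.
  rewrite -[LHS](ge0_integral_cV_shift (- H y)); last 2 first.
  - apply: emeasurable_funM => //; apply: (measurableT_comp mg).
    by apply: measurable_fun_addV => //; exact: measurable_cst.
  - by move=> x; exact: mule_ge0.
  apply: eq_integral => x _.
  have HN z : H (- z) = - H z.
    have H0 : H 0 = 0 by apply: (addrI (H 0)); rewrite -HD !addr0.
    by apply/eqP; rewrite -subr_eq0 opprK -HD addNr H0.
  by rewrite HD HN HK -(gH x) addrCA subrr addr0.
rewrite (fubini_tonelli (m1 := L p) (m2 := L p)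
  (fun w => F (H w.2 - w.1)%R * g w.2)%E)/=; last 2 first.
- apply: emeasurable_funM; last exact: (measurableT_comp mg).
  apply: (measurableT_comp mF); apply: measurable_fun_addV => //.
    exact: measurableT_comp.
  exact: measurable_fun_oppV.
- by move=> w; exact: mule_ge0.
transitivity (\int[L p]_x ((\int[L p]_y F y) * g x))%E; last first.
  by rewrite ge0_integralZl// ?g1 ?mule1//; exact: integral_ge0.
apply: eq_integral => x _; rewrite ge0_integralZr//; last first.
  apply: (measurableT_comp mF); apply: measurable_fun_addV.
    exact: measurable_cst.
  exact: measurable_fun_oppV.
congr (_ * _)%E; transitivity (\int[L p]_y F (H x + y)%R)%E.
  rewrite -[RHS]ge0_integral_cV_opp//.
  by apply: (measurableT_comp mF); apply: measurable_fun_addV => //; exact: measurable_cst.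
by rewrite -[RHS](ge0_integral_cV_shift (H x) mF F0); apply: eq_integral => y _; rewrite addrC.
Qed.

Lemma ge0_integral_cV_reflect p a (F : 'cV[R]_p -> \bar R) :
  measurable_fun setT F -> (forall x, 0 <= F x)%E ->
  (\int[L p]_x F (reflect_along a x) = \int[L p]_x F x)%E.
Proof.
move=> mF F0; apply: ge0_integral_cV_isometry => //.
- exact: measurable_fun_reflect.
- exact: reflect_alongK.
- exact: reflect_alongD.
- by move=> x; exact: dot_reflect_along.
Qed.

End vectors.

(** * Polar coordinates *)

Section polar.
Context (R : realType).
Notation leb := (@lebesgue_measure R).
Notation L p := (@lebesgue_cV R p).
Notation mR := (measurableTypeR R).

(** The cosine of the angle with sine [u]; outside [[-1, 1]] the square root is 0 by default. *)
Definition cosq (u : R) : R := Num.sqrt (1 - u ^+ 2).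

(** Indicators enter as real factors, so that integrals run over the whole line and Tonelli and the
    substitution formula apply directly. *)
Definition ind11 (u : R) : R := \1_`]-1, 1[ u.

Definition indpos (r : R) : R := \1_`]0, +oo[ r.

Lemma ind11E u : ind11 u = (-1 < u < 1)%R%:R.
Proof.
rewrite /ind11 indicE; congr (nat_of_bool _)%:R.
by apply/idP/idP; rewrite inE/= in_itv.
Qed.

Lemma indposE r : indpos r = (0 < r)%R%:R.
Proof.
rewrite /indpos indicE; congr (nat_of_bool _)%:R.
by apply/idP/idP; rewrite inE/= in_itv/= andbT.
Qed.

Definition ind01 (r : R) : R := \1_`]0, 1] r.

Lemma ind01E r : ind01 r = (0 < r <= 1)%R%:R.
Proof.
rewrite /ind01 indicE; congr (nat_of_bool _)%:R.
by apply/idP/idP; rewrite inE/= in_itv.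
Qed.

Lemma ind01_ge0 r : 0 <= ind01 r. Proof. by rewrite ind01E. Qed.

Lemma measurable_ind01 : measurable_fun setT ind01.
Proof. exact: measurable_indic. Qed.

Lemma ind11_ge0 u : 0 <= ind11 u. Proof. by rewrite ind11E. Qed.

Lemma indpos_ge0 u : 0 <= indpos u. Proof. by rewrite indposE. Qed.

Lemma cosq_ge0 u : 0 <= cosq u. Proof. exact: sqrtr_ge0. Qed.

Lemma cosq_gt0 u : -1 < u < 1 -> 0 < cosq u.
Proof.
move=> u1; rewrite sqrtr_gt0 subr_gt0 -[ltRHS](expr1n _ 2).
by rewrite -real_normK ?num_real// ltr_pXn2r// ?nnegrE// ltr_norml.
Qed.

Lemma sqr_cosq u : -1 < u < 1 -> cosq u ^+ 2 = 1 - u ^+ 2.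
Proof.
move=> u1; rewrite sqr_sqrtr// ltW//; have := cosq_gt0 u1.
by rewrite sqrtr_gt0.
Qed.

Lemma measurable_cosq : measurable_fun setT cosq.
Proof.
apply: measurable_fun_sqrt; apply: measurable_funB; first exact: measurable_cst.
exact: measurable_funX.
Qed.

Lemma measurable_ind11 : measurable_fun setT ind11.
Proof. exact: measurable_indic. Qed.

Lemma measurable_indpos : measurable_fun setT indpos.
Proof. exact: measurable_indic. Qed.

Lemma is_derive_div_cosq (u : R) : -1 < u < 1 ->
  is_derive u 1 (fun x => x / cosq x) ((cosq u)^-1 ^+ 3).
Proof.
move=> u1; have q0 := cosq_gt0 u1; have q2 := sqr_cosq u1.
have d1 : is_derive u 1 (fun x : R => 1 - x ^+ 2) (- (2 * u)).
  apply: is_derive_eq; rewrite /GRing.scale/= /GRing.scale/=; ring.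
have p0 : 0 < 1 - u ^+ 2 by rewrite -q2 exprn_gt0.
have d2 : is_derive u 1 cosq ((2 * cosq u)^-1 * - (2 * u)).
  exact: (@is_derive1_comp R (@Num.sqrt R) (fun x => 1 - x ^+ 2) u _ _ (is_derive1_sqrt p0) d1).
have d3 := is_deriveV (lt0r_neq0 q0) d2.
have d4 := is_deriveM (is_derive_id u (1 : R)) d3.
apply: (is_derive_eq d4); rewrite /GRing.scale/=.
have -> : (cosq u)^-1 ^+ 3 = (cosq u ^+ 2 + u ^+ 2) / cosq u ^+ 3.
  by rewrite q2 subrK mul1r exprVn.
field; exact: lt0r_neq0.
Qed.

(** With [u] the sine of an angle, [u / cosq u] is its tangent; it maps []-1, 1[] onto the line,
    with inverse [y / sqrt (1 + y^2)]. *)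
Lemma ge0_integral_div_cosq (G : R -> \bar R) :
  measurable_fun setT G -> (forall x, 0 <= G x)%E ->
  (\int[leb]_x G x =
   \int[leb]_u (G (u / cosq u)%R * (ind11 u * (cosq u)^-1 ^+ 3)%:E))%E.
Proof.
move=> mG G0.
have pI (x : R) : x \in `]-1, 1[ -> -1 < x < 1 by rewrite in_itv.
have KI (y : R) : -1 < y / Num.sqrt (1 + y ^+ 2) < 1.
  have p1 : 0 < 1 + y ^+ 2 by rewrite ltr_wpDr ?sqr_ge0.
  rewrite -ltr_norml normrM normfV (ger0_norm (sqrtr_ge0 _)).
  rewrite ltr_pdivrMr ?sqrtr_gt0// mul1r -sqrtr_sqr ltr_sqrt//.
  by rewrite ltrDr.
have cq y : cosq (y / Num.sqrt (1 + y ^+ 2)) = (Num.sqrt (1 + y ^+ 2))^-1.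
  have p1 : 0 < 1 + y ^+ 2 by rewrite ltr_wpDr ?sqr_ge0.
  rewrite /cosq exprMn exprVn sqr_sqrtr ?(ltW p1)// -sqrtrV ?(ltW p1)//.
  congr Num.sqrt; field; exact: lt0r_neq0.
rewrite (@ge0_integral_substitution R `]-1, 1[ (fun x => x / cosq x)
  (fun u => (cosq u)^-1 ^+ 3) (fun y => y / Num.sqrt (1 + y ^+ 2)))//.
- rewrite integral_mkcond; apply: eq_integral => u _.
  rewrite patchE ind11E; case: ifPn => [|].
    by rewrite inE/= => /pI ->; rewrite mul1r.
  rewrite notin_setE/= in_itv/= => /negP/negbTE ->.
  by rewrite mul0r mule0.
- apply: measurable_funM => //; apply: measurable_funV; exact: measurable_cosq.
- by move=> x /pI; exact: is_derive_div_cosq.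
- move=> x /pI x1; have d := is_derive_div_cosq x1.
  have cc : {for x, continuous cosq}.
    rewrite (_ : cosq = @Num.sqrt R \o (fun x : R => 1 - x ^+ 2))//.
    apply: continuous_comp.
      by apply: cvgB; [exact: cvg_cst|exact: sqr_continuous].
    exact: sqrt_continuous.
  apply: (continuous_comp (f := fun x => (cosq x)^-1) (g := fun x => x ^+ 3)).
    by apply: cvgV => //; rewrite lt0r_neq0// cosq_gt0.
  exact: exprn_continuous.
- by move=> x /pI x1; rewrite exprn_ge0// invr_ge0 cosq_ge0.
- by move=> y; rewrite cq invrK divfK// gt_eqF// sqrtr_gt0 ltr_wpDr ?sqr_ge0.
- move=> u /pI u1; have q0 := cosq_gt0 u1; have q2 := sqr_cosq u1.
  have -> : 1 + (u / cosq u) ^+ 2 = ((cosq u)^-1) ^+ 2.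
    rewrite exprMn exprVn q2; field.
    by rewrite -q2 expf_neq0// lt0r_neq0.
  rewrite sqrtr_sqr gtr0_norm ?invr_gt0// invrK divfK// lt0r_neq0//.
- have s0 (x : R) : 0 < Num.sqrt (1 + x ^+ 2).
    by rewrite sqrtr_gt0 ltr_wpDr ?sqr_ge0.
  (* Monotonicity of the inverse: after cross-multiplication squares are compared when [0 <= x], and
     oddness reduces two negative arguments to that case. *)
  have E (x y : R) : (x / Num.sqrt (1 + x ^+ 2) < y / Num.sqrt (1 + y ^+ 2)) =
      (x * Num.sqrt (1 + y ^+ 2) < y * Num.sqrt (1 + x ^+ 2)).
    by rewrite ltr_pdivrMr// mulrAC ltr_pdivlMr.
  have pos (x y : R) : 0 <= x -> x < y ->
      x * Num.sqrt (1 + y ^+ 2) < y * Num.sqrt (1 + x ^+ 2).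
    move=> x0 xy; have y0 := le_lt_trans x0 xy.
    have xy2 : x ^+ 2 < y ^+ 2 by rewrite ltr_pXn2r// ?nnegrE// ltW.
    rewrite -(@ltr_pXn2r _ 2)// ?nnegrE ?mulr_ge0 ?sqrtr_ge0 ?(ltW y0)//.
    rewrite !exprMn !sqr_sqrtr ?addr_ge0 ?sqr_ge0//.
    by rewrite !mulrDr !mulr1 (mulrC (y ^+ 2)) ltrD2r.
  move=> x y xy; rewrite E; have [x0|x0] := leP 0 x; first exact: pos.
  have [y0|y0] := leP 0 y.
    by rewrite (@lt_le_trans _ _ 0)// ?nmulr_rlt0// mulr_ge0// ltW.
  have := pos (- y) (- x); rewrite !sqrrN !mulNr !ltrN2; apply => //.
  by rewrite oppr_ge0 ltW.
Qed.

Lemma ge0_integral_indpos (G : R -> \bar R) :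
  measurable_fun setT G -> (forall x, 0 <= G x)%E ->
  (\int[leb]_x G x = \int[leb]_r ((G r + G (- r)%R) * (indpos r)%:E))%E.
Proof.
move=> mG G0.
have mGN : measurable_fun setT (fun x : R => G (- x)).
  by apply: (measurableT_comp mG); exact: oppr_measurable.
have mw : measurable_fun setT (EFin \o indpos).
  by apply/measurable_EFinP; exact: measurable_indpos.
have w0 r : (0 <= (indpos r)%:E)%E by rewrite lee_fin indpos_ge0.
have mGw : measurable_fun setT (fun x => G x * (indpos x)%:E)%E.
  by apply: emeasurable_funM.
have mwN : measurable_fun setT (fun x : R => (indpos (- x))%:E).
  by apply: (measurableT_comp mw); exact: oppr_measurable.
have mGwN : measurable_fun setT (fun x : R => G x * (indpos (- x)%R)%:E)%E.
  by apply: emeasurable_funM.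
transitivity (\int[leb]_x (G x * (indpos x)%:E + G x * (indpos (- x)%R)%:E))%E.
  (* The two half-line indicators add up to 1 except at 0, a null set. *)
  apply: ae_eq_integral => //; first exact: emeasurable_funD.
  exists [set 0]; split => //.
    exact: lebesgue_measure_set1.
  move=> x /=; apply: contra_notP => /eqP x0 _.
  rewrite !indposE oppr_gt0; have [xp|xn|x00] := ltgtP 0 x.
  - by rewrite mule1 mule0 adde0.
  - by rewrite mule1 mule0 add0e.
  - by rewrite -x00 eqxx in x0.
rewrite ge0_integralD//; last 2 first.
- by move=> x _; exact: mule_ge0.
- by move=> x _; exact: mule_ge0.
rewrite -[X in (_ + X)%E](ge0_integral_opp mGwN); last first.
  by move=> x; exact: mule_ge0.
rewrite -ge0_integralD//; last 3 first.
- by move=> x _; exact: mule_ge0.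
- by move=> x _; rewrite mule_ge0// ?opprK.
- by apply: (measurableT_comp (f := fun x : R => G x * (indpos (- x)%R)%:E)%E);
    [exact: mGwN|exact: oppr_measurable].
by apply: eq_integral => x _; rewrite opprK ge0_muleDl.
Qed.

(** On the half-plane [r > 0], with radius [t] and first direction cosine [s], one has
    [r = t * cosq s] and the Jacobian is [t / cosq s]. Two one-dimensional substitutions,
    [x = r * u / cosq u] at fixed [r] and [r = t * cosq u] at fixed [u], are joined by Tonelli. *)
Lemma polar_substitution (Psi : R -> R -> R -> \bar R) n :
  measurable_fun setT (fun z : mR * mR * mR => Psi z.1.1 z.1.2 z.2) ->
  (forall x y z, 0 <= Psi x y z)%E ->
  (\int[leb]_x \int[leb]_r
     (Psi (Num.sqrt (x ^+ 2 + r ^+ 2))%R (x / Num.sqrt (x ^+ 2 + r ^+ 2))%R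
          (r / Num.sqrt (x ^+ 2 + r ^+ 2))%R * (indpos r * r ^+ n)%:E) =
   \int[leb]_t \int[leb]_s (Psi t s (cosq s) *
     ((indpos t * t ^+ n.+1) * (ind11 s * (cosq s ^+ n / cosq s)))%:E))%E.
Proof.
move=> mPsi Psi0.
have mPsiC d (T : measurableType d) (f g h : T -> R) : measurable_fun setT f ->
    measurable_fun setT g -> measurable_fun setT h ->
    measurable_fun setT (fun t => Psi (f t) (g t) (h t)).
  move=> mf mg mh.
  apply: (measurableT_comp (g := fun t => (f t, g t, h t)) mPsi).
  by apply: measurable_fun_pair => //; exact: measurable_fun_pair.
have m1 : measurable_fun setT (fst : mR * mR -> mR) by exact: measurable_fst.
have m2 : measurable_fun setT (snd : mR * mR -> mR) by exact: measurable_snd.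
have mrho d (T : measurableType d) (f g : T -> R) : measurable_fun setT f ->
    measurable_fun setT g -> measurable_fun setT (fun t => Num.sqrt (f t ^+ 2 + g t ^+ 2)).
  move=> mf mg; apply: measurable_fun_sqrt.
  by apply: measurable_funD; exact: measurable_funX.
have w0 n' r : 0 <= indpos r * r ^+ n'.
  rewrite indposE; case: ltP => r0; last by rewrite mul0r.
  by rewrite mul1r exprn_ge0// ltW.
have mw d (T : measurableType d) n' (f : T -> R) : measurable_fun setT f ->
    measurable_fun setT (fun t => indpos (f t) * f t ^+ n').
  move=> mf; apply: measurable_funM; last exact: measurable_funX.
  exact: (measurableT_comp measurable_indpos).
have mw11 d (T : measurableType d) (f : T -> R) : measurable_fun setT f ->
    measurable_fun setT (fun t => ind11 (f t)).
  exact: (measurableT_comp measurable_ind11).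
have mcq d (T : measurableType d) (f : T -> R) : measurable_fun setT f ->
    measurable_fun setT (fun t => cosq (f t)).
  exact: (measurableT_comp measurable_cosq).
rewrite (fubini_tonelli (m1 := leb) (m2 := leb) (fun z : mR * mR =>
  Psi (Num.sqrt (z.1 ^+ 2 + z.2 ^+ 2))%R (z.1 / Num.sqrt (z.1 ^+ 2 + z.2 ^+ 2))%R
          (z.2 / Num.sqrt (z.1 ^+ 2 + z.2 ^+ 2))%R * (indpos z.2 * z.2 ^+ n)%:E)%E)/=;
  last 2 first.
- apply: emeasurable_funM; last by apply/measurable_EFinP; exact: mw.
  apply: mPsiC; first exact: mrho.
    by apply: measurable_funM => //; apply: measurable_funV; exact: mrho.
  by apply: measurable_funM => //; apply: measurable_funV; exact: mrho.
- by move=> z; rewrite mule_ge0// lee_fin.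
transitivity (\int[leb]_r \int[leb]_u (Psi (r / cosq u)%R u (cosq u) *
   ((indpos r * r ^+ n.+1) * (ind11 u * (cosq u)^-1 ^+ 3))%:E))%E.
  apply: eq_integral => r _; have [r0|r0] := ltP 0 r; last first.
    rewrite integral0_eq ?integral0_eq//; move=> x _.
      by rewrite indposE ltNge r0/= !mul0r mule0.
    by rewrite indposE ltNge r0/= !mul0r mule0.
  have mH : measurable_fun setT (fun x : R => Psi (Num.sqrt (x ^+ 2 + r ^+ 2))%R
      (x / Num.sqrt (x ^+ 2 + r ^+ 2))%R (r / Num.sqrt (x ^+ 2 + r ^+ 2))%R *
      (indpos r * r ^+ n)%:E)%E.
    apply: emeasurable_funM; last exact: measurable_cst.
    have mr : measurable_fun setT (fun x : R => Num.sqrt (x ^+ 2 + r ^+ 2)).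
      by apply: mrho => //; exact: measurable_cst.
    apply: mPsiC => //.
      by apply: measurable_funM => //; exact: measurable_funV.
    by apply: measurable_funM; [exact: measurable_cst|exact: measurable_funV].
  rewrite (ge0_integral_affine mH _ 0 r0); last first.
    by move=> x; rewrite mule_ge0// lee_fin.
  rewrite ge0_integral_div_cosq; last 2 first.
  - apply: emeasurable_funM; last exact: measurable_cst.
    apply: (measurableT_comp mH); apply: measurable_funD; last exact: measurable_cst.
    by apply: measurable_funM => //; exact: measurable_cst.
  - by move=> x; rewrite !mule_ge0// lee_fin// ltW.
  apply: eq_integral => u _; rewrite addr0 ind11E.
  case: (boolP (-1 < u < 1)) => [u1|_]; last by rewrite !mul0r mulr0 !mule0.
  have q0 := cosq_gt0 u1; have q2 := sqr_cosq u1.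
  have -> : Num.sqrt ((r * (u / cosq u)) ^+ 2 + r ^+ 2) = r / cosq u.
    rewrite (_ : _ + _ = (r / cosq u) ^+ 2); last first.
      rewrite !exprMn exprVn q2; field; rewrite -q2 expf_neq0// lt0r_neq0//.
    by rewrite sqrtr_sqr ger0_norm// divr_ge0// ltW.
  have -> : r * (u / cosq u) / (r / cosq u) = u.
    by field; rewrite !lt0r_neq0.
  have -> : r / (r / cosq u) = cosq u by field; rewrite !lt0r_neq0.
  rewrite -!muleA -!EFinM; congr (_ * _%:E)%E.
  by rewrite mul1r (exprSr r n) !mulrA.
rewrite (fubini_tonelli (m1 := leb) (m2 := leb) (fun z : mR * mR =>
  Psi (z.1 / cosq z.2)%R z.2 (cosq z.2) *
   ((indpos z.1 * z.1 ^+ n.+1) * (ind11 z.2 * (cosq z.2)^-1 ^+ 3))%:E)%E)/=; last 2 first.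
- apply: emeasurable_funM.
    apply: mPsiC; [|exact: m2|exact: mcq].
    by apply: measurable_funM => //; apply: measurable_funV; exact: mcq.
  apply/measurable_EFinP; apply: measurable_funM; first exact: mw.
  apply: measurable_funM; first exact: mw11.
  by apply: measurable_funX; apply: measurable_funV; exact: mcq.
- move=> z; rewrite mule_ge0// lee_fin mulr_ge0// mulr_ge0 ?ind11_ge0//.
  by rewrite exprn_ge0// invr_ge0 cosq_ge0.
rewrite [RHS](fubini_tonelli (m1 := leb) (m2 := leb) (fun z : mR * mR =>
  Psi z.1 z.2 (cosq z.2) * ((indpos z.1 * z.1 ^+ n.+1) *
    (ind11 z.2 * (cosq z.2 ^+ n / cosq z.2)))%:E)%E)/=; last 2 first.
- apply: emeasurable_funM; first by apply: mPsiC => //; exact: mcq.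
  apply/measurable_EFinP; apply: measurable_funM; first exact: mw.
  apply: measurable_funM; first exact: mw11.
  apply: measurable_funM; first by apply: measurable_funX; exact: mcq.
  by apply: measurable_funV; exact: mcq.
- move=> z; rewrite mule_ge0// lee_fin mulr_ge0// mulr_ge0 ?ind11_ge0//.
  by rewrite divr_ge0 ?exprn_ge0 ?cosq_ge0.
apply: eq_integral => u _; rewrite ind11E.
case: (boolP (-1 < u < 1)) => [u1|_]; last first.
  by rewrite integral0_eq ?integral0_eq// => x _; rewrite !mul0r mulr0 mule0.
have q0 := cosq_gt0 u1.
rewrite (ge0_integral_affine _ _ 0 q0); last 2 first.
- apply: emeasurable_funM.
    apply: mPsiC; [|exact: measurable_cst|exact: measurable_cst].
    by apply: measurable_funM => //; exact: measurable_cst.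
  apply/measurable_EFinP; apply: measurable_funM; first exact: mw.
  exact: measurable_cst.
- move=> z; rewrite mule_ge0// lee_fin mulr_ge0// mulr_ge0//.
  by rewrite exprn_ge0// invr_ge0 cosq_ge0.
apply: eq_integral => t _.
rewrite addr0 mulrAC divff ?lt0r_neq0// mul1r -muleA -EFinM.
rewrite !indposE pmulr_rgt0//; congr (_ * _%:E)%E.
by rewrite exprMn !exprS; field; exact: lt0r_neq0.
Qed.

(* Up to a constant factor, the law of the first coordinate on the unit sphere
   of [R^m], which for [m = 1] sits at the points [1] and [-1]. *)
Definition rho_int (m : nat) (F : R -> \bar R) : \bar R :=
  if m is k.+2 then
    (\int[leb]_u (F u * (ind11 u * (cosq u ^+ k / cosq u))%:E))%E
  else (F 1%R + F (-1)%R)%E.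

Lemma rho_weight_ge0 k u : 0 <= ind11 u * (cosq u ^+ k / cosq u).
Proof. by rewrite mulr_ge0 ?ind11_ge0// divr_ge0 ?exprn_ge0 ?cosq_ge0. Qed.

Lemma measurable_rho_weight k :
  measurable_fun setT (fun u => ind11 u * (cosq u ^+ k / cosq u)).
Proof.
apply: measurable_funM; first exact: measurable_ind11.
apply: measurable_funM; first by apply: measurable_funX; exact: measurable_cosq.
by apply: measurable_funV; exact: measurable_cosq.
Qed.

Lemma rho_int_ge0 m F : (forall u, 0 <= F u)%E -> (0 <= rho_int m F)%E.
Proof.
move=> F0; case: m => [|[|k]] /=; [exact: adde_ge0|exact: adde_ge0|].
by apply: integral_ge0 => u _; rewrite mule_ge0// lee_fin rho_weight_ge0.
Qed.

Lemma rho_intZ m F c : (forall u, 0 <= F u)%E -> measurable_fun setT F ->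
  (0 <= c)%E -> rho_int m (fun u => c * F u)%E = (c * rho_int m F)%E.
Proof.
move=> F0 mF c0; case: m => [|[|k]] /=; [by rewrite ge0_muleDr|by rewrite ge0_muleDr|].
rewrite -ge0_integralZl//.
- by apply: eq_integral => u _; rewrite muleA.
- apply: emeasurable_funM => //; apply/measurable_EFinP.
  exact: measurable_rho_weight.
- by move=> u _; rewrite mule_ge0// lee_fin rho_weight_ge0.
Qed.

Lemma eq_rho_int m F G : F =1 G -> rho_int m F = rho_int m G.
Proof. by move=> /funext ->. Qed.

Lemma measurable_rho_int d (T : measurableType d) m (F : T -> R -> \bar R) :
  measurable_fun setT (fun z : T * mR => F z.1 z.2) ->
  (forall t u, 0 <= F t u)%E -> measurable_fun setT (fun t => rho_int m (F t)).
Proof.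
move=> mF F0; case: m => [|[|k]] /=.
- apply: emeasurable_funD.
    by apply: (measurableT_comp (g := fun t => (t, 1 : R)) mF); exact: pair2_measurable.
  by apply: (measurableT_comp (g := fun t => (t, -1 : R)) mF); exact: pair2_measurable.
- apply: emeasurable_funD.
    by apply: (measurableT_comp (g := fun t => (t, 1 : R)) mF); exact: pair2_measurable.
  by apply: (measurableT_comp (g := fun t => (t, -1 : R)) mF); exact: pair2_measurable.
apply: (measurable_fun_fubini_tonelli_F (m2 := leb)
  (fun z : T * mR => F z.1 z.2 * (ind11 z.2 * (cosq z.2 ^+ k / cosq z.2))%:E)%E).
- apply: emeasurable_funM => //; apply/measurable_EFinP.
  by apply: (measurableT_comp (measurable_rho_weight k)); exact: measurable_snd.
- by move=> z; rewrite mule_ge0// lee_fin rho_weight_ge0.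
Qed.

Lemma cnorm_consV p (x : R) (z : 'cV[R]_p) :
  cnorm (consV x z) = Num.sqrt (x ^+ 2 + cnorm z ^+ 2).
Proof. by rewrite /cnorm dot_consV sqr_sqrtr ?dot_ge0// expr2. Qed.

(** Induction on the dimension: once the first coordinate is split off, the integrand depends on the
    remaining vector through its norm only, so the previous case is applied to a function of the
    radius, and [polar_substitution] recombines radius and first coordinate. The constant is an
    unknown extended real, chosen before [G]. *)
Lemma integral_polar k : exists2 C : \bar R, (0 <= C)%E &
  forall G : R -> R -> \bar R,
    measurable_fun setT (fun z : mR * mR => G z.1 z.2) ->
    (forall r u, 0 <= G r u)%E ->
  (\int[L k.+1]_z G (cnorm z) (z ord0 0 / cnorm z)%R =
   C * \int[leb]_r (rho_int k.+1 (G r) * (indpos r * r ^+ k)%:E))%E.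
Proof.
have mw k' : measurable_fun setT (fun r => indpos r * r ^+ k').
  apply: measurable_funM; first exact: measurable_indpos.
  exact: measurable_funX.
have w0 k' r : 0 <= indpos r * r ^+ k'.
  rewrite indposE; case: ltP => r0; last by rewrite mul0r.
  by rewrite mul1r exprn_ge0// ltW.
have mGz p (G : R -> R -> \bar R) : measurable_fun setT (fun z : mR * mR => G z.1 z.2) ->
    measurable_fun setT (fun z : 'cV[R]_p.+1 => G (cnorm z) (z ord0 0 / cnorm z)).
  move=> mG; apply: (measurableT_comp (g := fun z : 'cV[R]_p.+1 =>
    (cnorm z, z ord0 0 / cnorm z)) mG).
  have mc : measurable_fun setT (@cnorm R p.+1) by exact: measurable_fun_cnorm.
  apply: measurable_fun_pair => //; apply: measurable_funM.
    exact: measurable_entry.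
  exact: measurable_funV.
elim: k => [|k [C C0 IH]].
  exists 1%E => // G mG G0; rewrite mul1e ge0_integral_lebesgue_cV1//; last exact: mGz.
  rewrite ge0_integral_indpos//; last first.
    apply: (measurableT_comp (mGz 0 G mG)); apply: measurable_consV => //; exact: measurable_cst.
  apply: eq_integral => r _; rewrite /= expr0 mulr1.
  rewrite !cnorm_consV !consV0 cnorm0 expr0n !addr0 !sqrrN !sqrtr_sqr indposE.
  case: ltP => r0; last by rewrite !mule0.
  by rewrite ger0_norm ?ltW// mulNr divff// gt_eqF.
pose c1 := rho_int k.+1 (cst 1%E).
have c10 : (0 <= c1)%E by exact: rho_int_ge0.
exists (C * c1)%E; first exact: mule_ge0.
move=> G mG G0; rewrite ge0_integral_lebesgue_cVS//; last exact: mGz.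
pose Psi (t s v : R) := G t s.
have mPsi : measurable_fun setT (fun z : mR * mR * mR => Psi z.1.1 z.1.2 z.2).
  by apply: (measurableT_comp (g := fst) mG); exact: measurable_fst.
have := polar_substitution k mPsi (fun x y z => G0 x y).
rewrite /Psi => ps.
pose H x r := G (Num.sqrt (x ^+ 2 + r ^+ 2)) (x / Num.sqrt (x ^+ 2 + r ^+ 2)).
have mrho : measurable_fun setT (fun z : mR * mR => Num.sqrt (z.1 ^+ 2 + z.2 ^+ 2) : R).
  apply: measurable_fun_sqrt.
  by apply: measurable_funD; apply: measurable_funX.
have mH : measurable_fun setT (fun z : mR * mR => H z.1 z.2).
  apply: (measurableT_comp (g := fun z : mR * mR => (Num.sqrt (z.1 ^+ 2 + z.2 ^+ 2),
    z.1 / Num.sqrt (z.1 ^+ 2 + z.2 ^+ 2))) mG).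
  apply: measurable_fun_pair; first exact: mrho.
  apply: measurable_funM; first exact: measurable_fst.
  by apply: measurable_funV; exact: mrho.
have mHx x : measurable_fun setT (fun r => H x r).
  by apply: (measurableT_comp (g := fun r : R => (x : mR, r : mR)) mH); exact: pair1_measurable.
transitivity (\int[leb]_x (C * c1 * \int[leb]_r (H x r * (indpos r * r ^+ k)%:E)))%E.
  apply: eq_integral => x _.
  transitivity (\int[L k.+1]_z H x (cnorm z))%E.
    by apply: eq_integral => z _; rewrite cnorm_consV consV0.
  rewrite (IH (fun r _ => H x r)); last 2 first.
  - by apply: (measurableT_comp (mHx x)); exact: measurable_fst.
  - by move=> r u; exact: G0.
  rewrite -muleA; congr (C * _)%E.
  have mHw : measurable_fun setT (fun r => H x r * (indpos r * r ^+ k)%:E)%E.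
    apply: emeasurable_funM; first exact: mHx.
    by apply/measurable_EFinP; exact: mw.
  rewrite -[RHS](ge0_integralZl leb measurableT mHw); last 2 first.
  - by move=> r _; apply: mule_ge0; [exact: G0|rewrite lee_fin].
  - exact: c10.
  apply: eq_integral => r _; rewrite muleA (muleC c1); congr (_ * _)%E.
  transitivity (rho_int k.+1 (fun u => H x r * cst 1%E u)%E).
    by apply: eq_rho_int => u; rewrite /cst mule1.
  apply: rho_intZ; [by move=> u; exact: lee01|exact: measurable_cst|exact: G0].
have Hw0 (x r : R) : (0 <= H x r * (indpos r * r ^+ k)%:E)%E.
  by apply: mule_ge0; [exact: G0|rewrite lee_fin].
have mI : measurable_fun setT
    (fun x => \int[leb]_r (H x r * (indpos r * r ^+ k)%:E))%E.
  apply: (measurable_fun_fubini_tonelli_F (m2 := leb)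
    (fun z : mR * mR => H z.1 z.2 * (indpos z.2 * z.2 ^+ k)%:E)%E).
    apply: emeasurable_funM; first exact: mH.
    apply/measurable_EFinP; apply: (measurableT_comp (mw k)); exact: measurable_snd.
  by move=> z; exact: Hw0.
have I0 x : (0 <= \int[leb]_r (H x r * (indpos r * r ^+ k)%:E))%E.
  by apply: integral_ge0 => r _; exact: Hw0.
rewrite (ge0_integralZl leb measurableT mI (fun x _ => I0 x) (mule_ge0 C0 c10)).
congr (_ * _)%E; rewrite ps /=; apply: eq_integral => t _.
have mGu : measurable_fun setT (fun u =>
    G t u * (ind11 u * (cosq u ^+ k / cosq u))%:E)%E.
  apply: emeasurable_funM.
    by apply: (measurableT_comp (g := fun u : R => (t : mR, u : mR)) mG); exact: pair1_measurable.
  by apply/measurable_EFinP; exact: measurable_rho_weight.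
have Gu0 u : (0 <= G t u * (ind11 u * (cosq u ^+ k / cosq u))%:E)%E.
  by apply: mule_ge0; [exact: G0|rewrite lee_fin rho_weight_ge0].
have wt0 : (0 <= (indpos t * t ^+ k.+1)%:E)%E by rewrite lee_fin; exact: w0.
rewrite -(ge0_integralZr leb measurableT mGu (fun u _ => Gu0 u) wt0).
by apply: eq_integral => u _; rewrite -muleA -EFinM (mulrC (indpos _ * _)).
Qed.

(** The first coordinate gives the latitude [s]; the remaining vector has first direction cosine [u]
    by [integral_polar], so the second coordinate of the direction of [x] is [cosq s * u]. The
    radial factor, cut off by the unit ball, integrates separately into the constant. *)
Lemma integral_cone k : exists2 C : \bar R, (0 <= C)%E &
  forall F : R -> R -> \bar R,
    measurable_fun setT (fun z : mR * mR => F z.1 z.2) ->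
    (forall s v, 0 <= F s v)%E ->
  (\int[L k.+2]_x (F (x ord0 0 / cnorm x)%R (x (lift ord0 ord0) 0 / cnorm x)%R *
      (ind01 (cnorm x))%:E) =
   C * \int[leb]_s (rho_int k.+1 (fun u => F s (cosq s * u)%R) *
                    (ind11 s * (cosq s ^+ k / cosq s))%:E))%E.
Proof.
have [C C0 pol] := integral_polar k.
pose c2 := (\int[leb]_t (ind01 t * (indpos t * t ^+ k.+1))%:E)%E.
have wb d (T : measurableType d) (f : T -> R) : measurable_fun setT f ->
    measurable_fun setT (fun t => ind01 (f t)).
  exact: (measurableT_comp measurable_ind01).
have w0 k' r : 0 <= indpos r * r ^+ k'.
  rewrite indposE; case: ltP => r0; last by rewrite mul0r.
  by rewrite mul1r exprn_ge0// ltW.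
have mw k' : measurable_fun setT (fun r => indpos r * r ^+ k').
  apply: measurable_funM; first exact: measurable_indpos.
  exact: measurable_funX.
exists (C * c2)%E.
  by apply: mule_ge0 => //; apply: integral_ge0 => t _; rewrite lee_fin mulr_ge0 ?ind01_ge0.
move=> F mF F0.
pose rh (x r : R) := Num.sqrt (x ^+ 2 + r ^+ 2).
have mrh : measurable_fun setT (fun z : mR * mR => rh z.1 z.2).
  apply: measurable_fun_sqrt.
  by apply: measurable_funD; apply: measurable_funX.
have mFC d (T : measurableType d) (f g : T -> R) : measurable_fun setT f ->
    measurable_fun setT g -> measurable_fun setT (fun t => F (f t) (g t)).
  move=> mf mg; apply: (measurableT_comp (g := fun t => (f t, g t)) mF).
  exact: measurable_fun_pair.
pose Psi (t s v : R) := ((ind01 t)%:E * rho_int k.+1 (fun u => F s (v * u)%R))%E.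
have mRF : measurable_fun setT (fun z : mR * mR => rho_int k.+1 (fun u => F z.1 (z.2 * u))).
  apply: (@measurable_rho_int _ (mR * mR)%type k.+1 (fun z u => F z.1 (z.2 * u))) => //.
  apply: mFC; first exact: (measurableT_comp measurable_fst).
  by apply: measurable_funM => //; exact: (measurableT_comp measurable_snd).
have mPsi : measurable_fun setT (fun z : mR * mR * mR => Psi z.1.1 z.1.2 z.2).
  apply: emeasurable_funM.
    apply/measurable_EFinP; apply: wb.
    exact: (measurableT_comp measurable_fst).
  apply: (measurableT_comp (g := fun z : mR * mR * mR => (z.1.2, z.2)) mRF).
  by apply: measurable_fun_pair => //; exact: (measurableT_comp measurable_snd).
have Psi0 x y z : (0 <= Psi x y z)%E.
  by apply: mule_ge0; [rewrite lee_fin ind01_ge0|exact: rho_int_ge0].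
rewrite ge0_integral_lebesgue_cVS//; last 2 first.
- apply: emeasurable_funM.
    have mc : measurable_fun setT (@cnorm R k.+2) by exact: measurable_fun_cnorm.
    by apply: mFC; (apply: measurable_funM; [exact: measurable_entry|exact: measurable_funV]).
  by apply/measurable_EFinP; apply: wb; exact: measurable_fun_cnorm.
- by move=> x; rewrite mule_ge0// lee_fin ind01_ge0.
transitivity (\int[leb]_x (C * \int[leb]_r (Psi (rh x r) (x / rh x r)%R (r / rh x r)%R *
    (indpos r * r ^+ k)%:E)))%E.
  apply: eq_integral => x _.
  pose G r u := ((ind01 (rh x r))%:E * F (x / rh x r)%R (r / rh x r * u)%R)%E.
  transitivity (\int[L k.+1]_z G (cnorm z) (z ord0 0 / cnorm z)%R)%E.
    apply: eq_integral => z _; rewrite /G cnorm_consV consV0 consVS -/(rh x (cnorm z)).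
    rewrite muleC; congr (_ * F _ _)%E; have [z0|z0] := eqVneq (cnorm z) 0.
      have /eqP -> : z == 0 by rewrite -cnorm_eq0 z0.
      by rewrite mxE !mul0r mulr0.
    by rewrite [RHS]mulrC mulrA divfK.
  have mrx : measurable_fun setT (fun r => rh x r).
    by apply: (measurableT_comp (g := fun r : R => (x : mR, r : mR)) mrh); exact: pair1_measurable.
  rewrite pol; last 2 first.
  - apply: emeasurable_funM.
      apply/measurable_EFinP; apply: wb; exact: (measurableT_comp mrx).
    have m1 : measurable_fun setT (fun z : mR * mR => rh x z.1).
      exact: (measurableT_comp mrx).
    apply: mFC.
      by apply: measurable_funM; [exact: measurable_cst|exact: measurable_funV].
    apply: measurable_funM => //; apply: measurable_funM => //.
    exact: measurable_funV.
  - by move=> r u; rewrite mule_ge0// lee_fin ind01_ge0.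
  congr (C * _)%E; apply: eq_integral => r _; congr (_ * _)%E.
  rewrite /G rho_intZ//; last by rewrite lee_fin ind01_ge0.
  apply: mFC; first exact: measurable_cst.
  by apply: measurable_funM => //; exact: measurable_cst.
rewrite ge0_integralZl//; last 2 first.
- apply: (measurable_fun_fubini_tonelli_F (m2 := leb) (fun z : mR * mR =>
    Psi (rh z.1 z.2) (z.1 / rh z.1 z.2)%R (z.2 / rh z.1 z.2)%R *
    (indpos z.2 * z.2 ^+ k)%:E)%E).
    apply: emeasurable_funM.
      apply: (measurableT_comp (g := fun z : mR * mR =>
        (rh z.1 z.2, z.1 / rh z.1 z.2, z.2 / rh z.1 z.2)) mPsi).
      apply: measurable_fun_pair; first apply: measurable_fun_pair => //.
        by apply: measurable_funM => //; exact: measurable_funV.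
      by apply: measurable_funM => //; exact: measurable_funV.
    by apply/measurable_EFinP; exact: (measurableT_comp (mw k)).
  by move=> z; rewrite mule_ge0// lee_fin.
- by move=> x _; apply: integral_ge0 => r _; rewrite mule_ge0// lee_fin.
rewrite (polar_substitution k mPsi Psi0) -muleA; congr (C * _)%E.
have mI : measurable_fun setT (fun s => rho_int k.+1 (fun u => F s (cosq s * u)%R) *
    (ind11 s * (cosq s ^+ k / cosq s))%:E)%E.
  apply: emeasurable_funM; last by apply/measurable_EFinP; exact: measurable_rho_weight.
  apply: (measurableT_comp (g := fun s : mR => (s, cosq s)) mRF).
  by apply: measurable_fun_pair => //; exact: measurable_cosq.
have I0 s : (0 <= rho_int k.+1 (fun u => F s (cosq s * u)%R) *
    (ind11 s * (cosq s ^+ k / cosq s))%:E)%E.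
  by apply: mule_ge0; [exact: rho_int_ge0|rewrite lee_fin rho_weight_ge0].
rewrite -ge0_integralZr//; last 3 first.
- by apply/measurable_EFinP; apply: measurable_funM; [exact: measurable_ind01|exact: mw].
- by move=> t _; rewrite lee_fin mulr_ge0 ?ind01_ge0.
- exact: integral_ge0.
apply: eq_integral => t _; rewrite -ge0_integralZl//; last first.
  by rewrite lee_fin mulr_ge0 ?ind01_ge0.
apply: eq_integral => s _; rewrite /Psi EFinM [in RHS]EFinM.
by rewrite -!muleA; congr (_ * _)%E; rewrite muleCA.
Qed.

End polar.

(** * Surface measure and the joint law of two orthogonal coordinates *)

Section surface.
Context (R : realType).
Notation leb := (@lebesgue_measure R).
Notation L p := (@lebesgue_cV R p).
Notation mR := (measurableTypeR R).

Definition direction p (x : 'cV[R]_p) : 'cV[R]_p := (cnorm x)^-1 *: x.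

Lemma measurable_cnorm p : measurable_fun setT (@cnorm R p).
Proof. exact: measurable_fun_cnorm. Qed.

Lemma measurable_direction p : measurable_fun setT (@direction p).
Proof.
apply: measurable_fun_scaleV => //; apply: measurable_funV.
exact: measurable_cnorm.
Qed.

Lemma measurable_shell p :
  measurable [set x : 'cV[R]_p | (0 < cnorm x <= 1)%R].
Proof.
rewrite (_ : [set _ | _] = @cnorm R p @^-1` `]0, 1]); last first.
  by apply/seteqP; split => x /=; rewrite in_itv.
by rewrite -[X in measurable X]setTI; exact: measurable_cnorm.
Qed.

Lemma surface_area_measure p : exists m : {measure set 'cV[R]_p -> \bar R},
  m = @surface_area R p :> (set _ -> \bar R).
Proof.
have mB := @measurable_shell p.
have [m mE] := measure_of_pushforward (mrestr (L p) mB) (@measurable_direction p).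
exists (mscale (p%:R%:nng : {nonneg R}) m); apply/funext => A.
rewrite /surface_area -[LHS]/(p%:R%:E * m A)%E mE /pushforward /mrestr.
congr (_ * _)%E; congr (lebesgue_cV _).
by rewrite setIC.
Qed.

Lemma ge0_integral_surface_area p (F : 'cV[R]_p -> \bar R) :
  measurable_fun setT F -> (forall x, 0 <= F x)%E ->
  (\int[@surface_area R p]_x F x =
   p%:R%:E * \int[L p]_x (F (direction x) * (ind01 (cnorm x))%:E))%E.
Proof.
move=> mF F0; have mB := @measurable_shell p.
have [m mE] := measure_of_pushforward (mrestr (L p) mB) (@measurable_direction p).
have -> : @surface_area R p = mscale (p%:R%:nng : {nonneg R}) m.
  apply/esym/funext => A.
  rewrite /surface_area -[LHS]/(p%:R%:E * m A)%E mE /pushforward /mrestr.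
  congr (_ * _)%E; congr (lebesgue_cV _).
  by rewrite setIC.
rewrite ge0_integral_mscale//=; congr (_ * _)%E.
rewrite mE ge0_integral_pushforward//; last exact: measurable_direction.
rewrite preimage_setT; apply: (ge0_integral_density (g := fun x => ind01 (cnorm x))) => //.
- by apply: (measurableT_comp (@measurable_ind01 R)); exact: measurable_cnorm.
- move=> A mA; rewrite /mrestr.
  have -> : (fun x : 'cV[R]_p => (ind01 (cnorm x))%:E) =
      (fun x => (\1_[set x : 'cV[R]_p | (0 < cnorm x <= 1)%R] x)%:E).
    apply/funext => x; rewrite ind01E indicE; congr (nat_of_bool _)%:R%:E.
    by apply/idP/idP; rewrite inE.
  by rewrite integral_indic// setIC.
- by move=> x; exact: F0.
- by apply: (measurableT_comp mF); exact: measurable_direction.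
Qed.

(** Two reflections suffice: one carries [theta] to the first axis, the next carries the image of
    [eta] to the second axis and fixes the first, which is orthogonal to the vector reflected
    along. *)
Lemma ge0_integral_cV_axes k (theta eta : 'cV[R]_k.+2)
    (H : R -> R -> R -> \bar R) :
  dot theta theta = 1 -> dot eta eta = 1 -> dot theta eta = 0 ->
  measurable_fun setT (fun z : mR * mR * mR => H z.1.1 z.1.2 z.2) ->
  (forall a b c, 0 <= H a b c)%E ->
  (\int[L k.+2]_x H (dot x theta) (dot x eta) (cnorm x) =
   \int[L k.+2]_x H (x ord0 0%R) (x (lift ord0 ord0) 0%R) (cnorm x))%E.
Proof.
move=> th1 et1 thet mH H0.
pose e (i : 'I_k.+2) : 'cV[R]_k.+2 := \col_j (j == i)%:R.
have de x i : dot x (e i) = x i 0.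
  rewrite dotE (bigD1 i)//= big1 => [|j ji]; rewrite mxE ?eqxx ?mulr1 ?addr0//.
  by rewrite (negbTE ji) mulr0.
have ee i : dot (e i) (e i) = 1 by rewrite de mxE eqxx.
have mD d (T : measurableType d) (f : T -> 'cV[R]_k.+2) (a b : 'cV[R]_k.+2) :
    measurable_fun setT f ->
    measurable_fun setT (fun x => H (dot (f x) a) (dot (f x) b) (cnorm (f x))).
  move=> mf; apply: (measurableT_comp (g := fun x =>
    (dot (f x) a, dot (f x) b, cnorm (f x))) mH).
  apply: measurable_fun_pair; last exact: measurable_fun_cnorm.
  by apply: measurable_fun_pair; apply: measurable_fun_dot => //; exact: measurable_cst.
have refl a b c : (\int[L k.+2]_x H (dot x (reflect_along c a))
      (dot x (reflect_along c b)) (cnorm x) =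
    \int[L k.+2]_x H (dot x a) (dot x b) (cnorm x))%E.
  rewrite -[LHS](ge0_integral_cV_reflect c); last 2 first.
  - exact: (mD _ _ id).
  - by move=> x; exact: H0.
  apply: eq_integral => x _.
  by rewrite !dot_reflect_along /cnorm dot_reflect_along.
rewrite -(refl theta eta (theta - e ord0)) reflect_along_sub ?th1 ?ee//.
set eta1 := reflect_along _ eta.
have e1 : dot eta1 eta1 = 1 by rewrite dot_reflect_along.
have e01 : dot (e ord0) eta1 = 0.
  by rewrite -(reflect_along_sub (x := theta) (y := e ord0)) ?th1 ?ee// dot_reflect_along.
rewrite -(refl (e ord0) eta1 (eta1 - e (lift ord0 ord0))).
rewrite reflect_along_sub ?e1 ?ee// reflect_along_orth; last first.
  by rewrite dotBl dotC e01 de mxE subr0.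
by apply: eq_integral => x _; rewrite !de.
Qed.

Section law.
Context d (T : measurableType d) (P : probability T R) (k : nat).
Context (X : T -> 'cV[R]_k.+2) (theta : 'cV[R]_k.+2) (c : R) (phi : R -> R).
Hypotheses (mX : measurable_fun setT X) (th1 : dot theta theta = 1).
Hypotheses (c0 : 0 <= c) (phi0 : forall s, 0 <= phi s).
Hypothesis mphi : measurable_fun setT phi.
Hypothesis PX : has_density P X (@surface_area R k.+2)
  (fun x => c * phi (dot x theta)).

Lemma ge0_integral_has_density (F : 'cV[R]_k.+2 -> \bar R) :
  measurable_fun setT F -> (forall x, 0 <= F x)%E ->
  (\int[P]_w F (X w) = \int[@surface_area R k.+2]_x
     (F x * (c * phi (dot x theta))%:E))%E.
Proof.
move=> mF F0.
have [m mE] := measure_of_pushforward P mX.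
have [S SE] := surface_area_measure k.+2.
have -> : (\int[P]_w F (X w) = \int[m]_x F x)%E.
  by rewrite mE ge0_integral_pushforward// preimage_setT.
rewrite -SE; apply: (ge0_integral_density (g := fun x => c * phi (dot x theta))) => //.
- by move=> x; exact: mulr_ge0.
- apply: measurable_funM; first exact: measurable_cst.
  apply: (measurableT_comp mphi); apply: measurable_fun_dot => //; exact: measurable_cst.
- by move=> A mA; rewrite mE SE; exact: PX.
Qed.

Let W s := ind11 s * (cosq s ^+ k / cosq s) * phi s.

(** The constant is chosen before [eta] and [F]: a constant [F] will determine it, and its
    independence of [eta] carries the rotational symmetry around [theta]. *)
Lemma tangent_normal_law : exists2 K : \bar R, (0 <= K)%E &
  forall eta (F : R -> R -> \bar R), dot eta eta = 1 -> dot theta eta = 0 ->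
    measurable_fun setT (fun z : mR * mR => F z.1 z.2) ->
    (forall s v, 0 <= F s v)%E ->
  (\int[P]_w F (dot (X w) theta) (dot (X w) eta) =
   K * \int[leb]_s (rho_int k.+1 (fun u => F s (cosq s * u)%R) * (W s)%:E))%E.
Proof.
have [C C0 cone] := integral_cone R k.
exists (k.+2%:R%:E * c%:E * C)%E; first by rewrite !mule_ge0 ?lee_fin.
move=> eta F et1 thet mF F0.
have mFC d' (T' : measurableType d') (f g : T' -> R) : measurable_fun setT f ->
    measurable_fun setT g -> measurable_fun setT (fun t => F (f t) (g t)).
  move=> mf mg; apply: (measurableT_comp (g := fun t => (f t, g t)) mF).
  exact: measurable_fun_pair.
have mdt (v : 'cV[R]_k.+2) : measurable_fun setT (fun x => dot x v).
  by apply: measurable_fun_dot => //; exact: measurable_cst.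
rewrite (ge0_integral_has_density (F := fun x => F (dot x theta) (dot x eta)))//;
  last exact: mFC.
rewrite ge0_integral_surface_area; last 2 first.
- apply: emeasurable_funM; first exact: mFC.
  apply/measurable_EFinP; apply: measurable_funM; first exact: measurable_cst.
  exact: (measurableT_comp mphi).
- by move=> x; rewrite mule_ge0// lee_fin mulr_ge0.
rewrite -!muleA; congr (_ * _)%E.
pose F2 s v := (F s v * (phi s)%:E)%E.
have mF2 : measurable_fun setT (fun z : mR * mR => F2 z.1 z.2).
  apply: emeasurable_funM => //; apply/measurable_EFinP.
  exact: (measurableT_comp mphi).
have F20 s v : (0 <= F2 s v)%E by rewrite mule_ge0// lee_fin.
transitivity (\int[L k.+2]_x (c%:E * (F2 (dot x theta / cnorm x)%R (dot x eta / cnorm x)%R *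
    (ind01 (cnorm x))%:E)))%E.
  apply: eq_integral => x _; rewrite /direction !dotZl !(mulrC (cnorm x)^-1).
  by rewrite /F2 EFinM !muleA (muleC (F _ _)).
pose H a b r := (F2 (a / r)%R (b / r)%R * (ind01 r)%:E)%E.
have mH : measurable_fun setT (fun z : mR * mR * mR => H z.1.1 z.1.2 z.2).
  have m1 : measurable_fun setT (fun z : mR * mR * mR => z.1.1 / z.2 : R).
    apply: measurable_funM; first exact: (measurableT_comp measurable_fst).
    by apply: measurable_funV; exact: measurable_snd.
  have m2 : measurable_fun setT (fun z : mR * mR * mR => z.1.2 / z.2 : R).
    apply: measurable_funM; first exact: (measurableT_comp measurable_snd).
    by apply: measurable_funV; exact: measurable_snd.
  apply: emeasurable_funM.
    apply: (measurableT_comp (g := fun z : mR * mR * mR => (z.1.1 / z.2, z.1.2 / z.2)) mF2).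
    exact: measurable_fun_pair.
  apply/measurable_EFinP; apply: (measurableT_comp (@measurable_ind01 R)).
  exact: measurable_snd.
have H0 a b r : (0 <= H a b r)%E by rewrite mule_ge0// lee_fin ind01_ge0.
rewrite ge0_integralZl//; last 2 first.
- apply: (measurableT_comp (g := fun x : 'cV[R]_k.+2 =>
    (dot x theta, dot x eta, cnorm x)) mH).
  apply: measurable_fun_pair; last exact: measurable_cnorm.
  exact: measurable_fun_pair.
- by move=> x _; exact: H0.
congr (_ * _)%E.
rewrite (ge0_integral_cV_axes (H := H) th1 et1 thet mH H0) (cone F2 mF2 F20).
congr (_ * _)%E; apply: eq_integral => s _.
rewrite /F2 (_ : (fun u => _) = (fun u => (phi s)%:E * F s (cosq s * u)%R)%E); last first.
  by apply/funext => u; rewrite muleC.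
rewrite rho_intZ//; last 2 first.
- apply: mFC; first exact: measurable_cst.
  by apply: measurable_funM => //; exact: measurable_cst.
- by rewrite lee_fin.
by rewrite /W [in RHS]EFinM (muleC (phi s)%:E) -!muleA; congr (_ * _)%E; rewrite muleC.
Qed.

End law.

End surface.

(** * Gamma integrals and Laplace asymptotics *)

Section gamma.
Context (R : realType).
Notation leb := (@lebesgue_measure R).
Notation mR := (measurableTypeR R).
Implicit Types xi zeta : R.

Lemma measurable_powRf d (T : measurableType d) (f : T -> R) xi :
  measurable_fun setT f -> measurable_fun setT (fun x => f x `^ xi).
Proof. by move=> mf; apply: (measurableT_comp (measurable_powR xi)). Qed.

Lemma measurable_expRf d (T : measurableType d) (f : T -> R) :
  measurable_fun setT f -> measurable_fun setT (fun x => expR (f x)).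
Proof. by move=> mf; apply: (measurableT_comp (@measurable_expR R)). Qed.

Lemma integral_mkindic (D : set R) (g : R -> R) :
  (\int[leb]_(x in D) (g x)%:E = \int[leb]_x (\1_D x * g x)%:E)%E.
Proof.
rewrite integral_mkcond; apply: eq_integral => x _; rewrite patchE indicE.
by case: ifP => _; rewrite ?mul1r ?mul0r.
Qed.

Lemma integral_powR xi r : -1 < xi -> 0 < r ->
  (\int[leb]_(u in `]0%R, r]) (u `^ xi)%:E = (r `^ (xi + 1) / (xi + 1))%:E)%E.
Proof.
move=> xi1 r0; have xi0 : 0 < xi + 1 by rewrite -ltrBlDr sub0r.
pose e n : R := r / n.+1%:R.
have e0 n : 0 < e n by rewrite divr_gt0.
have er n : e n <= r by rewrite ler_pdivrMr// ler_peMr ?ler1n// ltW.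
pose A n : set R := [set` `]e n, r]].
have Ai n u : A n u <-> e n < u <= r by rewrite /A /= in_itv.
have mf : measurable_fun setT (fun u : R => (u `^ xi)%:E).
  by apply/measurable_EFinP; apply: measurable_powRf; exact: measurable_id.
have AE : `]0, r]%classic = \bigcup_n A n.
  apply/seteqP; split => [u/=|u [n _]/Ai /andP[nu ur]/=]; rewrite in_itv/=.
    move=> /andP[u0 ur]; have [n _ nu] : exists2 n, True & e n < u.
      exists (Num.truncn (r / u)) => //; rewrite /e ltr_pdivrMr// mulrC -ltr_pdivrMr//.
      by rewrite truncnS_gt.
    by exists n => //; apply/Ai; rewrite nu.
  by rewrite ur andbT (lt_trans _ nu).
have ndA : nondecreasing_seq A.
  move=> m n mn; apply/subsetPset => u /Ai /andP[mu ur]; apply/Ai.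
  rewrite ur andbT (le_lt_trans _ mu)// ler_pM2l// lef_pV2 ?posrE//.
  by rewrite ler_nat.
have h : (\int[leb]_(x in A n) (x `^ xi)%:E)%E @[n --> \oo] -->
    (\int[leb]_(x in `]0%R, r]) (x `^ xi)%:E)%E.
  rewrite AE; apply: (ge0_nondecreasing_set_cvg_integral (mu := leb) ndA).
  - by move=> n; exact: measurable_itv.
  - by move=> n; exact: measurable_funTS.
  - by move=> n x _; rewrite lee_fin powR_ge0.
have FTC n : (\int[leb]_(x in A n.+1) (x `^ xi)%:E =
    (r `^ (xi + 1) / (xi + 1) - e n.+1 `^ (xi + 1) / (xi + 1))%:E)%E.
  have enr : e n.+1 < r by rewrite ltr_pdivrMr// ltr_pMr// ltr1n.
  rewrite integral_itv_obnd_cbnd; last exact: measurable_funTS.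
  pose F (u : R) := u `^ (xi + 1) / (xi + 1).
  have dF (u : R) : 0 < u -> is_derive u 1 F (u `^ xi).
    move=> u0; have := is_deriveM (is_derive1_powR (xi + 1) u0)
      (is_derive_cst ((xi + 1)^-1) u (1 : R)).
    move=> d; apply: (is_derive_eq d).
    rewrite scaler0 add0r /GRing.scale/= addrK mulrA mulVf ?mul1r//.
    exact: lt0r_neq0.
  have cf (u : R) : 0 < u -> {for u, continuous (fun u => u `^ xi)}.
    move=> u0; apply: differentiable_continuous; apply/derivable1_diffP.
    by have [] := is_derive1_powR xi u0.
  have pos (u : R) : u \in `[e n.+1, r] -> 0 < u.
    by rewrite in_itv/= => /andP[+ _]; apply: lt_le_trans.
  rewrite (@continuous_FTC2 R (fun u => u `^ xi) F)//.
  - apply: continuous_in_subspaceT => u; rewrite inE => /pos; exact: cf.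
  - split.
    + by move=> u /subset_itv_oo_cc/pos/dF [].
    + apply: cvg_at_right_filter; apply: differentiable_continuous.
      by apply/derivable1_diffP; have [] := dF _ (e0 n.+1).
    + apply: cvg_at_left_filter; apply: differentiable_continuous.
      by apply/derivable1_diffP; have [] := dF _ r0.
  - by move=> u /subset_itv_oo_cc/pos/dF duF; rewrite derive1E; apply: derive_val.
(* Since [e 0 = r] gives an empty interval, the fundamental theorem of calculus is applied from
   index 1 on. Approaching 0 from the right is needed because a negative [xi] makes the integrand
   unbounded there. *)
move: h; rewrite -(cvg_shiftS (fun n => \int[leb]_(x in A n) (x `^ xi)%:E)%E) => h.
apply: (cvg_unique _ h) => //.
rewrite /= (eq_cvg _ _ FTC); apply: cvg_EFin; first by near=> n.
rewrite -[X in _ --> X]subr0; apply: cvgB; first exact: cvg_cst.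
rewrite -[X in _ --> X](mul0r (xi + 1)^-1); apply: cvgMl.
rewrite (cvg_shiftS (fun n => e n `^ (xi + 1))).
have ec : e n @[n --> \oo] --> (0 : R).
  rewrite -[X in _ --> X](mulr0 r); apply: cvgMr.
  exact: cvg_harmonic.
have pc := powR_cvg0 xi0; apply/cvgrPdist_lt => eps eps0.
move/cvgrPdist_lt : pc => /(_ _ eps0); rewrite near_withinE => /ec.
by move=> H; near=> n; have : 0 < e n -> `|0 - e n `^ (xi + 1)| < eps; [near: n|apply].
Unshelve. all: end_near. Qed.

Lemma integral_expRN u :
  (\int[leb]_r (\1_`]u, +oo[ r * expR (- r))%:E = (expR (- u))%:E)%E.
Proof.
have mI v : measurable_fun setT (fun r : R => (\1_`]v, +oo[ r * expR (- r))%:E).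
  apply/measurable_EFinP; apply: measurable_funM; first exact: measurable_indic.
  by apply: measurable_expRf; exact: measurable_funN.
have I0 v (r : R) : (0 <= (\1_`]v, +oo[ r * expR (- r))%:E)%E.
  by rewrite lee_fin mulr_ge0// ?expR_ge0// indicE.
rewrite -(ge0_integral_shift (mI u) (I0 u) u).
have <- : (\int[leb]_r ((expR (- u))%:E * (exponential_pdf 1 r)%:E) = (expR (- u))%:E)%E.
  have me : measurable_fun setT (fun r : R => (exponential_pdf 1 r)%:E).
    by apply/measurable_EFinP; exact: (measurable_exponential_pdf (1 : R)).
  have e0 (r : mR) : setT r -> (0 <= (exponential_pdf (1 : R) r)%:E)%E.
    by move=> _; rewrite lee_fin exponential_pdf_ge0.
  have k0 : (0 <= (expR (- u))%:E)%E by rewrite lee_fin expR_ge0.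
  rewrite (ge0_integralZl leb measurableT me e0 k0).
  by rewrite integral_exponential_pdf ?mule1.
apply: ae_eq_integral => //.
- by apply: (measurableT_comp (mI u)); exact: measurable_funD.
- apply/measurable_EFinP; apply: measurable_funM; first exact: measurable_cst.
  exact: measurable_exponential_pdf.
exists [set 0]; split => //; first exact: lebesgue_measure_set1.
move=> r /=; apply: contra_notP => /eqP r0 _.
rewrite -EFinM indicE; congr EFin; have [rn|rp] := ltP r 0.
  rewrite lt0_exponential_pdf// mulr0 memNset ?mul0r//= in_itv/= andbT.
  by rewrite ltrDr; apply/negP; rewrite -leNgt ltW.
have {r0} rp' : 0 < r by rewrite lt_def r0.
rewrite exponential_pdfE// mem_set/= ?in_itv/= ?andbT ?ltrDr//.
by rewrite !mul1r opprD mulN1r expRD mulrC.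
Qed.

(** The Gamma function at [xi + 1], as an extended real so that its finiteness is a separate
    statement. *)
Definition gammaE xi : \bar R :=
  (\int[leb]_r (indpos r * (r `^ xi * expR (- r)))%:E)%E.

Let mg xi : measurable_fun setT (fun r => indpos r * (r `^ xi * expR (- r))).
Proof.
apply: measurable_funM; first exact: measurable_indpos.
apply: measurable_funM; first by apply: measurable_powRf; exact: measurable_id.
by apply: measurable_expRf; exact: measurable_funN.
Qed.

Let g0 xi r : 0 <= indpos r * (r `^ xi * expR (- r)).
Proof. by rewrite mulr_ge0 ?indpos_ge0// mulr_ge0 ?powR_ge0 ?expR_ge0. Qed.

Lemma gammaE_ge0 xi : (0 <= gammaE xi)%E.
Proof. by apply: integral_ge0 => r _; rewrite lee_fin. Qed.

(** In place of an integration by parts, [r^(xi + 1)] is written as [xi + 1] times the integral of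
    [u^xi] over [0 < u < r]; after Tonelli the inner integral of [exp (- r)] over [r > u] is
    [exp (- u)]. *)
Lemma gammaE_rec xi : -1 < xi ->
  gammaE (xi + 1) = ((xi + 1)%:E * gammaE xi)%E.
Proof.
move=> xi1; have xi0 : 0 < xi + 1 by rewrite -ltrBlDr sub0r.
pose h (z : mR * mR) : R :=
  indpos z.2 * z.2 `^ xi * (\1_`]z.2, +oo[ z.1 * expR (- z.1)).
have h0 z : 0 <= h z.
  by rewrite /h mulr_ge0// mulr_ge0 ?indpos_ge0 ?powR_ge0 ?expR_ge0// indicE.
have mh : measurable_fun setT h.
  apply: measurable_funM.
    apply: measurable_funM; first exact: (measurableT_comp (@measurable_indpos R)).
    by apply: measurable_powRf; exact: measurable_snd.
  apply: measurable_funM.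
    rewrite (_ : (fun _ => _) = (fun z : mR * mR => indpos (z.1 - z.2))).
      apply: (measurableT_comp (@measurable_indpos R)); apply: measurable_funB.
        exact: measurable_fst.
      exact: measurable_snd.
    apply/funext => z; rewrite indposE indicE subr_gt0; congr (nat_of_bool _)%:R.
    by apply/idP/idP; rewrite inE/= in_itv/= andbT.
  by apply: measurable_expRf; apply: measurable_funN; exact: measurable_fst.
transitivity (\int[leb]_r ((xi + 1)%:E * \int[leb]_u (h (r, u))%:E))%E.
  apply: eq_integral => r _; rewrite indposE; case: ltP => r0; last first.
    rewrite mul0r integral0_eq ?mule0// => u _; rewrite /h/= indposE.
    case: ltP => u0; last by rewrite !mul0r.
    rewrite indicE memNset ?mul0r ?mulr0//= in_itv/= andbT.
    by apply/negP; rewrite -leNgt (le_trans r0)// ltW.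
  rewrite mul1r; have -> : (\int[leb]_u (h (r, u))%:E =
      \int[leb]_u ((expR (- r))%:E * (\1_`]0%R, r[ u * u `^ xi)%:E))%E.
    apply: eq_integral => u _; rewrite /h/= indposE.
    have -> : \1_`]0, r[ u = (0 < u < r)%R%:R :> R.
      rewrite indicE; congr (nat_of_bool _)%:R.
      by apply/idP/idP; rewrite inE/= in_itv.
    have -> : \1_`]u, +oo[ r = (u < r)%R%:R :> R.
      rewrite indicE; congr (nat_of_bool _)%:R.
      by apply/idP/idP; rewrite inE/= in_itv/= andbT.
    case: (0 < u)%R; case: (u < r)%R => /=; rewrite ?mul0r ?mulr0 ?mul0r ?mule0//.
    by rewrite !mul1r -EFinM mulrC.
  have mp : measurable_fun setT (fun u : R => (u `^ xi)%:E).
    by apply/measurable_EFinP; apply: measurable_powRf; exact: measurable_id.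
  have mi : measurable_fun setT (fun u : R => (\1_`]0%R, r[ u * u `^ xi)%:E).
    apply/measurable_EFinP; apply: measurable_funM; first exact: measurable_indic.
    by apply: measurable_powRf; exact: measurable_id.
  have i0 (u : mR) : setT u -> (0 <= (\1_`]0%R, r[ u * u `^ xi)%:E)%E.
    by move=> _; rewrite lee_fin mulr_ge0 ?powR_ge0// indicE.
  have k0 : (0 <= (expR (- r))%:E)%E by rewrite lee_fin expR_ge0.
  rewrite (ge0_integralZl leb measurableT mi i0 k0) -integral_mkindic integral_itv_bndo_bndc; last exact: measurable_funTS.
  rewrite integral_powR// -!EFinM; congr EFin; field; exact: lt0r_neq0.
have mhi : measurable_fun setT (fun r => \int[leb]_u (h (r, u))%:E)%E.
  apply: (measurable_fun_fubini_tonelli_F (m2 := leb) (EFin \o h)).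
    exact/measurable_EFinP.
  by move=> z; rewrite lee_fin.
rewrite ge0_integralZl//; last 2 first.
- by move=> r _; apply: integral_ge0 => u _; rewrite lee_fin.
- by rewrite lee_fin ltW.
congr (_ * _)%E.
rewrite (fubini_tonelli (m1 := leb) (m2 := leb) (EFin \o h))/=; last 2 first.
- exact/measurable_EFinP.
- by move=> z; rewrite lee_fin.
apply: eq_integral => u _.
transitivity (\int[leb]_x ((indpos u * u `^ xi)%:E *
    (\1_`]u, +oo[ x * expR (- x))%:E))%E.
  by apply: eq_integral => x _; rewrite -EFinM.
have mi : measurable_fun setT (fun x : R => (\1_`]u, +oo[ x * expR (- x))%:E).
  apply/measurable_EFinP; apply: measurable_funM; first exact: measurable_indic.
  by apply: measurable_expRf; exact: measurable_funN.
have i0 (x : mR) : setT x -> (0 <= (\1_`]u, +oo[ x * expR (- x))%:E)%E.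
  by move=> _; rewrite lee_fin mulr_ge0 ?expR_ge0// indicE.
have k0 : (0 <= (indpos u * u `^ xi)%:E)%E.
  by rewrite lee_fin mulr_ge0 ?indpos_ge0 ?powR_ge0.
rewrite (ge0_integralZl leb measurableT mi i0 k0).
by rewrite integral_expRN -EFinM mulrA.
Qed.

(** For [-1 < xi <= 0] the integrand is below [r^xi] on []0, 1]] and below [exp (- r)] beyond;
    larger exponents follow from the recursion. *)
Lemma gammaE_fin xi : -1 < xi -> (gammaE xi < +oo)%E.
Proof.
have base x : -1 < x -> x <= 0 -> (gammaE x < +oo)%E.
  move=> x1 x0; have mp : measurable_fun setT (fun u : R => (u `^ x)%:E).
    by apply/measurable_EFinP; apply: measurable_powRf; exact: measurable_id.
  have m1 : measurable_fun setT (fun u : R => (\1_`]0%R, 1%R] u * u `^ x)%:E).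
    apply/measurable_EFinP; apply: measurable_funM; first exact: measurable_indic.
    by apply: measurable_powRf; exact: measurable_id.
  have m2 : measurable_fun setT (fun r : R => (\1_`]0%R, +oo[ r * expR (- r))%:E).
    apply/measurable_EFinP; apply: measurable_funM; first exact: measurable_indic.
    by apply: measurable_expRf; exact: measurable_funN.
  have p1 (r : R) : (0 <= (\1_`]0%R, 1%R] r * r `^ x)%:E)%E.
    by rewrite lee_fin mulr_ge0 ?powR_ge0// indicE.
  have p2 (r : R) : (0 <= (\1_`]0%R, +oo[ r * expR (- r))%:E)%E.
    by rewrite lee_fin mulr_ge0// ?expR_ge0// indicE.
  apply: (@le_lt_trans _ _ (\int[leb]_r ((\1_`]0%R, 1%R] r * r `^ x)%:E +
    (\1_`]0%R, +oo[ r * expR (- r))%:E))%E).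
    apply: ge0_le_integral => //.
    - by move=> r _; rewrite lee_fin.
    - by apply/measurable_EFinP; exact: mg.
    - exact: emeasurable_funD.
    move=> r _; rewrite -/(indpos r) indposE; case: ltP => r0; last first.
      by rewrite !mul0r adde_ge0.
    rewrite !mul1r -EFinD lee_fin [X in _ <= X + _]mulrC.
    rewrite indicE; have [r1|r1] := leP r 1.
      rewrite mem_set/= ?in_itv/= ?r0// mulr1.
      rewrite (@le_trans _ _ (r `^ x))// ?lerDl ?expR_ge0//.
      by rewrite ler_piMr ?powR_ge0// expR_le1 oppr_le0 ltW.
    rewrite memNset/= ?in_itv/=; last by rewrite r0 leNgt r1.
    rewrite mulr0 add0r.
    by rewrite ler_piMl ?expR_ge0// -(powRr0 r) ler_powR// ltW.
  rewrite ge0_integralD// -integral_mkindic integral_powR// integral_expRN.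
  by rewrite -EFinD ltry.
suff : forall n x, -1 < x -> x <= n%:R -> (gammaE x < +oo)%E.
  move=> h x1; apply: (h (Num.truncn (xi + 1))) => //.
  have [x0|x0] := leP 0 (xi + 1).
    by have := truncnS_gt (xi + 1); rewrite -natr1; lra.
  by rewrite (@le_trans _ _ 0)//; lra.
elim => [|n IH] x x1 xn; first exact: base.
have [x0|x0] := leP x 0; first exact: base.
rewrite -(subrK 1 x) gammaE_rec; last by rewrite ltrBrDr addNr.
rewrite lte_mul_pinfty// ?lee_fin ?subrK ?ltW//.
by apply: IH; [rewrite ltrBrDr addNr|rewrite lerBlDr -natr1 in xn *].
Qed.

Lemma gammaE_gt0 xi : -1 < xi -> (0 < gammaE xi)%E.
Proof.
move=> x1; have mp : measurable_fun setT (fun u : R => (u `^ xi)%:E).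
  by apply/measurable_EFinP; apply: measurable_powRf; exact: measurable_id.
have m1 : measurable_fun setT (fun u : R => (\1_`]0%R, 1%R] u * u `^ xi)%:E).
  apply/measurable_EFinP; apply: measurable_funM; first exact: measurable_indic.
    by apply: measurable_powRf; exact: measurable_id.
have p1 (r : R) : (0 <= (\1_`]0%R, 1%R] r * r `^ xi)%:E)%E.
  by rewrite lee_fin mulr_ge0 ?powR_ge0// indicE.
have e0 : (0 <= (expR (-1 : R))%:E)%E by rewrite lee_fin expR_ge0.
apply: (@lt_le_trans _ _ (\int[leb]_r ((expR (-1 : R))%:E *
    (\1_`]0%R, 1%R] r * r `^ xi)%:E))%E).
  rewrite (ge0_integralZl leb measurableT m1 (fun x _ => p1 x) e0).
  rewrite -integral_mkindic integral_powR// -EFinM lte_fin.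
  by rewrite mulr_gt0 ?expR_gt0// divr_gt0 ?powR_gt0// -ltrBlDr sub0r.
apply: ge0_le_integral => //.
- by move=> r _; exact: mule_ge0.
- by apply: emeasurable_funM => //; exact: measurable_cst.
- by apply/measurable_EFinP; exact: mg.
move=> r _; rewrite -EFinM lee_fin indicE.
case: (boolP (r \in _)) => [|_]; last by rewrite mul0r mulr0.
rewrite inE/= in_itv/= => /andP[r0 r1]; rewrite indposE r0 !mul1r.
by rewrite mulrC ler_wpM2l ?powR_ge0// ler_expR lerN2.
Qed.

End gamma.

(** * Laplace asymptotics at the endpoint 1 *)

Section laplace.
Context (R : realType).
Notation leb := (@lebesgue_measure R).
Notation mR := (measurableTypeR R).
Implicit Types xi zeta : R.

Lemma integral_indicE (D : set R) (g : R -> R) : measurable D ->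
  measurable_fun setT g -> measurable_fun setT (fun x : R => (\1_D x * g x)%:E).
Proof.
by move=> mD mg; apply/measurable_EFinP; apply: measurable_funM.
Qed.

Lemma integral_cc11 (g : R -> R) : measurable_fun setT g ->
  (\int[leb]_(x in `[(-1)%R, 1%R]) (g x)%:E = \int[leb]_x (ind11 x * g x)%:E)%E.
Proof.
move=> mg; rewrite integral_itv_bndoo; first exact: integral_mkindic.
by apply/measurable_EFinP; exact: measurable_funTS.
Qed.

Lemma continuous_powR xi (x : R) : 0 < x -> {for x, continuous (fun u => u `^ xi)}.
Proof.
move=> x0; apply: differentiable_continuous; apply/derivable1_diffP.
by have [] := is_derive1_powR xi x0.
Qed.

Lemma cvge0_ge0 (g : nat -> \bar R) : (forall n, (0 <= g n)%E) ->
  (forall e : R, 0 < e -> \forall n \near \oo, (g n <= e%:E)%E) ->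
  g n @[n --> \oo] --> 0%E.
Proof.
move=> g0 h; apply/fine_cvgP; split.
  near=> n; rewrite ge0_fin_numE//; have : (g n <= 1%:E)%E by near: n; exact: h.
  by move=> /le_lt_trans; apply; rewrite ltry.
apply/cvgrPdist_le => e e0; near=> n; rewrite /= sub0r normrN ger0_norm ?fine_ge0//.
have ge : (g n <= e%:E)%E by near: n; exact: h.
rewrite -lee_fin fineK// ge0_fin_numE//.
by apply: (le_lt_trans ge); rewrite ltry.
Unshelve. all: end_near. Qed.

Definition beta_weight xi zeta (s : R) : R := (1 - s) `^ xi * (1 + s) `^ zeta.

Lemma measurable_beta_weight xi zeta :
  measurable_fun setT (beta_weight xi zeta).
Proof.
apply: measurable_funM; apply: measurable_powRf.
  by apply: measurable_funB => //; exact: measurable_cst.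
by apply: measurable_funD => //; exact: measurable_cst.
Qed.

Lemma beta_weight_ge0 xi zeta s : 0 <= beta_weight xi zeta s.
Proof. by rewrite mulr_ge0 ?powR_ge0. Qed.

(** The variable [r = l * (1 - s)] magnifies the endpoint [s = 1] at scale [1 / l], where the mass
    concentrates. *)
Lemma laplace_scaling xi zeta l : 0 < l ->
  ((l `^ (xi + 1))%:E *
     \int[leb]_s (\1_`[0%R, 1%R[ s * (beta_weight xi zeta s * expR ((s - 1) * l)))%:E =
   \int[leb]_r (\1_`]0%R, l] r *
     (r `^ xi * (2 - l^-1 * r) `^ zeta * expR (- r)))%:E)%E.
Proof.
move=> l0.
pose g s := \1_`[0%R, 1%R[ s * (beta_weight xi zeta s * expR ((s - 1) * l)).
have mg : measurable_fun setT g.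
  apply: measurable_funM; first exact: measurable_indic.
  apply: measurable_funM; first exact: measurable_beta_weight.
  apply: measurable_expRf; apply: measurable_funM; last exact: measurable_cst.
  by apply: measurable_funB => //; exact: measurable_cst.
have g0 s : 0 <= g s.
  by rewrite /g mulr_ge0 ?indicE// mulr_ge0 ?beta_weight_ge0 ?expR_ge0.
pose G (s : R) := (g s)%:E.
have mG : measurable_fun setT G by apply/measurable_EFinP.
have G0 s : (0 <= G s)%E by rewrite lee_fin.
have mG1 : measurable_fun setT (fun s : R => G (s + 1)).
  by apply: (measurableT_comp mG); exact: measurable_funD.
have mG2 : measurable_fun setT (fun s : R => G (- s + 1)).
  by apply: (measurableT_comp mG); apply: measurable_funD.
rewrite -/G -(ge0_integral_shift mG G0 1) -(ge0_integral_opp mG1)//.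
have li : 0 < l^-1 by rewrite invr_gt0.
rewrite (ge0_integral_affine mG2 _ 0 li)//.
have mG3 : measurable_fun setT (fun r : R => G (- (l^-1 * r + 0) + 1)%R * (l^-1)%:E)%E.
  apply: emeasurable_funM; last exact: measurable_cst.
  by apply: (measurableT_comp mG2); apply: measurable_funD.
have p0 : (0 <= (l `^ (xi + 1))%:E)%E by rewrite lee_fin powR_ge0.
have q0 (r : mR) : setT r -> (0 <= G (- (l^-1 * r + 0) + 1)%R * (l^-1)%:E)%E.
  by move=> _; rewrite mule_ge0// lee_fin ltW.
rewrite -(ge0_integralZl leb measurableT mG3 q0 p0); apply: eq_integral => r _.
rewrite addr0 /G /g -!EFinM; congr EFin.
have -> : \1_`[0, 1[ (- (l^-1 * r) + 1) = \1_`]0, l] r :> R.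
  rewrite !indicE; congr (nat_of_bool _)%:R; apply/idP/idP; rewrite !inE/= !in_itv/=.
    rewrite addrC subr_ge0 ltrBlDr ltrDl pmulr_rgt0// => /andP[+ ->].
    by rewrite mulrC ler_pdivrMr// mul1r => ->.
  rewrite addrC subr_ge0 ltrBlDr ltrDl pmulr_rgt0// => /andP[-> +].
  by rewrite mulrC ler_pdivrMr// mul1r => ->.
rewrite indicE; case: (boolP (r \in _)) => [|_]; last by rewrite !mul0r mulr0.
rewrite inE/= in_itv/= => /andP[r0 rl]; rewrite !mul1r /beta_weight.
have -> : 1 - (- (l^-1 * r) + 1) = l^-1 * r by ring.
have -> : 1 + (- (l^-1 * r) + 1) = 2 - l^-1 * r by ring.
have -> : (- (l^-1 * r) + 1 - 1) * l = - r by field; exact: lt0r_neq0.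
rewrite powRM ?invr_ge0 ?ltW// powRD; last by rewrite (gt_eqF l0) implybT.
rewrite powRr1 ?ltW//.
have -> : (l^-1) `^ xi = (l `^ xi)^-1.
  by rewrite -(powR_inv1 (ltW l0)) -powRrM mulN1r powRN.
have lx : l `^ xi != 0 by rewrite lt0r_neq0// powR_gt0.
by field; rewrite lx lt0r_neq0.
Qed.

Lemma powR_le_norm (x y c : R) : 1 <= x <= y -> x `^ c <= y `^ `|c|.
Proof.
move=> /andP[x1 xy]; rewrite (@le_trans _ _ (x `^ `|c|))//.
  by apply: ler_powR => //; exact: ler_norm.
by apply: ge0_ler_powR; rewrite ?nnegrE ?normr_ge0//; lra.
Qed.

Lemma cvg_inv_pinfty (l : nat -> R) : l n @[n --> \oo] --> +oo ->
  (l n)^-1 @[n --> \oo] --> (0 : R).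
Proof. by move=> h; apply/gtr0_cvgV0; [move/cvgryPgt: h => /(_ 0)|]. Qed.

(** For [0 <= s < 1] the factor [2 - r / l] lies in [[1, 2]], so the rescaled integrand is dominated
    by [2^|zeta|] times the Gamma integrand whatever the sign of [zeta], and that factor tends to
    2. *)
Lemma laplace_near xi zeta (l : nat -> R) : -1 < xi ->
  (forall n, 1 <= l n) -> l n @[n --> \oo] --> +oo ->
  ((l n `^ (xi + 1))%:E * \int[leb]_s (\1_`[0%R, 1%R[ s *
      (beta_weight xi zeta s * expR ((s - 1) * l n)))%:E)%E @[n --> \oo] -->
  ((2 `^ zeta)%:E * gammaE xi)%E.
Proof.
move=> xi1 l1 loo; have l0 n : 0 < l n by exact: lt_le_trans (l1 n).
pose g (r : R) := indpos r * (r `^ xi * expR (- r)).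
have mg : measurable_fun setT g.
  apply: measurable_funM; first exact: measurable_indpos.
  apply: measurable_funM; first by apply: measurable_powRf; exact: measurable_id.
  by apply: measurable_expRf; exact: measurable_funN.
have g0 r : 0 <= g r by rewrite /g mulr_ge0 ?indpos_ge0// mulr_ge0 ?powR_ge0 ?expR_ge0.
have intg c : leb.-integrable setT (fun r : R => (c * g r)%:E).
  rewrite (_ : (fun _ => _) = (fun r : R => c%:E * (g r)%:E)%E)//.
  apply: integrableZl => //; apply/integrableP; split; first exact/measurable_EFinP.
  under eq_integral => r _ do rewrite gee0_abs ?lee_fin//.
  exact: gammaE_fin.
pose F n (r : R) := \1_`]0%R, l n] r * (r `^ xi * (2 - (l n)^-1 * r) `^ zeta * expR (- r)).
have mF n : measurable_fun setT (fun r => (F n r)%:E).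
  apply: integral_indicE => //; apply: measurable_funM; last first.
    by apply: measurable_expRf; exact: measurable_funN.
  apply: measurable_funM; first by apply: measurable_powRf; exact: measurable_id.
  apply: measurable_powRf; apply: measurable_funB; first exact: measurable_cst.
  by apply: measurable_funM => //; exact: measurable_cst.
have FE n r : F n r = (0 < r <= l n)%R%:R * (r `^ xi * (2 - (l n)^-1 * r) `^ zeta * expR (- r)).
  by rewrite /F indicE; congr (_%:R * _); congr nat_of_bool; apply/idP/idP; rewrite inE/= in_itv.
rewrite (eq_cvg _ _ (fun n => laplace_scaling xi zeta (l0 n))).
have -> : ((2 `^ zeta)%:E * gammaE xi = \int[leb]_r (2 `^ zeta * g r)%:E)%E.
  have k0 : (0 <= (2 `^ zeta : R)%:E)%E by rewrite lee_fin powR_ge0.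
  have mg' : measurable_fun setT (fun r : R => (g r)%:E) by apply/measurable_EFinP.
  have g0' (r : mR) : setT r -> (0 <= (g r)%:E)%E by rewrite lee_fin.
  exact/esym/(ge0_integralZl leb measurableT mg' g0' k0).
apply: (@dominated_cvg _ _ _ leb setT measurableT (fun n (r : mR) => (F n r)%:E)
  _ (fun r => (2 `^ `|zeta| * g r)%:E)) => //.
- move=> r _; rewrite -/(F _ _); apply: cvg_EFin; first by near=> n.
  rewrite /g indposE; have [r0|r0] := leP r 0.
    rewrite (_ : (fun _ => _) = (fun=> 0)).
      by rewrite mul0r mulr0; exact: cvg_cst.
    by apply/funext => n /=; rewrite FE ltNge r0 mul0r.
  rewrite mul1r; apply: (@cvg_trans _ ((r `^ xi * (2 - (l n)^-1 * r) `^ zeta * expR (- r)) @[n --> \oo])).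
    apply: near_eq_cvg; near=> n; rewrite /= FE r0 (_ : r <= l n) ?mul1r//.
    by near: n; move/cvgryPge : loo => /(_ r).
  rewrite mulrA [2 `^ zeta * _]mulrC; apply: cvgMl; apply: cvgMr.
  have c2 : 2 - (l n)^-1 * r @[n --> \oo] --> (2 : R).
    rewrite -[X in _ --> X]subr0 -[X in _ - X](mul0r r).
    by apply: cvgB; [exact: cvg_cst|apply: cvgMl; exact: cvg_inv_pinfty].
  by apply: (@continuous_cvg _ _ _ _ _ _ (fun x : R => x `^ zeta) 2 _ c2); apply: continuous_powR.
- move=> n r _; rewrite abse_EFin lee_fin FE ger0_norm; last first.
    by rewrite mulr_ge0// mulr_ge0 ?expR_ge0// mulr_ge0 ?powR_ge0.
  rewrite /g indposE; have [r0|r0] := leP r 0; first by rewrite !mul0r mulr0.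
  rewrite /=; have [rl|rl] := leP r (l n); last by rewrite mul0r mulr_ge0 ?powR_ge0// mulr_ge0// mulr_ge0 ?powR_ge0 ?expR_ge0.
  rewrite !mul1r [leRHS]mulrA ler_pM2r ?expR_gt0// [leRHS]mulrC ler_wpM2l ?powR_ge0//.
  apply: powR_le_norm.
  have : 0 < (l n)^-1 * r <= 1.
    by rewrite mulr_gt0 ?invr_gt0//= mulrC ler_pdivrMr ?mul1r.
  by lra.
Unshelve. all: end_near. Qed.

Lemma powR_expRN_cvg0 (c : R) (l : nat -> R) : (forall n, 1 <= l n) ->
  l n @[n --> \oo] --> +oo -> l n `^ c * expR (- l n) @[n --> \oo] --> (0 : R).
Proof.
move=> l1 loo; have l0 n : 0 < l n by exact: lt_le_trans (l1 n).
(* With this [m] one has [c <= m - 1], so [exp l >= (l / m)^m] leaves the bound [m^m / l]. *)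
pose m := (Num.truncn `|c|).+2.
have cm : c <= m%:R - 1.
  have := truncnS_gt `|c|; rewrite /m -[in X in _ <= X - _]natr1 addrK.
  by move=> /ltW; apply: le_trans; exact: ler_norm.
apply: (@squeeze_cvgr _ _ _ _ (fun=> 0) (fun n => m%:R ^+ m * (l n)^-1)); last 2 first.
- exact: cvg_cst.
- by rewrite -[X in _ --> X](mulr0 (m%:R ^+ m)); apply: cvgMr; exact: cvg_inv_pinfty.
near=> n; rewrite mulr_ge0 ?powR_ge0 ?expR_ge0//= expRN ler_pdivrMr ?expR_gt0//.
have m0 : 0 < m%:R :> R by [].
have h : (l n / m%:R) ^+ m <= expR (l n).
  rewrite -[leRHS](_ : expR (l n / m%:R) ^+ m = _).
    rewrite lerXn2r ?nnegrE ?expR_ge0 ?divr_ge0 ?ltW//.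
    by have := expR_ge1Dx (l n / m%:R); lra.
  by rewrite -expRM_natl mulrC divfK ?lt0r_neq0.
rewrite (le_trans (ler_powR (l1 n) cm))// powRD; last first.
  by apply/implyP => _; exact: lt0r_neq0.
rewrite (powR_mulrn _ (ltW (l0 n))) (powR_inv1 (ltW (l0 n))) [leRHS]mulrAC ler_pM2r ?invr_gt0//.
by move: h; rewrite expr_div_n ler_pdivrMr ?exprn_gt0// mulrC.
Unshelve. all: end_near. Qed.

(** For [s < 0] the exponential is at most [exp (- l)], which beats any power of [l]; the condition
    on [zeta] makes the weight integrable at -1. *)
Lemma laplace_far xi zeta (l : nat -> R) : -1 < zeta ->
  (forall n, 1 <= l n) -> l n @[n --> \oo] --> +oo ->
  ((l n `^ (xi + 1))%:E * \int[leb]_s (\1_`](-1)%R, 0%R[ s *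
      (beta_weight xi zeta s * expR ((s - 1) * l n)))%:E)%E @[n --> \oo] --> 0%E.
Proof.
move=> z1 l1 loo; have l0 n : 0 < l n by exact: lt_le_trans (l1 n).
have z0 : 0 < zeta + 1 by rewrite -ltrBlDr sub0r.
pose C : R := 2 `^ `|xi|.
have mp : measurable_fun setT (fun u : R => u `^ zeta).
  by apply: measurable_powRf; exact: measurable_id.
have mp1 : measurable_fun setT (fun u : R => (\1_`]0%R, 1%R] u * u `^ zeta)%:E).
  exact: integral_indicE.
have p1 (u : R) : (0 <= (\1_`]0%R, 1%R] u * u `^ zeta)%:E)%E.
  by rewrite lee_fin mulr_ge0 ?powR_ge0// indicE.
have mp2 : measurable_fun setT (fun u : R => (\1_`]0%R, 1%R] (u + 1) * (u + 1) `^ zeta)%:E).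
  by apply: (measurableT_comp mp1); apply: measurable_funD.
have bound n : ((l n `^ (xi + 1))%:E * \int[leb]_s (\1_`](-1)%R, 0%R[ s *
      (beta_weight xi zeta s * expR ((s - 1) * l n)))%:E <=
    (l n `^ (xi + 1) * expR (- l n) * (C / (zeta + 1)))%:E)%E.
  have k0 : (0 <= (C * expR (- l n))%:E)%E by rewrite lee_fin mulr_ge0 ?powR_ge0 ?expR_ge0.
  have -> : ((l n `^ (xi + 1) * expR (- l n) * (C / (zeta + 1)))%:E =
     (l n `^ (xi + 1))%:E * \int[leb]_u ((C * expR (- l n))%:E *
       (\1_`]0%R, 1%R] (u + 1)%R * (u + 1) `^ zeta)%:E))%E.
    rewrite (ge0_integralZl leb measurableT mp2 (fun u _ => p1 (u + 1)) k0).
    rewrite (ge0_integral_shift mp1 p1) -integral_mkindic integral_powR// powR1.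
    by rewrite -!EFinM; congr EFin; ring.
  rewrite lee_wpmul2l ?lee_fin ?powR_ge0//; apply: ge0_le_integral => //.
  - move=> s _; rewrite lee_fin mulr_ge0 ?indicE//.
    by rewrite mulr_ge0 ?beta_weight_ge0 ?expR_ge0.
  - apply: integral_indicE => //; apply: measurable_funM.
      exact: measurable_beta_weight.
    apply: measurable_expRf; apply: measurable_funM; last exact: measurable_cst.
    by apply: measurable_funB => //; exact: measurable_cst.
  - by apply: emeasurable_funM => //; exact: measurable_cst.
  move=> s _; rewrite -EFinM lee_fin !indicE.
  case: (boolP (s \in _)) => [|_]; last first.
    by rewrite mul0r mulr_ge0 ?mulr_ge0 ?powR_ge0 ?expR_ge0.
  rewrite inE/= in_itv/= => /andP[s1 s0].
  rewrite mem_set/= ?in_itv/=; last by apply/andP; split; lra.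
  rewrite !mul1r /beta_weight mulrAC [1 + s]addrC ler_pM2r ?powR_gt0//; last by lra.
  apply: ler_pM; rewrite ?powR_ge0 ?expR_ge0//.
    by apply: powR_le_norm; apply/andP; split; lra.
  by rewrite ler_expR mulrBl mul1r gerDr nmulr_rle0// ltW.
apply: (@squeeze_cvge _ _ _ _ (fun=> 0%E) _
  (fun n => (l n `^ (xi + 1) * expR (- l n) * (C / (zeta + 1)))%:E)).
- near=> n; rewrite bound andbT mule_ge0 ?lee_fin ?powR_ge0//.
  apply: integral_ge0 => s _; rewrite lee_fin mulr_ge0 ?indicE//.
  by rewrite mulr_ge0 ?beta_weight_ge0 ?expR_ge0.
- exact: cvg_cst.
apply: cvg_EFin; first by near=> n.
by rewrite -[X in _ --> X](mul0r (C / (zeta + 1))); apply: cvgMl; exact: powR_expRN_cvg0.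
Unshelve. all: end_near. Qed.

Lemma laplace_limit xi zeta (l : nat -> R) : -1 < xi -> -1 < zeta ->
  l n @[n --> \oo] --> +oo ->
  ((l n `^ (xi + 1))%:E * \int[leb]_(s in `[(-1)%R, 1%R])
      (beta_weight xi zeta s * expR ((s - 1) * l n))%:E)%E @[n --> \oo] -->
  ((2 `^ zeta)%:E * gammaE xi)%E.
Proof.
(* The two halves are stated for sequences bounded below by 1; truncation changes finitely many
   terms. *)
move=> xi1 z1 loo; pose m n := Num.max (l n) 1.
have m1 n : 1 <= m n by rewrite le_max lexx orbT.
have lm : \forall n \near \oo, l n = m n.
  near=> n; rewrite /m max_l//; near: n.
  by move/cvgryPge : loo => /(_ 1).
have moo : m n @[n --> \oo] --> +oo.
  by apply: cvg_trans loo; apply: near_eq_cvg.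
have mb n : measurable_fun setT (fun s => beta_weight xi zeta s * expR ((s - 1) * m n)).
  apply: measurable_funM; first exact: measurable_beta_weight.
  apply: measurable_expRf; apply: measurable_funM; last exact: measurable_cst.
  by apply: measurable_funB => //; exact: measurable_cst.
pose I (D : set R) n := (\int[leb]_s (\1_D s * (beta_weight xi zeta s * expR ((s - 1) * m n)))%:E)%E.
have split n : (\int[leb]_(s in `[(-1)%R, 1%R])
    (beta_weight xi zeta s * expR ((s - 1) * m n))%:E =
    I `[0%R, 1%R[%classic n + I `](-1)%R, 0%R[%classic n)%E.
  rewrite integral_cc11//; rewrite -ge0_integralD//; last 4 first.
  - by move=> s _; rewrite lee_fin mulr_ge0 ?indicE// mulr_ge0 ?beta_weight_ge0 ?expR_ge0.
  - exact: integral_indicE.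
  - by move=> s _; rewrite lee_fin mulr_ge0 ?indicE// mulr_ge0 ?beta_weight_ge0 ?expR_ge0.
  - exact: integral_indicE.
  apply: eq_integral => s _; rewrite -EFinD -mulrDl ind11E; congr (_ * _)%:E.
  rewrite !indicE -natrD; congr _%:R.
  have -> : (s \in `[0, 1[%classic) = (0 <= s < 1).
    by apply/idP/idP; rewrite inE/= in_itv.
  have -> : (s \in `]-1, 0[%classic) = (-1 < s < 0).
    by apply/idP/idP; rewrite inE/= in_itv.
  have [s0|s0] := ltP s 0; last by rewrite andbF addn0 (lt_le_trans _ s0).
  by rewrite andbT (lt_trans s0 ltr01) andbT.
apply: (@cvg_trans _ ((((m n `^ (xi + 1))%:E * I `[0%R, 1%R[%classic n) +
    ((m n `^ (xi + 1))%:E * I `](-1)%R, 0%R[%classic n))%E @[n --> \oo])).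
  apply: near_eq_cvg; near=> n; have -> : l n = m n by near: n.
  rewrite /= split; apply/esym/ge0_muleDr; apply: integral_ge0 => s _;
    by rewrite lee_fin mulr_ge0 ?indicE// mulr_ge0 ?beta_weight_ge0 ?expR_ge0.
rewrite -[X in _ `=>` nbhs X]adde0; apply: cvgeD.
- by rewrite fin_num_adde_defl.
- exact: laplace_near.
- exact: laplace_far.
Unshelve. all: end_near. Qed.

Lemma gammaE_fin_num xi : -1 < xi -> gammaE xi \is a fin_num.
Proof. by move=> x1; rewrite ge0_fin_numE ?gammaE_ge0// gammaE_fin. Qed.

(** * Laplace asymptotics for angular functions of class F *)

Section class_F_laplace.
Variables (f : R -> R) (kappa : nat -> R).
Hypotheses (Ff : class_F f) (koo : kappa n @[n --> \oo] --> +oo).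

Lemma class_F_gt0 x : 0 < f x.
Proof. by case: Ff. Qed.

Lemma class_F_homo : {homo f : x y / x <= y}.
Proof.
case: Ff => _ [h1 h2] _ _ _ x y xy.
have [x0|x0] := leP x 0; have [y0|y0] := leP y 0.
- by apply: h1; rewrite ?in_itv.
- apply: (@le_trans _ _ (f 0)); first by apply: h1; rewrite ?in_itv/=.
  by apply/ltW/h2; rewrite ?in_itv/= ?lexx// ltW.
- by have := lt_le_trans x0 (le_trans xy y0); rewrite ltxx.
- have [->|] := eqVneq x y; first by [].
  by move=> n; apply/ltW/h2; rewrite ?in_itv/= ?andbT ?ltW// lt_def eq_sym n.
Qed.

Lemma measurable_class_F : measurable_fun setT f.
Proof. exact: nondecreasing_measurable class_F_homo. Qed.

Lemma measurable_class_F_comp d (T : measurableType d) (g : T -> R) :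
  measurable_fun setT g -> measurable_fun setT (fun x => f (g x)).
Proof. by move=> mg; apply: (measurableT_comp measurable_class_F). Qed.

Definition concentration n := kappa n * varphi f (kappa n).

Lemma concentration_cvg : concentration n @[n --> \oo] --> +oo.
Proof. by case: Ff => _ _ _ [h _] _; apply: cvg_comp koo h. Qed.

Lemma elittleo_seq (u : R -> \bar R) (v : R -> R) : elittleo +oo u v ->
  elittleo \oo (fun n => u (kappa n)) (fun n => v (kappa n)).
Proof. by move=> h e e0; apply: (koo (h e e0)). Qed.

(** Condition (iv) says that, after scaling, [f (kappa s) / f kappa] and the exponential are
    asymptotically equal in weighted L1. The comparison uses pointwise inequalities in both
    directions, because the integral with [f] is not known to be finite beforehand. *)
Lemma laplace_class_F xi zeta : -1 < xi -> -1 < zeta ->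
  ((concentration n `^ (xi + 1))%:E * \int[leb]_(s in `[(-1)%R, 1%R])
     (beta_weight xi zeta s * (f (kappa n * s) / f (kappa n)))%:E)%E
    @[n --> \oo] --> ((2 `^ zeta)%:E * gammaE xi)%E.
Proof.
move=> xi1 z1; have f0 := class_F_gt0.
pose l := concentration; have loo : l n @[n --> \oo] --> +oo := concentration_cvg.
pose D : set R := `[(-1)%R, 1%R]%classic.
pose ga n s := beta_weight xi zeta s * expR ((s - 1) * l n).
pose gb n s := beta_weight xi zeta s * (f (kappa n * s) / f (kappa n)).
pose ge n s := beta_weight xi zeta s *
  `|f (kappa n * s) / f (kappa n) - expR ((s - 1) * l n)|.
have mw := measurable_beta_weight xi zeta.
have me n : measurable_fun setT (fun s : R => expR ((s - 1) * l n)).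
  apply: measurable_expRf; apply: measurable_funM; last exact: measurable_cst.
  by apply: measurable_funB => //; exact: measurable_cst.
have mf n : measurable_fun setT (fun s : R => f (kappa n * s) / f (kappa n)).
  apply: measurable_funM; last exact: measurable_cst.
  by apply: measurable_class_F_comp; apply: measurable_funM => //; exact: measurable_cst.
have mga n : measurable_fun setT (ga n) by exact: measurable_funM.
have mgb n : measurable_fun setT (gb n) by exact: measurable_funM.
have mge n : measurable_fun setT (ge n).
  apply: measurable_funM => //; apply: measurableT_comp => //.
  exact: measurable_funB.
have ga0 n s : 0 <= ga n s by rewrite mulr_ge0 ?beta_weight_ge0 ?expR_ge0.
have gb0 n s : 0 <= gb n s.
  by rewrite mulr_ge0 ?beta_weight_ge0// divr_ge0// ltW.
have ge0 n s : 0 <= ge n s by rewrite mulr_ge0 ?beta_weight_ge0.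
pose I (g : nat -> R -> R) n := ((l n `^ (xi + 1))%:E * \int[leb]_(s in D) (g n s)%:E)%E.
have I_le (g h k : nat -> R -> R) : (forall n, measurable_fun setT (g n)) ->
  (forall n, measurable_fun setT (h n)) -> (forall n, measurable_fun setT (k n)) ->
  (forall n s, 0 <= g n s) -> (forall n s, 0 <= h n s) -> (forall n s, 0 <= k n s) ->
  (forall n s, g n s <= h n s + k n s) -> forall n, (I g n <= I h n + I k n)%E.
  move=> mg mh mk g0 h0 k0 ghk n; have mD : measurable D by exact: measurable_itv.
  have mE (q : R -> R) : measurable_fun setT q -> measurable_fun D (EFin \o q).
    by move=> mq; apply/measurable_EFinP; exact: measurable_funTS.
  rewrite -ge0_muleDr; last 2 first.
  - by apply: integral_ge0 => s _; rewrite lee_fin.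
  - by apply: integral_ge0 => s _; rewrite lee_fin.
  rewrite lee_wpmul2l ?lee_fin ?powR_ge0// -ge0_integralD//; last 4 first.
  - by move=> s _; rewrite lee_fin.
  - exact: mE.
  - by move=> s _; rewrite lee_fin.
  - exact: mE.
  apply: ge0_le_integral => //.
  - by move=> s _; rewrite lee_fin.
  - exact: mE.
  - by apply: emeasurable_funD; exact: mE.
  by move=> s _; rewrite -EFinD lee_fin.
have ab n : (I ga n <= I gb n + I ge n)%E.
  apply: I_le => // k s; rewrite /ga /gb /ge -mulrDr ler_wpM2l ?beta_weight_ge0//.
  by rewrite -lerBlDl distrC ler_norm.
have ba n : (I gb n <= I ga n + I ge n)%E.
  apply: I_le => // k s; rewrite /ga /gb /ge -mulrDr ler_wpM2l ?beta_weight_ge0//.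
  by rewrite -lerBlDl ler_norm.
have Ige0 n : (0 <= I ge n)%E.
  by rewrite mule_ge0 ?lee_fin ?powR_ge0//; apply: integral_ge0 => s _; rewrite lee_fin.
have Ige_le (e : R) : 0 < e -> \forall n \near \oo, (I ge n <= e%:E)%E.
  move=> e0; case: Ff => _ _ _ _ /(_ xi zeta xi1 z1)/elittleo_seq/(_ e e0) h.
  have l1n : \forall n \near \oo, 1 <= l n by move/cvgryPge : loo => /(_ 1).
  apply: filterS2 l1n h => n l1; set J := (\int[_]_(_ in _) _)%E => H.
  have lp : 0 < l n `^ (xi + 1) by rewrite powR_gt0// (lt_le_trans _ l1).
  have -> : e%:E = ((l n `^ (xi + 1))%:E * (e * `|(l n `^ (xi + 1))^-1|)%:E)%E.
    rewrite -EFinM ger0_norm ?invr_ge0 ?ltW//; congr EFin; field; exact: lt0r_neq0.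
  rewrite /I lee_wpmul2l ?lee_fin ?(ltW lp)//.
  apply: le_trans H; rewrite /J.
  rewrite gee0_abs; last first.
    by apply: integral_ge0 => s _; rewrite lee_fin mulr_ge0 ?mulr_ge0 ?powR_ge0.
  rewrite le_eqVlt; apply/orP; left; apply/eqP/eq_integral => s _.
  by rewrite /ge /beta_weight expRB !lnK ?posrE.
have Ige_cvg : I ge n @[n --> \oo] --> 0%E.
  exact: cvge0_ge0.
have Iga_cvg := laplace_limit xi1 z1 loo.
have Lfin : ((2 `^ zeta)%:E * gammaE xi)%E \is a fin_num.
  by rewrite fin_numM// gammaE_fin_num.
apply: (@squeeze_cvge _ _ _ _ (fun n => (I ga n - I ge n)%E) _ (fun n => (I ga n + I ge n)%E)).
- near=> n; rewrite ba andbT leeBlDr//.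
  rewrite ge0_fin_numE//; have : (I ge n <= 1%:E)%E by near: n; exact: Ige_le.
  by move=> /le_lt_trans; apply; rewrite ltry.
- rewrite -[X in _ --> X]sube0; apply: cvgeB => //.
  by rewrite fin_num_adde_defl// fin_numN.
- rewrite -[X in _ --> X]adde0; apply: cvgeD => //.
  by rewrite fin_num_adde_defl.
Unshelve. all: end_near. Qed.

End class_F_laplace.
End laplace.

(** * Law of one observation *)

Section squared_variable.
Context (R : realType).
Notation leb := (@lebesgue_measure R).
Notation mR := (measurableTypeR R).
Variable h : R -> \bar R.
Hypotheses (mh : measurable_fun setT h) (h0 : forall x, (0 <= h x)%E).

Lemma ge0_integral_expR :
  (\int[leb]_y (h (expR y) * (expR y)%:E) = \int[leb]_u (h u * (indpos u)%:E))%E.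
Proof.
rewrite (@ge0_integral_substitution R `]0, +oo[ (@ln R) (fun u => u^-1) (@expR R)
  _ (@measurable_ln R)) //.
- rewrite integral_mkcond; apply: eq_integral => u _; rewrite patchE indposE.
  have -> : (u \in `]0, +oo[%classic) = (0 < u).
    by apply/idP/idP; rewrite inE/= in_itv/= andbT.
  case: ltP => u0; last by rewrite mule0.
  by rewrite lnK ?posrE// -muleA -EFinM divff ?lt0r_neq0.
- by move=> u; rewrite in_itv/= andbT => u0; exact: is_derive1_ln.
- by move=> u; rewrite in_itv/= andbT => u0; apply: inv_continuous; exact: lt0r_neq0.
- by move=> u; rewrite in_itv/= andbT => u0; rewrite invr_ge0 ltW.
- by move=> y; rewrite in_itv/= expR_gt0.
- exact: expRK.
- by move=> u; rewrite in_itv/= andbT => u0; rewrite lnK.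
- by move=> x y xy; rewrite ltr_expR.
- apply: emeasurable_funM; last by apply/measurable_EFinP; exact: measurable_expR.
  by apply: (measurableT_comp mh); exact: measurable_expR.
- by move=> y; rewrite mule_ge0// lee_fin expR_ge0.
Qed.

End squared_variable.

Section squared_variable2.
Context (R : realType).
Notation leb := (@lebesgue_measure R).
Notation mR := (measurableTypeR R).
Variable h : R -> \bar R.
Hypotheses (mh : measurable_fun setT h) (h0 : forall x, (0 <= h x)%E).

(** The substitution formula wants a map onto the whole line, so the half-line is first carried
    there by the logarithm, where squaring becomes [y -> 2 * y]. *)
Lemma ge0_integral_sqr :
  (\int[leb]_w (h w * (indpos w)%:E) =
   \int[leb]_u (h (u ^+ 2)%R * (2 * u)%:E * (indpos u)%:E))%E.
Proof.
rewrite -ge0_integral_expR//.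
pose h2 (u : R) := (h (u ^+ 2)%R * (2 * `|u|)%:E)%E.
have mh2 : measurable_fun setT h2.
  apply: emeasurable_funM; first by apply: (measurableT_comp mh); exact: measurable_funX.
  by apply/measurable_EFinP; apply: measurable_funM => //; exact: measurable_cst.
have h20 u : (0 <= h2 u)%E by rewrite mule_ge0// lee_fin mulr_ge0.
transitivity (\int[leb]_u (h2 u * (indpos u)%:E))%E; last first.
  apply: eq_integral => u _; rewrite indposE /h2; case: ltP => u0; last by rewrite !mule0.
  by rewrite ger0_norm ?ltW.
rewrite -ge0_integral_expR//.
have mG : measurable_fun setT (fun y : R => h (expR y) * (expR y)%:E)%E.
  apply: emeasurable_funM; last by apply/measurable_EFinP; exact: measurable_expR.
  by apply: (measurableT_comp mh); exact: measurable_expR.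
have G0 (y : R) : (0 <= h (expR y) * (expR y)%:E)%E.
  by rewrite mule_ge0// lee_fin expR_ge0.
rewrite (ge0_integral_affine mG G0 0 (c := 2))//; apply: eq_integral => y _.
rewrite addr0 /h2 ger0_norm ?expR_ge0// expRM_natl -!muleA -!EFinM; congr (_ * _%:E)%E.
by ring.
Qed.

End squared_variable2.

Section G_law.
Context (R : realType).
Notation leb := (@lebesgue_measure R).
Notation mR := (measurableTypeR R).

Lemma cosq_powR k (s : R) : -1 < s < 1 ->
  cosq s ^+ k / cosq s = (1 - s ^+ 2) `^ ((k.+2%:R - 3) / 2).
Proof.
move=> s1; have q0 : 0 < 1 - s ^+ 2 by have := cosq_gt0 s1; rewrite /cosq sqrtr_gt0.
rewrite /cosq -powR12_sqrt ?ltW// -powR_mulrn ?powR_ge0// -[X in _ / X]powRr1 ?powR_ge0//.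
rewrite -powRN -powRD; last by apply/implyP => _; rewrite lt0r_neq0 ?powR_gt0.
by rewrite -powRrM; congr (_ `^ _); rewrite -[k.+2]addn2 natrD; field.
Qed.

Let symm (F : R -> \bar R) (w : R) := (F (Num.sqrt w) + F (- Num.sqrt w)%R)%E.

Let msymm F : measurable_fun setT F -> measurable_fun setT (symm F).
Proof.
move=> mF; have msqrt : measurable_fun setT (fun w : R => Num.sqrt w).
  by apply: measurable_fun_sqrt; exact: measurable_id.
apply: emeasurable_funD; apply: (measurableT_comp mF) => //.
exact: measurable_funN.
Qed.

Let beta k (w : R) := w `^ (2^-1 - 1) * (1 - w) `^ ((k.+3%:R - 2) / 2 - 1).

Let mbeta k : measurable_fun setT (beta k).
Proof.
apply: measurable_funM; apply: measurable_powRf; first exact: measurable_id.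
by apply: measurable_funB => //; exact: measurable_cst.
Qed.

Let beta0 k w : 0 <= beta k w. Proof. by rewrite mulr_ge0 ?powR_ge0. Qed.

(** With [w = u^2] the weight [cosq u ^+ k / cosq u] becomes the unnormalized Beta density, the two
    signs of [u] are gathered in [symm], and the Jacobian [2 * u] accounts for the factor 2. *)
Lemma rho_int_beta k (F : R -> \bar R) :
  measurable_fun setT F -> (forall u, 0 <= F u)%E ->
  (\int[leb]_(w in `[0%R, 1%R]) (symm F w * (beta k w)%:E) =
   2%:E * rho_int k.+2 F)%E.
Proof.
move=> mF F0; pose b : R := (k.+3%:R - 2) / 2 - 1.
have ms := msymm mF.
have s0 w : (0 <= symm F w)%E by rewrite adde_ge0.
have mq : measurable_fun setT (fun w => symm F w * (beta k w)%:E)%E.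
  by apply: emeasurable_funM => //; apply/measurable_EFinP.
rewrite integral_itv_bndoo; last exact: measurable_funTS.
(* The bound -2 is any negative number: only the cut at 1 matters, and [indpos] supplies the cut at
   0. *)
pose h w := (symm F w * (\1_`](-2)%R, 1%R[ w * (beta k w))%:E)%E.
have mh : measurable_fun setT h.
  apply: emeasurable_funM => //; apply/measurable_EFinP; apply: measurable_funM => //.
have h0 w : (0 <= h w)%E.
  by rewrite mule_ge0// lee_fin mulr_ge0 ?beta0// indicE.
have hE w : 0 < w -> h w = (symm F w * ((w < 1)%R%:R * (beta k w))%:E)%E.
  move=> w0; rewrite /h indicE (_ : (w \in _) = (w < 1))//.
  apply/idP/idP; rewrite inE/= in_itv/=; first by case/andP.
  by move=> ->; rewrite andbT (lt_trans _ w0).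
transitivity (\int[leb]_w (h w * (indpos w)%:E))%E.
  rewrite integral_mkcond; apply: eq_integral => w _; rewrite patchE indposE.
  have -> : (w \in `]0, 1[%classic) = (0 < w < 1) by apply/idP/idP; rewrite inE/= in_itv.
  case: ltP => w0; last by rewrite mule0.
  by rewrite hE// mule1; case: ltP => w1; rewrite ?mul1r ?mul0r ?mule0.
pose c (u : R) := ind11 u * (cosq u ^+ k / cosq u).
have mc : measurable_fun setT c := @measurable_rho_weight R k.
have c0 u : 0 <= c u := rho_weight_ge0 k u.
have cN u : c (- u) = c u.
  rewrite /c /cosq sqrrN !ind11E; congr (_%:R * _); congr nat_of_bool.
  by apply/idP/idP; lra.
have mFc : measurable_fun setT (fun u => F u * (c u)%:E)%E.
  by apply: emeasurable_funM => //; apply/measurable_EFinP.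
have Fc0 u : (0 <= F u * (c u)%:E)%E by rewrite mule_ge0// lee_fin.
rewrite (ge0_integral_sqr mh h0) /= (ge0_integral_indpos mFc Fc0).
have mW : measurable_fun setT (fun u : R => ((F u * (c u)%:E +
    F (- u)%R * (c (- u)%R)%:E) * (indpos u)%:E)%E).
  apply: emeasurable_funM; last by apply/measurable_EFinP; exact: measurable_indpos.
  by apply: emeasurable_funD => //; apply: (measurableT_comp mFc); exact: oppr_measurable.
have W0 (u : mR) : setT u -> (0 <= (F u * (c u)%:E +
    F (- u)%R * (c (- u)%R)%:E) * (indpos u)%:E)%E.
  by move=> _; rewrite mule_ge0 ?adde_ge0// lee_fin indpos_ge0.
have k0 : (0 <= (2 : R)%:E)%E by rewrite lee_fin.
rewrite -(ge0_integralZl leb measurableT mW W0 k0).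
apply: eq_integral => u _; rewrite indposE; case: ltP => u0; last by rewrite !mule0.
rewrite !mule1 hE ?exprn_gt0// /symm sqrtr_sqr (ger0_norm (ltW u0)) cN -ge0_muleDl//.
rewrite -muleA -EFinM [RHS]muleC -muleA -EFinM; congr (_ * _%:E)%E.
rewrite /c ind11E /beta -/b expr_lt1//; last exact: ltW.
case: ltP => u1; last by rewrite andbF !mul0r.
have u11 : -1 < u < 1 by rewrite u1 andbT (lt_trans _ u0).
have um : -1 < u by lra.
rewrite um cosq_powR// !mul1r.
have -> : (k.+2%:R - 3) / 2 = b :> R by rewrite /b -[k.+3]addn1 natrD; field.
have -> : (u ^+ 2) `^ (2^-1 - 1) = u^-1.
  rewrite -powR_mulrn ?ltW// -powRrM (_ : 2%:R * _ = -1); last by field.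
  by rewrite powR_inv1// ltW.
by field; exact: lt0r_neq0.
Qed.


(** For [p = 2] both sides live on the points 1 and -1. For larger [p] the Beta constant is
    identified with the total mass of [rho_int] by taking [F = 1] in [rho_int_beta]. *)
Lemma rho_int_G_law k (F : R -> \bar R) :
  measurable_fun setT F -> (forall u, 0 <= F u)%E ->
  (0 < rho_int k.+1 (fun=> 1%E : \bar R) < +oo)%E ->
  (rho_int k.+1 F = (fine (rho_int k.+1 (fun=> 1%E : \bar R)) / 2)%:E *
    \int[@G_law R k.+2]_(w in `[0%R, 1%R]) symm F w)%E.
Proof.
case: k => [|k] mF F0 r1.
  rewrite /G_law/= integral_mkcond integral_dirac//; last first.
    by apply/(measurable_restrictT _ (measurable_itv _)); apply: measurable_funTS; exact: msymm.
  rewrite diracT mul1e patchE mem_set; last by rewrite /= in_itv/= ler01 lexx.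
  by rewrite /symm sqrtr1 (_ : (1 + 1) / 2 = 1 :> R) ?mul1e//; field.
set D : set R := `[0%R, 1%R]%classic; set r := rho_int k.+2 (fun=> 1%E).
have mD : measurable D by exact: measurable_itv.
have rE : (\int[leb]_(w in D) (beta k w)%:E = r)%E.
  have m1 : measurable_fun setT (fun _ : R => 1%E : \bar R) by exact: measurable_cst.
  have := rho_int_beta k m1 (fun=> lee01) => /=; rewrite -/r /symm.
  have mb : measurable_fun D (fun w => (beta k w)%:E).
    by apply/measurable_EFinP; exact: measurable_funTS.
  have b0 w : D w -> (0 <= (beta k w)%:E)%E by move=> _; rewrite lee_fin.
  have k0 : (0 <= (2 : R)%:E)%E by rewrite lee_fin.
  rewrite (ge0_integralZl leb mD mb b0 k0) => /(congr1 (fun x => (2^-1 : R)%:E * x)%E).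
  by rewrite !muleA -!EFinM mulVf// !mul1e.
set B : R := fine r.
have BE : rbeta_fun (2^-1) ((k.+3%:R - 2) / 2) = B by rewrite /rbeta_fun /Rintegral rE.
have B0 : 0 < B by rewrite fine_gt0.
pose g w := \1_D w * (beta k w / B).
have mg : measurable_fun setT g.
  apply: measurable_funM; first exact: (measurable_indic mD).
  by apply: measurable_funM => //; exact: measurable_cst.
have g0 w : 0 <= g w by rewrite mulr_ge0 ?divr_ge0 ?(ltW B0)// indicE.
have gE A : @G_law R k.+3 A = (\int[leb]_(w in A) (g w)%:E)%E.
  rewrite /G_law/= /rbeta_prob BE integral_mkcond [RHS]integral_mkcond.
  apply: eq_integral => w _; rewrite !patchE in_setI /g indicE /D.
  by case: (w \in A); case: (w \in _) => //=; rewrite ?mul1r ?mul0r.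
have ms := msymm mF.
have s0 w : (0 <= symm F w)%E by rewrite adde_ge0.
have [m' m'E] := measure_of_density leb g0 mg.
have -> : @G_law R k.+3 = m' by apply/funext => A; rewrite gE m'E.
rewrite integral_mkcond.
rewrite (ge0_integral_densityE (T := mR) (m := m') (mu := leb) g0 mg m'E); last 2 first.
- by move=> w; rewrite patchE; case: ifP.
- by apply/(measurable_restrictT _ mD); exact: measurable_funTS.
have k0 : (0 <= (B^-1)%:E)%E by rewrite lee_fin invr_ge0 ltW.
transitivity ((B / 2)%:E * ((B^-1)%:E * (2%:E * rho_int k.+2 F)))%E.
  rewrite !muleA -!EFinM (_ : _ * 2 = 1) ?mul1e//.
  by field; exact: lt0r_neq0.
congr (_ * _)%E; rewrite -rho_int_beta//.
have mq : measurable_fun D (fun w => symm F w * (beta k w)%:E)%E.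
  by apply: measurable_funTS; apply: emeasurable_funM => //; apply/measurable_EFinP.
have q0 w : D w -> (0 <= symm F w * (beta k w)%:E)%E.
  by move=> _; rewrite mule_ge0// lee_fin.
rewrite -(ge0_integralZl leb mD mq q0 k0) integral_mkcond.
apply: eq_integral => w _; rewrite !patchE /g indicE; case: ifP => _; rewrite ?mul1r ?mul0e//.
by rewrite muleCA -EFinM mulrC.
Qed.

End G_law.

(** * Tangent-normal decomposition of one observation *)

Section one_observation.
Context (R : realType) (k : nat).
Notation leb := (@lebesgue_measure R).
Notation mR := (measurableTypeR R).
Context (M : probability 'cV[R]_k.+2 R) (theta : 'cV[R]_k.+2) (c : R).
Context (phi : R -> R).
Hypotheses (th1 : dot theta theta = 1) (c0 : 0 <= c).
Hypotheses (phi0 : forall s, 0 <= phi s) (mphi : measurable_fun setT phi).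
Hypothesis HM : has_density M idfun (@surface_area R k.+2)
  (fun x => c * phi (dot x theta)).

Definition projection (x : 'cV[R]_k.+2) := x - dot theta x *: theta.

Lemma dot_projection x y : dot (projection x) (projection y) =
  dot x y - dot theta x * dot theta y.
Proof.
rewrite /projection !dotBl !dotBr !dotZl !dotZr th1 (dotC x theta).
by ring.
Qed.

Lemma dot_projectionr x y : dot x (projection y) = dot x y - dot theta x * dot theta y.
Proof. by rewrite /projection dotBr dotZr (dotC x theta) mulrC. Qed.

Lemma projection_orth x : dot theta (projection x) = 0.
Proof. by rewrite dot_projectionr th1 mul1r subrr. Qed.

Let e i : 'cV[R]_k.+2 := delta_mx i 0.

Let dot_e i x : dot x (e i) = x i 0.
Proof.
rewrite dotE (bigD1 i)//= mxE !eqxx mulr1 big1 ?addr0// => j ji.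
by rewrite mxE (negbTE ji) mulr0.
Qed.

(** The trace of the orthogonal projector onto the complement of [theta], that is, its rank. *)
Lemma sum_projection_basis :
  \sum_i dot (projection (e i)) (projection (e i)) = k.+1%:R.
Proof.
under eq_bigr => i _ do rewrite dot_projection !dot_e.
rewrite sumrB (_ : \sum_i theta i 0 * theta i 0 = 1); last by rewrite -th1 dotE.
under eq_bigr => i _ do rewrite mxE !eqxx.
by rewrite sumr_const card_ord -[k.+2]addn1 natrD addrK.
Qed.

(** Parseval for the projected standard basis, which is not orthonormal but is a tight frame of the
    tangent space; on the sphere the right side is [1 - U^2]. *)
Lemma sum_dot_projection_basis x :
  \sum_i dot x (projection (e i)) ^+ 2 = dot x x - dot theta x ^+ 2.
Proof.
under eq_bigr => i _ do rewrite dot_projectionr !dot_e.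
rewrite (eq_bigr (fun i => x i 0 * x i 0 - (2 * dot theta x) * (x i 0 * theta i 0)
  + dot theta x ^+ 2 * (theta i 0 * theta i 0))); last by move=> i _; ring.
rewrite big_split/= sumrB -!mulr_sumr -!dotE th1 (dotC x theta).
by ring.
Qed.

(** The projections of the standard basis cannot all vanish, their squared lengths having sum
    [k.+1]. *)
Lemma orthogonal_unit : exists eta, dot eta eta = 1 /\ dot theta eta = 0.
Proof.
have [i i0] : exists i, dot (projection (e i)) (projection (e i)) != 0.
  apply/not_existsP => h; have := sum_projection_basis.
  rewrite big1; last by move=> i _; apply/eqP/negPn/negP; exact: h.
  by move=> /esym/eqP; rewrite pnatr_eq0.
pose v := projection (e i).
have v0 : 0 < dot v v by rewrite lt_def i0 dot_ge0.
exists ((cnorm v)^-1 *: v); rewrite dotZl !dotZr projection_orth mulr0; split=> //.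
rewrite mulrA -expr2 -sqr_cnorm -exprMn mulVf ?expr1n// cnorm_eq0 -dot_eq0.
exact: i0.
Qed.

Definition angular_weight s := (1 - s ^+ 2) `^ ((k.+2%:R - 3) / 2) * phi s.

Lemma angular_weight_ge0 s : 0 <= angular_weight s.
Proof. by rewrite mulr_ge0 ?powR_ge0. Qed.

Lemma measurable_angular_weight : measurable_fun setT angular_weight.
Proof.
apply: measurable_funM => //; apply: measurable_powRf.
by apply: measurable_funB; [exact: measurable_cst|exact: measurable_funX].
Qed.

Let W s := ind11 s * (cosq s ^+ k / cosq s) * phi s.

Let WE (G : R -> \bar R) : measurable_fun setT G ->
  (\int[leb]_s (G s * (W s)%:E) =
   \int[leb]_(s in `[(-1)%R, 1%R]) (G s * (angular_weight s)%:E))%E.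
Proof.
move=> mG; rewrite integral_itv_bndoo; last first.
  apply: measurable_funTS; apply: emeasurable_funM => //; apply/measurable_EFinP.
  exact: measurable_angular_weight.
rewrite [RHS]integral_mkcond; apply: eq_integral => s _; rewrite patchE /W ind11E.
have -> : (s \in `]-1, 1[%classic) = (-1 < s < 1) by apply/idP/idP; rewrite inE/= in_itv.
case: ifPn => s1; last by rewrite !mul0r mule0.
by rewrite mul1r cosq_powR.
Qed.

Let rho1 := rho_int k.+1 (fun=> 1%E : \bar R).

Definition angular_mass :=
  (\int[leb]_(s in `[(-1)%R, 1%R]) (angular_weight s)%:E)%E.

Let mulye_neq1 (w : \bar R) : (0 <= w)%E -> (+oo * w)%E <> 1%E.
Proof.
rewrite le_eqVlt => /orP[/eqP <-|w0]; last by rewrite gt0_mulye.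
by rewrite mule0 => /eqP; rewrite eqe eq_sym oner_eq0.
Qed.

Let mule3_eq1 (x y z : \bar R) : (0 <= x)%E -> (0 <= y)%E -> (0 <= z)%E ->
  (x * (y * z) = 1)%E ->
  [/\ (0 < y < +oo)%E, (0 < z < +oo)%E & x = ((fine y * fine z)^-1)%:E].
Proof.
have [->|xoo] := eqVneq x +oo%E; first by move=> _ y0 z0 /(mulye_neq1 (mule_ge0 y0 z0)).
have [->|yoo] := eqVneq y +oo%E.
  by move=> x0 _ z0; rewrite muleCA => /(mulye_neq1 (mule_ge0 x0 z0)).
have [->|zoo] := eqVneq z +oo%E.
  by move=> x0 y0 _; rewrite muleA muleC => /(mulye_neq1 (mule_ge0 x0 y0)).
move: x y z xoo yoo zoo => [x||] [y||] [z||]// _ _ _; rewrite !lee_fin => x0 y0 z0.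
move=> /eqP; rewrite -!EFinM eqe => /eqP xyz.
have yn : y != 0.
  by apply/eqP => y00; move: xyz; rewrite y00 mul0r mulr0 => /esym/eqP; rewrite oner_eq0.
have zn : z != 0.
  by apply/eqP => z00; move: xyz; rewrite z00 !mulr0 => /esym/eqP; rewrite oner_eq0.
rewrite !ltry !andbT !lte_fin !lt_def yn zn y0 z0; split=> //.
by congr EFin; apply: (mulIf (x := y * z)); rewrite ?mulf_neq0// xyz /= mulVf// mulf_neq0.
Qed.

(** Testing [tangent_normal_law] with [F = 1] gives [K * (rho1 * angular_mass) = 1]. Hence the
    finiteness and positivity of these factors, and the value of [K], come from [M] being a
    probability. *)
Let law : [/\ (0 < rho1 < +oo)%E, (0 < angular_mass < +oo)%E &
  forall eta (F : R -> R -> \bar R), dot eta eta = 1 -> dot theta eta = 0 ->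
    measurable_fun setT (fun z : mR * mR => F z.1 z.2) ->
    (forall s v, 0 <= F s v)%E ->
  (\int[M]_x F (dot x theta) (dot x eta) =
   ((fine rho1 * fine angular_mass)^-1)%:E *
     \int[leb]_(s in `[(-1)%R, 1%R])
       (rho_int k.+1 (fun u => F s (cosq s * u)%R) * (angular_weight s)%:E))%E].
Proof.
have mid : measurable_fun setT (@idfun 'cV[R]_k.+2) by exact: measurable_id.
have [K K0 KE] := tangent_normal_law (P := M) mid th1 c0 phi0 mphi HM.
have KE' eta (F : R -> R -> \bar R) : dot eta eta = 1 -> dot theta eta = 0 ->
    measurable_fun setT (fun z : mR * mR => F z.1 z.2) ->
    (forall s v, 0 <= F s v)%E ->
  (\int[M]_x F (dot x theta) (dot x eta) = K * \int[leb]_(s in `[(-1)%R, 1%R])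
       (rho_int k.+1 (fun u => F s (cosq s * u)%R) * (angular_weight s)%:E))%E.
  move=> et1 thet mF F0; rewrite (KE _ _ et1 thet mF F0) -/(W _) WE//.
  apply: measurable_rho_int => //.
  apply: (measurableT_comp (g := fun z : mR * mR => (z.1, cosq z.1 * z.2)) mF).
  apply: measurable_fun_pair; first exact: measurable_fst.
  apply: measurable_funM; last exact: measurable_snd.
  by apply: (measurableT_comp (@measurable_cosq R)); exact: measurable_fst.
have [eta [et1 thet]] := orthogonal_unit.
have m1 : measurable_fun setT (fun _ : mR * mR => 1%E : \bar R) by exact: measurable_cst.
have := KE' eta (fun _ _ => 1%E) et1 thet m1 (fun _ _ => lee01).
rewrite integral_cst// mul1e [X in X = _](@probability_setT _ _ _ M) -/rho1.
have r0 : (0 <= rho1)%E by apply: rho_int_ge0.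
have mw : measurable_fun (`[(-1)%R, 1%R]%classic : set R) (fun s : R => (angular_weight s)%:E).
  by apply/measurable_EFinP; apply: measurable_funTS; exact: measurable_angular_weight.
have w0 (s : mR) : `[(-1)%R, 1%R]%classic s -> (0 <= (angular_weight s)%:E)%E.
  by move=> _; rewrite lee_fin angular_weight_ge0.
rewrite (ge0_integralZl leb (measurable_itv _) mw w0 r0) -/angular_mass => /esym K1.
have am0 : (0 <= angular_mass)%E by exact: integral_ge0.
by have [? ? <-] := mule3_eq1 K0 r0 am0 K1.
Qed.

Let angular_mass_pos : 0 < fine angular_mass.
Proof. by apply: fine_gt0; case: law. Qed.

(* The tangent-normal decomposition: given the latitude [s], the longitude is
   [(1 - s^2)^(1/2)] times a symmetric variable whose square has law G_p. *)
Lemma integral_latitude_longitude eta (F : R -> R -> \bar R) :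
    dot eta eta = 1 -> dot theta eta = 0 ->
    measurable_fun setT (fun z : mR * mR => F z.1 z.2) ->
    (forall s v, 0 <= F s v)%E ->
  (\int[M]_x F (dot x theta) (dot x eta) =
   (2^-1 / fine angular_mass)%:E *
     \int[leb]_(s in `[(-1)%R, 1%R])
       (\int[@G_law R k.+2]_(w in `[0%R, 1%R])
          (F s (Num.sqrt (1 - s ^+ 2) * Num.sqrt w)%R +
           F s (- (Num.sqrt (1 - s ^+ 2) * Num.sqrt w))%R)
        * (angular_weight s)%:E))%E.
Proof.
move=> et1 thet mF F0; have [r1 _ ->//] := law.
have r0 : 0 < fine rho1 by apply: fine_gt0.
have mFs s : measurable_fun setT (fun u => F s (cosq s * u)).
  apply: (measurableT_comp (g := fun u : R => (s, cosq s * u)) mF).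
  apply: measurable_fun_pair; first exact: measurable_cst.
  by apply: measurable_funM => //; exact: measurable_cst.
pose rho s := rho_int k.+1 (fun u => F s (cosq s * u)%R).
have mrho : measurable_fun setT rho.
  apply: measurable_rho_int => //.
  apply: (measurableT_comp (g := fun z : mR * mR => (z.1, cosq z.1 * z.2)) mF).
  apply: measurable_fun_pair; first exact: measurable_fst.
  apply: measurable_funM; last exact: measurable_snd.
  by apply: (measurableT_comp (@measurable_cosq R)); exact: measurable_fst.
have rho0 s : (0 <= rho s)%E by exact: rho_int_ge0.
have JE s : (\int[@G_law R k.+2]_(w in `[0%R, 1%R])
          (F s (Num.sqrt (1 - s ^+ 2) * Num.sqrt w)%R +
           F s (- (Num.sqrt (1 - s ^+ 2) * Num.sqrt w))%R) = (2 / fine rho1)%:E * rho s)%E.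
  rewrite /rho (rho_int_G_law (mFs s))// muleA -EFinM -/rho1.
  rewrite (_ : _ * _ = 1) ?mul1e; last by field; exact: lt0r_neq0.
  by congr integral; apply/funext => w; rewrite mulrN.
under [in RHS]eq_integral => s _ do rewrite JE -muleA.
have mra : measurable_fun (`[(-1)%R, 1%R]%classic : set R) (fun s => rho s * (angular_weight s)%:E)%E.
  apply: measurable_funTS; apply: emeasurable_funM => //; apply/measurable_EFinP.
  exact: measurable_angular_weight.
have ra0 (s : mR) : `[(-1)%R, 1%R]%classic s -> (0 <= rho s * (angular_weight s)%:E)%E.
  by move=> _; rewrite mule_ge0// lee_fin angular_weight_ge0.
have k0 : (0 <= (2 / fine rho1)%:E)%E by rewrite lee_fin divr_ge0// ltW.
rewrite (ge0_integralZl leb (measurable_itv _) mra ra0 k0) muleA -EFinM.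
by congr (_%:E * _)%E; field; rewrite !lt0r_neq0.
Qed.

Lemma integral_latitude (F : R -> \bar R) : measurable_fun setT F ->
  (forall s, 0 <= F s)%E ->
  (\int[M]_x F (dot x theta) = (fine angular_mass)^-1%:E *
     \int[leb]_(s in `[(-1)%R, 1%R]) (F s * (angular_weight s)%:E))%E.
Proof.
move=> mF F0; have [r1 _ lawE] := law.
have r0 : 0 < fine rho1 by apply: fine_gt0.
have [eta [et1 thet]] := orthogonal_unit.
have mF2 : measurable_fun setT (fun z : mR * mR => F z.1).
  by apply: (measurableT_comp mF); exact: measurable_fst.
rewrite (lawE eta (fun s _ => F s) et1 thet mF2 (fun s _ => F0 s)).
have -> : (\int[leb]_(s in `[(-1)%R, 1%R])
    (rho_int k.+1 (fun=> F s) * (angular_weight s)%:E) =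
  rho1 * \int[leb]_(s in `[(-1)%R, 1%R]) (F s * (angular_weight s)%:E))%E.
  rewrite -ge0_integralZl//; last 3 first.
  - apply: measurable_funTS; apply: emeasurable_funM => //; apply/measurable_EFinP.
    exact: measurable_angular_weight.
  - by move=> s _; rewrite mule_ge0// lee_fin angular_weight_ge0.
  - exact: rho_int_ge0.
  apply: eq_integral => s _; rewrite (muleC rho1) muleAC -rho_intZ//.
  by congr (_ * _)%E; apply: eq_rho_int => u; rewrite mule1.
rewrite muleA; congr (_ * _)%E; rewrite -[rho1 in X in (_ * X)%E]fineK; last first.
  by rewrite ge0_fin_numE ?(andP r1).2// ltW// (andP r1).1.
by rewrite -EFinM; congr EFin; field; rewrite !lt0r_neq0.
Qed.

(** The formula of [law] has the same right side for a unit tangent vector and its opposite; the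
    length of [eta] is absorbed into [F]. *)
Lemma integral_longitude_symmetric eta (F : R -> R -> \bar R) :
    dot theta eta = 0 ->
    measurable_fun setT (fun z : mR * mR => F z.1 z.2) ->
    (forall s v, 0 <= F s v)%E ->
  (\int[M]_x F (dot x theta) (dot x eta) =
   \int[M]_x F (dot x theta) (- dot x eta)%R)%E.
Proof.
move=> thet mF F0; have [_ _ lawE] := law.
have [->|e0] := eqVneq eta 0.
  by apply: eq_integral => x _; rewrite dot0r oppr0.
have n0 : 0 < cnorm eta by rewrite lt_def cnorm_ge0 cnorm_eq0 e0.
pose u := (cnorm eta)^-1 *: eta.
have u1 : dot u u = 1.
  by rewrite dotZl dotZr mulrA -expr2 -sqr_cnorm -exprMn mulVf ?expr1n// lt0r_neq0.
have thu : dot theta u = 0 by rewrite dotZr thet mulr0.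
have etaE x : dot x eta = cnorm eta * dot x u by rewrite dotZr mulrA divff ?mul1r// lt0r_neq0.
have mF2 (a : R) : measurable_fun setT (fun z : mR * mR => F z.1 (a * z.2)).
  apply: (measurableT_comp (g := fun z : mR * mR => (z.1, a * z.2)) mF).
  apply: measurable_fun_pair; first exact: measurable_fst.
  by apply: measurable_funM; [exact: measurable_cst|exact: measurable_snd].
transitivity (\int[M]_x F (dot x theta) (cnorm eta * dot x u)%R)%E.
  by apply: eq_integral => x _; rewrite etaE.
rewrite (lawE u (fun s v => F s (cnorm eta * v)%R) u1 thu)//.
rewrite -(lawE (- u) (fun s v => F s (cnorm eta * v)%R))//.
- by apply: eq_integral => x _; rewrite dotNr etaE mulrN.
- by rewrite dotNl dotNr opprK.
- by rewrite dotNr thu oppr0.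
Qed.

End one_observation.

(** * Moments of the tangent component *)

Section spherical_moments.
Context (R : realType) (k : nat).
Notation leb := (@lebesgue_measure R).
Notation mR := (measurableTypeR R).
Context (M : probability 'cV[R]_k.+2 R) (theta : 'cV[R]_k.+2) (c : R).
Context (phi : R -> R).
Hypotheses (th1 : dot theta theta = 1) (c0 : 0 <= c).
Hypotheses (phi0 : forall s, 0 <= phi s) (mphi : measurable_fun setT phi).
Hypothesis HM : has_density M idfun (@surface_area R k.+2)
  (fun x => c * phi (dot x theta)).

Lemma measurable_dotl (v : 'cV[R]_k.+2) : measurable_fun setT (fun x => dot x v).
Proof. by apply: measurable_fun_dot; [exact: measurable_id|exact: measurable_cst]. Qed.

(** [surface_area] sees only normalized vectors, and those have length 1, so the complement of the
    sphere has measure 0. *)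
Lemma ae_unit_sphere : {ae M, forall x, dot x x = 1}.
Proof.
pose S : set 'cV[R]_k.+2 := [set x | dot x x = 1].
have mS : measurable S.
  have -> : S = (fun x => dot x x) @^-1` [set 1] by [].
  rewrite -[X in measurable X]setTI.
  by apply: measurable_fun_dot => //; exact: measurable_id.
exists (~` S); split => //; first exact: measurableC.
have [m mE] := surface_area_measure R k.+2.
have m0 : m (~` S) = 0%E.
  rewrite mE /surface_area [X in lebesgue_cV X](_ : _ = set0).
    by rewrite measure0 mule0.
  apply/seteqP; split => // x [/andP[x0 _]]; apply; rewrite /S/= dotZl dotZr mulrA.
  by rewrite -expr2 -sqr_cnorm -exprMn mulVf ?expr1n// lt0r_neq0.
have := HM (measurableC mS); rewrite preimage_id => ->.
rewrite -mE; apply: null_set_integral => //; first exact: measurableC.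
apply/measurable_EFinP; apply: measurable_funTS; apply: measurable_funM.
  exact: measurable_cst.
by apply: (measurableT_comp mphi); exact: measurable_dotl.
Qed.

Lemma eq_integral_sphere (F G : 'cV[R]_k.+2 -> \bar R) :
  measurable_fun setT F -> measurable_fun setT G ->
  (forall x, dot x x = 1 -> F x = G x) -> (\int[M]_x F x = \int[M]_x G x)%E.
Proof.
move=> mF mG FG; apply: ae_eq_integral => //.
by apply: filterS ae_unit_sphere => x x1 _; exact: FG.
Qed.

Lemma le_integral_sphere (F G : 'cV[R]_k.+2 -> \bar R) :
  measurable_fun setT F -> measurable_fun setT G ->
  (forall x, 0 <= F x)%E -> (forall x, 0 <= G x)%E ->
  (forall x, (dot x x = 1)%R -> (F x <= G x)%E) -> (\int[M]_x F x <= \int[M]_x G x)%E.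
Proof.
move=> mF mG F0 G0 FG; apply: ae_ge0_le_integral => //.
by apply: filterS ae_unit_sphere => x x1 _; exact: FG.
Qed.

Let mU : measurable_fun setT (fun x => 1 - dot x theta ^+ 2).
Proof.
by apply: measurable_funB; [exact: measurable_cst|apply: measurable_funX; exact: measurable_dotl].
Qed.

Let unit_second_moment eta eta' : dot eta eta = 1 -> dot theta eta = 0 ->
  dot eta' eta' = 1 -> dot theta eta' = 0 ->
  (\int[M]_x (dot x eta ^+ 2)%:E = \int[M]_x (dot x eta' ^+ 2)%:E)%E.
Proof.
move=> e1 te e1' te'; pose F (_ v : R) := (v ^+ 2)%:E.
have mF : measurable_fun setT (fun z : mR * mR => F z.1 z.2).
  by apply/measurable_EFinP; apply: measurable_funX; exact: measurable_snd.
have F0 s v : (0 <= F s v)%E by rewrite lee_fin sqr_ge0.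
rewrite -[LHS]/(\int[M]_x F (dot x theta) (dot x eta))%E.
rewrite -[RHS]/(\int[M]_x F (dot x theta) (dot x eta'))%E.
by rewrite !(integral_latitude_longitude th1 c0 phi0 mphi HM).
Qed.

Let scaled_second_moment eta v : dot eta eta = 1 -> dot theta eta = 0 ->
  dot theta v = 0 ->
  (\int[M]_x (dot x v ^+ 2)%:E = (dot v v)%:E * \int[M]_x (dot x eta ^+ 2)%:E)%E.
Proof.
move=> e1 te tv; have [->|v0] := eqVneq v 0.
  rewrite dot0l mul0e integral0_eq// => x _; by rewrite dot0r expr0n.
have n0 : 0 < cnorm v by rewrite lt_def cnorm_ge0 cnorm_eq0 v0.
pose u := (cnorm v)^-1 *: v.
have u1 : dot u u = 1.
  by rewrite dotZl dotZr mulrA -expr2 -sqr_cnorm -exprMn mulVf ?expr1n// lt0r_neq0.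
have tu : dot theta u = 0 by rewrite dotZr tv mulr0.
rewrite -(unit_second_moment u1 tu e1 te) -ge0_integralZl//; last 3 first.
- by apply/measurable_EFinP; apply: measurable_funX; exact: measurable_dotl.
- by move=> x _; rewrite lee_fin sqr_ge0.
- by rewrite lee_fin dot_ge0.
apply: eq_integral => x _; rewrite -EFinM dotZr exprMn exprVn -sqr_cnorm mulrA divff ?mul1r//.
by rewrite expf_neq0// lt0r_neq0.
Qed.

(** By symmetry around [theta] the second moment is a constant times [dot v v]. Summing over the
    projected standard basis determines the constant: the squared coordinates add up to [1 - U^2]
    and the squared lengths to [k.+1]. The absolute value keeps the integrand nonnegative off the
    sphere. *)
Lemma second_moment v : dot theta v = 0 ->
  (\int[M]_x (dot x v ^+ 2)%:E =
   (dot v v / k.+1%:R)%:E * \int[M]_x (`|1 - dot x theta ^+ 2|)%:E)%E.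
Proof.
move=> tv; have [eta [e1 te]] := orthogonal_unit th1.
rewrite (scaled_second_moment e1 te tv) EFinM -muleA; congr (_ * _)%E.
set V := (\int[M]_x (dot x eta ^+ 2)%:E)%E.
suff -> : (\int[M]_x (`|1 - dot x theta ^+ 2|)%:E = k.+1%:R%:E * V)%E.
  by rewrite muleA -EFinM mulVf ?mul1e.
pose b i := projection theta (delta_mx i 0 : 'cV[R]_k.+2).
have mb i : measurable_fun setT (fun x => (dot x (b i) ^+ 2)%:E).
  by apply/measurable_EFinP; apply: measurable_funX; exact: measurable_dotl.
transitivity (\int[M]_x (\sum_i (dot x (b i) ^+ 2)%:E))%E.
  apply: eq_integral_sphere.
  - by apply/measurable_EFinP; apply: measurableT_comp.
  - exact: emeasurable_sum.
  move=> x x1; rewrite sumEFin (sum_dot_projection_basis th1) x1 dotC ger0_norm//.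
  by rewrite subr_ge0; have := dot_sqr_le theta x; rewrite x1 th1 mulr1.
rewrite ge0_integral_sum//; last by move=> i x _; rewrite lee_fin sqr_ge0.
under eq_bigr => i _ do rewrite (scaled_second_moment e1 te (projection_orth th1 _)).
rewrite -ge0_sume_distrl; last by move=> i _; rewrite lee_fin dot_ge0.
by rewrite sumEFin (sum_projection_basis th1).
Qed.

(** Cauchy-Schwarz between [v] and the tangent part of [x], whose squared length is [1 - U^2] on the
    sphere. *)
Lemma fourth_moment_le v : dot theta v = 0 ->
  (\int[M]_x (dot x v ^+ 4)%:E <=
   (dot v v ^+ 2)%:E * \int[M]_x ((1 - dot x theta ^+ 2) ^+ 2)%:E)%E.
Proof.
move=> tv; rewrite -ge0_integralZl//; last 3 first.
- by apply/measurable_EFinP; apply: measurable_funX.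
- by move=> x _; rewrite lee_fin sqr_ge0.
- by rewrite lee_fin sqr_ge0.
apply: le_integral_sphere.
- by apply/measurable_EFinP; apply: measurable_funX; exact: measurable_dotl.
- apply: emeasurable_funM; first exact: measurable_cst.
  by apply/measurable_EFinP; apply: measurable_funX.
- by move=> x; rewrite lee_fin (_ : 4 = 2 * 2)%N// exprM sqr_ge0.
- by move=> x; rewrite -EFinM lee_fin -exprMn sqr_ge0.
move=> x x1; rewrite -EFinM lee_fin -exprMn (_ : 4 = 2 * 2)%N// exprM.
have := dot_sqr_le (projection theta x) v.
have -> : dot (projection theta x) v = dot x v.
  by rewrite dotC dot_projectionr tv mul0r subr0 dotC.
rewrite (dot_projection th1) x1 -expr2 (dotC theta x) => h.
have h0 := le_trans (sqr_ge0 (dot x v)) h.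
by rewrite [dot v v * _]mulrC lerXn2r ?nnegrE ?sqr_ge0.
Qed.

End spherical_moments.

(** * Asymptotic moments of the latitude *)

Section asymptotics.
Context (R : realType) (k : nat).
Notation leb := (@lebesgue_measure R).
Notation mR := (measurableTypeR R).
Context (M : nat -> probability 'cV[R]_k.+2 R) (theta : 'cV[R]_k.+2).
Context (c : nat -> R) (f : R -> R) (kappa : nat -> R).
Hypotheses (th1 : dot theta theta = 1) (c0 : forall n, 0 <= c n).
Hypotheses (Ff : class_F f) (kappa0 : forall n, 0 < kappa n).
Hypothesis koo : kappa n @[n --> \oo] --> +oo.
Hypothesis HM : forall n, has_density (M n) idfun (@surface_area R k.+2)
  (fun x => c n * f (kappa n * dot x theta)).

Let lam := concentration f kappa.
Let a : R := (k.+2%:R - 3) / 2.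
Let phi n s := f (kappa n * s).

Let a1 : -1 < a.
Proof. by rewrite /a -[k.+2]addn2 natrD; have := ler0n R k; lra. Qed.

Let a1_gt0 : 0 < a + 1. Proof. by rewrite -ltrBlDr sub0r. Qed.

Let a2_gt0 : 0 < a + 2.
Proof. by rewrite (lt_trans a1_gt0)// ltrD2l ltr1n. Qed.

Let f0 x : 0 < f x. Proof. exact: class_F_gt0. Qed.

Let phi0 n s : 0 <= phi n s. Proof. exact/ltW/f0. Qed.

Let mphi n : measurable_fun setT (phi n).
Proof. by apply: measurable_class_F_comp => //; exact: measurable_funM. Qed.

Lemma concentration_gt0 : \forall n \near \oo, 0 < lam n.
Proof. by move/cvgryPgt : (concentration_cvg Ff koo) => /(_ 0). Qed.

Let I x z n := (\int[leb]_(s in `[(-1)%R, 1%R])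
  (beta_weight x z s * (f (kappa n * s) / f (kappa n)))%:E)%E.

(** The Laplace integral scaled to have a finite limit; by that convergence [fine] discards nothing
    for large [n]. *)
Definition laplace_coef x z n := fine ((lam n `^ (x + 1))%:E * I x z n)%E.

Definition laplace_const x z := 2 `^ z * fine (@gammaE R x).

Lemma laplace_const_gt0 x z : -1 < x -> 0 < laplace_const x z.
Proof.
by move=> x1; rewrite mulr_gt0 ?powR_gt0 ?fine_gt0// gammaE_gt0//= gammaE_fin.
Qed.

Let laplaceP x z : -1 < x -> -1 < z ->
  ((lam n `^ (x + 1))%:E * I x z n)%E @[n --> \oo] --> (laplace_const x z)%:E.
Proof.
move=> x1 z1; have := laplace_class_F Ff koo x1 z1.
by rewrite -/lam EFinM fineK// gammaE_fin_num.
Qed.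

Lemma laplace_coef_cvg x z : -1 < x -> -1 < z ->
  laplace_coef x z n @[n --> \oo] --> laplace_const x z.
Proof. by move=> x1 z1; have /fine_cvgP[] := laplaceP x1 z1. Qed.

Let laplace_coefE x z : -1 < x -> -1 < z ->
  \forall n \near \oo, I x z n = (laplace_coef x z n / lam n `^ (x + 1))%:E.
Proof.
move=> x1 z1; have /fine_cvgP[fn _] := laplaceP x1 z1.
apply: filterS2 concentration_gt0 fn => n l0 fn; rewrite mulrC EFinM fineK//.
by rewrite muleA -EFinM mulVf ?mul1e// lt0r_neq0// powR_gt0.
Qed.

Lemma beta_weight_sym (x s : R) : -1 <= s <= 1 -> beta_weight x x s = (1 - s ^+ 2) `^ x.
Proof.
move=> s1; rewrite /beta_weight -powRM; [|lra|lra].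
by congr (_ `^ _); ring.
Qed.

Let massE n : angular_mass k (phi n) = ((f (kappa n))%:E * I a a n)%E.
Proof.
have mw : measurable_fun (`[(-1)%R, 1%R]%classic : set R)
    (fun s : R => (beta_weight a a s * (f (kappa n * s) / f (kappa n)))%:E).
  apply/measurable_EFinP; apply: measurable_funTS; apply: measurable_funM.
    exact: measurable_beta_weight.
  by apply: measurable_funM; [exact: mphi|exact: measurable_cst].
have w0 (s : mR) : (`[(-1)%R, 1%R]%classic : set R) s ->
    (0 <= (beta_weight a a s * (f (kappa n * s) / f (kappa n)))%:E)%E.
  by move=> _; rewrite lee_fin mulr_ge0 ?beta_weight_ge0// divr_ge0// ltW.
have k0 : (0 <= (f (kappa n))%:E)%E by rewrite lee_fin ltW.
rewrite -(ge0_integralZl leb (measurable_itv _) mw w0 k0).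
apply: eq_integral => s; rewrite inE/= in_itv/= => s1.
rewrite -EFinM /angular_weight (beta_weight_sym _ s1) -/a; congr EFin.
by rewrite /phi; field; rewrite lt0r_neq0.
Qed.

Lemma angular_mass_asymp : \forall n \near \oo,
  fine (angular_mass k (phi n)) =
  f (kappa n) * laplace_coef a a n / lam n `^ (a + 1).
Proof.
by apply: filterS (laplace_coefE a1 a1) => n h; rewrite massE h -EFinM/= mulrA.
Qed.

Lemma laplace_coef_gt0 : \forall n \near \oo, 2^-1 * laplace_const a a < laplace_coef a a n.
Proof.
have L0 := laplace_const_gt0 a a1.
have /cvgr_gt := laplace_coef_cvg a1 a1; apply; lra.
Qed.

(** The factor [f kappa] cancels between the integral and the mass, leaving a ratio of two Laplace
    integrals; the power of [lam] is the difference of their scaling exponents [a + 1] and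
    [x + 1]. *)
Lemma latitude_moment x z (F : R -> R) : -1 < x -> -1 < z ->
  measurable_fun setT F -> (forall s, 0 <= F s) ->
  (forall s, -1 <= s <= 1 -> F s * (1 - s ^+ 2) `^ a = beta_weight x z s) ->
  \forall n \near \oo, (\int[M n]_x (F (dot x theta))%:E)%E =
    (laplace_coef x z n / laplace_coef a a n * lam n `^ (a - x))%:E.
Proof.
move=> x1 z1 mF F0 FE; have L0 := laplace_const_gt0 a a1.
apply: filterS3 laplace_coef_gt0 angular_mass_asymp
  (filterI concentration_gt0 (laplace_coefE x1 z1)) => n c2 mE [l0 IE].
have j0 : 0 < laplace_coef a a n by lra.
have mF' : measurable_fun setT (fun s => (F s)%:E) by apply/measurable_EFinP.
have F0' s : (0 <= (F s)%:E)%E by rewrite lee_fin.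
rewrite (integral_latitude th1 (c0 n) (phi0 n) (mphi n) (HM n) mF' F0') mE.
have -> : (\int[leb]_(s in `[(-1)%R, 1%R]) ((F s)%:E * (angular_weight k (phi n) s)%:E) =
    (f (kappa n))%:E * I x z n)%E.
  have mw : measurable_fun (`[(-1)%R, 1%R]%classic : set R)
      (fun s : R => (beta_weight x z s * (f (kappa n * s) / f (kappa n)))%:E).
    apply/measurable_EFinP; apply: measurable_funTS; apply: measurable_funM.
      exact: measurable_beta_weight.
    by apply: measurable_funM; [exact: mphi|exact: measurable_cst].
  have w0 (s : mR) : (`[(-1)%R, 1%R]%classic : set R) s ->
      (0 <= (beta_weight x z s * (f (kappa n * s) / f (kappa n)))%:E)%E.
    by move=> _; rewrite lee_fin mulr_ge0 ?beta_weight_ge0// divr_ge0// ltW.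
  have k0 : (0 <= (f (kappa n))%:E)%E by rewrite lee_fin ltW.
  rewrite -(ge0_integralZl leb (measurable_itv _) mw w0 k0).
  apply: eq_integral => s; rewrite inE/= in_itv/= => s1.
  rewrite -!EFinM; congr EFin.
  have -> : F s * angular_weight k (phi n) s = F s * (1 - s ^+ 2) `^ a * phi n s.
    by rewrite /angular_weight mulrA.
  rewrite (FE _ s1).
  by rewrite /phi; field; rewrite lt0r_neq0.
rewrite IE -!EFinM; congr EFin.
have -> : lam n `^ (a - x) = lam n `^ (a + 1) / lam n `^ (x + 1).
  rewrite -powRN -powRD; last by apply/implyP => _; exact: lt0r_neq0.
  by congr (_ `^ _); ring.
by field; rewrite !lt0r_neq0 ?powR_gt0.
Qed.

Let mabs (F : R -> R) : measurable_fun setT F -> measurable_fun setT (fun s => `|F s|).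
Proof. by move=> mF; apply: measurableT_comp. Qed.

Let msq : measurable_fun setT (fun s : R => 1 - s ^+ 2).
Proof. by apply: measurable_funB; [exact: measurable_cst|exact: measurable_funX]. Qed.

(** Raising both exponents from [a] to [a + 1] multiplies the Laplace constant by [2 * Gamma(a + 2)
    / Gamma(a + 1) = 2 * (a + 1)], which is [k.+1]. *)
Lemma deviation_cvg :
  ((lam n)%:E * \int[M n]_x (`|1 - dot x theta ^+ 2|)%:E)%E @[n --> \oo] -->
  (k.+1%:R)%:E.
Proof.
have a2 : -1 < a + 1 by rewrite (lt_trans a1)// ltrDl.
have FE (s : R) : -1 <= s <= 1 ->
    `|1 - s ^+ 2| * (1 - s ^+ 2) `^ a = beta_weight (a + 1) (a + 1) s.
  move=> s1; have q0 : 0 <= 1 - s ^+ 2 by nra.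
  rewrite beta_weight_sym// ger0_norm// mulrC; have [q1|q1] := eqVneq (1 - s ^+ 2) 0.
    by rewrite q1 mulr0 powR0// lt0r_neq0.
  by rewrite powRD ?powRr1// q1 implybT.
have h := latitude_moment a2 a2 (mabs msq) (fun s => normr_ge0 _) FE.
apply: (@cvg_trans _ ((laplace_coef (a + 1) (a + 1) n / laplace_coef a a n)%:E @[n --> \oo])).
  apply: near_eq_cvg; apply: filterS2 concentration_gt0 h => n l0 ->.
  rewrite -EFinM (_ : a - (a + 1) = -1); last by ring.
  rewrite (powR_inv1 (ltW l0)); congr EFin.
  by rewrite mulrCA divff ?mulr1// lt0r_neq0.
have -> : k.+1%:R = laplace_const (a + 1) (a + 1) / laplace_const a a.
  have ga : 0 < fine (@gammaE R a) by rewrite fine_gt0// gammaE_gt0//= gammaE_fin.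
  rewrite /laplace_const gammaE_rec// fineM ?gammaE_fin_num//= powRD; last by rewrite pnatr_eq0 implybT.
  rewrite powRr1// (_ : k.+1%:R = 2 * (a + 1)).
    by field; rewrite !lt0r_neq0 ?powR_gt0.
  by rewrite /a -[k.+2]addn1 natrD; field.
apply: cvg_EFin; first by near=> n.
apply: cvgM; first exact: laplace_coef_cvg.
by apply: cvgV; [rewrite lt0r_neq0// laplace_const_gt0|exact: laplace_coef_cvg].
Unshelve. all: end_near. Qed.

Lemma sqr_deviation_bound : exists C : R, \forall n \near \oo,
  ((lam n ^+ 2)%:E * \int[M n]_x ((1 - dot x theta ^+ 2) ^+ 2)%:E <= C%:E)%E.
Proof.
have a2 : -1 < a + 2 by rewrite (lt_trans a1)// ltrDl.
have FE (s : R) : -1 <= s <= 1 ->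
    (1 - s ^+ 2) ^+ 2 * (1 - s ^+ 2) `^ a = beta_weight (a + 2) (a + 2) s.
  move=> s1; have q0 : 0 <= 1 - s ^+ 2 by nra.
  rewrite beta_weight_sym// mulrC; have [q1|q1] := eqVneq (1 - s ^+ 2) 0.
    by rewrite q1 expr0n mulr0 powR0// lt0r_neq0.
  by rewrite powRD ?powR_mulrn// q1 implybT.
have msq2 : measurable_fun setT (fun s : R => (1 - s ^+ 2) ^+ 2) by exact: measurable_funX.
have h := latitude_moment a2 a2 msq2 (fun s => sqr_ge0 _) FE.
exists (laplace_const (a + 2) (a + 2) / laplace_const a a + 1).
have cc : laplace_coef (a + 2) (a + 2) n / laplace_coef a a n @[n --> \oo] -->
    laplace_const (a + 2) (a + 2) / laplace_const a a.
  apply: cvgM; first exact: laplace_coef_cvg.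
  by apply: cvgV; [rewrite lt0r_neq0// laplace_const_gt0|exact: laplace_coef_cvg].
have cl : \forall n \near \oo, laplace_coef (a + 2) (a + 2) n / laplace_coef a a n <
    laplace_const (a + 2) (a + 2) / laplace_const a a + 1.
  by have /cvgr_lt := cc; apply; rewrite ltrDl.
apply: filterS3 concentration_gt0 h cl => n l0 -> /ltW cl.
rewrite -EFinM lee_fin (_ : a - (a + 2) = - 2%:R); last by ring.
rewrite powRN (powR_mulrn _ (ltW l0)); apply: le_trans cl.
by rewrite le_eqVlt mulrCA divff ?mulr1 ?eqxx// expf_neq0// lt0r_neq0.
Qed.

Lemma concentrated_cvg :
  (\int[M n]_x (`|1 - dot x theta|)%:E)%E @[n --> \oo] --> 0%E.
Proof.
have a2 : -1 < a + 1 by rewrite (lt_trans a1)// ltrDl.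
have m1 : measurable_fun setT (fun s : R => 1 - s).
  by apply: measurable_funB => //; exact: measurable_cst.
have FE (s : R) : -1 <= s <= 1 ->
    `|1 - s| * (1 - s ^+ 2) `^ a = beta_weight (a + 1) a s.
  move=> s1; rewrite -beta_weight_sym// /beta_weight ger0_norm; last by lra.
  rewrite mulrA; congr (_ * _); rewrite mulrC; have [q1|q1] := eqVneq (1 - s) 0.
    by rewrite q1 mulr0 powR0// lt0r_neq0.
  by rewrite powRD ?powRr1//; [lra|rewrite q1 implybT].
have h := latitude_moment a2 a1 (mabs m1) (fun s => normr_ge0 _) FE.
apply: (@cvg_trans _ ((laplace_coef (a + 1) a n / laplace_coef a a n * (lam n)^-1)%:E @[n --> \oo])).
  apply: near_eq_cvg; apply: filterS2 concentration_gt0 h => n l0 ->.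
  by rewrite (_ : a - (a + 1) = -1) ?(powR_inv1 (ltW l0))//; ring.
apply: cvg_EFin; first by near=> n.
rewrite -[X in _ --> X](mulr0 (laplace_const (a + 1) a / laplace_const a a)).
apply: cvgM; last exact: cvg_inv_pinfty (concentration_cvg Ff koo).
apply: cvgM; first exact: laplace_coef_cvg.
by apply: cvgV; [rewrite lt0r_neq0// laplace_const_gt0|exact: laplace_coef_cvg].
Unshelve. all: end_near. Qed.

End asymptotics.

(** * Measurability of the score *)

Lemma measurable_cvgn d (T : measurableType d) (R : realType) (g : nat -> T -> R) :
  (forall n, measurable_fun setT (g n)) -> measurable [set x | cvgn (g ^~ x)].
Proof.
move=> mg.
(* The Cauchy criterion with tolerances [1 / (k + 1)] expresses convergence by countable set
   operations. *)
have -> : [set x | cvgn (g ^~ x)] = \bigcap_k \bigcup_N \bigcap_(n in [set n | (N <= n)%N])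
    [set x | `|g n x - g N x| <= k.+1%:R^-1].
  apply/seteqP; split => x /=.
    move=> gx k _; have k0 : 0 < k.+1%:R^-1 / 2 :> R by [].
    have /cvgrPdist_le/(_ _ k0)[N _ hN] := gx.
    exists N => // n /= Nn; have h1 := hN n Nn; have h2 := hN N (leqnn N).
    rewrite (_ : g n x - g N x = (limn (g ^~ x) - g N x) - (limn (g ^~ x) - g n x)); last by ring.
    by rewrite (le_trans (ler_normB _ _))// [leRHS]splitr lerD.
  move=> gx; apply/cauchy_cvgP/cauchy_exP => e e0.
  pose k := Num.truncn e^-1; have [N _ hN] := gx k I.
  exists (g N x); exists N => // n /= Nn; rewrite /ball/= distrC.
  rewrite (le_lt_trans (hN n Nn))// invf_plt ?posrE//; exact: truncnS_gt.
apply: bigcapT_measurable => k; apply: bigcup_measurable => N _.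
apply: bigcap_measurableType => n _.
rewrite (_ : [set _ | _] = (fun x => `|g n x - g N x|) @^-1` `]-oo, k.+1%:R^-1]); last first.
  by apply/seteqP; split => x /=; rewrite in_itv.
rewrite -[X in measurable X]setTI.
have m1 : measurable_fun setT (fun x => `|g n x - g N x|).
  by apply: measurableT_comp => //; exact: measurable_funB.
exact: m1.
Qed.

Section monotone_derivative.
Context (R : realType) (f : R -> R).
Hypothesis hf : {homo f : x y / x <= y}.

(** The steps are [1, -1, 1/2, -1/2, 1/3, ...], so that a single sequence tests both one-sided
    derivatives. *)
Let step (j : nat) : R := (-1) ^+ odd j / (j./2).+1%:R.

Let slope (x h : R) : R := h^-1 * (f (h + x) - f x).

(* Two consecutive steps of the same sign have a ratio tending to 1, so by
   monotonicity they control the slopes in between. *)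
Let slope_cvg x l : slope x (step j) @[j --> \oo] --> (l : R) ->
  slope x h @[h --> (0 : R)^'] --> l.
Proof.
have slope0 h : 0 <= slope x h.
  rewrite /slope; have [h0|h0] := leP 0 h.
    by rewrite mulr_ge0 ?invr_ge0// subr_ge0 hf// lerDr.
  by rewrite mulr_le0 ?invr_le0 ?(ltW h0)// subr_le0 hf// gerDr ltW.
move=> cl; have l0 : 0 <= l.
  by apply: (cvgr_to_ge cl); near=> j; exact: slope0.
apply/cvgrPdist_le => e e0; pose d : R := e / 2; have d0 : 0 < d by rewrite divr_gt0.
move/cvgrPdist_le : cl => /(_ _ d0)[J _ hJ].
(* The second entry forces [l + d <= d * m]; the increment over the step [1 / m] is then at most
   [d], which pays for replacing [m] by [m + 1]. *)
pose K : nat := maxn J.+1 (Num.truncn ((l + d) / d)).+1.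
have K0 : 0 < K.+1%:R :> R by [].
near=> h; have h0 : h != 0 by near: h; exact: nbhs_dnbhs_neq.
have hK : `|h| < K.+1%:R^-1 by near: h; apply: dnbhs0_lt; rewrite invr_gt0.
have n0 : 0 < `|h| by rewrite normr_gt0.
pose m := Num.truncn `|h|^-1.
have hi0 : 0 <= `|h|^-1 by rewrite invr_ge0 ltW.
have /andP[mh hm] : m%:R <= `|h|^-1 < m.+1%:R by exact: truncn_itv.
have Km : (K < m.+1)%N.
  rewrite -(ltr_nat R) (lt_trans _ hm)//.
  rewrite (le_lt_trans _ (_ : K.+1%:R < _))//; first by rewrite ler_nat.
  by rewrite -[K.+1%:R]invrK ltf_pV2 ?posrE// invr_gt0.
have m0 : (0 < m)%N by rewrite (leq_trans _ (_ : K <= m)%N)// leq_max.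
(* With the sign of [h], the steps of index [i] and [i'] have sizes [1 / (m + 1)] and [1 / m], which
   bracket the size of [h]. *)
pose b := (h < 0); pose i := (b + m.*2)%N; pose i' := (b + m.-1.*2)%N.
have odd_i : odd i = b by rewrite oddD odd_double addbF oddb.
have odd_i' : odd i' = b by rewrite oddD odd_double addbF oddb.
have half_i : i./2 = m by rewrite halfD odd_double andbF add0n doubleK; case: (b).
have half_i' : i'./2 = m.-1 by rewrite halfD odd_double andbF add0n doubleK; case: (b).
have Ji : (J <= i)%N.
  rewrite (@leq_trans m)//; last by rewrite /i -addnn addnA leq_addl.
  by move: Km; rewrite ltnS; apply: leq_trans; rewrite leq_max leqnSn.
have Ji' : (J <= i')%N.
  rewrite (@leq_trans m.-1)//; last by rewrite /i' -addnn addnA leq_addl.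
  by move: Km; rewrite ltnS geq_max => /andP[+ _]; case: (m) m0.
have hE : h = (-1) ^+ b * `|h|.
  rewrite /b; case: (ltP h 0) => h1 /=.
    by rewrite expr1 (ltr0_norm h1) mulN1r opprK.
  by rewrite expr0 mul1r (ger0_norm h1).
pose D (u : R) := (-1) ^+ b * (f ((-1) ^+ b * u + x) - f x).
have D_homo u v : u <= v -> D u <= D v.
  rewrite /D; case: (b); rewrite ?expr1 ?expr0 ?mulN1r ?mul1r.
    by move=> uv; rewrite lerN2 lerD2r hf// lerD2r lerN2.
  by move=> uv; rewrite lerD2r hf// lerD2r.
have slopeE u : 0 < u -> slope x ((-1) ^+ b * u) = D u / u.
  move=> u0; rewrite /slope /D; case: (b); rewrite ?expr1 ?expr0.
    by field; exact: lt0r_neq0.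
  by field; exact: lt0r_neq0.
have qE : slope x h = D `|h| * `|h|^-1 by rewrite {1}hE slopeE.
have wi : slope x (step i) = D m.+1%:R^-1 * m.+1%:R.
  by rewrite /step odd_i half_i slopeE// ?invrK.
have wi' : slope x (step i') = D m%:R^-1 * m%:R.
  by rewrite /step odd_i' half_i' prednK// slopeE ?invrK// invr_gt0 ltr0n.
have alg (q y y1 y2 m' : R) : 0 < m' -> l + d <= d * m' -> m' <= q -> q < m' + 1 ->
    y1 <= y -> y <= y2 -> 0 <= y1 -> `|l - y2 * m'| <= d -> `|l - y1 * (m' + 1)| <= d ->
    `|l - y * q| <= 2 * d.
  move=> M0 Kd mq qm yy1 yy2 y10; rewrite !ler_norml => /andP[a1 a2] /andP[b1 b2].
  have y2d : y2 <= d by rewrite -(ler_pM2r M0); lra.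
  by apply/andP; split; nra.
have D_ge0 u : 0 <= u -> 0 <= D u.
  by move=> u0; rewrite -[X in X <= _](_ : D 0 = 0) ?D_homo// /D mulr0 add0r subrr mulr0.
rewrite (_ : e = 2 * d); last by rewrite /d; field.
rewrite qE; apply: (alg _ _ (D m.+1%:R^-1) (D m%:R^-1) m%:R).
- by rewrite ltr0n.
- rewrite mulrC -ler_pdivrMr// (le_trans (ltW (truncnS_gt _)))// ler_nat.
  by move: Km; rewrite ltnS geq_max => /andP[].
- by [].
- by rewrite natr1.
- apply: D_homo; rewrite -[leRHS]invrK lef_pV2 ?posrE// ?invr_gt0//; exact: ltW.
- by apply: D_homo; rewrite -[leLHS]invrK lef_pV2 ?posrE// ?invr_gt0// ltr0n.
- by apply: D_ge0; rewrite invr_ge0.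
- by rewrite -wi'; exact: hJ.
- by rewrite natr1 -wi; exact: hJ.
Unshelve. all: end_near. Qed.

(** Where the slopes along [step] converge, the derivative is their limit; elsewhere [f] is not
    differentiable and the derivative takes the default value [point], a constant. *)
Lemma measurable_derive1_homo : measurable_fun setT (f^`()%classic).
Proof.
have mf : measurable_fun setT f by exact: nondecreasing_measurable.
have ms j : measurable_fun setT (fun x => slope x (step j)).
  apply: measurable_funM; first exact: measurable_cst.
  apply: measurable_funB => //; apply: (measurableT_comp mf).
  by apply: measurable_funD => //; exact: measurable_cst.
pose C := [set x | cvgn (fun j => slope x (step j))].
have mC : measurable C := measurable_cvgn ms.
have step0 : step j @[j --> \oo] --> (0 : R)^'.
  have s0 : step j @[j --> \oo] --> (0 : R).
    apply/cvgrPdist_lt => e e0; near=> j; rewrite /= sub0r normrN normrM normrX normrN1 expr1n.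
    rewrite mul1r normfV ger0_norm// invf_plt ?posrE// (lt_le_trans (truncnS_gt _))//.
    rewrite ler_nat ltnS -[X in (X <= _)%N](doubleK (Num.truncn e^-1)); apply: half_leq.
    by near: j; exact: nbhs_infty_ge.
  move=> P P0; have [N _ hN] := s0 _ P0; exists N => // j /= Nj; apply: (hN j Nj).
  by rewrite mulf_neq0// ?signr_eq0// invr_eq0 pnatr_eq0.
rewrite (_ : setT = C `|` ~` C); last by rewrite setUv.
apply/measurable_funU => //; first exact: measurableC.
split.
  apply: (measurable_fun_cvg (h := fun j x => slope x (step j))).
    by move=> j; exact: measurable_funTS.
  move=> x /= cx; rewrite /derive1; have := slope_cvg cx.
  by rewrite /slope => /cvg_lim ->.
apply: (eq_measurable_fun (fun=> point)) => // x; rewrite inE/= => ncx.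
rewrite /derive1 dvgP// => dx; apply: ncx.
apply/cvg_ex; exists (lim (slope x h @[h --> (0 : R)^'])).
exact: (cvg_comp _ _ step0 dx).
Unshelve. all: end_near. Qed.

End monotone_derivative.

Lemma measurable_varphi (R : realType) (f : R -> R) : class_F f ->
  measurable_fun setT (varphi f).
Proof.
move=> Ff; apply: measurable_funM.
  by apply: measurable_derive1_homo; exact: class_F_homo.
by apply: measurable_funV; exact: measurable_class_F.
Qed.

Lemma cvge0_near (R : realType) (g : nat -> \bar R) :
  (\forall n \near \oo, (0 <= g n)%E) ->
  (forall e : R, 0 < e -> \forall n \near \oo, (g n <= e%:E)%E) ->
  g n @[n --> \oo] --> 0%E.
Proof.
move=> g0 h; apply: (@cvg_trans _ (maxe 0%E (g n) @[n --> \oo])).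
  by apply: near_eq_cvg; apply: filterS g0 => n gn; rewrite max_r.
apply: cvge0_ge0 => [n|e e0]; first by rewrite le_max lexx.
by apply: filterS (h e e0) => n gn; rewrite ge_max lee_fin ltW.
Qed.

Section G_law_measure.
Context (R : realType).
Notation leb := (@lebesgue_measure R).
Notation mR := (measurableTypeR R).

(** Measurability of partial integrals is proved separately for the point mass and for the Beta
    density, the latter by Tonelli for Lebesgue measure: [G_law] is a bare set function without a
    sigma-finite structure. *)
Lemma G_law_measure k : exists2 m : {measure set mR -> \bar R},
  m = @G_law R k.+2 :> (set mR -> \bar R) &
  forall (D : set mR) (H : R -> R -> \bar R), measurable D ->
    measurable_fun setT (fun z : mR * mR => H z.1 z.2) ->
    (forall s w, 0 <= H s w)%E ->
    measurable_fun setT (fun s => \int[m]_(w in D) H s w)%E.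
Proof.
case: k => [|k].
  exists (\d_(1 : mR) : {measure set mR -> \bar R}) => // D H mD mH H0.
  rewrite (_ : (fun _ => _) = (fun s : R => \d_(1%R : mR) D * H s 1%R)%E); last first.
    apply/funext => s; rewrite -(setTI D) integral_mkcondr integral_dirac//.
      by rewrite diracT mul1e patchE setTI diracE; case: (_ \in _); rewrite ?mul1e ?mul0e.
    apply/(measurable_restrictT _ mD); apply: measurable_funTS.
    by apply: (measurableT_comp (g := fun w : R => (s, w)) mH); exact: pair1_measurable.
  apply: emeasurable_funM; first exact: measurable_cst.
  by apply: (measurableT_comp (g := fun s : R => (s, 1 : R)) mH); exact: pair2_measurable.
pose I : set R := `[0%R, 1%R]%classic; pose b : R := (k.+3%:R - 2) / 2.
have mI : measurable I by exact: measurable_itv.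
pose beta (w : R) := w `^ (2^-1 - 1) * (1 - w) `^ (b - 1) / rbeta_fun (2^-1) b.
have B0 : 0 <= rbeta_fun (2^-1) b.
  by rewrite /rbeta_fun /Rintegral fine_ge0// integral_ge0// => w _;
    rewrite lee_fin mulr_ge0 ?powR_ge0.
have beta0 w : 0 <= beta w by rewrite divr_ge0// mulr_ge0 ?powR_ge0.
pose g w := \1_I w * beta w.
have mg : measurable_fun setT g.
  apply: measurable_funM; first exact: (measurable_indic mI).
  apply: measurable_funM; last exact: measurable_cst.
  apply: measurable_funM; apply: measurable_powRf; first exact: measurable_id.
  by apply: measurable_funB => //; exact: measurable_cst.
have g0 w : 0 <= g w by rewrite mulr_ge0// indicE.
have gE A : @G_law R k.+3 A = (\int[leb]_(w in A) (g w)%:E)%E.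
  rewrite /G_law/= /rbeta_prob integral_mkcond [RHS]integral_mkcond.
  apply: eq_integral => w _; rewrite !patchE in_setI /g indicE.
  by case: (w \in A); case: (w \in _) => //=; rewrite ?mul1r ?mul0r.
have [m mE] := measure_of_density leb g0 mg.
exists m => [|D H mD mH H0]; first by apply/funext => A; rewrite gE mE.
rewrite (_ : (fun _ => _) = (fun s : R => \int[leb]_w ((\1_D w)%:E * H s w * (g w)%:E))%E).
  apply: (measurable_fun_fubini_tonelli_F (m2 := leb)
    (fun z : mR * mR => (\1_D z.2)%:E * H z.1 z.2 * (g z.2)%:E)%E).
    apply: emeasurable_funM.
      apply: emeasurable_funM => //; apply/measurable_EFinP.
      apply: (measurableT_comp (f := \1_D : mR -> R)); last exact: measurable_snd.
      exact: measurable_indic.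
    by apply/measurable_EFinP; apply: (measurableT_comp mg); exact: measurable_snd.
  by move=> z; rewrite !mule_ge0 ?lee_fin// indicE.
apply/funext => s; rewrite integral_mkcond.
have mHs : measurable_fun setT (H s).
  by apply: (measurableT_comp (g := fun w : R => (s, w)) mH); exact: pair1_measurable.
rewrite (ge0_integral_densityE (T := mR) (m := m) (mu := leb) g0 mg mE).
- apply: eq_integral => w _; rewrite patchE indicE.
  by case: ifP => _; rewrite ?mul1e ?mul0e.
- by move=> w; rewrite patchE; case: ifP.
- by apply/(measurable_restrictT _ mD); exact: measurable_funTS.
Qed.

End G_law_measure.

(** * The two integral conditions as statements on expectations *)

Section lan_conditions.
Context (R : realType) (k : nat).
Notation leb := (@lebesgue_measure R).
Notation mR := (measurableTypeR R).
Context (M : nat -> probability 'cV[R]_k.+2 R) (theta : 'cV[R]_k.+2).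
Context (c : nat -> R) (f : R -> R) (kappa : nat -> R).
Hypotheses (th1 : dot theta theta = 1) (c0 : forall n, 0 <= c n).
Hypotheses (Ff : class_F f) (kappa0 : forall n, 0 < kappa n).
Hypothesis koo : kappa n @[n --> \oo] --> +oo.
Hypothesis HM : forall n, has_density (M n) idfun (@surface_area R k.+2)
  (fun x => c n * f (kappa n * dot x theta)).

Let lam := concentration f kappa.
Let a : R := (k.+2%:R - 3) / 2.
Let phi n s := f (kappa n * s).
Let L := laplace_const a a.

Let a1 : -1 < a.
Proof. by rewrite /a -[k.+2]addn2 natrD; have := ler0n R k; lra. Qed.

Let L0 : 0 < L. Proof. exact: laplace_const_gt0. Qed.

Let f0 x : 0 < f x. Proof. exact: class_F_gt0. Qed.

Let phi0 n s : 0 <= phi n s. Proof. exact/ltW/f0. Qed.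

Let mphi n : measurable_fun setT (phi n).
Proof. by apply: measurable_class_F_comp => //; exact: measurable_funM. Qed.

Let mvar : measurable_fun setT (varphi f). Proof. exact: measurable_varphi. Qed.

Let mass_near : \forall n \near \oo, 0 < lam n /\
  exists2 j : R, 2^-1 * L < j &
    fine (angular_mass k (phi n)) = f (kappa n) * j / lam n `^ (a + 1).
Proof.
apply: filterS3 (concentration_gt0 Ff koo) (laplace_coef_gt0 k Ff koo)
  (angular_mass_asymp k Ff koo) => n l0 c2 mE.
by split=> //; exists (laplace_coef f kappa a a n).
Qed.

Definition score_error n (x : 'cV[R]_k.+2) :=
  varphi f (kappa n * dot x theta) - varphi f (kappa n).

Lemma measurable_score_error n : measurable_fun setT (score_error n).
Proof.
apply: measurable_funB; last exact: measurable_cst.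
apply: (measurableT_comp mvar); apply: measurable_funM; first exact: measurable_cst.
exact: measurable_dotl.
Qed.

(** The factor [kappa / varphi] is the one for which all powers cancel once the condition is divided
    by the mass, of order [f kappa / lam^(a + 1)]: in the condition [kappa] has exponent [a + 2] and
    [varphi] has exponent [a]. *)
Lemma score_error_cvg :
  elittleo +oo (fun q => (((f q)^-1)%:E *
     \int[leb]_(s in `[(-1)%R, 1%R])
       ((varphi f (q * s) - varphi f q) ^+ 2
        * (1 - s ^+ 2) `^ ((k.+2%:R - 3) / 2) * f (q * s))%:E)%E)
   (fun q => (q `^ ((k.+2%:R + 1) / 2) * varphi f q `^ ((k.+2%:R - 3) / 2))^-1) ->
  ((kappa n / varphi f (kappa n))%:E * \int[M n]_x (score_error n x ^+ 2)%:E)%E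
    @[n --> \oo] --> 0%E.
Proof.
move=> C2; have v0 n : 0 < lam n -> 0 < varphi f (kappa n).
  by rewrite /lam /concentration pmulr_rgt0.
apply: cvge0_near.
  apply: filterS (concentration_gt0 Ff koo) => n /v0 vn.
  apply: mule_ge0; first by rewrite lee_fin divr_ge0 ?(ltW vn) ?(ltW (kappa0 n)).
  by apply: integral_ge0 => x _; rewrite lee_fin sqr_ge0.
move=> e e0; pose e' := e * (2^-1 * L); have e'0 : 0 < e' by rewrite mulr_gt0// mulr_gt0// invr_gt0.
apply: filterS2 mass_near (elittleo_seq koo C2 e'0) => n [l0 [j jL mE]].
have vn := v0 n l0; have kn := kappa0 n.
have j0 : 0 < j by apply: lt_trans jL; rewrite mulr_gt0.
set q := kappa n in mE vn kn *; set v := varphi f q in vn *.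
set I := (\int[_]_(_ in _) _)%E => H.
have I0 : (0 <= I)%E.
  by apply: integral_ge0 => s _; rewrite lee_fin mulr_ge0 ?(ltW (f0 _))// mulr_ge0 ?sqr_ge0 ?powR_ge0.
pose F s := ((varphi f (q * s) - v) ^+ 2)%:E.
have mF : measurable_fun setT F.
  apply/measurable_EFinP; apply: measurable_funX; apply: measurable_funB; last exact: measurable_cst.
  by apply: (measurableT_comp mvar); exact: measurable_funM.
have F0 s : (0 <= F s)%E by rewrite lee_fin sqr_ge0.
have -> : (\int[M n]_x (score_error n x ^+ 2)%:E =
    ((f q * j / lam n `^ (a + 1))^-1)%:E * I)%E.
  rewrite -mE -[LHS]/(\int[M n]_x F (dot x theta))%E.
  rewrite (integral_latitude th1 (c0 n) (phi0 n) (mphi n) (HM n) mF F0).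
  by congr (_ * _)%E; apply: eq_integral => s _; rewrite /F /angular_weight -EFinM mulrA.
move: H; rewrite gee0_abs ?mule_ge0 ?lee_fin ?invr_ge0 ?(ltW (f0 q))// => H.
have pq : 0 < q `^ ((k.+2%:R + 1) / 2) * v `^ a by rewrite mulr_gt0 ?powR_gt0.
rewrite ger0_norm in H; last by rewrite invr_ge0 ltW.
pose B := (q / v) * (lam n `^ (a + 1) / j).
have B0 : 0 <= B by rewrite !mulr_ge0 ?invr_ge0 ?powR_ge0 ?ltW.
rewrite (_ : (_ * _)%E = (B%:E * ((f q)^-1%:E * I))%E); last first.
  rewrite !muleA -!EFinM; congr (_%:E * _)%E; rewrite /B.
  by field; rewrite !lt0r_neq0// powR_gt0.
apply: (@le_trans _ _ (B%:E * (e' * (q `^ ((k.+2%:R + 1) / 2) * v `^ a)^-1)%:E)%E).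
  by rewrite lee_wpmul2l ?lee_fin.
rewrite -EFinM lee_fin.
have -> : B * (e' * (q `^ ((k.+2%:R + 1) / 2) * v `^ a)^-1) = e' / j.
  have -> : q `^ ((k.+2%:R + 1) / 2) = q `^ (a + 1) * q.
    rewrite (_ : (k.+2%:R + 1) / 2 = a + 1 + 1); last by rewrite /a; field.
    by rewrite powRD ?(gt_eqF kn) ?implybT// (powRr1 (ltW kn)).
  rewrite /B /lam /concentration -/q -/v powRM ?(ltW kn) ?(ltW vn)//.
  rewrite [v `^ (a + 1)]powRD; last by rewrite (gt_eqF vn) implybT.
  rewrite (powRr1 (ltW vn)); field; rewrite !lt0r_neq0 ?powR_gt0//.
rewrite ler_pdivrMr// ler_wpM2l ?(ltW e0)//; exact: ltW.
Qed.

Variables (N A B : nat -> R) (eta : nat -> 'cV[R]_k.+2).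
Hypotheses (N0 : forall n, 0 < N n).
Hypotheses (eta1 : forall n, dot (eta n) (eta n) = 1).
Hypotheses (eta_orth : forall n, dot theta (eta n) = 0).

Definition taylor_error n (s h : R) :=
  ln (f (kappa n * s + h)) - ln (f (kappa n * s)) - h * varphi f (kappa n * s).

Lemma measurable_taylor_error d (T : measurableType d) n (s h : T -> R) :
  measurable_fun setT s -> measurable_fun setT h ->
  measurable_fun setT (fun t => taylor_error n (s t) (h t)).
Proof.
move=> ms mh; have mks : measurable_fun setT (fun t => kappa n * s t).
  by apply: measurable_funM => //; exact: measurable_cst.
have mln (g : T -> R) : measurable_fun setT g -> measurable_fun setT (fun t => ln (f (g t))).
  by move=> mg; apply: (measurableT_comp (@measurable_ln R)); exact: measurable_class_F_comp.
apply: measurable_funB.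
  by apply: measurable_funB; [apply: mln; exact: measurable_funD|exact: mln].
by apply: measurable_funM => //; exact: (measurableT_comp mvar).
Qed.

(** Given the latitude [s] and [w], the longitude is plus or minus [sqrt (1 - s^2) * sqrt w] with
    equal weights, so the two signs of the condition add up to an expectation. [N] stands for the
    sample size, [A] and [B] for the coefficients of latitude and longitude in the shift of the
    argument of [f]. *)
Lemma taylor_error_cvg :
  (forall minus : bool, elittleo \oo
    (fun n => (((f (kappa n))^-1)%:E *
       \int[leb]_(s in `[(-1)%R, 1%R])
       \int[@G_law R k.+2]_(w in `[0%R, 1%R])
         (`|taylor_error n s (A n * s + (-1) ^+ minus *
              (B n * Num.sqrt (1 - s ^+ 2) * Num.sqrt w))|
          * f (kappa n * s) * (1 - s ^+ 2) `^ ((k.+2%:R - 3) / 2))%:E)%E)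
    (fun n => (N n * lam n `^ ((k.+2%:R - 1) / 2))^-1)) ->
  ((N n)%:E * \int[M n]_x
     (`|taylor_error n (dot x theta) (A n * dot x theta + B n * dot x (eta n))|)%:E)%E
    @[n --> \oo] --> 0%E.
Proof.
move=> C3; apply: cvge0_ge0 => [n|e e0].
  by rewrite mule_ge0 ?lee_fin ?(ltW (N0 n))// integral_ge0// => x _; rewrite lee_fin.
pose e' := e * (2^-1 * L); have e'0 : 0 < e' by rewrite mulr_gt0// mulr_gt0// invr_gt0.
apply: filterS3 mass_near (C3 false _ e'0) (C3 true _ e'0) => n [l0 [j jL mE]].
have [m mG mI] := G_law_measure R k; rewrite -mG.
pose F s v := (`|taylor_error n s (A n * s + B n * v)|)%:E.
have mF : measurable_fun setT (fun z : mR * mR => F z.1 z.2).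
  apply/measurable_EFinP; apply: measurableT_comp => //.
  apply: (measurable_taylor_error n (T := (mR * mR)%type)); first exact: measurable_fst.
  apply: measurable_funD; apply: measurable_funM; [exact: measurable_cst|exact: measurable_fst|
    exact: measurable_cst|exact: measurable_snd].
have F0 s v : (0 <= F s v)%E by rewrite lee_fin.
pose w s := angular_weight k (phi n) s.
have w0 s : 0 <= w s by exact: angular_weight_ge0.
have mw : measurable_fun setT w by exact: measurable_angular_weight.
pose G (i : bool) s v := (F s ((-1) ^+ i * (Num.sqrt (1 - s ^+ 2) * Num.sqrt v))%R * (w s)%:E)%E.
have G0 i s v : (0 <= G i s v)%E by rewrite mule_ge0// lee_fin.
have mG' i : measurable_fun setT (fun z : mR * mR => G i z.1 z.2).
  apply: emeasurable_funM; last first.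
    by apply/measurable_EFinP; apply: (measurableT_comp mw); exact: measurable_fst.
  apply: (measurableT_comp (g := fun z : mR * mR =>
    (z.1, (-1) ^+ i * (Num.sqrt (1 - z.1 ^+ 2) * Num.sqrt z.2))) mF).
  apply: measurable_fun_pair; first exact: measurable_fst.
  apply: measurable_funM; first exact: measurable_cst.
  apply: measurable_funM; apply: measurable_fun_sqrt; last exact: measurable_snd.
  by apply: measurable_funB; [exact: measurable_cst|apply: measurable_funX; exact: measurable_fst].
have mGs i s : measurable_fun setT (G i s).
  by apply: (measurableT_comp (g := fun v : R => (s, v)) (mG' i)); exact: pair1_measurable.
have [J [J0 JE JS]] : exists J : bool -> \bar R, [/\ forall i, (0 <= J i)%E,
    forall i : bool, (\int[leb]_(s in `[(-1)%R, 1%R]) \int[m]_(v in `[0%R, 1%R])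
      (`|taylor_error n s (A n * s + (-1) ^+ i * (B n * Num.sqrt (1 - s ^+ 2) * Num.sqrt v))|
       * f (kappa n * s) * (1 - s ^+ 2) `^ ((k.+2%:R - 3) / 2))%:E = J i)%E &
    (\int[leb]_(s in `[(-1)%R, 1%R])
    ((\int[m]_(v in `[0%R, 1%R])
      (F s (Num.sqrt (1 - s ^+ 2) * Num.sqrt v)%R +
       F s (- (Num.sqrt (1 - s ^+ 2) * Num.sqrt v))%R)) * (angular_weight k (phi n) s)%:E) =
    J false + J true)%E].
  pose J i := (\int[leb]_(s in `[(-1)%R, 1%R]) \int[m]_(v in `[0%R, 1%R]) G i s v)%E.
  have J0 i : (0 <= J i)%E.
    by apply: integral_ge0 => s _; apply: integral_ge0.
  have JE (i : bool) : (\int[leb]_(s in `[(-1)%R, 1%R]) \int[m]_(v in `[0%R, 1%R])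
      (`|taylor_error n s (A n * s + (-1) ^+ i * (B n * Num.sqrt (1 - s ^+ 2) * Num.sqrt v))|
       * f (kappa n * s) * (1 - s ^+ 2) `^ ((k.+2%:R - 3) / 2))%:E = J i)%E.
    apply: eq_integral => s _; apply: eq_integral => v _.
    rewrite /G /F /w /angular_weight -EFinM; congr EFin.
    rewrite -mulrA; congr (`|taylor_error _ _ _| * _); last exact: mulrC.
    by congr (_ + _); ring.
  exists J; split=> //.
  have mI01 : measurable (`[0%R, 1%R]%classic : set mR) by exact: measurable_itv.
  rewrite -ge0_integralD//; last 4 first.
  - by move=> s _; exact: integral_ge0.
  - by apply: measurable_funTS; apply: mI.
  - by move=> s _; exact: integral_ge0.
  - by apply: measurable_funTS; apply: mI.
  apply: eq_integral => s _; rewrite -ge0_integralD//; last 2 first.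
  - by apply: measurable_funTS; exact: mGs.
  - by apply: measurable_funTS; exact: mGs.
  rewrite muleC -ge0_integralZl//; last 3 first.
  - apply: measurable_funTS; apply: emeasurable_funD.
      apply: (measurableT_comp (g := fun v : R => (s, Num.sqrt (1 - s ^+ 2) * Num.sqrt v)) mF).
      apply: measurable_fun_pair; first exact: measurable_cst.
      apply: measurable_funM; first exact: measurable_cst.
      by apply: measurable_fun_sqrt; exact: measurable_id.
    apply: (measurableT_comp (g := fun v : R => (s, - (Num.sqrt (1 - s ^+ 2) * Num.sqrt v))) mF).
    apply: measurable_fun_pair; first exact: measurable_cst.
    apply: measurable_funN; apply: measurable_funM; first exact: measurable_cst.
    by apply: measurable_fun_sqrt; exact: measurable_id.
  - by move=> v _; exact: adde_ge0.
  - by rewrite lee_fin; exact: w0.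
  apply: eq_integral => v _; rewrite /G expr0 expr1 mul1r mulN1r.
  by rewrite ge0_muleDr// !(muleC (angular_weight _ _ _)%:E).
have fJ0 i : (0 <= ((f (kappa n))^-1)%:E * J i)%E.
  by apply: mule_ge0; [rewrite lee_fin invr_ge0; exact: ltW|exact: J0].
rewrite !JE (gee0_abs (fJ0 false)) (gee0_abs (fJ0 true)) => Hp Hm.
rewrite -[X in (_ * X)%E]/(\int[M n]_x F (dot x theta) (dot x (eta n)))%E.
rewrite (integral_latitude_longitude th1 (c0 n) (phi0 n) (mphi n) (HM n)
  (eta1 n) (eta_orth n) mF F0) mE -mG.
rewrite JS.
have j0 : 0 < j by apply: lt_trans jL; rewrite mulr_gt0// invr_gt0.
have lp : 0 < lam n `^ (a + 1) by rewrite powR_gt0.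
have aE : (k.+2%:R - 1) / 2 = a + 1 :> R by rewrite /a; field.
rewrite aE in Hp Hm; rewrite ger0_norm in Hp; last by rewrite invr_ge0 mulr_ge0 ?(ltW (N0 n)) ?(ltW lp).
rewrite ger0_norm in Hm; last by rewrite invr_ge0 mulr_ge0 ?(ltW (N0 n)) ?(ltW lp).
pose C := N n * (2^-1 * lam n `^ (a + 1) / j).
have C0' : 0 <= C by rewrite !mulr_ge0 ?invr_ge0 ?(ltW (N0 n)) ?(ltW lp) ?(ltW j0).
rewrite (_ : (_ * _)%E = (C%:E * ((f (kappa n))^-1%:E * J false + (f (kappa n))^-1%:E * J true))%E); last first.
  rewrite -ge0_muleDr// !muleA -!EFinM; congr (_%:E * _)%E; rewrite /C.
  by field; rewrite !lt0r_neq0.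
apply: (@le_trans _ _ (C%:E * (e' * (N n * lam n `^ (a + 1))^-1 + e' * (N n * lam n `^ (a + 1))^-1)%:E)%E).
  by apply: lee_wpmul2l; [rewrite lee_fin; exact: C0'|rewrite EFinD; exact: leeD].
rewrite -EFinM lee_fin.
have -> : C * (e' * (N n * lam n `^ (a + 1))^-1 + e' * (N n * lam n `^ (a + 1))^-1) = e' / j.
  by rewrite /C; field; rewrite !lt0r_neq0.
rewrite ler_pdivrMr// ler_wpM2l ?(ltW e0)//; exact: ltW.
Qed.

End lan_conditions.

(** * Independent samples *)

Section independent_sample.
Context d (T : measurableType d) (R : realType).

Definition box n (A : 'I_n -> set T) : set (n.-tuple T) :=
  \bigcap_i ((fun t : n.-tuple T => tnth t i) @^-1` A i).

Lemma measurable_box n (A : 'I_n -> set T) : (forall i, measurable (A i)) ->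
  measurable (box A).
Proof.
move=> mA; apply: fin_bigcap_measurable => [|i _]; first exact: finite_finset.
by rewrite -[X in measurable X]setTI; exact: measurable_tnth.
Qed.

Lemma tuple_measure_box (m : {sigma_finite_measure set T -> \bar R}) n
    (A : 'I_n -> set T) : (forall i, measurable (A i)) ->
  @tuple_measure _ _ _ m n (box A) = (\prod_i m (A i))%E.
Proof.
elim: n A => [|n IH] A mA.
  by rewrite big_ord0 /= diracE mem_set// => -[].
rewrite big_ord_recl -IH//= /pushforward -product_measure1E//; last exact: measurable_box.
congr (product_measure1 _ _ _); apply/seteqP; split => -[x t] /=.
  move=> h; split; first by have := h ord0 I.
  by move=> i _ /=; have := h (lift ord0 i) I; rewrite /= tnthS.
move=> [Ax Bt] i _ /=; case: (unliftP ord0 i) => [j|] -> //.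
by rewrite tnthS; exact: Bt.
Qed.

(** Boxes form a generating class stable under intersection, and independence over the full index
    set makes both measures factor on them. *)
Lemma independent_tuple_measure n (P : probability (n.-tuple T) R)
    (M : probability T R) :
  mutually_independent P (fun (i : 'I_n) (x : n.-tuple T) => tnth x i) ->
  (forall i A, measurable A -> P ((fun x => tnth x i) @^-1` A) = M A) ->
  forall A, measurable A -> P A = @tuple_measure _ _ _ M n A.
Proof.
move=> indep marg; pose G := [set B | exists2 A : 'I_n -> set T,
  (forall i, measurable (A i)) & B = box A].
have GT : G setT.
  by exists (fun=> setT) => //; apply/esym/seteqP; split.
apply: (measure_unique G (fun=> setT)) => //.
- rewrite /measurable/= /g_sigma_preimage; apply/seteqP; split.
    apply: smallest_sub; first exact: smallest_sigma_algebra.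
    elim/big_ind: _ => [B []|B B' hB hB' C [/hB|/hB']//|i _ _ [A mA <-]].
    apply: sub_sigma_algebra; exists (fun j => if j == i then A else setT).
      by move=> j; case: ifP.
    apply/seteqP; split => t /=.
      by move=> [_ At] j _ /=; case: eqP => // ->.
    by move=> h; split => //; have := h i I; rewrite /= eqxx.
  apply: smallest_sub; first exact: smallest_sigma_algebra.
  by move=> _ [A mA ->]; exact: measurable_box.
- move=> _ _ [A mA ->] [B mB ->]; exists (fun i => A i `&` B i).
    by move=> i; exact: measurableI.
  by rewrite /box -bigcapI.
- by rewrite bigcup_const//; exists 0%N.
- move=> _ [A mA ->]; transitivity (\prod_i M (A i))%E; last exact/esym/(tuple_measure_box M mA).
  have := indep [set i | true]%SET A mA; rewrite (_ : [set` _] = setT); last first.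
    by apply/seteqP; split => // i _ /=; rewrite inE.
  move=> H; refine (eq_trans H _); apply: eq_big => [i|i _]; first by rewrite inE.
  exact: marg.
- by move=> _; rewrite (le_lt_trans (probability_le1 _ _))// ltry.
Qed.

Section sample_integrals.
Variable M : probability T R.
Notation tm n := (@tuple_measure _ _ _ M n).

Lemma tuple_measureT n : tm n setT = 1%E.
Proof.
have -> : [set: n.-tuple T] = box (fun=> setT) by apply/esym/seteqP; split.
rewrite tuple_measure_box// big1// => i _; exact: probability_setT.
Qed.

Lemma sum_tnth_cons (V : nmodType) n (g : T -> V) x (t : n.-tuple T) :
  \sum_(i < n.+1) g (tnth [tuple of x :: t] i) = g x + \sum_(i < n) g (tnth t i).
Proof. by rewrite big_ord_recl tnth0; under eq_bigr => i _ do rewrite tnthS. Qed.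

Lemma measurable_sum_tnth n (g : T -> R) : measurable_fun setT g ->
  measurable_fun setT (fun t : n.-tuple T => \sum_(i < n) g (tnth t i)).
Proof.
move=> mg; apply: measurable_sum => i.
by apply: (measurableT_comp mg); exact: measurable_tnth.
Qed.

Lemma integral_tuple_sum n (g : T -> R) : measurable_fun setT g ->
  (forall x, 0 <= g x) ->
  (\int[tm n]_t (\sum_(i < n) g (tnth t i))%:E = n%:R%:E * \int[M]_x (g x)%:E)%E.
Proof.
move=> mg g0; have s0 k (t : k.-tuple T) : 0 <= \sum_(i < k) g (tnth t i).
  by apply: sumr_ge0.
have mgE : measurable_fun setT (fun x => (g x)%:E) by exact/measurable_EFinP.
elim: n => [|n IH].
  by rewrite mul0e integral0_eq// => t _; rewrite big_ord0.
rewrite ge0_integral_tuple_measureS; last 2 first.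
- by apply/measurable_EFinP; exact: measurable_sum_tnth.
- by move=> t; rewrite lee_fin.
set C := (\int[M]_x _)%E in IH *.
have C0 : (0 <= C)%E by apply: integral_ge0 => x _; rewrite lee_fin.
transitivity (\int[M]_x ((g x)%:E + n%:R%:E * C))%E.
  apply: eq_integral => x _; rewrite -IH.
  under eq_integral => t _ do rewrite sum_tnth_cons EFinD.
  rewrite ge0_integralD//; last 3 first.
  - by move=> t _; rewrite lee_fin.
  - by move=> t _; rewrite lee_fin.
  - by apply/measurable_EFinP; exact: measurable_sum_tnth.
  by rewrite integral_cst// [X in (_ * X)%E]tuple_measureT mule1.
rewrite ge0_integralD//; last 2 first.
- by move=> x _; rewrite lee_fin.
- by move=> x _; rewrite mule_ge0.
rewrite integral_cst// [X in (_ * X)%E]probability_setT mule1 -/C.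
by rewrite -natr1 EFinD ge0_muleDl// mul1e addeC.
Qed.

Variable Y : T -> R.
Hypothesis mY : measurable_fun setT Y.
Hypothesis symY : forall F : R -> \bar R, measurable_fun setT F ->
  (forall y, 0 <= F y)%E -> (\int[M]_x F (Y x) = \int[M]_x F (- Y x)%R)%E.

(** [F (Y)] and [F (- Y)] have the same integral, hence so does their average; the odd part
    disappears without ever being integrated on its own. *)
Lemma symmetrized_integral (F G : R -> R) : measurable_fun setT F ->
  (forall y, 0 <= F y) -> (forall y, F y + F (- y) = 2 * G y) ->
  (\int[M]_x (F (Y x))%:E = \int[M]_x (G (Y x))%:E)%E.
Proof.
move=> mF F0 FG; have mFE : measurable_fun setT (fun y => (F y)%:E).
  exact/measurable_EFinP.
have mFY : measurable_fun setT (fun x => (F (Y x))%:E).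
  by apply: (measurableT_comp mFE).
have mFN : measurable_fun setT (fun x => (F (- Y x))%:E).
  by apply: (measurableT_comp (g := fun x => - Y x) mFE); exact: measurable_funN.
have F0E y : (0 <= (F y)%:E)%E by rewrite lee_fin.
have GE y : G y = 2^-1 * (F y + F (- y)) by rewrite FG mulrA mulVf ?mul1r.
transitivity (\int[M]_x (2^-1%:E * ((F (Y x))%:E + (F (- Y x))%:E)))%E; last first.
  by apply: eq_integral => x _; rewrite GE.
have h0 : (0 <= (2^-1 : R)%:E)%E by rewrite lee_fin.
rewrite ge0_integralZl//; last 2 first.
- exact: emeasurable_funD.
- by move=> x _; rewrite adde_ge0.
rewrite ge0_integralD// -(symY mFE F0E).
have I0 : (0 <= \int[M]_x (F (Y x))%:E)%E by exact: integral_ge0.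
move: (\int[M]_x _)%E I0 => [r||]// _.
  by rewrite -EFinD -EFinM; congr EFin; field.
by rewrite addye// gt0_muley ?lte_fin.
Qed.

(** Variances add up. The offset [s] makes the induction close: conditioning on the first
    observation replaces it by [s + Y x], and symmetry removes the cross term. *)
Lemma integral_tuple_sqr_sum n s :
  (\int[tm n]_t ((s + \sum_(i < n) Y (tnth t i)) ^+ 2)%:E =
   (s ^+ 2)%:E + n%:R%:E * \int[M]_x (Y x ^+ 2)%:E)%E.
Proof.
set C := (\int[M]_x _)%E.
have C0 : (0 <= C)%E by apply: integral_ge0 => x _; rewrite lee_fin sqr_ge0.
elim: n s => [|n IH] s.
  rewrite mul0e adde0 /= integral_dirac//.
    by rewrite diracT mul1e big_ord0 addr0.
  apply/measurable_EFinP; apply: measurable_funX; apply: measurable_funD; first exact: measurable_cst.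
  exact: measurable_sum_tnth.
rewrite ge0_integral_tuple_measureS; last 2 first.
- apply/measurable_EFinP; apply: measurable_funX; apply: measurable_funD; first exact: measurable_cst.
  exact: measurable_sum_tnth.
- by move=> t; rewrite lee_fin sqr_ge0.
transitivity (\int[M]_x (((s + Y x) ^+ 2)%:E + n%:R%:E * C))%E.
  by apply: eq_integral => x _; rewrite -IH; apply: eq_integral => t _;
    rewrite sum_tnth_cons addrA.
have ms : measurable_fun setT (fun y : R => (s + y) ^+ 2).
  by apply: measurable_funX; apply: measurable_funD => //; exact: measurable_cst.
rewrite ge0_integralD//; last 3 first.
- by move=> x _; rewrite lee_fin sqr_ge0.
- by apply/measurable_EFinP; apply: (measurableT_comp ms).
- by move=> x _; rewrite mule_ge0.
rewrite integral_cst// [X in (_ * X)%E]probability_setT mule1.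
rewrite (symmetrized_integral (F := fun y => (s + y) ^+ 2) (G := fun y => s ^+ 2 + y ^+ 2))//; last 2 first.
- by move=> y; exact: sqr_ge0.
- by move=> y; ring.
under eq_integral => x _ do rewrite EFinD.
rewrite ge0_integralD//; last 3 first.
- by move=> x _; rewrite lee_fin sqr_ge0.
- by move=> x _; rewrite lee_fin sqr_ge0.
- by apply/measurable_EFinP; exact: measurable_funX.
rewrite integral_cst// [X in (_ * X)%E]probability_setT mule1 -/C -addeA; congr (_ + _)%E.
by rewrite -natr1 EFinD ge0_muleDl// mul1e addeC.
Qed.

Lemma bounded_integrable (P : probability T R) (g : T -> R) (C : R) :
  measurable_fun setT g -> (forall x, `|g x| <= C) ->
  P.-integrable setT (EFin \o g).
Proof.
move=> mg gC; apply: measurable_bounded_integrable => //.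
  by apply: (le_lt_trans (probability_le1 P measurableT)); rewrite ltry.
by exists C; split; [exact: num_real|move=> y Cy x _; exact: le_trans (ltW Cy)].
Qed.

Definition mean_cos := fine (\int[M]_x (cos (Y x))%:E)%E.

Let cosY_int : M.-integrable setT (EFin \o (fun x => cos (Y x))).
Proof.
apply: (@bounded_integrable _ _ 1); last by move=> x; rewrite ler_norml cos_geN1 cos_le1.
by apply: (measurableT_comp (f := @cos R)) => //; exact: (continuous_measurable_fun (@continuous_cos R)).
Qed.

Lemma mean_cosE : (\int[M]_x (cos (Y x))%:E = mean_cos%:E)%E.
Proof. by rewrite /mean_cos fineK//; exact: (integrable_fin_num measurableT cosY_int). Qed.

Lemma mean_cos_norm : `|mean_cos| <= 1.
Proof.
rewrite -lee_fin -abse_EFin -mean_cosE.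
apply: (le_trans (le_abse_integral _ measurableT (measurable_int _ cosY_int))).
apply: (@le_trans _ _ (\int[M]_(x in setT) (cst 1%E x))%E); last first.
  by rewrite integral_cst// mul1e; exact: probability_le1.
apply: ge0_le_integral => //.
- by apply: measurableT_comp => //; exact: (measurable_int _ cosY_int).
- by move=> x _; rewrite abse_EFin lee_fin ler_norml cos_geN1 cos_le1.
Qed.

Lemma integral_affine_cos (a b : R) :
  (\int[M]_x (a + b * cos (Y x))%:E = (a + b * mean_cos)%:E)%E.
Proof.
under eq_integral => x _ do rewrite EFinD EFinM.
rewrite integralD//; last 2 first.
- by apply: finite_measure_integrable_cst.
- exact: (integrableZl measurableT _ cosY_int).
rewrite integral_cst// [X in (_ * X)%E]probability_setT mule1.
by rewrite (integralZl measurableT cosY_int) mean_cosE -EFinM -EFinD.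
Qed.

(** The phase [a] absorbs the first observation at each step of the induction, and symmetry turns
    [cos (a + y)] into [cos a * cos y]. *)
Lemma integral_tuple_cos n a :
  (\int[tm n]_t (1 + cos (a + \sum_(i < n) Y (tnth t i)))%:E =
   (1 + mean_cos ^+ n * cos a)%:E)%E.
Proof.
have mcos (b : R) : measurable_fun setT (fun y : R => cos (b + y)).
  apply: (measurableT_comp (f := @cos R)); first exact: (continuous_measurable_fun (@continuous_cos R)).
  by apply: measurable_funD => //; exact: measurable_cst.
have mt k : measurable_fun setT (fun t : k.-tuple T => (1 + cos (a + \sum_(i < k) Y (tnth t i)))%:E).
  apply/measurable_EFinP; apply: measurable_funD; first exact: measurable_cst.
  by apply: (measurableT_comp (mcos a)); exact: measurable_sum_tnth.
have pos (y : R) : 0 <= 1 + cos y by have := cos_geN1 y; lra.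
elim: n a mt => [|n IH] a mt.
  have m0 := mt 0%N; rewrite /= integral_dirac; [|exact: measurableT|exact: m0].
  by rewrite diracT mul1e big_ord0 addr0 expr0 mul1r.
rewrite ge0_integral_tuple_measureS; last 2 first.
- exact: mt.
- by move=> t; rewrite lee_fin.
pose F y := 1 + mean_cos ^+ n * cos (a + y).
transitivity (\int[M]_x (F (Y x))%:E)%E.
  apply: eq_integral => x _; rewrite -IH; last first.
    move=> k; apply/measurable_EFinP; apply: measurable_funD; first exact: measurable_cst.
    by apply: (measurableT_comp (mcos (a + Y x))); exact: measurable_sum_tnth.
  by apply: eq_integral => t _; rewrite sum_tnth_cons addrA.
have F0 y : 0 <= F y.
  have : `|mean_cos ^+ n * cos (a + y)| <= 1.
    rewrite normrM normrX -[leRHS]mulr1 ler_pM ?exprn_ge0//.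
      by rewrite exprn_ile1// mean_cos_norm.
    by rewrite ler_norml cos_geN1 cos_le1.
  by rewrite ler_norml /F => /andP[]; lra.
rewrite (symmetrized_integral (G := fun y => 1 + mean_cos ^+ n * cos a * cos y))//; last 2 first.
- apply: measurable_funD; first exact: measurable_cst.
  by apply: measurable_funM => //; exact: measurable_cst.
- by move=> y; rewrite /F !cosD cosN sinN; ring.
by rewrite integral_affine_cos exprSr; congr (1 + _)%:E; ring.
Qed.

End sample_integrals.

Lemma ge0_integral_tuple_density (M M' : probability T R) (r : T -> R) n
    (F : n.-tuple T -> \bar R) :
  measurable_fun setT r -> (forall x, 0 <= r x) ->
  (forall G : T -> \bar R, measurable_fun setT G -> (forall x, 0 <= G x)%E ->
    (\int[M']_x G x = \int[M]_x (G x * (r x)%:E))%E) ->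
  measurable_fun setT F -> (forall t, 0 <= F t)%E ->
  (\int[@tuple_measure _ _ _ M' n]_t F t =
   \int[@tuple_measure _ _ _ M n]_t (F t * (\prod_(i < n) r (tnth t i))%:E))%E.
Proof.
move=> mr r0 MM'; have mprod k : measurable_fun setT (fun t : k.-tuple T => \prod_(i < k) r (tnth t i)).
  apply: measurable_prod => i _; apply: (measurableT_comp mr); exact: measurable_tnth.
have prod0 k (t : k.-tuple T) : 0 <= \prod_(i < k) r (tnth t i) by apply: prodr_ge0.
elim: n F => [|n IH] F mF F0.
  apply: eq_integral => t _; by rewrite big_ord0 mule1.
have mcons x : measurable_fun setT (fun t : n.-tuple T => F [tuple of x :: t]).
  by apply: (measurableT_comp mF); apply: measurable_cons => //; exact: measurable_cst.
rewrite !ge0_integral_tuple_measureS//; last 2 first.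
- by apply: emeasurable_funM => //; by apply/measurable_EFinP; exact: mprod.
- by move=> t; rewrite mule_ge0// lee_fin.
have mG : measurable_fun setT (fun x => \int[@tuple_measure _ _ _ M n]_t
    (F [tuple of x :: t] * (\prod_(i < n) r (tnth t i))%:E))%E.
  apply: (measurable_fun_fubini_tonelli_F (m2 := @tuple_measure _ _ _ M n)
    (fun z : T * n.-tuple T => F (cons_pair z) * (\prod_(i < n) r (tnth z.2 i))%:E)%E).
    apply: emeasurable_funM.
      by apply: (measurableT_comp mF); exact: measurable_cons_pair.
    apply/measurable_EFinP; apply: (measurableT_comp (mprod n)); exact: measurable_snd.
  by move=> z; rewrite mule_ge0// lee_fin.
transitivity (\int[M']_x \int[@tuple_measure _ _ _ M n]_t
    (F [tuple of x :: t] * (\prod_(i < n) r (tnth t i))%:E))%E.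
  by apply: eq_integral => x _; rewrite IH.
rewrite MM'//; last first.
  by move=> x; apply: integral_ge0 => t _; rewrite mule_ge0// lee_fin.
apply: eq_integral => x _; rewrite muleC -ge0_integralZl//; last 3 first.
- by apply: emeasurable_funM => //; by apply/measurable_EFinP; exact: mprod.
- by move=> t _; rewrite mule_ge0// lee_fin.
- by rewrite lee_fin.
apply: eq_integral => t _; rewrite big_ord_recl tnth0 EFinM muleCA; congr (_ * (_ * _%:E))%E.
by apply: eq_bigr => i _; rewrite tnthS.
Qed.

End independent_sample.

(** * Local asymptotic normality *)

Lemma measurable_lne (R : realType) : measurable_fun setT (@lne R).
Proof.
apply: (measurability _ (ErealGenOInfty.measurableE R)) => //.
move=> _ [_ [x ->] <-].
rewrite setTI (_ : _ @^-1` _ = `](expR x)%:E, +oo[%classic); first exact: emeasurable_itv.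
apply/seteqP; split => -[r||] //=; rewrite !in_itv/= ?andbT ?ltry//.
  case: (leP r 0) => // r0; rewrite !lte_fin => h.
  by rewrite -[r]lnK ?posrE// ltr_expR.
rewrite lte_fin => h; have r0 : 0 < r by apply: lt_trans h; exact: expR_gt0.
by rewrite leNgt r0/= lte_fin -ltr_expR lnK ?posrE.
Qed.

(** * The likelihood ratio of product laws *)

Section likelihood.
Context (R : realType) (k n : nat).
Notation V := 'cV[R]_k.+2.

Definition rot_const (q : R) (f : R -> R) : R :=
  c_norm k.+2 q f * gamma_fun ((k.+2%:R - 1) / 2) /
    (2 * pi `^ ((k.+2%:R - 1) / 2)).

Lemma rot_const_ge0 q f : (forall x, 0 < f x) -> 0 <= rot_const q f.
Proof.
move=> f0; rewrite /rot_const divr_ge0 ?mulr_ge0 ?powR_ge0 ?invr_ge0 ?fine_ge0//.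
  by apply: integral_ge0 => s _; rewrite lee_fin mulr_ge0 ?powR_ge0// ltW.
by apply: integral_ge0 => s _; rewrite lee_fin mulr_ge0 ?powR_ge0// expR_ge0.
Qed.

(** The common law is taken to be that of the first observation, hence the nonempty sample; its
    existence as a probability measure comes with [P]. *)
Lemma sample_marginal (vartheta : V) q f (P : probability (n.+1.-tuple V) R) :
  hypothesis_law vartheta q f P ->
  exists2 M : probability V R,
    has_density M idfun (@surface_area R k.+2) (rot_density vartheta q f) &
    forall A, measurable A -> P A = @tuple_measure _ _ _ M n.+1 A.
Proof.
move=> [indep dens].
have mt : measurable_fun setT (fun t : n.+1.-tuple V => tnth t ord0).
  exact: measurable_tnth.
pose M := distribution P (mfun_Sub (mem_set mt)); exists M.
  by move=> A mA; rewrite -(dens ord0 _ mA).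
apply: (independent_tuple_measure (M := M)) => // i A mA.
by rewrite dens// -(dens ord0 _ mA).
Qed.

Context (f : R -> R) (q : R) (theta theta' : V) (M M' : probability V R).
Hypothesis Ff : class_F f.
Hypotheses (HM : has_density M idfun (@surface_area R k.+2) (rot_density theta q f))
  (HM' : has_density M' idfun (@surface_area R k.+2) (rot_density theta' q f)).

Let f0 x : 0 < f x. Proof. exact: class_F_gt0. Qed.

Definition likelihood_ratio (x : V) := f (q * dot x theta') / f (q * dot x theta).

Let mfd (v : V) : measurable_fun setT (fun x => f (q * dot x v)).
Proof.
apply: measurable_class_F_comp => //; apply: measurable_funM; first exact: measurable_cst.
exact: measurable_dotl.
Qed.

Lemma likelihood_ratio_gt0 x : 0 < likelihood_ratio x.
Proof. by rewrite divr_gt0. Qed.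

Lemma measurable_likelihood_ratio : measurable_fun setT likelihood_ratio.
Proof. by apply: measurable_funM => //; exact: measurable_funV. Qed.

Lemma integral_likelihood_ratio (G : V -> \bar R) : measurable_fun setT G ->
  (forall x, 0 <= G x)%E ->
  (\int[M']_x G x = \int[M]_x (G x * (likelihood_ratio x)%:E))%E.
Proof.
move=> mG G0; have c0 := rot_const_ge0 q f0.
have fq0 s : 0 <= f (q * s) by exact: ltW.
have mfq : measurable_fun setT (fun s => f (q * s)).
  by apply: measurable_class_F_comp => //; exact: measurable_funM.
have mid : measurable_fun setT (@idfun V) by exact: measurable_id.
rewrite (ge0_integral_has_density mid c0 fq0 mfq HM' mG G0).
rewrite (ge0_integral_has_density mid c0 fq0 mfq HM (F := fun x => G x * (likelihood_ratio x)%:E)%E).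
- congr integral; apply/funext => x; rewrite -muleA -EFinM.
  rewrite (_ : likelihood_ratio x * _ = rot_const q f * f (q * dot x theta'))//.
  move: (rot_const q f) => c; rewrite /likelihood_ratio; field; exact: lt0r_neq0.
- by apply: emeasurable_funM => //; apply/measurable_EFinP; exact: measurable_likelihood_ratio.
- by move=> x; rewrite mule_ge0// lee_fin ltW// likelihood_ratio_gt0.
Qed.

Context (P Q : probability (n.-tuple V) R).
Hypotheses (PM : forall A, measurable A -> P A = @tuple_measure _ _ _ M n A)
  (QM : forall A, measurable A -> Q A = @tuple_measure _ _ _ M' n A).

Lemma integral_tuple_law (F : n.-tuple V -> \bar R) :
  (\int[P]_t F t = \int[@tuple_measure _ _ _ M n]_t F t)%E.
Proof. by apply: eq_measure_integral => A mA _; exact: PM. Qed.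

Definition log_likelihood (t : n.-tuple V) : R :=
  \sum_(i < n) (ln (f (q * dot (tnth t i) theta')) - ln (f (q * dot (tnth t i) theta))).

Let L (t : n.-tuple V) := \prod_(i < n) likelihood_ratio (tnth t i).

Let L0 t : 0 < L t.
Proof. by apply: prodr_gt0 => i _; exact: likelihood_ratio_gt0. Qed.

Let mL : measurable_fun setT L.
Proof.
apply: measurable_prod => i _; apply: (measurableT_comp measurable_likelihood_ratio).
exact: measurable_tnth.
Qed.

Let QE A : measurable A -> Q A = (\int[P]_(t in A) (L t)%:E)%E.
Proof.
move=> mA; rewrite QM// -[LHS]/(@tuple_measure _ _ _ M' n A).
have -> : @tuple_measure _ _ _ M' n A = (\int[@tuple_measure _ _ _ M' n]_t (\1_A t)%:E)%E.
  by rewrite integral_indic// setIT.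
rewrite (ge0_integral_tuple_density measurable_likelihood_ratio _ integral_likelihood_ratio)//.
- rewrite [RHS]integral_mkcond integral_tuple_law; apply: eq_integral => t _.
  by rewrite patchE indicE; case: ifP => _; rewrite ?mul1e ?mul0e.
- by move=> x; rewrite ltW// likelihood_ratio_gt0.
- by apply/measurable_EFinP; exact: measurable_indic.
Qed.

Let dom : charge_of_finite_measure Q `<< P.
Proof.
apply/null_content_dominatesP => A mA PA /=; rewrite -[LHS]/(Q A) QE//.
apply: null_set_integral => //.
by apply/measurable_EFinP; exact: measurable_funTS.
Qed.

Lemma measurable_log_lik_ratio : measurable_fun setT (log_lik_ratio Q P).
Proof.
apply: (measurableT_comp (@measurable_lne R)).
exact: measurable_int (Radon_Nikodym_integrable dom).
Qed.

(** The Radon-Nikodym derivative and the product of the individual ratios have the same integral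
    over every measurable set, so they agree almost everywhere. *)
Lemma log_lik_ratioE :
  {ae P, forall t, log_lik_ratio Q P t = (log_likelihood t)%:E}.
Proof.
have RNi := Radon_Nikodym_integrable dom.
have : ae_eq P setT (Radon_Nikodym (charge_of_finite_measure Q) P) (EFin \o L).
  apply: integral_ae_eq => //; first exact/measurable_EFinP.
  by move=> E _ mE; rewrite -(Radon_Nikodym_integral dom mE) -[LHS]/(Q E) QE.
apply: filterS => t /(_ I) h; rewrite /log_lik_ratio h -[(EFin \o L) t]/((L t)%:E) lne_EFin//; congr EFin.
rewrite /L /log_likelihood.
(* Positivity travels with the equality through the induction, since the logarithm of a product
   splits only for positive factors. *)
have [_ ->//] : 0 < \prod_(i < n) likelihood_ratio (tnth t i) /\
    ln (\prod_(i < n) likelihood_ratio (tnth t i)) =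
    \sum_(i < n) (ln (f (q * dot (tnth t i) theta')) - ln (f (q * dot (tnth t i) theta))).
elim/big_ind2: _ => [|x1 x2 y1 y2 [p1 e1] [p2 e2]|i _].
- by rewrite ln1 ltr01.
- by rewrite mulr_gt0// lnM ?posrE// e1 e2.
- by rewrite likelihood_ratio_gt0 /likelihood_ratio ln_div ?posrE.
Qed.

End likelihood.

(** * Bound on the expansion error at fixed sample size *)

Section lan_bound.
Context (R : realType) (k m : nat).
Notation V := 'cV[R]_k.+2.
Notation mR := (measurableTypeR R).
Notation N := (m.+1%:R : R).
Context (M : probability V R) (theta tau : V) (c nv : R) (f : R -> R).
Context (kappa : nat -> R) (j : nat).
Notation q := (kappa j).
Hypotheses (th1 : dot theta theta = 1) (c0 : 0 <= c) (Ff : class_F f).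
Hypothesis HM : has_density M idfun (@surface_area R k.+2)
  (fun x => c * f (q * dot x theta)).
Let theta' := theta + nv *: tau.
Let phi := varphi f q.
Let lam := q * phi.
Hypotheses (th1' : dot theta' theta' = 1) (q0 : 0 < q) (phi0 : 0 < phi) (nv0 : 0 < nv).
Hypothesis nvE : nv ^+ 2 * (N * lam) = 1.

Let v := projection theta tau.
Let t2 := dot tau tau.
(** Coefficient of the latitude in [q * nv * dot x tau]: the radial part of [tau] is
    [- nv * t2 / 2], and the tangent part [v] gives the longitude. *)
Let A := - (2^-1 * t2 * q * nv ^+ 2).
Let delta := score_error theta f kappa j.
Let Y x := q * nv * dot x v * delta x.
Let te x := taylor_error f kappa j (dot x theta) (A * dot x theta + q * nv * dot x v).

Let lam0 : 0 < lam. Proof. exact: mulr_gt0. Qed.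

Let f0 x : 0 < f x. Proof. exact: class_F_gt0. Qed.

Let fq0 s : 0 <= f (q * s). Proof. exact: ltW. Qed.

Let mfq : measurable_fun setT (fun s => f (q * s)).
Proof. by apply: measurable_class_F_comp => //; exact: measurable_funM. Qed.

Let mdelta : measurable_fun setT delta. Proof. exact: measurable_score_error. Qed.

Let mY : measurable_fun setT Y.
Proof.
apply: measurable_funM => //; apply: measurable_funM; first exact: measurable_cst.
exact: measurable_dotl.
Qed.

Let mte : measurable_fun setT te.
Proof.
apply: measurable_taylor_error => //; first exact: measurable_dotl.
by apply: measurable_funD; apply: measurable_funM;
  [exact: measurable_cst|exact: measurable_dotl|exact: measurable_cst|exact: measurable_dotl].
Qed.

(** Expand the squared length of [theta']: moving along the sphere forces on [tau] a radial
    component of order [nv]. *)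
Lemma dot_tau_theta : dot theta tau = - (2^-1 * nv * t2).
Proof.
have : 2 * nv * dot theta tau = - (nv ^+ 2 * t2).
  move: th1'; rewrite /theta' !dotDl !dotDr !dotZl !dotZr th1 (dotC tau theta) -/t2.
  by rewrite -/t2 => h; apply: (addrI (1 : R)); move: h => /eqP; rewrite -subr_eq0 => /eqP h;
    apply/eqP; rewrite -subr_eq0 -[X in _ == X]h; apply/eqP; ring.
move=> h; apply: (mulfI (x := 2 * nv)); first by rewrite mulf_neq0// lt0r_neq0.
by rewrite h; field.
Qed.

(** This is [t2 * c_n^2], the origin of the constant [c_lan]. *)
Lemma dot_projection_tau : dot v v = t2 - 4^-1 * nv ^+ 2 * t2 ^+ 2.
Proof. by rewrite /v (dot_projection th1) dot_tau_theta -/t2; field. Qed.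

Let t20 : 0 <= t2. Proof. exact: dot_ge0. Qed.

Let vv_le : dot v v <= t2.
Proof. by rewrite dot_projection_tau gerBl mulr_ge0 ?sqr_ge0// mulr_ge0 ?sqr_ge0. Qed.

Let qv : q * nv ^+ 2 * N = phi^-1.
Proof.
apply: (mulIf (lt0r_neq0 phi0)); rewrite mulVf ?lt0r_neq0//.
by rewrite -[RHS]nvE /lam; ring.
Qed.

(* The first-order part [h * varphi f (q * U)] of the increment is split as
   [h * delta + h * phi]; in the latter the longitude yields the central sequence
   and the latitude, close to 1, the quadratic term. *)
Lemma increment_decomposition x :
  ln (f (q * dot x theta')) - ln (f (q * dot x theta)) =
  te x + A * (dot x theta * delta x) + Y x +
  (nv^-1 * N^-1 * dot x v - 2^-1 * t2 * N^-1 * dot x theta).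
Proof.
have vx : dot x v = dot x tau + 2^-1 * nv * t2 * dot x theta.
  by rewrite /v dot_projectionr dot_tau_theta (dotC theta x); ring.
have -> : q * dot x theta' = q * dot x theta + (A * dot x theta + q * nv * dot x v).
  by rewrite /theta' dotDr dotZr vx /A; ring.
rewrite /te /taylor_error /Y /delta /score_error -/phi.
(* The identities [e1] and [e2] are [nv^2 * N * lam = 1] solved for the coefficients of the central
   sequence and of the quadratic term. *)
have e1 : nv^-1 * N^-1 = q * nv * phi.
  have n0 : nv * N != 0 by rewrite mulf_neq0// lt0r_neq0.
  apply: (mulfI n0); rewrite mulrACA !divff ?lt0r_neq0// mul1r.
  by rewrite -[LHS]nvE /lam; ring.
have e2 : 2^-1 * t2 * N^-1 = - (A * phi).
  have n0 : N != 0 by [].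
  apply: (mulfI n0); rewrite mulrCA divff// mulr1 /A.
  have -> : N * - (- (2^-1 * t2 * q * nv ^+ 2) * phi) = 2^-1 * t2 * (nv ^+ 2 * (N * lam)).
    by rewrite /lam; ring.
  by rewrite nvE mulr1.
rewrite e1 e2; ring.
Qed.

Lemma Gamma_mx_mul (x : V) : Gamma_mx theta *m x = projection theta x.
Proof.
rewrite /Gamma_mx mulmxBl mul1mx -mulmxA /projection; congr (_ - _).
by rewrite [theta^T *m x]mx11_scalar mul_mx_scalar.
Qed.

Lemma dot_Gamma_mean (w : V) n (t : n.-tuple V) : dot w (Gamma_mx theta *m sample_mean t) =
  n%:R^-1 * \sum_(i < n) dot (tnth t i) (projection theta w).
Proof.
rewrite Gamma_mx_mul dot_projectionr /sample_mean !dotZr !dot_sumr.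
rewrite mulrA [dot theta w * _]mulrC -mulrA -mulrBr; congr (_ * _).
rewrite mulr_sumr -sumrB; apply: eq_bigr => i _.
by rewrite dot_projectionr (dotC theta w) (dotC (tnth t i)) (dotC theta) [in RHS]mulrC.
Qed.

Lemma measurable_dot_Gamma_mean (w : V) a n : measurable_fun setT
  (fun t : n.-tuple V => dot w (a *: (Gamma_mx theta *m sample_mean t))).
Proof.
rewrite (_ : (fun _ => _) = fun t : n.-tuple V =>
  a * (n%:R^-1 * \sum_(i < n) dot (tnth t i) (projection theta w))).
  apply: measurable_funM; first exact: measurable_cst.
  apply: measurable_funM; first exact: measurable_cst.
  by apply: (measurable_sum_tnth (g := fun x => dot x (projection theta w))); exact: measurable_dotl.
by apply/funext => t; rewrite dotZr dot_Gamma_mean.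
Qed.

Definition lan_error (t : m.+1.-tuple V) : R :=
  log_likelihood f q theta theta' t -
  (dot tau (nv^-1 *: (Gamma_mx theta *m sample_mean t)) -
   2^-1 * dot tau (Gamma_mx theta *m tau)).


Let g x := `|te x| + `|A| * `|dot x theta * delta x| + 2^-1 * t2 * N^-1 * `|1 - dot x theta|.

(** Half of [t2 - dot v v]: the latitude produces the quadratic term with [t2], whereas the
    expansion has it with [dot v v]. *)
Let d := 8^-1 * nv ^+ 2 * t2 ^+ 2.

(** [Y] stays out of the majorant [g]: absolute values would destroy the cancellation in the sum of
    these centered terms, which is controlled in L2. The [0 +] matches the offset in
    [integral_tuple_sqr_sum]. *)
Lemma lan_error_le t : `|lan_error t| <=
  \sum_(i < m.+1) g (tnth t i) + d + `|0 + \sum_(i < m.+1) Y (tnth t i)|.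
Proof.
have -> : lan_error t = \sum_(i < m.+1) (te (tnth t i) +
    A * (dot (tnth t i) theta * delta (tnth t i)) +
    2^-1 * t2 * N^-1 * (1 - dot (tnth t i) theta)) - d
    + (0 + \sum_(i < m.+1) Y (tnth t i)).
  rewrite /lan_error /log_likelihood dotZr dot_Gamma_mean Gamma_mx_mul -/v.
  have -> : dot tau v = t2 - 4^-1 * nv ^+ 2 * t2 ^+ 2.
    by rewrite -dot_projection_tau /v (dot_projection th1) dot_projectionr.
  have sc : \sum_(i < m.+1) (2^-1 * t2 * N^-1) = 2^-1 * t2.
    by rewrite sumr_const card_ord -[LHS]mulr_natr -[LHS]mulrA mulVf ?mulr1.
  under eq_bigr => i _ do rewrite increment_decomposition.
  rewrite add0r [nv^-1 * (_ * _)]mulrA mulr_sumr.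
  have -> : \sum_(i < m.+1) (te (tnth t i) +
      A * (dot (tnth t i) theta * delta (tnth t i)) +
      2^-1 * t2 * N^-1 * (1 - dot (tnth t i) theta)) =
      \sum_(i < m.+1) (te (tnth t i) +
      A * (dot (tnth t i) theta * delta (tnth t i)) -
      2^-1 * t2 * N^-1 * dot (tnth t i) theta) + 2^-1 * t2.
    rewrite -{3}sc -big_split/=; apply: eq_bigr => i _; ring.
  set S2 := \sum_(i < m.+1) nv^-1 / N * dot _ v.
  set S1 := \sum_(i < m.+1) (te _ + _ * _ + Y _ + _).
  have -> : S1 = \sum_(i < m.+1) (te (tnth t i) +
      A * (dot (tnth t i) theta * delta (tnth t i)) -
      2^-1 * t2 * N^-1 * dot (tnth t i) theta) + \sum_(i < m.+1) Y (tnth t i) + S2.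
    rewrite /S1 /S2 -!big_split/=; apply: eq_bigr => i _; ring.
  by rewrite /d; move: (\sum_(i < m.+1) _) (\sum_(i < m.+1) _) => ? ?; field.
rewrite (le_trans (ler_normD _ _))// lerD2r (le_trans (ler_normB _ _))//.
have d0 : 0 <= d by rewrite mulr_ge0 ?sqr_ge0// mulr_ge0 ?sqr_ge0.
rewrite (ger0_norm d0) lerD2r (le_trans (ler_norm_sum _ _ _))// ler_sum// => i _.
rewrite /g (le_trans (ler_normD _ _))// lerD//.
  by rewrite (le_trans (ler_normD _ _))// lerD2l normrM.
rewrite normrM ger0_norm// mulr_ge0 ?invr_ge0//.
by rewrite mulr_ge0.
Qed.

Lemma measurable_lan_error : measurable_fun setT lan_error.
Proof.
have mtn (h : V -> R) i : measurable_fun setT h ->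
    measurable_fun setT (fun t : m.+1.-tuple V => h (tnth t i)).
  by move=> mh; apply: (measurableT_comp mh); exact: measurable_tnth.
have mln (w : V) : measurable_fun setT (fun x : V => ln (f (q * dot x w))).
  apply: (measurableT_comp (@measurable_ln R)); apply: measurable_class_F_comp => //.
  apply: measurable_funM; first exact: measurable_cst.
  exact: measurable_dotl.
apply: measurable_funB.
  apply: measurable_sum => i.
  apply: (mtn (fun x => ln (f (q * dot x theta')) - ln (f (q * dot x theta)))).
  by apply: measurable_funB; exact: mln.
apply: measurable_funB; last exact: measurable_cst.
exact: measurable_dot_Gamma_mean.
Qed.

(* [r] is [lam^(-1/2)], the weight in the AM-GM bound [score_le]. *)
Context (P : probability (m.+1.-tuple V) R) (r : R).
Hypothesis PM : forall E, measurable E -> P E = @tuple_measure _ _ _ M m.+1 E.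
Hypotheses (r0 : 0 < r) (rlam : r ^+ 2 * lam = 1).

Let S := ((q / phi)%:E * \int[M]_x (delta x ^+ 2)%:E)%E.

Let mUM (a : V -> R) : measurable_fun setT a -> measurable_fun setT (fun x => `|a x|).
Proof. by move=> ma; apply: measurableT_comp. Qed.

Let mdot : measurable_fun setT (fun x => dot x theta). Proof. exact: measurable_dotl. Qed.

Let mg : measurable_fun setT g.
Proof.
apply: measurable_funD; first apply: measurable_funD; first exact: mUM.
  by apply: measurable_funM; [exact: measurable_cst|apply: mUM; exact: measurable_funM].
apply: measurable_funM; first exact: measurable_cst.
by apply: mUM; apply: measurable_funB; [exact: measurable_cst|].
Qed.

Let g0 x : 0 <= g x.
Proof. by rewrite !addr_ge0// mulr_ge0// mulr_ge0 ?invr_ge0// mulr_ge0. Qed.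

(** Since [q / phi = (r * phi)^-2], the bound amounts to the nonnegativity of the square of
    [1 - |delta| / (r * phi)]. It turns an L1 quantity into the L2 one that the condition controls,
    at the price of a factor [r] that tends to 0. *)
Let score_le x : dot x x = 1 -> N * (`|A| * `|dot x theta * delta x|) <=
  4^-1 * t2 * r * (1 + q / phi * delta x ^+ 2).
Proof.
move=> x1; have U1 : `|dot x theta| <= 1.
  have := dot_sqr_le x theta; rewrite x1 th1 mulr1 -[dot x theta ^+ 2]real_normK ?num_real//.
  by rewrite expr_le1.
have -> : N * (`|A| * `|dot x theta * delta x|) =
    2^-1 * t2 * (phi^-1 * `|dot x theta * delta x|).
  rewrite /A normrN ger0_norm; last by rewrite mulr_ge0 ?sqr_ge0// mulr_ge0 ?(ltW q0)// mulr_ge0.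
  by rewrite -qv; ring.
have -> : 4^-1 * t2 * r * (1 + q / phi * delta x ^+ 2) =
    2^-1 * t2 * (2^-1 * r * (1 + q / phi * delta x ^+ 2)) by field; exact: lt0r_neq0.
rewrite ler_wpM2l// ?mulr_ge0//.
apply: (@le_trans _ _ (phi^-1 * `|delta x|)).
  by rewrite ler_wpM2l ?invr_ge0 ?(ltW phi0)// normrM ler_piMl.
have -> : q / phi = (r ^+ 2 * phi ^+ 2)^-1.
  have rp : r ^+ 2 * phi ^+ 2 != 0 by rewrite mulf_neq0// lt0r_neq0// exprn_gt0.
  by apply: (mulIf rp); rewrite mulVf// -[RHS]rlam /lam; field; exact: lt0r_neq0.
rewrite -[delta x ^+ 2]real_normK ?num_real//.
rewrite -subr_ge0 (_ : _ - _ = 2^-1 * r * (1 - `|delta x| / (r * phi)) ^+ 2).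
  by rewrite mulr_ge0 ?sqr_ge0// mulr_ge0 ?invr_ge0// ltW.
by field; rewrite !lt0r_neq0.
Qed.

(** Markov for the sum of the majorants and Chebyshev for the sum of the [Y], each at threshold
    [e / 2], whence [2 / e] and [4 / e^2]. *)
Lemma lan_error_prob (e : R) : 0 < e ->
  (P [set t | (e < `|lan_error t|)%R] <=
   (2 / e)%:E * (N%:E * \int[M]_x (`|te x|)%:E + (4^-1 * t2 * r)%:E * (1 + S) +
     (2^-1 * t2)%:E * \int[M]_x (`|1 - dot x theta|)%:E + d%:E) +
   (4 / e ^+ 2)%:E * (t2%:E * S))%E.
Proof.
move=> e0.
pose G t := \sum_(i < m.+1) g (tnth t i) + d.
pose H t := (0 + \sum_(i < m.+1) Y (tnth t i)) ^+ 2.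
have mG : measurable_fun setT G.
  by apply: measurable_funD; [exact: measurable_sum_tnth|exact: measurable_cst].
have mH : measurable_fun setT H.
  apply: measurable_funX; apply: measurable_funD; first exact: measurable_cst.
  exact: measurable_sum_tnth.
have d0 : 0 <= d by rewrite mulr_ge0 ?sqr_ge0// mulr_ge0 ?sqr_ge0.
have G0 t : 0 <= G t by rewrite addr_ge0// sumr_ge0.
have H0 t : 0 <= H t by rewrite sqr_ge0.
pose B := [set t | (e < `|lan_error t|)%R].
have mB : measurable B.
  rewrite (_ : B = setT `&` (fun t => `|lan_error t|) @^-1` `]e, +oo[%classic).
    have : measurable_fun setT (fun t => `|lan_error t|).
      by apply: measurableT_comp => //; exact: measurable_lan_error.
    by apply => //; exact: measurable_itv.
  by rewrite setTI; apply/seteqP; split => t /=; rewrite in_itv/= andbT.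
have c1 : 0 <= 2 / e by rewrite divr_ge0// ltW.
have c2 : 0 <= 4 / e ^+ 2 by rewrite divr_ge0// sqr_ge0.
have PB : (P B <= (2 / e)%:E * \int[@tuple_measure _ _ _ M m.+1]_t (G t)%:E +
    (4 / e ^+ 2)%:E * \int[@tuple_measure _ _ _ M m.+1]_t (H t)%:E)%E.
  rewrite PM// -[X in (X <= _)%E]/(@tuple_measure _ _ _ M m.+1 B).
  have -> : @tuple_measure _ _ _ M m.+1 B = (\int[@tuple_measure _ _ _ M m.+1]_t (\1_B t)%:E)%E.
    by rewrite integral_indic// setIT.
  have mGE : measurable_fun setT (EFin \o G) by exact/measurable_EFinP.
  have mHE : measurable_fun setT (EFin \o H) by exact/measurable_EFinP.
  have hG t : setT t -> (0 <= (EFin \o G) t)%E by move=> _; rewrite lee_fin.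
  have hH t : setT t -> (0 <= (EFin \o H) t)%E by move=> _; rewrite lee_fin.
  rewrite -(ge0_integralZl (@tuple_measure _ _ _ M m.+1) measurableT mGE hG)//.
  rewrite -(ge0_integralZl (@tuple_measure _ _ _ M m.+1) measurableT mHE hH)//.
  rewrite -ge0_integralD//; last 4 first.
  - by move=> t _; rewrite mule_ge0// lee_fin.
  - by apply: emeasurable_funM => //; exact: measurable_cst.
  - by move=> t _; rewrite mule_ge0// lee_fin.
  - by apply: emeasurable_funM => //; exact: measurable_cst.
  apply: ge0_le_integral => //.
  - by apply/measurable_EFinP; exact: measurable_indic.
  - by apply: emeasurable_funD; apply: emeasurable_funM => //; exact: measurable_cst.
  move=> t _ /=; rewrite -!EFinM -EFinD lee_fin.
  rewrite indicE; have [|] := boolP (t \in B); last by rewrite addr_ge0// mulr_ge0.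
  rewrite inE /B/= => eB; have := lt_le_trans eB (lan_error_le t); rewrite -/(G t) => h.
  rewrite /H -[(0 + _) ^+ 2]real_normK ?num_real//; move: h.
  set b := `|0 + _|; have b0 : 0 <= b by exact: normr_ge0.
  clearbody b; move: (G t) (G0 t) => a a0 ab.
  have -> : 2 / e * a + 4 / e ^+ 2 * b ^+ 2 = (2 * a * e + 4 * b ^+ 2) / e ^+ 2.
    by field; exact: lt0r_neq0.
  rewrite ler_pdivlMr ?exprn_gt0// mul1r.
  (* Either [a >= e / 2] and the first term suffices, or [b > e / 2] and the second does. *)
  have [ae|ae] := leP e (2 * a); nra.
apply: (le_trans PB); apply: leeD; apply: lee_wpmul2l; rewrite ?lee_fin//.
  have -> : (\int[@tuple_measure _ _ _ M m.+1]_t (G t)%:E =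
      N%:E * \int[M]_x (g x)%:E + d%:E)%E.
    rewrite /G; under eq_integral => t _ do rewrite EFinD.
    rewrite ge0_integralD//; last 2 first.
    - by move=> t _; rewrite lee_fin sumr_ge0.
    - by apply/measurable_EFinP; exact: measurable_sum_tnth.
    rewrite integral_tuple_sum// integral_cst//.
    by rewrite [X in (d%:E * X)%E]tuple_measureT mule1.
  rewrite leeD2r//.
  pose g' x := ((N)%:E * `|te x|%:E + ((4^-1 * t2 * r)%:E * (1 + (q / phi * delta x ^+ 2)%:E) +
     (2^-1 * t2)%:E * `|1 - dot x theta|%:E))%E.
  have qp0 : 0 <= q / phi by rewrite divr_ge0// ltW.
  have a10 : 0 <= 4^-1 * t2 * r by rewrite mulr_ge0 ?(ltW r0)// mulr_ge0.
  have a20 : 0 <= 2^-1 * t2 by rewrite mulr_ge0.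
  have m1 : measurable_fun setT (fun x => `|te x|%:E).
    by apply/measurable_EFinP; exact: mUM.
  have m2 : measurable_fun setT (fun x => (delta x ^+ 2)%:E).
    by apply/measurable_EFinP; exact: measurable_funX.
  have m2' : measurable_fun setT (fun x => (q / phi * delta x ^+ 2)%:E).
    by under eq_fun do rewrite EFinM; apply: emeasurable_funM => //; exact: measurable_cst.
  have m2'' : measurable_fun setT (fun x => 1 + (q / phi * delta x ^+ 2)%:E)%E.
    by apply: emeasurable_funD => //; exact: measurable_cst.
  have m3 : measurable_fun setT (fun x => `|1 - dot x theta|%:E).
    by apply/measurable_EFinP; apply: mUM; apply: measurable_funB; [exact: measurable_cst|].
  have p2 x : (0 <= (q / phi * delta x ^+ 2)%:E)%E by rewrite lee_fin mulr_ge0 ?sqr_ge0.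
  have p2' x : (0 <= 1 + (q / phi * delta x ^+ 2)%:E)%E by rewrite adde_ge0.
  have mZ (a : R) (h : V -> \bar R) : measurable_fun setT h -> measurable_fun setT (fun x => a%:E * h x)%E.
    by move=> mh; apply: emeasurable_funM => //; exact: measurable_cst.
  have N0 : 0 <= N by [].
  have n1 x : (0 <= N%:E * `|te x|%:E)%E by rewrite mule_ge0 ?lee_fin.
  have n2 x : (0 <= (4^-1 * t2 * r)%:E * (1 + (q / phi * delta x ^+ 2)%:E))%E.
    by apply: mule_ge0 (p2' x); rewrite lee_fin.
  have n3 x : (0 <= (2^-1 * t2)%:E * `|1 - dot x theta|%:E)%E by rewrite mule_ge0 ?lee_fin.
  have g'E : (\int[M]_x g' x = N%:E * \int[M]_x (`|te x|)%:E + (4^-1 * t2 * r)%:E * (1 + S) +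
     (2^-1 * t2)%:E * \int[M]_x (`|1 - dot x theta|)%:E)%E.
    have mte' := mZ N _ m1; have mdel' := mZ (4^-1 * t2 * r) _ m2''.
    have mU' := mZ (2^-1 * t2) _ m3.
    rewrite /g' (ge0_integralD _ measurableT (fun x _ => n1 x) mte'
      (fun x _ => adde_ge0 (n2 x) (n3 x)) (emeasurable_funD mdel' mU')).
    rewrite (ge0_integralD _ measurableT (fun x _ => n2 x) mdel' (fun x _ => n3 x) mU').
    rewrite (ge0_integralZl M measurableT m1 (fun x _ => abse_ge0 (te x)%:E) (k := N%:E))//.
    rewrite (ge0_integralZl M measurableT m3 (fun x _ => abse_ge0 (1 - dot x theta)%:E)
      (k := (2^-1 * t2)%:E))//.
    rewrite (ge0_integralZl M measurableT m2'' (fun x _ => p2' x) (k := (4^-1 * t2 * r)%:E))//.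
    have -> : (\int[M]_x (1 + (q / phi * delta x ^+ 2)%:E) =
        1 + \int[M]_x (q / phi * delta x ^+ 2)%:E)%E.
      rewrite ge0_integralD//.
      by rewrite integral_cst// mul1e [X in (X + _)%E]probability_setT.
    rewrite (ge0_integralZl M measurableT m2 (fun x _ => sqr_ge0 (delta x)) (k := (q / phi)%:E))//.
    exact: addeA.
  rewrite -ge0_integralZl//; last 2 first.
  - exact/measurable_EFinP.
  - by move=> x _; rewrite lee_fin.
  rewrite -g'E; apply: (le_integral_sphere mfq HM).
  - by apply: mZ; exact/measurable_EFinP.
  - by apply: emeasurable_funD; [exact: mZ|apply: emeasurable_funD; exact: mZ].
  - by move=> x; rewrite mule_ge0// lee_fin.
  - by move=> x; rewrite !adde_ge0.
  move=> x x1; apply: (@le_trans _ _ (N * `|te x| + (4^-1 * t2 * r *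
    (1 + q / phi * delta x ^+ 2) + 2^-1 * t2 * `|1 - dot x theta|))%:E); last exact: lexx.
  rewrite -EFinM lee_fin /g.
  have := score_le x1; have : N * (2^-1 * t2 * N^-1 * `|1 - dot x theta|) =
    2^-1 * t2 * `|1 - dot x theta| by field.
  rewrite !mulrDr => -> ?; lra.
have mH0 : measurable_fun setT (fun x => (dot x v ^+ 2)%:E).
  by apply/measurable_EFinP; apply: measurable_funX; exact: measurable_dotl.
rewrite integral_tuple_sqr_sum//; last first.
  move=> F mF F0.
  (* [Y] is linear in the longitude, with a coefficient that depends on the latitude only, hence
     symmetric. *)
  pose F' (s z : R) := F (q * nv * z * (varphi f (q * s) - phi)).
  have mF' : measurable_fun setT (fun z : mR * mR => F' z.1 z.2).
    apply: (measurableT_comp (g := fun z : mR * mR => q * nv * z.2 * (varphi f (q * z.1) - phi)) mF).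
    apply: measurable_funM.
      by apply: measurable_funM; [exact: measurable_cst|exact: measurable_snd].
    apply: measurable_funB; last exact: measurable_cst.
    apply: (measurableT_comp (measurable_varphi Ff)).
    by apply: measurable_funM; [exact: measurable_cst|exact: measurable_fst].
  have := integral_longitude_symmetric th1 c0 fq0 mfq HM (projection_orth th1 tau) mF' (fun s z => F0 _).
  rewrite /F' /Y => ->; apply: eq_integral => x _; congr F; rewrite /delta /score_error -/phi; ring.
rewrite expr0n/= add0e /S muleA -EFinM -!ge0_integralZl//; last 5 first.
- by apply/measurable_EFinP; exact: measurable_funX.
- by move=> x _; rewrite lee_fin sqr_ge0.
- by rewrite lee_fin mulr_ge0// divr_ge0// ltW.
- by apply/measurable_EFinP; exact: measurable_funX.
- by move=> x _; rewrite lee_fin sqr_ge0.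
apply: (le_integral_sphere mfq HM).
- by apply: emeasurable_funM; [exact: measurable_cst|apply/measurable_EFinP; exact: measurable_funX].
- by apply: emeasurable_funM; [exact: measurable_cst|apply/measurable_EFinP; exact: measurable_funX].
- by move=> x; rewrite lee_fin mulr_ge0 ?sqr_ge0.
- by move=> x; rewrite lee_fin mulr_ge0 ?sqr_ge0// mulr_ge0// divr_ge0// ltW.
move=> x x1; rewrite lee_fin.
have -> : N * Y x ^+ 2 = dot x v ^+ 2 * (q / phi) * delta x ^+ 2.
  by rewrite -qv /Y; ring.
have qp0 : 0 <= q / phi by rewrite divr_ge0// ltW.
rewrite ler_wpM2r ?sqr_ge0// ler_wpM2r//.
by apply: le_trans vv_le; have := dot_sqr_le x v; rewrite x1 mul1r.
Qed.

End lan_bound.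

Lemma near_shiftS (A : nat -> Prop) :
  (\forall n \near \oo, A n) -> \forall n \near \oo, A n.+1.
Proof. by move=> [N _ h]; exists N => // n Nn; apply: h; exact: leqW. Qed.

Lemma cvge0M (R : realType) (a b : nat -> \bar R) (c : R) :
  a n @[n --> \oo] --> 0%E -> b n @[n --> \oo] --> c%:E ->
  (a n * b n)%E @[n --> \oo] --> 0%E.
Proof. by move=> ha hb; rewrite -[0%E](mul0e c%:E); exact: cvgeM. Qed.

Lemma cvge0D (R : realType) (a b : nat -> \bar R) :
  a n @[n --> \oo] --> 0%E -> b n @[n --> \oo] --> 0%E ->
  (a n + b n)%E @[n --> \oo] --> 0%E.
Proof. by move=> ha hb; rewrite -[0%E](adde0 0%E); exact: cvgeD. Qed.

Lemma cvge0Z (R : realType) (c : R) (b : nat -> \bar R) :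
  b n @[n --> \oo] --> 0%E -> (c%:E * b n)%E @[n --> \oo] --> 0%E.
Proof. by move=> hb; rewrite -[0%E](mule0 c%:E); exact: cvgeZl. Qed.

Lemma cvg_sqrt_pinfty (R : realType) (l : nat -> R) : l n @[n --> \oo] --> +oo ->
  Num.sqrt (l n) @[n --> \oo] --> +oo.
Proof.
move=> /cvgryPge h; apply/cvgryPge => a; apply: filterS (h (a ^+ 2)) => n an.
by rewrite (le_trans (ler_norm a))// -sqrtr_sqr ler_wsqrtr.
Qed.

Section shifted_laws.
Context (R : realType) (k : nat).
Notation V := 'cV[R]_k.+2.
Context (theta : V) (kappa : nat -> R) (f : R -> R).
Context (P : forall n : nat, probability (n.-tuple V) R).
Hypothesis HP : forall n, hypothesis_law theta (kappa n) f (P n).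

Lemma sample_marginals : exists M : nat -> probability V R,
  (forall n, has_density (M n) idfun (@surface_area R k.+2)
    (fun x => rot_const k (kappa n.+1) f * f (kappa n.+1 * dot x theta))) /\
  (forall n A, measurable A -> P n.+1 A = @tuple_measure _ _ _ (M n) n.+1 A).
Proof.
have h n := cid2 (sample_marginal (HP n.+1)).
by exists (fun n => s2val (h n)); split => n; have [HM PM] := (s2valP (h n), s2valP' (h n)).
Qed.

End shifted_laws.

Lemma nu_normalization (R : realType) (f : R -> R) (kappa : nat -> R) n :
  0 < concentration f (fun n => kappa n.+1) n -> 0 < nu f kappa n.+1 /\
  nu f kappa n.+1 ^+ 2 * (n.+1%:R * concentration f (fun n => kappa n.+1) n) = 1.
Proof.
set l := concentration _ _ _ => l0.
have h : 0 < n.+1%:R * l by rewrite mulr_gt0.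
have -> : nu f kappa n.+1 = (Num.sqrt (n.+1%:R * l))^-1 by rewrite /nu -mulrA.
split; first by rewrite invr_gt0 sqrtr_gt0.
by rewrite exprVn sqr_sqrtr ?(ltW h)// mulVf// lt0r_neq0.
Qed.

(** * The expansion of the log-likelihood ratio in the limit *)

Section lan_limit.
Context (R : realType) (k : nat).
Notation V := 'cV[R]_k.+2.
Context (theta : V) (kappa : nat -> R) (tau : nat -> V) (f : R -> R).
Context (P Q : forall n : nat, probability (n.-tuple V) R).
Hypotheses (th1 : dot theta theta = 1) (kappa0 : forall n, 0 < kappa n).
Hypothesis koo : kappa n @[n --> \oo] --> +oo.
Hypothesis taub : exists M : R, forall n, cnorm (tau n) <= M.
Hypothesis taus : forall n, unit_sphere (theta + nu f kappa n *: tau n).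
Hypothesis FL : class_F_LAN k.+2 kappa (fun n => cnorm (tau n)) f.
Hypothesis HP : forall n, hypothesis_law theta (kappa n) f (P n).
Hypothesis HQ : forall n,
  hypothesis_law (theta + nu f kappa n *: tau n) (kappa n) f (Q n).

Let Ff : class_F f. Proof. by have [] := FL. Qed.

Let kap n := kappa n.+1.
Let nv n := nu f kappa n.+1.
Let ta n := tau n.+1.
Let lam := concentration f kap.
Let v n := projection theta (ta n).

Let kap_oo : kap n @[n --> \oo] --> +oo.
Proof. by rewrite /kap (cvg_shiftS kappa). Qed.

Let lam_oo : lam n @[n --> \oo] --> +oo.
Proof. exact: (concentration_cvg Ff kap_oo). Qed.

Let lam_gt0 : \forall n \near \oo, 0 < lam n.
Proof. exact: (concentration_gt0 Ff kap_oo). Qed.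

Let nvP n : 0 < lam n -> 0 < nv n /\ nv n ^+ 2 * (n.+1%:R * lam n) = 1.
Proof. exact: nu_normalization. Qed.

Let t n := cnorm (ta n).
Let A n : R := - (2^-1 * dot (ta n) (ta n) * kap n * nv n ^+ 2).
Let B n : R := c_lan f kappa (fun n => cnorm (tau n)) n.+1 * t n * kap n * nv n.

(** When the tangent part of [tau] vanishes any unit tangent vector will do, its coefficient being
    0. *)
Let unit_direction n : {eta | [/\ dot eta eta = 1, dot theta eta = 0 & v n = cnorm (v n) *: eta]}.
Proof.
apply: cid; have [v0|v0] := eqVneq (v n) 0.
  have [eta [e1 e2]] := orthogonal_unit th1; exists eta; split => //.
  have -> : cnorm (v n) = 0 by apply/eqP; rewrite cnorm_eq0 v0.
  by rewrite scale0r.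
have n0 : cnorm (v n) != 0 by rewrite cnorm_eq0.
exists ((cnorm (v n))^-1 *: v n); split.
- by rewrite dotZl dotZr mulrA -expr2 -sqr_cnorm -exprMn mulVf// expr1n.
- by rewrite dotZr (projection_orth th1) mulr0.
- by rewrite scalerA divff// scale1r.
Qed.

Let eta n := sval (unit_direction n).

Let theta1 n : dot (theta + nv n *: ta n) (theta + nv n *: ta n) = 1.
Proof. exact: unit_sphereE (taus n.+1). Qed.

(** The factor [c_n * t_n] in the condition is the length of the tangent part of [tau], so the shift
    in the condition is the actual increment. *)
Let B_v n x : 0 < lam n -> B n * dot x (eta n) = kap n * nv n * dot x (v n).
Proof.
move=> l0; have [nv0 nvE] := nvP l0.
have [_ _ ve] := svalP (unit_direction n); rewrite -/(eta n) in ve.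
rewrite [in RHS]ve dotZr; suff -> : cnorm (v n) = c_lan f kappa (fun n => cnorm (tau n)) n.+1 * t n.
  by rewrite /B; ring.
have vv := dot_projection_tau th1 (theta1 n) nv0.
rewrite -/(v n) in vv.
have [t0|t0] := eqVneq (t n) 0.
  have t00 : dot (ta n) (ta n) = 0 by rewrite -sqr_cnorm -/(t n) t0 expr0n.
  by rewrite t0 mulr0 /cnorm vv t00 expr0n/= mulr0 subrr sqrtr0.
have tp : 0 < t n by rewrite lt_def t0 cnorm_ge0.
rewrite /cnorm vv -sqr_cnorm -/(t n).
have -> : t n ^+ 2 - 4^-1 * nv n ^+ 2 * (t n ^+ 2) ^+ 2 =
  t n ^+ 2 * (1 - 4^-1 * nv n ^+ 2 * t n ^+ 2) by ring.
by rewrite sqrtrM ?sqr_ge0// sqrtr_sqr gtr0_norm// mulrC.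
Qed.

Theorem log_lik_ratio_expansion : cvg_prob0 P
  (fun n x => (log_lik_ratio (Q n) (P n) x
     - (dot (tau n) (Delta f kappa theta x)
        - 2^-1 * dot (tau n) (Gamma_mx theta *m tau n))%:E)%E).
Proof.
have [M [HM PM]] := sample_marginals HP.
have HQ1 n : exists M' : probability V R,
  has_density M' idfun (@surface_area R k.+2) (rot_density (theta + nv n *: ta n) (kap n) f) /\
  forall E, measurable E -> Q n.+1 E = @tuple_measure _ _ _ M' n.+1 E.
  by have [M' H1 H2] := sample_marginal (HQ n.+1); exists M'.
have c0 n : 0 <= rot_const k (kap n) f.
  by apply: rot_const_ge0 => x; exact: class_F_gt0.
pose N n : R := n.+1%:R.
have [_ C2 C3] := FL.
pose te n x := taylor_error f kap n (dot x theta) (A n * dot x theta + kap n * nv n * dot x (v n)).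
have T0 : ((N n)%:E * \int[M n]_x (`|te n x|)%:E)%E @[n --> \oo] --> 0%E.
  have : ((N n)%:E * \int[M n]_x
     (`|taylor_error f kap n (dot x theta) (A n * dot x theta + B n * dot x (eta n))|)%:E)%E
    @[n --> \oo] --> 0%E.
    apply: (taylor_error_cvg th1 c0 Ff kap_oo HM) => //.
    - by move=> n; have [] := svalP (unit_direction n).
    - by move=> n; have [] := svalP (unit_direction n).
    - move=> minus e e0.
      have hE n s w : h_lan f kappa (fun n => cnorm (tau n)) minus n.+1 s w =
          A n * s + (-1) ^+ minus * (B n * Num.sqrt (1 - s ^+ 2) * Num.sqrt w).
        by rewrite /h_lan /A -sqr_cnorm mulNr.
      have /near_shiftS := C3 minus e e0.
      apply: filterS => n; set I1 := (\int[_]_(_ in _) _)%E; set I2 := (\int[_]_(_ in _) _)%E.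
      suff -> : I1 = I2 by [].
      congr integral; apply/funext => s; congr integral; apply/funext => w.
      by rewrite hE /taylor_error.
  apply: cvg_trans; apply: near_eq_cvg; apply: filterS lam_gt0 => n l0.
  congr (_ * _)%E; apply: eq_integral => x _; congr (`|taylor_error _ _ _ _ (_ + _)|)%:E.
  by rewrite B_v.
have S0 := score_error_cvg th1 c0 Ff (fun n => kappa0 n.+1) kap_oo HM C2.
have W0 := concentrated_cvg th1 c0 Ff kap_oo HM.
have [K0 hK] := taub; pose K := K0 ^+ 2.
have tK n : dot (ta n) (ta n) <= K.
  by rewrite -sqr_cnorm /K !expr2 ler_pM ?cnorm_ge0 ?hK.
have t0 n : 0 <= dot (ta n) (ta n) by exact: dot_ge0.
have Kge0 : 0 <= K by exact: sqr_ge0.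
move=> e e0; pose r n := (Num.sqrt (lam n))^-1.
pose S n := ((kap n / varphi f (kap n))%:E * \int[M n]_x (score_error theta f kap n x ^+ 2)%:E)%E.
pose W n := (\int[M n]_x (`|1 - dot x theta|)%:E)%E.
pose T n := ((N n)%:E * \int[M n]_x (`|te n x|)%:E)%E.
(* The bound of [lan_error_prob] with [K] in place of the squared length of [tau], and with [nv^2]
   replaced by the larger [1 / lam]. *)
pose b n := ((2 / e)%:E * (T n + (4^-1 * K)%:E * ((r n)%:E * (1 + S n)) +
  (2^-1 * K)%:E * W n + (8^-1 * K ^+ 2)%:E * ((lam n)^-1)%:E) + (4 / e ^+ 2)%:E * (K%:E * S n))%E.
have b0 : b n @[n --> \oo] --> 0%E.
  apply: cvge0D; apply: cvge0Z; last exact: cvge0Z.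
  apply: cvge0D; last first.
    apply: cvge0Z; apply: cvg_EFin; first exact: nearW.
    exact: cvg_inv_pinfty lam_oo.
  apply: cvge0D; last exact: cvge0Z.
  apply: cvge0D => //; apply: cvge0Z; apply: (@cvge0M _ _ _ 1).
    apply: cvg_EFin; first exact: nearW.
    exact: cvg_inv_pinfty (cvg_sqrt_pinfty lam_oo).
  by rewrite -[X in _ --> X](adde0 (1%E : \bar R)); apply: cvgeD => //; exact: cvg_cst.
rewrite -(cvg_shiftS (fun n => P n _)).
apply: (squeeze_cvge _ (cvg_cst 0%E) b0); apply: filterS lam_gt0 => n l0 /=.
rewrite measure_ge0/=.
have [nv0 nvE] := nvP l0; have [M' [HM' QM]] := HQ1 n.
have phi0 : 0 < varphi f (kap n) by move: l0; rewrite /lam /concentration pmulr_rgt0// /kap.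
pose A1 := [set x | (e%:E < `|log_lik_ratio (Q n.+1) (P n.+1) x -
  (dot (tau n.+1) (Delta f kappa theta x) -
   2^-1 * dot (tau n.+1) (Gamma_mx theta *m tau n.+1))%:E|)%E].
pose A2 := [set x : n.+1.-tuple V | e < `|lan_error theta (ta n) (nv n) f kap n x|].
have mA1 : measurable A1.
  have mf : measurable_fun setT (fun x => `|log_lik_ratio (Q n.+1) (P n.+1) x -
    (dot (tau n.+1) (Delta f kappa theta x) -
     2^-1 * dot (tau n.+1) (Gamma_mx theta *m tau n.+1))%:E|%E).
    apply: measurableT_comp => //; apply: emeasurable_funB.
      exact: (measurable_log_lik_ratio Ff (HM n) HM' (PM n) QM).
    apply/measurable_EFinP; apply: measurable_funB; last exact: measurable_cst.
    exact: measurable_dot_Gamma_mean.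
  have := mf measurableT _ (emeasurable_itv `]e%:E, +oo[).
  by rewrite setTI; congr measurable; apply/seteqP; split => x /=; rewrite in_itv/= andbT.
have mA2 : measurable A2.
  have mf : measurable_fun setT (fun x : n.+1.-tuple V => `|lan_error theta (ta n) (nv n) f kap n x|).
    by apply: measurableT_comp => //; exact: measurable_lan_error.
  have := mf measurableT _ (measurable_itv `]e, +oo[).
  by rewrite setTI; congr measurable; apply/seteqP; split => x /=; rewrite in_itv/= andbT.
(* The explicit form of the log-likelihood ratio holds almost everywhere only, so the events agree
   up to a null set and are compared through their indicators. *)
rewrite -/A1; have -> : P n.+1 A1 = P n.+1 A2.
  have I E : measurable E -> P n.+1 E = (\int[P n.+1]_x (\1_E x)%:E)%E.
    by move=> mE; rewrite integral_indic// setIT.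
  rewrite (I _ mA1) (I _ mA2); apply: ae_eq_integral => //.
  - by apply/measurable_EFinP; exact: measurable_indic.
  - by apply/measurable_EFinP; exact: measurable_indic.
  apply: filterS (log_lik_ratioE Ff (HM n) HM' (PM n) QM) => x hx _.
  rewrite !indicE; suff -> : (x \in A1) = (x \in A2) by [].
  apply/idP/idP; rewrite !inE /A1 /A2/= hx.
    by rewrite -EFinB lte_fin.
  by rewrite -EFinB lte_fin.
have r0 : 0 < r n by rewrite invr_gt0 sqrtr_gt0.
have rlam : r n ^+ 2 * (kap n * varphi f (kap n)) = 1.
  by rewrite exprVn sqr_sqrtr ?(ltW l0)// mulVf// lt0r_neq0.
apply: (le_trans (lan_error_prob th1 (c0 n) Ff (HM n) (theta1 n) (kappa0 n.+1) phi0
  nv0 nvE (PM n) r0 rlam e0)).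
have S0' : (0 <= S n)%E.
  apply: mule_ge0; first by rewrite lee_fin divr_ge0// ltW// kappa0.
  by apply: integral_ge0 => x _; rewrite lee_fin sqr_ge0.
have W0' : (0 <= W n)%E by apply: integral_ge0 => x _; rewrite lee_fin.
rewrite -/(S n) -/(W n) -/(te n) -[(n.+1%:R%:E * _)%E]/(T n) /b.
apply: leeD; last first.
  apply: lee_wpmul2l; first by rewrite lee_fin divr_ge0 ?sqr_ge0.
  by apply: lee_wpmul2r => //; rewrite lee_fin.
apply: lee_wpmul2l; first by rewrite lee_fin divr_ge0// ltW.
apply: leeD.
  apply: leeD.
    apply: leeD => //; rewrite muleA -EFinM; apply: lee_wpmul2r; first exact: adde_ge0.
    by rewrite lee_fin ler_wpM2r ?(ltW r0)// ler_wpM2l.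
  by apply: lee_wpmul2r => //; rewrite lee_fin ler_wpM2l.
rewrite -EFinM lee_fin.
have nvl : nv n ^+ 2 <= (lam n)^-1.
  have -> : nv n ^+ 2 = (n.+1%:R)^-1 * (lam n)^-1.
    apply: (mulIf (x := n.+1%:R * lam n)); first by rewrite mulf_neq0// lt0r_neq0.
    by rewrite nvE; field; rewrite lt0r_neq0//= pnatr_eq0.
  by rewrite ler_piMl ?invr_ge0 ?(ltW l0)// invf_le1// ler1n.
have -> : 8^-1 * nv n ^+ 2 * dot (ta n) (ta n) ^+ 2 =
  8^-1 * (dot (ta n) (ta n) ^+ 2 * nv n ^+ 2) by ring.
have l0' : 0 <= (lam n)^-1 by rewrite invr_ge0 ltW.
rewrite -(mulrA 8^-1) ler_wpM2l//; apply: ler_pM; rewrite ?sqr_ge0//.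
by rewrite ler_sqr ?nnegrE.
Qed.

End lan_limit.

(** * Gaussian laws *)

Section cosine_bounds.
Context (R : realType).
Implicit Types x y : R.

(** Engine of the alternating Taylor bounds for sine and cosine: the function that expresses each
    bound has the previous one as its derivative. Evenness extends the cosine bounds to negative
    arguments. *)
Lemma ge0_of_derive (f df : R -> R) : (forall x, is_derive x 1 f (df x)) ->
  f 0 = 0 -> (forall x, 0 <= x -> 0 <= df x) -> forall x, 0 <= x -> 0 <= f x.
Proof.
move=> fd f0 df0 x x0; rewrite -f0; apply: (@ger0_derive1_ndecry _ f 0) => //.
- by move=> y; rewrite in_itv/= andbT derive1E derive_val => /ltW; exact: df0.
- by apply: continuous_subspaceT => y; apply: differentiable_continuous; exact/derivable1_diffP.
Qed.

Let sin_le_id x : 0 <= x -> sin x <= x.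
Proof.
move=> x0; rewrite -subr_ge0.
apply: (@ge0_of_derive (fun x => x - sin x) (fun x => 1 - cos x)) => //.
by rewrite sin0 subr0.
Qed.

Let even_bound (f : R -> R) : (forall x, f (- x) = f x) ->
  (forall x, 0 <= x -> 0 <= f x) -> forall x, 0 <= f x.
Proof.
move=> fN f0 x; have [/f0//|x0] := leP 0 x.
by rewrite -fN; apply: f0; rewrite oppr_ge0 ltW.
Qed.

Lemma cos_ge_quadratic x : 1 - x ^+ 2 / 2 <= cos x.
Proof.
rewrite -subr_ge0; pose f x := cos x - (1 - x ^+ 2 / 2).
apply: (even_bound (f := f)) => [y|]; first by rewrite /f cosN sqrrN.
apply: (@ge0_of_derive f (fun x => x - sin x)).
- move=> y; by apply: is_derive_eq; rewrite /GRing.scale/=; field.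
- by rewrite /f cos0 expr0n/= mul0r subr0 subrr.
- by move=> y y0; rewrite subr_ge0 sin_le_id.
Qed.

Let sin_ge_cubic x : 0 <= x -> x - x ^+ 3 / 6 <= sin x.
Proof.
move=> x0; rewrite -subr_ge0.
apply: (@ge0_of_derive (fun x => sin x - (x - x ^+ 3 / 6)) (fun x => cos x - (1 - x ^+ 2 / 2))) => //.
- move=> y; by apply: is_derive_eq; rewrite /GRing.scale/=; field.
- by rewrite sin0 expr0n/= mul0r !subr0.
- by move=> y _; rewrite subr_ge0 cos_ge_quadratic.
Qed.

Lemma cos_le_quartic x : cos x <= 1 - x ^+ 2 / 2 + x ^+ 4 / 24.
Proof.
rewrite -subr_ge0; pose f x := 1 - x ^+ 2 / 2 + x ^+ 4 / 24 - cos x.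
apply: (even_bound (f := f)) => [y|]; first by rewrite /f cosN sqrrN -[4%N]/(2 * 2)%N !exprM sqrrN.
apply: (@ge0_of_derive f (fun x => sin x - (x - x ^+ 3 / 6))).
- move=> y; by apply: is_derive_eq; rewrite /GRing.scale/=; field.
- by rewrite /f cos0 !expr0n/= !mul0r subr0 addr0 subrr.
- by move=> y y0; rewrite subr_ge0 sin_ge_cubic.
Qed.

End cosine_bounds.

(** * Powers converging to an exponential *)

Section power_limit.
Context (R : realType).

(** Telescoping, all factors being at most 1 in absolute value. *)
Lemma expr_dist_le (a b : R) n : `|a| <= 1 -> `|b| <= 1 ->
  `|a ^+ n - b ^+ n| <= n%:R * `|a - b|.
Proof.
move=> a1 b1; elim: n => [|n IH]; first by rewrite !expr0 subrr normr0 mul0r.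
have -> : a ^+ n.+1 - b ^+ n.+1 = a * (a ^+ n - b ^+ n) + b ^+ n * (a - b) by rewrite !exprS; ring.
rewrite (le_trans (ler_normD _ _))// -natr1 mulrDl mul1r !normrM normrX lerD//.
  by rewrite (le_trans _ IH)// ler_piMl.
by rewrite ler_piMl// exprn_ile1.
Qed.

Lemma cvg_invS : (n.+1%:R^-1 : R) @[n --> \oo] --> (0 : R).
Proof. exact: cvg_harmonic. Qed.

(** [c n] is compared with [exp (- b / n.+1)], whose power is exactly the limit, so no logarithm of
    [c n], possibly negative, is taken. With [x = b / n.+1], the bounds
    [1 - x <= exp (- x) <= 1 / (1 + x)] leave an error of at most [x^2]. *)
Lemma expr_cvg_expR (c : nat -> R) (b : R) : 0 <= b -> (forall n, `|c n| <= 1) ->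
  n.+1%:R * (1 - c n) @[n --> \oo] --> b ->
  c n ^+ n.+1 @[n --> \oo] --> expR (- b).
Proof.
move=> b0 c1 cb; pose d n := expR (- (b / n.+1%:R)).
have dE n : d n ^+ n.+1 = expR (- b).
  by rewrite -expRM_natl mulrN mulrC divfK.
have xb n : 0 <= b / n.+1%:R by rewrite divr_ge0.
have d1 n : `|d n| <= 1 by rewrite ger0_norm ?expR_ge0// expR_le1 oppr_le0.
pose r n := `|n.+1%:R * (1 - c n) - b| + b ^+ 2 * n.+1%:R^-1.
have r0 : r n @[n --> \oo] --> (0 : R).
  rewrite -[X in _ --> X](addr0 0); apply: cvgD.
    rewrite -(normr0 R); apply: cvg_norm.
    by rewrite -(subrr b); apply: cvgB => //; exact: cvg_cst.
  by rewrite -(mulr0 (b ^+ 2)); apply: cvgM; [exact: cvg_cst|exact: cvg_invS].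
apply/cvgrPdist_le => e e0; move/cvgrPdist_le : r0 => /(_ e e0); apply: filterS => n.
rewrite sub0r normrN ger0_norm; last by rewrite addr_ge0// mulr_ge0 ?sqr_ge0// invr_ge0.
move=> /(le_trans _); apply; rewrite distrC -(dE n) (le_trans (expr_dist_le _ (c1 n) (d1 n)))//.
have N0 : 0 < n.+1%:R :> R by [].
rewrite -[X in X * _ <= _](gtr0_norm N0) -normrM.
have -> : n.+1%:R * (c n - d n) =
  - (n.+1%:R * (1 - c n) - b) + (n.+1%:R * (1 - d n) - b) by ring.
rewrite (le_trans (ler_normD _ _))// normrN lerD2l.
set x := b / n.+1%:R; have x0 : 0 <= x by exact: xb.
have bE : b = n.+1%:R * x by rewrite /x mulrCA divff ?mulr1.
have h1 : 1 - x <= d n by have := expR_ge1Dx (- x).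
have h2 : d n * (1 + x) <= 1.
  by have := expR_ge1Dx x; rewrite /d -/x expRN mulrC ler_pdivrMr ?mul1r ?expR_gt0.
have -> : b ^+ 2 / n.+1%:R = n.+1%:R * x ^+ 2 by rewrite {1}bE; field.
rewrite [X in `|_ - X|]bE -mulrBr normrM (gtr0_norm N0) ler_wpM2l ?(ltW N0)//.
have dn0 : 0 <= d n by exact: expR_ge0.
rewrite ler_norml; apply/andP; split; last by nra.
nra.
Qed.

End power_limit.

Section mean_cos_bounds.
Context d (T : measurableType d) (R : realType) (M : probability T R) (Y : T -> R).
Hypothesis mY : measurable_fun setT Y.

Lemma mean_cos_bounds (s r : R) :
  (\int[M]_x (Y x ^+ 2)%:E = s%:E)%E -> (\int[M]_x (Y x ^+ 4)%:E <= r%:E)%E ->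
  s / 2 - r / 24 <= 1 - mean_cos M Y <= s / 2.
Proof.
move=> sE rE; have := integral_affine_cos M mY 1 (-1); rewrite mulN1r => mE.
have mcos : measurable_fun setT (fun x => (1 - cos (Y x))%:E).
  apply/measurable_EFinP; apply: measurable_funB; first exact: measurable_cst.
  by apply: (measurableT_comp (f := @cos R)) => //; exact: (continuous_measurable_fun (@continuous_cos R)).
have mX k : measurable_fun setT (fun x => (Y x ^+ k)%:E).
  by apply/measurable_EFinP; exact: measurable_funX.
have e2 k x : ~~ odd k -> (0 <= (Y x ^+ k)%:E)%E by move=> ?; rewrite lee_fin exprn_even_ge0.
have c0 x : (0 <= (1 - cos (Y x))%:E)%E by rewrite lee_fin subr_ge0 cos_le1.
have {}mE : (\int[M]_x (1 - cos (Y x))%:E = (1 - mean_cos M Y)%:E)%E.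
  by rewrite -mE; apply: eq_integral => x _; rewrite mulN1r.
have sE2 : (\int[M]_x (2^-1%:E * (Y x ^+ 2)%:E) = (s / 2)%:E)%E.
  rewrite ge0_integralZl//; last by move=> x _; exact: e2.
  by rewrite sE -EFinM mulrC.
apply/andP; split; last first.
  rewrite -lee_fin -mE -sE2; apply: ge0_le_integral => //.
  - by apply: emeasurable_funM => //; exact: measurable_cst.
  - by move=> x _; rewrite -EFinM lee_fin; have := cos_ge_quadratic (Y x); lra.
have mY4 : measurable_fun setT (fun x => (24^-1%:E * (Y x ^+ 4)%:E)%E).
  by apply: emeasurable_funM => //; exact: measurable_cst.
have Y40 x : (0 <= 24^-1%:E * (Y x ^+ 4)%:E)%E.
  by apply: mule_ge0; [rewrite lee_fin invr_ge0|exact: e2].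
rewrite lerBlDr -lee_fin -sE2 EFinD -mE.
apply: (@le_trans _ _ (\int[M]_x ((1 - cos (Y x))%:E + 24^-1%:E * (Y x ^+ 4)%:E))%E).
  apply: ge0_le_integral => //.
  - by move=> x _; apply: mule_ge0; [rewrite lee_fin invr_ge0|exact: e2].
  - by apply: emeasurable_funM => //; exact: measurable_cst.
  - exact: emeasurable_funD.
  - by move=> x _; rewrite -!EFinM -EFinD lee_fin; have := cos_le_quartic (Y x); lra.
rewrite ge0_integralD// leeD2l// ge0_integralZl//; last by move=> x _; exact: e2.
by rewrite mulrC EFinM lee_wpmul2l// lee_fin invr_ge0.
Qed.

End mean_cos_bounds.

(** * Moments of the standard normal law *)

Section normal_moments.
Context (R : realType).
Notation leb := (@lebesgue_measure R).

(** The substitutions [w = u^2] and then [w = 2 * r] turn an even moment into a Gamma integral. *)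
Lemma integral_normal_moment m :
  (\int[leb]_x (x ^+ (2 * m) * normal_pdf 0 1 x)%:E =
   (2 * 2 `^ (m%:R - 2^-1) * normal_peak 1)%:E * @gammaE R (m%:R - 2^-1))%E.
Proof.
set a : R := m%:R - 2^-1.
pose G (x : R) := (x ^+ (2 * m) * normal_pdf 0 1 x)%:E.
have mG : measurable_fun setT G.
  apply/measurable_EFinP; apply: measurable_funM; first exact: measurable_funX.
  exact: measurable_normal_pdf.
have GN x : G (- x) = G x.
  by rewrite /G exprM sqrrN -exprM !normal_pdfE ?oner_neq0// /normal_fun !subr0 sqrrN.
have G0 x : (0 <= G x)%E.
  by rewrite lee_fin mulr_ge0 ?normal_pdf_ge0// exprM exprn_ge0// sqr_ge0.
rewrite -[LHS]/(\int[leb]_x G x)%E (ge0_integral_indpos mG G0).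
pose h (w : R) := (normal_peak 1 * (w `^ a * expR (- (w / 2))))%:E.
have mh : measurable_fun setT h.
  apply/measurable_EFinP; apply: measurable_funM; first exact: measurable_cst.
  apply: measurable_funM; first by apply: measurable_powRf; exact: measurable_id.
  by apply: measurable_expRf; apply: measurable_funN; apply: measurable_funM => //; exact: measurable_cst.
have h0 w : (0 <= h w)%E.
  by rewrite lee_fin !mulr_ge0 ?powR_ge0 ?expR_ge0// ltW// normal_peak_gt0.
transitivity (\int[leb]_u (h (u ^+ 2)%R * (2 * u)%:E * (indpos u)%:E))%E.
  apply: eq_integral => u _; rewrite GN indposE; case: ltP => u0; last by rewrite !mule0.
  rewrite !mule1 /G /h -EFinD -EFinM normal_pdfE ?oner_neq0// /normal_fun subr0.
  have -> : (u ^+ 2) `^ a = u ^+ (2 * m) / u.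
    rewrite -powR_mulrn ?(ltW u0)// -powRrM.
    have -> : 2%:R * a = (2 * m)%:R - 1 by rewrite /a natrM; field.
    by rewrite powRB ?(gt_eqF u0) ?implybT// powR_mulrn ?(ltW u0)// powRr1 ?(ltW u0).
  have -> : - u ^+ 2 / (1 ^+ 2 *+ 2) = - (u ^+ 2 / 2) by rewrite expr1n mulNr.
  by congr EFin; field; rewrite lt0r_neq0.
rewrite -(ge0_integral_sqr mh h0).
have mF : measurable_fun setT (fun w => h w * (indpos w)%:E)%E.
  by apply: emeasurable_funM => //; apply/measurable_EFinP; exact: measurable_indpos.
have F0 w : (0 <= h w * (indpos w)%:E)%E by rewrite mule_ge0// lee_fin indpos_ge0.
rewrite (ge0_integral_affine mF F0 0 (ltr0n _ 2)) /gammaE -ge0_integralZl//.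
- apply: eq_integral => r _; rewrite addr0 /h -!EFinM !indposE pmulr_rgt0//.
  case: ltP => r0; last by rewrite !(mulr0, mul0r).
  rewrite powRM ?(ltW r0)// !mul1r mulr1; congr EFin.
  have -> : 2 * r / 2 = r by field.
  by ring.
- apply/measurable_EFinP; apply: measurable_funM; first exact: measurable_indpos.
  apply: measurable_funM; first by apply: measurable_powRf; exact: measurable_id.
  by apply: measurable_expRf; exact: measurable_funN.
- by move=> r _; rewrite lee_fin !mulr_ge0 ?indpos_ge0 ?powR_ge0 ?expR_ge0.
- by rewrite lee_fin !mulr_ge0 ?powR_ge0// ltW// normal_peak_gt0.
Qed.

Let gamma_half : exists2 g : R, 0 < g & @gammaE R (- 2^-1) = g%:E.
Proof.
have h : -1 < - 2^-1 :> R by lra.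
have := gammaE_gt0 h; have := gammaE_fin h; move: (gammaE _) => [r||]// _.
by rewrite lte_fin => r0; exists r.
Qed.

(** The case [m = 0] is the total mass 1, which eliminates the unknown value of Gamma at 1/2; the
    recursion then gives the case [m = 1]. *)
Lemma normal_second_moment :
  (\int[leb]_x (x ^+ 2 * normal_pdf 0 1 x)%:E = 1)%E.
Proof.
have [g g0 gE] := gamma_half.
have := integral_normal_moment 0; rewrite muln0 sub0r gE.
under eq_integral => x _ do rewrite expr0 mul1r.
rewrite integral_normal_pdf// -EFinM => -[e1].
rewrite (integral_normal_moment 1) -[1%:R - 2^-1](_ : - 2^-1 + 1 = _ :> R); last by ring.
rewrite gammaE_rec ?gE; last by lra.
rewrite -!EFinM [X in _ = X%:E]e1; congr EFin.
rewrite powRD; last by apply/implyP.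
by rewrite powRr1//; field.
Qed.

Lemma normal_fourth_moment : exists K : R,
  (\int[leb]_x (x ^+ 4 * normal_pdf 0 1 x)%:E = K%:E)%E.
Proof.
rewrite (integral_normal_moment 2); have h : -1 < 2%:R - 2^-1 :> R by lra.
rewrite -(fineK (gammaE_fin_num h)); move: (fine _) => g.
by exists (2 * 2 `^ (2%:R - 2^-1) * normal_peak 1 * g).
Qed.

End normal_moments.

(** * Standard Gaussian vectors *)

Section gaussian.
Context (R : realType).
Notation leb := (@lebesgue_measure R).
Notation mR := (measurableTypeR R).
Notation L p := (@lebesgue_cV R p).

Definition normal01 : probability mR R := normal_prob 0 1.

Lemma integral_normal01 (F : R -> \bar R) : measurable_fun setT F ->
  (forall x, 0 <= F x)%E ->
  (\int[normal01]_x F x = \int[leb]_x (F x * (normal_pdf 0 1 x)%:E))%E.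
Proof.
move=> mF F0; apply: ge0_integral_densityE => //.
- by move=> x; exact: normal_pdf_ge0.
- exact: measurable_normal_pdf.
Qed.

Let mdens p : measurable_fun setT (EFin \o @gauss_density R p).
Proof. by apply/measurable_EFinP; exact: measurable_gauss_density. Qed.

Let mFg p (F : 'cV[R]_p -> \bar R) : measurable_fun setT F ->
  measurable_fun setT (fun x => F x * (gauss_density x)%:E)%E.
Proof. by move=> mF; apply: emeasurable_funM => //; exact: mdens. Qed.

Let dens0 p (x : 'cV[R]_p) : (0 <= (gauss_density x)%:E)%E.
Proof. by rewrite lee_fin gauss_density_ge0. Qed.

Let gauss_consV p (a : R) (z : 'cV[R]_p) :
  gauss_density (consV a z) = normal_pdf 0 1 a * gauss_density z.
Proof.
rewrite /gauss_density big_ord_recl consV0; congr (_ * _).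
by apply: eq_bigr => i _; rewrite consVS.
Qed.

Lemma ge0_integral_gauss_tuple n (F : 'cV[R]_n -> \bar R) :
  measurable_fun setT F -> (forall x, 0 <= F x)%E ->
  (\int[L n]_x (F x * (gauss_density x)%:E) =
   \int[@tuple_measure _ _ _ normal01 n]_t F (colt t))%E.
Proof.
elim: n F => [|n IH] F mF F0.
  rewrite ge0_integral_lebesgue_cV0; [|exact: mFg|by move=> x; rewrite mule_ge0].
  rewrite /gauss_density big_ord0 mule1 /= integral_dirac//; last first.
    by apply: measurableT_comp => //; exact: measurable_colt.
  by rewrite diracT mul1e; congr F; apply/colP => i; case: i.
rewrite ge0_integral_lebesgue_cVS; [|exact: mFg|by move=> x; rewrite mule_ge0].
have mFc : measurable_fun setT (fun t => F (@colt R n.+1 t)).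
  by apply: measurableT_comp => //; exact: measurable_colt.
rewrite (ge0_integral_tuple_measureS normal01 mFc (fun t => F0 _)).
have mFa a : measurable_fun setT (fun z : 'cV[R]_n => F (consV a z)).
  by apply: (measurableT_comp mF); apply: measurable_consV => //; exact: measurable_cst.
have inner (a : R) : (\int[@tuple_measure _ _ _ normal01 n]_t F (@colt R n.+1 [tuple of a :: t]) =
    \int[L n]_z (F (consV a z) * (gauss_density z)%:E))%E.
  rewrite IH//; apply: eq_integral => t _; congr F; apply/colP => i; rewrite mxE.
  by have [i' ->|->] := unliftP ord0 i; rewrite ?tnthS ?tnth0 ?consVS ?consV0 ?mxE.
have J0 (a : R) : (0 <= \int[L n]_z (F (consV a z) * (gauss_density z)%:E))%E.
  by apply: integral_ge0 => z _; rewrite mule_ge0.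
have mJ : measurable_fun setT (fun a : R => \int[L n]_z (F (consV a z) * (gauss_density z)%:E))%E.
  apply: (measurable_integral_cV (F := fun w : R * 'cV[R]_n => F (consV w.1 w.2) * (gauss_density w.2)%:E)%E).
    apply: emeasurable_funM.
      apply: (measurableT_comp mF); apply: measurable_consV; [exact: measurable_fst|exact: measurable_snd].
    by apply/measurable_EFinP; apply: (measurableT_comp (@measurable_gauss_density R n)); exact: measurable_snd.
  by move=> w; rewrite mule_ge0.
under [RHS]eq_integral => a _ do rewrite inner.
rewrite (integral_normal01 mJ J0); apply: eq_integral => a _.
transitivity (\int[L n]_z ((normal_pdf 0 1 a)%:E * (F (consV a z) * (gauss_density z)%:E)))%E.
  by apply: eq_integral => z _; rewrite gauss_consV EFinM muleCA.
rewrite ge0_integralZl//; last 3 first.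
- exact: mFg.
- by move=> z _; rewrite mule_ge0.
- by rewrite lee_fin normal_pdf_ge0.
by rewrite muleC.
Qed.

(** A reflection carries [w] to the first axis while preserving Lebesgue measure and the density;
    the other coordinates then integrate to 1. *)
Lemma ge0_integral_gauss_direction p (w : 'cV[R]_p.+1) (F : R -> \bar R) :
  dot w w = 1 -> measurable_fun setT F -> (forall x, 0 <= F x)%E ->
  (\int[L p.+1]_x (F (dot w x) * (gauss_density x)%:E) =
   \int[normal01]_x F x)%E.
Proof.
move=> w1 mF F0; pose e : 'cV[R]_p.+1 := consV 1 0.
have e1 : dot e e = 1 by rewrite dot_consV dot0l addr0 mulr1.
pose H := reflect_along (w - e).
have Hw : H w = e by apply: reflect_along_sub; rewrite w1 e1.
have md (v : 'cV[R]_p.+1) : measurable_fun setT (fun x => F (dot v x)).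
  by apply: (measurableT_comp mF); apply: measurable_fun_dot => //; exact: measurable_cst.
transitivity (\int[L p.+1]_x (F (dot e x) * (gauss_density x)%:E))%E.
  rewrite -[RHS](ge0_integral_cV_reflect (w - e)); [|exact: mFg|by move=> x; rewrite mule_ge0].
  apply: eq_integral => x _; rewrite -/(H x); congr (F _ * _)%E.
    by rewrite -Hw /H dot_reflect_along.
  by rewrite !gauss_densityE /H dot_reflect_along.
rewrite ge0_integral_lebesgue_cVS; [|exact: mFg|by move=> x; rewrite mule_ge0].
rewrite integral_normal01//; apply: eq_integral => a _.
transitivity (\int[L p]_z ((F a * (normal_pdf 0 1 a)%:E) * (gauss_density z)%:E))%E.
  apply: eq_integral => z _.
  by rewrite gauss_consV /e dot_consV dot0l addr0 mul1r EFinM muleA.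
rewrite ge0_integralZl//; [|exact: mdens|by rewrite mule_ge0// lee_fin normal_pdf_ge0].
by rewrite integral_gauss_density mule1.
Qed.

Definition normal_cos (u : R) : R := mean_cos normal01 (fun x : mR => u * x).

Let mscale (u : R) : measurable_fun setT (fun x : mR => u * x).
Proof. exact: measurable_funM. Qed.

Let symscale (u : R) (F : R -> \bar R) : measurable_fun setT F ->
  (forall y, 0 <= F y)%E ->
  (\int[normal01]_x F (u * x)%R = \int[normal01]_x F (- (u * x))%R)%E.
Proof.
move=> mF F0; have mFu (a : R) : measurable_fun setT (fun x : mR => F (a * x)).
  by apply: (measurableT_comp mF); exact: measurable_funM.
under [RHS]eq_integral => x _ do rewrite -mulNr.
rewrite (integral_normal01 (mFu u))// (integral_normal01 (mFu (- u)))//.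
have mG : measurable_fun setT (fun x : mR => F (u * x)%R * (normal_pdf 0 1 x)%:E)%E.
  by apply: emeasurable_funM => //; apply/measurable_EFinP; exact: measurable_normal_pdf.
have G0 x : (0 <= F (u * x)%R * (normal_pdf 0 1 x)%:E)%E.
  by rewrite mule_ge0// lee_fin normal_pdf_ge0.
rewrite -[LHS](ge0_integral_opp mG G0); apply: eq_integral => x _; rewrite mulrN mulNr.
by rewrite !normal_pdfE ?oner_neq0// /normal_fun !subr0 sqrrN.
Qed.

Lemma normal_cosE u : normal_cos u = expR (- (u ^+ 2 / 2)).
Proof.
have mcos (b : R) : measurable_fun setT (fun y : R => (1 + cos (b * y))%:E).
  apply/measurable_EFinP; apply: measurable_funD; first exact: measurable_cst.
  apply: (measurableT_comp (f := @cos R)); first exact: (continuous_measurable_fun (@continuous_cos R)).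
  exact: measurable_funM.
have cos0 (b y : R) : (0 <= (1 + cos (b * y))%:E)%E.
  by rewrite lee_fin -lerBlDl sub0r cos_geN1.
pose c n := normal_cos (u / Num.sqrt n.+1%:R).
(* A standard Gaussian vector has the same law along the diagonal as along the
   first axis, so the mean is invariant under the normalized convolution power
   to which the limit theorem applies. *)
have scale n : c n ^+ n.+1 = normal_cos u.
  pose s : R := (Num.sqrt n.+1%:R)^-1.
  pose w : 'cV[R]_n.+1 := \col_i s.
  have w1 : dot w w = 1.
    rewrite dotE; under eq_bigr do rewrite !mxE.
    by rewrite sumr_const card_ord -expr2 exprVn sqr_sqrtr// -[LHS]mulr_natr mulVf.
  have := ge0_integral_gauss_direction w1 (mcos u) (cos0 u).
  have mcw : measurable_fun setT (fun x : 'cV[R]_n.+1 => (1 + cos (u * dot w x))%:E).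
    by apply: (measurableT_comp (mcos u)); apply: measurable_fun_dot => //; exact: measurable_cst.
  rewrite (ge0_integral_gauss_tuple mcw (fun x => cos0 _ _)).
  under [X in _ = X -> _]eq_integral => x _ do rewrite -[cos _]mul1r.
  rewrite (integral_affine_cos normal01 (mscale u) 1 1) mul1r -/(normal_cos u).
  have -> : (\int[@tuple_measure _ _ _ normal01 n.+1]_t (1 + cos (u * dot w (colt t)))%:E =
      \int[@tuple_measure _ _ _ normal01 n.+1]_t (1 + cos (0 + \sum_(i < n.+1) (u / Num.sqrt n.+1%:R) * tnth t i))%:E)%E.
    apply: eq_integral => t _; congr (1 + cos _)%:E; rewrite add0r dotE mulr_sumr.
    by apply: eq_bigr => i _; rewrite !mxE mulrA.
  rewrite (integral_tuple_cos (mscale _) (symscale _)) trigo.cos0 mulr1 => -[] /addrI.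
  by [].
have [K KE] := normal_fourth_moment R.
have bounds n : u ^+ 2 / 2 - (u ^+ 4 * K / 24) * n.+1%:R^-1 <= n.+1%:R * (1 - c n) <= u ^+ 2 / 2.
  set u' := u / Num.sqrt n.+1%:R.
  have N0 : 0 < n.+1%:R :> R by [].
  have u2 : u' ^+ 2 = u ^+ 2 / n.+1%:R by rewrite expr_div_n sqr_sqrtr.
  have IX (j : nat) (r : R) : ~~ odd j ->
      (\int[leb]_x (x ^+ j * normal_pdf 0 1 x)%:E = r%:E)%E ->
      (\int[normal01]_x ((u' * x) ^+ j)%:E = (u' ^+ j * r)%:E)%E.
    move=> oj rE; rewrite (integral_normal01 (F := fun x => ((u' * x) ^+ j)%:E)); last 2 first.
    - by apply/measurable_EFinP; apply: measurable_funX; exact: mscale.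
    - by move=> x; rewrite lee_fin exprn_even_ge0.
    rewrite EFinM -rE -ge0_integralZl//; last 3 first.
    - apply/measurable_EFinP; apply: measurable_funM; first exact: measurable_funX.
      exact: measurable_normal_pdf.
    - by move=> x _; rewrite lee_fin mulr_ge0 ?normal_pdf_ge0 ?exprn_even_ge0.
    - by rewrite lee_fin exprn_even_ge0.
    by apply: eq_integral => x _; rewrite -!EFinM exprMn mulrA.
  have I2 := IX 2%N 1 isT (normal_second_moment R); rewrite mulr1 in I2.
  have I4 : (\int[normal01]_x ((u' * x) ^+ 4)%:E <= (u' ^+ 4 * K)%:E)%E by rewrite (IX 4%N K isT KE).
  have := mean_cos_bounds (mscale u') I2 I4; rewrite -/(normal_cos u') -/(c n).
  rewrite -[4%N]/(2 * 2)%N !exprM u2 => /andP[h1 h2]; apply/andP; split.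
    rewrite -ler_pdivrMl//; apply: le_trans h1; rewrite le_eqVlt; apply/orP; left; apply/eqP.
    by field; rewrite lt0r_neq0.
  rewrite -ler_pdivlMl//; apply: (le_trans h2); rewrite le_eqVlt; apply/orP; left; apply/eqP.
  by field; rewrite lt0r_neq0.
have : c n ^+ n.+1 @[n --> \oo] --> expR (- (u ^+ 2 / 2)).
  apply: expr_cvg_expR; first by rewrite divr_ge0// sqr_ge0.
    by move=> n; apply: mean_cos_norm; exact: mscale.
  apply: (squeeze_cvgr _ _ (cvg_cst (u ^+ 2 / 2))); first by apply: nearW; exact: bounds.
  rewrite -[X in _ --> X]subr0; apply: cvgB; first exact: cvg_cst.
  by rewrite -(mulr0 (u ^+ 4 * K / 24)); apply: cvgM; [exact: cvg_cst|exact: cvg_invS].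
under eq_cvg do rewrite scale.
by move=> /(cvg_unique (@Rhausdorff R) (cvg_cst _)).
Qed.

Let density_measure p :=
  cid (measure_of_density (L p) (@gauss_density_ge0 R p) (@measurable_gauss_density R p)).

Definition gaussian_law p : set 'cV[R]_p -> \bar R := sval (density_measure p).

Let gaussian_lawE p A : gaussian_law A = (\int[L p]_(x in A) (gauss_density x)%:E)%E.
Proof. exact: (svalP (density_measure p)). Qed.

Let gaussian_lawT p : @gaussian_law p setT = 1%E.
Proof. by rewrite gaussian_lawE integral_gauss_density. Qed.

HB.instance Definition _ p := isMeasure.Build _ _ _ (@gaussian_law p)
  (measure0 (sval (density_measure p))) (measure_ge0 (sval (density_measure p)))
  (@measure_semi_sigma_additive _ _ _ (sval (density_measure p))).

HB.instance Definition _ p :=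
  Measure_isProbability.Build _ _ _ (@gaussian_law p) (gaussian_lawT p).

Definition gaussian p : probability 'cV[R]_p R := @gaussian_law p.

Lemma ge0_integral_gaussian p (F : 'cV[R]_p -> \bar R) :
  measurable_fun setT F -> (forall x, 0 <= F x)%E ->
  (\int[gaussian p]_x F x = \int[L p]_x (F x * (gauss_density x)%:E))%E.
Proof.
move=> mF F0.
exact: (ge0_integral_densityE (@gauss_density_ge0 R p) (@measurable_gauss_density R p) (@gaussian_lawE p)).
Qed.

Lemma polar_form p (z : 'cV[R]_p.+1) :
  exists2 w, dot w w = 1 & z = cnorm z *: w.
Proof.
have [->|z0] := eqVneq z 0.
  exists (consV 1 0); first by rewrite dot_consV dot0l addr0 mulr1.
  by rewrite cnorm0 scale0r.
have n0 : cnorm z != 0 by rewrite cnorm_eq0.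
exists ((cnorm z)^-1 *: z); last by rewrite scalerA divff// scale1r.
by rewrite dotZl dotZr mulrA -expr2 -sqr_cnorm -exprMn mulVf// expr1n.
Qed.

Lemma ge0_integral_gaussian_dot p (z : 'cV[R]_p.+1) (F : R -> \bar R) :
  measurable_fun setT F -> (forall x, 0 <= F x)%E ->
  (\int[gaussian p.+1]_x F (dot z x) = \int[normal01]_x F (cnorm z * x)%R)%E.
Proof.
move=> mF F0; have [w w1 zE] := polar_form z.
have mFw (v : 'cV[R]_p.+1) : measurable_fun setT (fun x => F (dot v x)).
  by apply: (measurableT_comp mF); apply: measurable_fun_dot => //; exact: measurable_cst.
rewrite ge0_integral_gaussian//.
rewrite -(ge0_integral_gauss_direction (F := fun y => F (cnorm z * y)) w1)//; last first.
  by apply: (measurableT_comp mF); exact: mscale.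
by apply: eq_integral => x _; rewrite {1}zE dotZl.
Qed.

Lemma integral_gaussian_cos p (z : 'cV[R]_p.+1) (a : R) :
  (\int[gaussian p.+1]_x (1 + cos (a + dot z x))%:E =
   (1 + expR (- (dot z z / 2)) * cos a)%:E)%E.
Proof.
pose F (y : R) := 1 + cos (a + y).
have mF : measurable_fun setT F.
  apply: measurable_funD; first exact: measurable_cst.
  apply: (measurableT_comp (f := @cos R)); first exact: (continuous_measurable_fun (@continuous_cos R)).
  by apply: measurable_funD => //; exact: measurable_cst.
have F0 y : 0 <= F y by rewrite /F -lerBlDl sub0r cos_geN1.
rewrite -[LHS]/(\int[gaussian p.+1]_x (EFin \o F) (dot z x))%E.
rewrite ge0_integral_gaussian_dot; [|exact/measurable_EFinP|by move=> y; rewrite lee_fin].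
rewrite (symmetrized_integral (mscale (cnorm z)) (symscale (cnorm z)) (G := fun y => 1 + cos a * cos y) mF F0); last first.
  by move=> y; rewrite /F !cosD cosN sinN; ring.
rewrite (integral_affine_cos normal01 (mscale _) 1 (cos a)).
by rewrite -/(normal_cos (cnorm z)) normal_cosE sqr_cnorm mulrC.
Qed.

End gaussian.

(** * The limit law *)

Section projected_gaussian.
Context (R : realType) (k : nat).
Notation V := 'cV[R]_k.+2.
Notation leb := (@lebesgue_measure R).
Context (theta : V).
Hypothesis th1 : dot theta theta = 1.

Let mproj : measurable_fun setT (projection theta).
Proof.
rewrite (_ : projection theta = fun x => x + - (dot theta x *: theta))//.
apply: measurable_fun_addV => //; apply: measurable_fun_oppV.
apply: measurable_fun_scaleV; last exact: measurable_cst.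
by apply: measurable_fun_dot => //; exact: measurable_cst.
Qed.

Definition projected_gaussian : probability V R :=
  distribution (gaussian R k.+2) (mfun_Sub (mem_set mproj)).

Lemma dot_projection_sym (x y : V) : dot (projection theta x) y = dot x (projection theta y).
Proof. by rewrite dot_projectionr dotC dot_projectionr (dotC y x) mulrC. Qed.

Lemma ge0_integral_projected_gaussian (F : R -> \bar R) (u : V) :
  measurable_fun setT F -> (forall x, 0 <= F x)%E ->
  (\int[projected_gaussian]_x F (dot u x) =
   \int[normal01 R]_x F (cnorm (projection theta u) * x)%R)%E.
Proof.
move=> mF F0; rewrite -(ge0_integral_gaussian_dot (projection theta u) mF F0).
rewrite ge0_integral_distribution//; last first.
  by apply: (measurableT_comp mF); apply: measurable_fun_dot => //; exact: measurable_cst.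
by apply: eq_integral => x _ /=; rewrite dot_projection_sym.
Qed.

Lemma integral_projected_gaussian_cos (z : V) (a : R) :
  (\int[projected_gaussian]_x (1 + cos (a + dot z x))%:E =
   (1 + expR (- (dot (projection theta z) (projection theta z) / 2)) * cos a)%:E)%E.
Proof.
pose F (y : R) := (1 + cos (a + y))%:E.
have mF : measurable_fun setT F.
  apply/measurable_EFinP; apply: measurable_funD; first exact: measurable_cst.
  apply: (measurableT_comp (f := @cos R)); first exact: (continuous_measurable_fun (@continuous_cos R)).
  by apply: measurable_funD => //; exact: measurable_cst.
have F0 y : (0 <= F y)%E by rewrite lee_fin -lerBlDl sub0r cos_geN1.
rewrite -[LHS]/(\int[projected_gaussian]_x F (dot z x))%E (ge0_integral_projected_gaussian z mF F0).
by rewrite -(ge0_integral_gaussian_dot _ mF F0) integral_gaussian_cos.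
Qed.

(** As [Gamma] is a symmetric projector, [u'Gamma Z] is a standard normal variable times the length
    of [Gamma u]; for [u] proportional to [theta] that length is 0 and the law is a point mass. *)
Lemma multinormal_projected_gaussian :
  multinormal 0 (Gamma_mx theta) projected_gaussian.
Proof.
move=> u A mA; rewrite dot0r Gamma_mx_mul.
have -> : dot u (projection theta u) = cnorm (projection theta u) ^+ 2.
  by rewrite sqr_cnorm (dot_projection th1) dot_projectionr.
set s := cnorm _; have s0 : 0 <= s by exact: cnorm_ge0.
have mI : measurable_fun setT (fun y : R => (\1_A y)%:E : \bar R).
  by apply/measurable_EFinP; exact: measurable_indic.
have -> : projected_gaussian ((fun x => dot u x) @^-1` A) =
    (\int[normal01 R]_x (\1_A (s * x))%:E)%E.
  rewrite -(ge0_integral_projected_gaussian u mI); last by move=> y; rewrite lee_fin.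
  have mB : measurable ((fun x => dot u x) @^-1` A).
    have md : measurable_fun setT (fun x => dot u x).
      by apply: measurable_fun_dot => //; exact: measurable_cst.
    by have := md measurableT A mA; rewrite setTI.
  rewrite -[in LHS](setIT ((fun x => dot u x) @^-1` A)) -integral_indic//.
rewrite /normal_law sqrf_eq0; have [s00|sn0] := eqVneq s 0.
  under eq_integral => x _ do rewrite s00 mul0r.
  by rewrite integral_cst// [X in (_ * X)%E]probability_setT mule1 diracE indicE.
have sp : 0 < s by rewrite lt_def sn0.
rewrite sqrtr_sqr ger0_norm// /normal_prob.
have mIs : measurable_fun setT (fun x : R => (\1_A (s * x))%:E : \bar R).
  by apply: (measurableT_comp mI); exact: measurable_funM.
rewrite (integral_normal01 mIs) => [|x]; last by rewrite lee_fin.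
transitivity (\int[leb]_x ((\1_A x)%:E * (normal_pdf 0 s x)%:E))%E; last first.
  rewrite [RHS]integral_mkcond; apply: eq_integral => x _.
  by rewrite patchE indicE; case: ifP => _; rewrite ?mul1e ?mul0e.
have mG : measurable_fun setT (fun x : R => (\1_A x)%:E * (normal_pdf 0 s x)%:E)%E.
  by apply: emeasurable_funM => //; apply/measurable_EFinP; exact: measurable_normal_pdf.
have G0 x : (0 <= (\1_A x)%:E * (normal_pdf 0 s x)%:E)%E.
  by rewrite mule_ge0// lee_fin normal_pdf_ge0.
rewrite [RHS](ge0_integral_affine mG G0 0 sp); apply: eq_integral => x _.
rewrite addr0 -muleA -EFinM.
suff -> : normal_pdf 0 1 x = normal_pdf 0 s (s * x) * s by [].
rewrite !normal_pdfE ?oner_neq0// /normal_fun !subr0.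
have -> : normal_peak (1 : R) = normal_peak s * s.
  have sqrtE (a : R) : 0 <= a -> Num.sqrt (a ^+ 2 * pi *+ 2) = a * Num.sqrt (pi *+ 2).
    by move=> a0; rewrite -(mulrnAr (a ^+ 2) pi 2) sqrtrM ?sqr_ge0// sqrtr_sqr ger0_norm.
  rewrite /normal_peak !sqrtE// mul1r.
  have p0 : 0 < Num.sqrt (pi *+ 2 : R) by rewrite sqrtr_gt0 mulrn_wgt0// pi_gt0.
  by rewrite invfM mulrAC mulVf// mul1r.
have -> : - (s * x) ^+ 2 / (s ^+ 2 *+ 2) = - x ^+ 2 / (1 ^+ 2 *+ 2).
  by rewrite expr1n; field.
by rewrite mulrAC.
Qed.

End projected_gaussian.

(** * Weak convergence from cosine transforms *)

Section continuous_measurable.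
Context (R : realType) (p : nat).
Notation V := 'cV[R]_p.+1.

Lemma mx_norm_le (x : V) (e : R) : 0 <= e -> (forall i, `|x i 0| <= e) -> `|x| <= e.
Proof.
move=> e0 h; rewrite [leLHS]mx_normrE; apply: bigmax_le => // -[i j] _ /=.
by rewrite (ord1 j).
Qed.

Let grid_index m (x : V) : 'cV[int]_p.+1 := \col_i Num.floor (x i 0 * m.+1%:R).

Let grid_point m (v : 'cV[int]_p.+1) : V := \col_i ((v i 0)%:~R / m.+1%:R).

Let grid_cvg (x : V) : grid_point m (grid_index m x) @[m --> \oo] --> x.
Proof.
apply/cvgrPdist_le => e e0.
have : (m.+1%:R^-1 : R) @[m --> \oo] --> (0 : R) by exact: cvg_invS.
move=> /cvgrPdist_le /(_ e e0); apply: filterS => m; rewrite sub0r normrN => me.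
apply: mx_norm_le => [|i]; first exact: ltW.
have N0 : 0 < m.+1%:R :> R by [].
rewrite !mxE; set y := x i 0; apply: le_trans me; rewrite [leRHS]ger0_norm ?invr_ge0//.
have /andP[h1 h2] := floor_itv (y * m.+1%:R).
have -> : y - (Num.floor (y * m.+1%:R))%:~R / m.+1%:R =
  (y * m.+1%:R - (Num.floor (y * m.+1%:R))%:~R) / m.+1%:R.
  by field; rewrite lt0r_neq0.
rewrite normrM [X in _ * X]ger0_norm ?invr_ge0// ler_piMl ?invr_ge0//.
rewrite ger0_norm ?subr_ge0// lerBlDl; move: h2; rewrite intrD => /ltW.
by [].
Qed.

Let measurable_grid m (h : 'cV[int]_p.+1 -> R) :
  measurable_fun setT (fun x : V => h (grid_index m x)).
Proof.
move=> _ B mB; rewrite setTI.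
rewrite (_ : _ @^-1` B = \bigcup_v [set x | grid_index m x = v /\ B (h v)]); last first.
  apply/seteqP; split => x /=; first by exists (grid_index m x).
  by move=> [v _ /= [-> ]].
apply: countable_bigcupT_measurable => [|v]; first exact: countableP.
have [Bv|nBv] := pselect (B (h v)); last first.
  by rewrite (_ : [set _ | _] = set0)//; apply/seteqP; split => x //= [_].
rewrite (_ : [set _ | _] = \bigcap_(i in [set: 'I_p.+1])
    [set x : V | (v i 0)%:~R <= x i 0 * m.+1%:R < (v i 0 + 1)%:~R]); last first.
  apply/seteqP; split => x /=.
    by move=> [<- _] i _ /=; rewrite mxE; exact: floor_itv.
  move=> h'; split => //; apply/colP => i; rewrite mxE; exact/floor_def/h'.
apply: fin_bigcap_measurable => // i _.
have mi : measurable_fun setT (fun x : V => x i 0 * m.+1%:R).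
  by apply: measurable_funM; [exact: measurable_entry|exact: measurable_cst].
have := mi measurableT _ (measurable_itv `[(v i 0)%:~R, (v i 0 + 1)%:~R[).
by rewrite setTI; congr measurable; apply/seteqP; split => x /=; rewrite in_itv.
Qed.

(** The sigma-algebra is generated by the entries, so the topology enters through approximation: [g]
    is the pointwise limit of its values on grids of mesh [1 / (m + 1)], functions of an index with
    countably many values. *)
Lemma continuous_measurable_cV (g : V -> R) : continuous g -> measurable_fun setT g.
Proof.
move=> cg; apply: (@measurable_fun_cvg _ _ _ _ (fun m x => g (grid_point m (grid_index m x)))).
  by move=> m; exact: (measurable_grid m (fun v => g (grid_point m v))).
by move=> x _; apply: continuous_cvg; [exact: cg|exact: grid_cvg].
Qed.

End continuous_measurable.

(** * Lipschitz approximation from below *)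

Section inf_convolution.
Context (R : realType) (p : nat).
Notation V := 'cV[R]_p.+1.
Context (g : V -> R) (C : R).
Hypotheses (g0 : forall x, 0 <= g x) (gC : forall x, g x <= C).

(** The Pasch-Hausdorff envelope of [g], its largest [k]-Lipschitz minorant for the norm of the
    largest entry. *)
Definition inf_convolution (k : nat) (x : V) : R :=
  inf [set g y + k%:R * `|x - y| | y in setT].

Let lbS k x : has_lbound [set g y + k%:R * `|x - y| | y in setT].
Proof. by exists 0 => _ [y _ <-]; rewrite addr_ge0// mulr_ge0. Qed.

Let neS k x : [set g y + k%:R * `|x - y| | y in setT] !=set0.
Proof. by exists (g x + k%:R * `|x - x|), x. Qed.

Lemma inf_convolution_le k x y : inf_convolution k x <= g y + k%:R * `|x - y|.
Proof. by apply: ge_inf; [exact: lbS|exists y]. Qed.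

Lemma inf_convolution_ge0 k x : 0 <= inf_convolution k x.
Proof. by apply: lb_le_inf; [exact: neS|move=> _ [y _ <-]; rewrite addr_ge0// mulr_ge0]. Qed.

Lemma inf_convolution_leg k x : inf_convolution k x <= g x.
Proof. by have := inf_convolution_le k x x; rewrite subrr normr0 mulr0 addr0. Qed.

Lemma inf_convolution_lip k x y :
  inf_convolution k x <= inf_convolution k y + k%:R * `|x - y|.
Proof.
rewrite -lerBlDr; apply: lb_le_inf; first exact: neS.
move=> _ [z _ <-]; rewrite lerBlDr; apply: (le_trans (inf_convolution_le k x z)).
rewrite -addrA lerD2l -mulrDr ler_wpM2l//.
by rewrite -(subrKA y) addrC ler_normD.
Qed.

Lemma continuous_lip (h : V -> R) (K : R) : 0 <= K ->
  (forall x y, h x <= h y + K * `|x - y|) -> continuous h.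
Proof.
move=> K0 hl x; apply/(@cvgrPdist_le _ _ _ (nbhs x) (nbhs_filter x)) => e e0.
have d0 : 0 < e / (K + 1) by rewrite divr_gt0// ltr_wpDl.
have := @nbhsx_ballx _ _ x _ d0; apply: filterS => y.
rewrite mx_norm_ball /ball_/= => xy.
have hxy : K * `|x - y| <= e.
  apply: (@le_trans _ _ ((K + 1) * (e / (K + 1)))).
    by apply: ler_pM => //; [rewrite lerDl|exact: ltW].
  by rewrite mulrCA divff ?mulr1// lt0r_neq0// ltr_wpDl.
rewrite ler_norml; apply/andP; split.
  by rewrite lerBrDl -lerBrDr opprK; have := hl y x; rewrite distrC; lra.
by rewrite lerBlDl; have := hl x y; lra.
Qed.

Lemma inf_convolution_cvg x : {for x, continuous g} ->
  inf_convolution k x @[k --> \oo] --> g x.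
Proof.
move=> cg; have C0 : 0 <= C by exact: le_trans (g0 x) (gC x).
apply/cvgrPdist_le => e e0.
have /cvgrPdist_le /(_ e e0) := cg; rewrite -nbhs_ballE => -[d /= d0 hd].
have := @nbhs_infty_ger R (C / d); apply: filterS => k kd.
rewrite ger0_norm ?subr_ge0 ?inf_convolution_leg// lerBlDr -lerBlDl.
apply: lb_le_inf; first exact: neS.
(* Near [x] continuity bounds [g y] from below; farther away the penalty alone exceeds [C], by the
   choice of [k]. *)
move=> _ [y _ <-]; have [xy|xy] := ltP `|x - y| d.
  have := hd y; rewrite mx_norm_ball /ball_/= => /(_ xy); rewrite ler_norml => /andP[_ h].
  have : 0 <= k%:R * `|x - y| by rewrite mulr_ge0.
  lra.
have : C <= k%:R * `|x - y|.
  apply: (@le_trans _ _ (C / d * d)); first by rewrite divfK// lt0r_neq0.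
  by apply: ler_pM => //; [rewrite divr_ge0// ltW|exact: ltW].
by have := gC x; have := g0 y; lra.
Qed.

End inf_convolution.

Lemma cvge_near_le (R : realType) (u : nat -> \bar R) (l e : R) : 0 < e ->
  u n @[n --> \oo] --> l%:E -> \forall n \near \oo, (l%:E <= u n + e%:E)%E.
Proof.
move=> e0 /fine_cvgP[ufin /cvgrPdist_le /(_ e e0)]; apply: filterS2 ufin => n un.
by rewrite -(fineK un) -EFinD lee_fin ler_norml /= => /andP[_]; rewrite lerBlDl addrC.
Qed.

(** * Gaussian smoothing and weak convergence *)

Section smoothing.
Context (R : realType) (p : nat).
Notation V := 'cV[R]_p.+1.
Notation L := (@lebesgue_cV R p.+1).
Notation G := (gaussian R p.+1).

Let mgauss : measurable_fun setT (@gauss_density R p.+1) := @measurable_gauss_density R p.+1.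

Section fixed_scale.
Context (s : R).
Hypothesis s0 : 0 < s.

(** The density at [a] of [X + s * Z], with [X] of law [mu] and [Z] an independent standard Gaussian
    vector. *)
Definition kernel_density (mu : probability V R) (a : V) : \bar R :=
  ((s ^- p.+1)%:E * \int[mu]_x (gauss_density (s^-1 *: (a - x)))%:E)%E.

Let mker : measurable_fun setT (fun w : V * V => gauss_density (s^-1 *: (w.2 - w.1))).
Proof.
apply: (measurableT_comp mgauss); apply: measurable_fun_scaleV; first exact: measurable_cst.
apply: measurable_fun_addV; first exact: measurable_snd.
by apply: measurable_fun_oppV; exact: measurable_fst.
Qed.

Lemma measurable_kernel_density mu : measurable_fun setT (kernel_density mu).
Proof.
apply: emeasurable_funM; first exact: measurable_cst.
apply: (measurable_fun_fubini_tonelli_G (m1 := mu)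
  (fun w : V * V => (gauss_density (s^-1 *: (w.2 - w.1)))%:E)).
  exact/measurable_EFinP.
by move=> w; rewrite lee_fin gauss_density_ge0.
Qed.

Lemma kernel_density_ge0 mu a : (0 <= kernel_density mu a)%E.
Proof.
rewrite mule_ge0 ?lee_fin ?invr_ge0 ?exprn_ge0 ?(ltW s0)//.
by apply: integral_ge0 => x _; rewrite lee_fin gauss_density_ge0.
Qed.

Lemma integral_smoothing (mu : probability V R) (g : V -> R) :
  measurable_fun setT g -> (forall x, 0 <= g x) ->
  (\int[mu]_x \int[G]_z (g (x + s *: z))%:E =
   \int[L]_a ((g a)%:E * kernel_density mu a))%E.
Proof.
move=> mg g0.
have mgE : measurable_fun setT (fun x => (g x)%:E) by exact/measurable_EFinP.
have gE0 x : (0 <= (g x)%:E)%E by rewrite lee_fin.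
pose F (w : V * V) := ((g w.2)%:E * (s ^- p.+1 * gauss_density (s^-1 *: (w.2 - w.1)))%:E)%E.
have sp : 0 < s ^- p.+1 by rewrite invr_gt0 exprn_gt0.
have mF : measurable_fun setT F.
  apply: emeasurable_funM; first by apply: (measurableT_comp mgE); exact: measurable_snd.
  by apply/measurable_EFinP; apply: measurable_funM => //; exact: measurable_cst.
have F0 w : (0 <= F w)%E by rewrite mule_ge0// lee_fin mulr_ge0 ?gauss_density_ge0// ltW.
have inner x : (\int[G]_z (g (x + s *: z))%:E = \int[L]_a F (x, a))%E.
  have mshift : measurable_fun setT (fun z : V => (g (x + s *: z))%:E).
    apply: (measurableT_comp mgE); apply: measurable_fun_addV; first exact: measurable_cst.
    by apply: measurable_fun_scaleV => //; exact: measurable_cst.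
  rewrite ge0_integral_gaussian//.
  have mFx : measurable_fun setT (fun a => F (x, a)).
    by apply: (measurableT_comp mF); exact: pair1_measurable.
  rewrite -(ge0_integral_cV_shift x mFx)//.
  rewrite [RHS](ge0_integral_cV_scale s0)//; last first.
    apply: (measurableT_comp mFx); apply: measurable_fun_addV => //; exact: measurable_cst.
  apply: eq_integral => z _; rewrite /F/= addrK scalerA mulVf ?lt0r_neq0// scale1r addrC.
  suff {1}-> : gauss_density z = s ^- p.+1 * gauss_density z * s ^+ p.+1.
    by rewrite EFinM muleA.
  by rewrite mulrAC mulVf ?mul1r// expf_neq0// lt0r_neq0.
under eq_integral => x _ do rewrite inner.
rewrite (fubini_tonelli (m1 := mu) (m2 := L) F mF F0); apply: eq_integral => a _.
have mk : measurable_fun setT (fun x : V => (gauss_density (s^-1 *: ((a : V) - x)))%:E).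
  apply/measurable_EFinP; apply: (measurableT_comp (g := fun x : V => (x, a)) mker).
  exact: pair2_measurable.
rewrite /kernel_density muleA -EFinM -ge0_integralZl//.
- by apply: eq_integral => x _; rewrite /F/= -!EFinM mulrA.
- by move=> x _; rewrite lee_fin gauss_density_ge0.
- by rewrite lee_fin mulr_ge0// ltW.
Qed.

Lemma integral_kernel_density mu : (\int[L]_a kernel_density mu a = 1)%E.
Proof.
have := @integral_smoothing mu (cst 1) (measurable_cst _) (fun=> ler01).
have -> : (\int[mu]_x \int[G]_z (cst 1 (x + s *: z))%:E = 1)%E.
  transitivity (\int[mu]_x (cst 1%E x))%E; last first.
    by rewrite integral_cst// mul1e [LHS]probability_setT.
  apply: eq_integral => x _; transitivity (\int[G]_z (cst 1%E z))%E => //.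
  by rewrite integral_cst// mul1e; exact: probability_setT.
by move=> h; rewrite [RHS]h; apply: eq_integral => a _; rewrite mul1e.
Qed.

Section kernel_limit.
Context (mu : nat -> probability V R) (nu : probability V R).
Hypothesis cos_cvg : forall (z : V) (a : R),
  (\int[mu n]_x (1 + cos (a + dot z x))%:E)%E @[n --> \oo] -->
  (\int[nu]_x (1 + cos (a + dot z x))%:E)%E.

(** The Gaussian density at the origin, which is also the constant of Fourier inversion:
    [gauss_density y] is [peak] times the mean of [cos (y'Z)]. *)
Let peak : R := normal_peak 1 ^+ p.+1.

Let peak0 : 0 < peak. Proof. by rewrite exprn_gt0// normal_peak_gt0. Qed.

Let cos_integral (m : probability V R) (a z : V) :=
  (\int[m]_x (1 + cos (- (s^-1 * dot a z) + dot (s^-1 *: z) x))%:E)%E.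

Let mcos : measurable_fun setT (fun w : V * (V * V) =>
  1 + cos (- (s^-1 * dot w.1 w.2.1) + dot (s^-1 *: w.2.1) w.2.2)).
Proof.
have m1 : measurable_fun setT (fun w : V * (V * V) => w.2.1).
  by apply: (measurableT_comp (f := fst)) => //; exact: measurable_snd.
have m2 : measurable_fun setT (fun w : V * (V * V) => w.2.2).
  by apply: (measurableT_comp (f := snd)) => //; exact: measurable_snd.
apply: measurable_funD; first exact: measurable_cst.
apply: (measurableT_comp (f := @cos R)); first exact: (continuous_measurable_fun (@continuous_cos R)).
apply: measurable_funD.
  apply: measurable_funN; apply: measurable_funM; first exact: measurable_cst.
  by apply: measurable_fun_dot => //; exact: measurable_fst.
apply: measurable_fun_dot => //; apply: measurable_fun_scaleV => //; exact: measurable_cst.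
Qed.

Let mcos_a a : measurable_fun setT (fun w : V * V =>
  1 + cos (- (s^-1 * dot a w.1) + dot (s^-1 *: w.1) w.2)).
Proof. by apply: (measurableT_comp (g := fun w : V * V => (a, w)) mcos); exact: pair1_measurable. Qed.

Let cos_bounds (y : R) : 0 <= 1 + cos y <= 2.
Proof. by rewrite -lerBlDl sub0r cos_geN1/= -[2]/(1 + 1) lerD2l cos_le1. Qed.

(* Fourier inversion for the Gaussian kernel; the constant 1 keeps the
   integrands nonnegative. *)
Let kernel_cos (m : probability V R) a :
  (peak%:E + \int[m]_x (gauss_density (s^-1 *: (a - x)))%:E =
   peak%:E * \int[G]_z cos_integral m a z)%E.
Proof.
have mG : measurable_fun setT (fun w : V * V =>
    (1 + cos (- (s^-1 * dot a w.1) + dot (s^-1 *: w.1) w.2))%:E).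
  by apply/measurable_EFinP.
have G0 (w : V * V) : (0 <= (1 + cos (- (s^-1 * dot a w.1) + dot (s^-1 *: w.1) w.2))%:E)%E.
  by rewrite lee_fin; have /andP[] := cos_bounds (- (s^-1 * dot a w.1) + dot (s^-1 *: w.1) w.2).
rewrite /cos_integral (fubini_tonelli (m1 := G) (m2 := m) _ mG G0)/=.
have mk : measurable_fun setT (fun x : V => (gauss_density (s^-1 *: (a - x)))%:E).
  apply/measurable_EFinP; apply: (measurableT_comp (g := fun x : V => (x, a)) mker).
  exact: pair2_measurable.
have k0 x : (0 <= (gauss_density (s^-1 *: (a - x)))%:E)%E by rewrite lee_fin gauss_density_ge0.
have -> : (peak%:E + \int[m]_x (gauss_density (s^-1 *: (a - x)))%:E =
    \int[m]_x (peak%:E + (gauss_density (s^-1 *: (a - x)))%:E))%E.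
  rewrite ge0_integralD//; last by move=> x _; rewrite lee_fin ltW.
  by rewrite integral_cst// [X in (_ * X + _)%E]probability_setT mule1.
rewrite -ge0_integralZl//; last 3 first.
- exact: (measurable_fun_fubini_tonelli_G (m1 := G) _ mG G0).
- by move=> x _; apply: integral_ge0 => z _; exact: (G0 (z, x)).
- by rewrite lee_fin ltW.
apply: eq_integral => x _.
transitivity (peak%:E * (1 + expR (- (dot (s^-1 *: (x - a)) (s^-1 *: (x - a)) / 2)) * cos 0)%:E)%E.
  rewrite cos0 mulr1 -EFinM -EFinD mulrDr mulr1; congr (_ + _)%:E.
  have dE : dot (s^-1 *: (a - x)) (s^-1 *: (a - x)) = dot (s^-1 *: (x - a)) (s^-1 *: (x - a)).
    by rewrite -opprB scalerN dotNl dotNr opprK.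
  by rewrite gauss_densityE dE mulNr.
rewrite -integral_gaussian_cos; congr (_ * _)%E; apply: eq_integral => z _.
congr (1 + cos _)%:E; rewrite add0r !dotZl dotBl (dotC z); ring.
Qed.

Let cos_integral_ge0 m a z : (0 <= cos_integral m a z)%E.
Proof.
by apply: integral_ge0 => x _; rewrite lee_fin;
  have /andP[] := cos_bounds (- (s^-1 * dot a z) + dot (s^-1 *: z) x).
Qed.

Let cos_integral_le2 m a z : (cos_integral m a z <= 2%:E)%E.
Proof.
apply: (@le_trans _ _ (\int[m]_x (cst 2%:E x))%E); last first.
  by rewrite integral_cst// [X in (_ * X)%E]probability_setT mule1.
apply: ge0_le_integral => //.
- apply/measurable_EFinP; apply: (measurableT_comp (g := fun x : V => (z, x)) (mcos_a a)).
  exact: pair1_measurable.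
- by move=> x _; rewrite lee_fin;
    have /andP[] := cos_bounds (- (s^-1 * dot a z) + dot (s^-1 *: z) x).
Qed.

Let measurable_cos_integral m a : measurable_fun setT (cos_integral m a).
Proof.
apply: (measurable_fun_fubini_tonelli_F (m2 := m)
  (fun w : V * V => (1 + cos (- (s^-1 * dot a w.1) + dot (s^-1 *: w.1) w.2))%:E)).
  exact/measurable_EFinP.
by move=> w; rewrite lee_fin;
  have /andP[] := cos_bounds (- (s^-1 * dot a w.1) + dot (s^-1 *: w.1) w.2).
Qed.

Let kernel_densityE m a : kernel_density m a =
  ((s ^- p.+1)%:E * (peak%:E * \int[G]_z cos_integral m a z - peak%:E))%E.
Proof. by rewrite -kernel_cos [(peak%:E + _)%E]addeC addeK. Qed.

Let kernel_density_fin m a : kernel_density m a \is a fin_num.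
Proof.
rewrite kernel_densityE fin_numM// fin_numB fin_numM// ge0_fin_numE.
  apply: (@le_lt_trans _ _ (\int[G]_z (cst 2%:E z))%E).
    by apply: ge0_le_integral => // z _; exact: cos_integral_le2.
  by rewrite integral_cst// [X in (_ * X)%E]probability_setT mule1 ltry.
by apply: integral_ge0 => z _.
Qed.

Lemma kernel_density_cvg a :
  kernel_density (mu n) a @[n --> \oo] --> kernel_density nu a.
Proof.
rewrite kernel_densityE; under eq_cvg do rewrite kernel_densityE.
apply: cvgeZl => //; apply: cvgeB; [by rewrite fin_num_adde_defl// fin_numN| |exact: cvg_cst].
apply: cvgeZl => //.
apply: (@dominated_cvg _ _ _ G setT measurableT (fun n => cos_integral (mu n) a) _ (cst 2%:E)) => //.
- by move=> z _; exact: cos_cvg.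
- exact: finite_measure_integrable_cst.
- by move=> n z _; rewrite gee0_abs//; exact: cos_integral_le2.
Qed.

Lemma smoothing_liminf (g : V -> R) (C : R) : measurable_fun setT g ->
  (forall x, 0 <= g x <= C) -> forall e : R, 0 < e -> \forall n \near \oo,
  (\int[nu]_x \int[G]_z (g (x + s *: z))%:E <=
   \int[mu n]_x \int[G]_z (g (x + s *: z))%:E + e%:E)%E.
Proof.
move=> mg gC e e0; have g0 x : 0 <= g x by have /andP[] := gC x.
have mgE : measurable_fun setT (fun x => (g x)%:E) by exact/measurable_EFinP.
(* Truncating by the limit density makes dominated convergence applicable, and
   a lower bound is all that is needed. *)
pose q n a := Order.min (kernel_density (mu n) a) (kernel_density nu a).
have mq n : measurable_fun setT (q n).
  by apply: measurable_mine; exact: measurable_kernel_density.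
have qcvg a : q n a @[n --> \oo] --> kernel_density nu a.
  rewrite -[X in _ --> X](@minxx _ _ (kernel_density nu a)).
  apply: (@continuous2_cvg _ _ _ _ _ _ _ _ (fun x y : \bar R => Order.min x y)).
  - exact: (@min_continuous _ (\bar R) (kernel_density nu a, kernel_density nu a)).
  - exact: kernel_density_cvg.
  - exact: cvg_cst.
have : (\int[L]_a ((g a)%:E * q n a))%E @[n --> \oo] --> (\int[L]_a ((g a)%:E * kernel_density nu a))%E.
  apply: (@dominated_cvg _ _ _ L setT measurableT (fun n a => ((g a)%:E * q n a)%E) _ (fun a => (C%:E * kernel_density nu a)%E)) => //.
  - by move=> n; exact: emeasurable_funM.
  - by move=> a _; apply: cvgeZl => //; exact: qcvg.
  - by move=> a _; rewrite fin_numM.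
  - apply: integrableZl => //; apply/integrableP; split; first exact: measurable_kernel_density.
    under eq_integral => a _ do rewrite gee0_abs ?kernel_density_ge0//.
    by rewrite integral_kernel_density ltry.
  - move=> n a _; rewrite gee0_abs; last by rewrite mule_ge0 ?lee_fin// le_min !kernel_density_ge0.
    apply: lee_pmul; rewrite ?lee_fin//; first by rewrite le_min !kernel_density_ge0.
      by have /andP[] := gC a.
    by rewrite ge_min lexx orbT.
set I := (\int[L]_a _)%E => cI.
have I0 : (0 <= I)%E by apply: integral_ge0 => a _; rewrite mule_ge0 ?lee_fin// kernel_density_ge0.
have C0 : 0 <= C by exact: le_trans (g0 0) (proj2 (andP (gC 0))).
have IC : (I <= C%:E)%E.
  rewrite -[leRHS]mule1 -(integral_kernel_density nu) -ge0_integralZl//; last 2 first.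
  - exact: measurable_kernel_density.
  - by move=> a _; exact: kernel_density_ge0.
  apply: ge0_le_integral => //.
  - by move=> a _; rewrite mule_ge0 ?lee_fin// kernel_density_ge0.
  - by apply: emeasurable_funM => //; exact: measurable_kernel_density.
  - by apply: emeasurable_funM; [exact: measurable_cst|exact: measurable_kernel_density].
  - move=> a _; apply: lee_wpmul2r; first exact: kernel_density_ge0.
    by rewrite lee_fin; have /andP[] := gC a.
have Ifin : I \is a fin_num by rewrite ge0_fin_numE// (le_lt_trans IC)// ltry.
move: cI; rewrite -(fineK Ifin) => /(cvge_near_le e0); apply: filterS => n.
rewrite (integral_smoothing nu mg g0) (integral_smoothing (mu n) mg g0) -/I (fineK Ifin).
move=> /le_trans; apply; rewrite leeD2r//; apply: ge0_le_integral => //.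
- by move=> a _; rewrite mule_ge0 ?lee_fin// le_min !kernel_density_ge0.
- exact: emeasurable_funM.
- by apply: emeasurable_funM => //; exact: measurable_kernel_density.
- by move=> a _; apply: lee_wpmul2l; [rewrite lee_fin|rewrite ge_min lexx].
Qed.

End kernel_limit.
End fixed_scale.

Section lipschitz.
Context (g : V -> R) (C K : R).
Hypotheses (g0 : forall x, 0 <= g x) (gC : forall x, g x <= C) (K0 : 0 <= K).
Hypothesis gl : forall x y, g x <= g y + K * `|x - y|.

(** Bounds the mean change of [g] under a Gaussian perturbation of scale [s], uniformly in the
    point. The cap [C] keeps the integrand bounded, so dominated convergence needs no moment of the
    norm of [Z]. *)
Definition smoothing_error (s : R) : \bar R :=
  (\int[G]_z (Num.min C (K * (s * `|z|)))%:E)%E.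

Let mg : measurable_fun setT g.
Proof. by apply: continuous_measurable_cV; exact: continuous_lip gl. Qed.

Let C0 : 0 <= C. Proof. exact: le_trans (g0 0) (gC 0). Qed.

Let mnorm : measurable_fun setT (fun z : V => `|z|).
Proof. by apply: continuous_measurable_cV; exact: norm_continuous. Qed.

Let merr s : measurable_fun setT (fun z : V => (Num.min C (K * (s * `|z|)))%:E).
Proof.
apply/measurable_EFinP; apply: measurable_minr; first exact: measurable_cst.
by apply: measurable_funM; [exact: measurable_cst|apply: measurable_funM => //; exact: measurable_cst].
Qed.

Let err0 s (z : V) : 0 <= s -> 0 <= Num.min C (K * (s * `|z|)).
Proof. by move=> s0; rewrite le_min C0/= mulr_ge0// mulr_ge0. Qed.

Lemma smoothing_error_cvg : smoothing_error n.+1%:R^-1 @[n --> \oo] --> 0%E.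
Proof.
rewrite [X in _ --> X](_ : _ = (\int[G]_z (cst 0%E z))%E); last by rewrite integral0.
apply: (@dominated_cvg _ _ _ G setT measurableT
  (fun n (z : V) => (Num.min C (K * (n.+1%:R^-1 * `|z|)))%:E) _ (cst C%:E)) => //.
- move=> z _; apply: cvg_EFin; first exact: nearW.
  have h : K * (n.+1%:R^-1 * `|z|) @[n --> \oo] --> (0 : R).
    rewrite -(mulr0 K); apply: cvgM; first exact: cvg_cst.
    by rewrite -[X in _ --> X](mul0r `|z|); apply: cvgM; [exact: cvg_invS|exact: cvg_cst].
  apply: (squeeze_cvgr _ (cvg_cst 0) h); apply: nearW => n /=.
  by rewrite err0 ?invr_ge0//= ge_min lexx orbT.
- exact: finite_measure_integrable_cst.
- by move=> n z _; rewrite abse_EFin lee_fin ger0_norm ?err0 ?invr_ge0// ge_min lexx.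
Qed.

Let inner_le (s : R) (x : V) : 0 < s ->
  (\int[G]_z (g (x + s *: z))%:E <= (g x)%:E + smoothing_error s)%E /\
  ((g x)%:E <= \int[G]_z (g (x + s *: z))%:E + smoothing_error s)%E.
Proof.
move=> s0; have ms : measurable_fun setT (fun z : V => (g (x + s *: z))%:E).
  apply/measurable_EFinP; apply: (measurableT_comp mg); apply: measurable_fun_addV.
    exact: measurable_cst.
  by apply: measurable_fun_scaleV => //; exact: measurable_cst.
have gcst (r : R) : (\int[G]_z (cst r%:E z) = r%:E)%E.
  by rewrite integral_cst// [X in (_ * X)%E]probability_setT mule1.
have sz1 (z : V) : `|x + s *: z - x| = s * `|z|.
  by rewrite [x + _]addrC addrK normrZ gtr0_norm.
have sz2 (z : V) : `|x - (x + s *: z)| = s * `|z| by rewrite distrC sz1.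
have e0 (z : V) : (0 <= (Num.min C (K * (s * `|z|)))%:E)%E by rewrite lee_fin err0// ltW.
have gs0 (z : V) : (0 <= (g (x + s *: z))%:E)%E by rewrite lee_fin.
have gx0 : (0 <= (g x)%:E)%E by rewrite lee_fin.
have bound (a b w : R) : a <= C -> 0 <= b -> a <= b + w -> a <= b + Num.min C w.
  by move=> aC b0 aw; rewrite -lerBlDl le_min !lerBlDl aw andbT; lra.
split.
  apply: (@le_trans _ _ (\int[G]_z ((g x)%:E + (Num.min C (K * (s * `|z|)))%:E))%E).
    apply: ge0_le_integral => //; first by apply: emeasurable_funD => //; exact: measurable_cst.
    by move=> z _; rewrite -EFinD lee_fin bound// -(sz1 z).
  by rewrite ge0_integralD// gcst.
apply: (@le_trans _ _ (\int[G]_z ((g (x + s *: z))%:E + (Num.min C (K * (s * `|z|)))%:E))%E).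
  rewrite -(gcst (g x)); apply: ge0_le_integral => //; first exact: emeasurable_funD.
  by move=> z _; rewrite -EFinD lee_fin bound// -(sz2 z).
by rewrite ge0_integralD.
Qed.

Lemma smoothing_bounds (s : R) (m : probability V R) : 0 < s ->
  (\int[m]_x \int[G]_z (g (x + s *: z))%:E <= \int[m]_x (g x)%:E + smoothing_error s)%E /\
  (\int[m]_x (g x)%:E <= \int[m]_x \int[G]_z (g (x + s *: z))%:E + smoothing_error s)%E.
Proof.
move=> s0; have mF : measurable_fun setT (fun w : V * V => (g (w.1 + s *: w.2))%:E).
  apply/measurable_EFinP; apply: (measurableT_comp mg); apply: measurable_fun_addV.
    exact: measurable_fst.
  by apply: measurable_fun_scaleV; [exact: measurable_cst|exact: measurable_snd].
have F0 (w : V * V) : (0 <= (g (w.1 + s *: w.2))%:E)%E by rewrite lee_fin.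
have mI : measurable_fun setT (fun x : V => \int[G]_z (g (x + s *: z))%:E)%E.
  exact: (measurable_fun_fubini_tonelli_F (m2 := G) _ mF F0).
have I0 (x : V) : (0 <= \int[G]_z (g (x + s *: z))%:E)%E by apply: integral_ge0 => z _; rewrite lee_fin.
have E0 : (0 <= smoothing_error s)%E.
  by apply: integral_ge0 => z _; rewrite lee_fin err0// ltW.
have mgE : measurable_fun setT (fun x => (g x)%:E) by exact/measurable_EFinP.
have gE0 x : (0 <= (g x)%:E)%E by rewrite lee_fin.
have Ecst : (\int[m]_x (cst (smoothing_error s) x) = smoothing_error s)%E.
  by rewrite integral_cst// [X in (_ * X)%E]probability_setT mule1.
have mE : measurable_fun [set: V] (cst (smoothing_error s)) by exact: measurable_cst.
split; rewrite -Ecst -ge0_integralD//; apply: ge0_le_integral => //.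
- exact: emeasurable_funD.
- by move=> x _; have [] := inner_le x s0.
- exact: emeasurable_funD.
- by move=> x _; have [] := inner_le x s0.
Qed.

End lipschitz.

Section weak_convergence.
Context (mu : nat -> probability V R) (nu : probability V R).
Hypothesis cos_cvg : forall (z : V) (a : R),
  (\int[mu n]_x (1 + cos (a + dot z x))%:E)%E @[n --> \oo] -->
  (\int[nu]_x (1 + cos (a + dot z x))%:E)%E.

(** One third of [e] pays for smoothing under [nu], one for smoothing under [mu n], and one for the
    convergence of the smoothed integrals. The scale is fixed first, which is possible because the
    smoothing error does not depend on the measure. *)
Lemma lipschitz_liminf (g : V -> R) (C K : R) : (forall x, 0 <= g x) ->
  (forall x, g x <= C) -> 0 <= K -> (forall x y, g x <= g y + K * `|x - y|) ->
  forall e : R, 0 < e -> \forall n \near \oo,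
    (\int[nu]_x (g x)%:E <= \int[mu n]_x (g x)%:E + e%:E)%E.
Proof.
move=> g0 gC K0 gl e e0; have e3 : 0 < e / 3 by rewrite divr_gt0.
have mg : measurable_fun setT g by apply: continuous_measurable_cV; exact: continuous_lip gl.
have [m merr] : exists m : nat, (smoothing_error C K m.+1%:R^-1 <= (e / 3)%:E)%E.
  have /fine_cvgP[ufin /cvgrPdist_le /(_ _ e3) ule] := smoothing_error_cvg g0 gC K0.
  have [m _ h] := filterI ufin ule; exists m; have [un] := h m (leqnn m).
  by rewrite -(fineK un) lee_fin sub0r normrN ler_norml => /andP[].
have s0 : 0 < m.+1%:R^-1 :> R by rewrite invr_gt0.
have g0C x : 0 <= g x <= C by rewrite g0 gC.
apply: filterS (smoothing_liminf s0 cos_cvg mg g0C e3) => n hn.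
have [_ h1] := smoothing_bounds g0 gC K0 gl nu s0.
have [h2 _] := smoothing_bounds g0 gC K0 gl (mu n) s0.
have eE : e%:E = ((e / 3)%:E + (e / 3)%:E + (e / 3)%:E)%E :> \bar R by rewrite -!EFinD; congr EFin; field.
rewrite eE !addeA; apply: (le_trans h1); apply: leeD => //.
apply: (le_trans hn); rewrite leeD2r//; apply: (le_trans h2).
by rewrite leeD2l.
Qed.

(** Approximating from below makes the bound uniform in [n]: under [mu n] only [h k <= g] is used,
    and the quality of the approximation matters under [nu] alone. *)
Lemma continuous_liminf (g : V -> R) (C : R) : continuous g ->
  (forall x, 0 <= g x) -> (forall x, g x <= C) -> forall e : R, 0 < e ->
  \forall n \near \oo, (\int[nu]_x (g x)%:E <= \int[mu n]_x (g x)%:E + e%:E)%E.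
Proof.
move=> cg g0 gC e e0; have e2 : 0 < e / 2 by rewrite divr_gt0.
have mg := continuous_measurable_cV cg.
pose h k := inf_convolution g k.
have h0 k x : 0 <= h k x by exact: inf_convolution_ge0.
have hg k x : h k x <= g x by exact: inf_convolution_leg.
have hC k x : h k x <= C by exact: le_trans (hg k x) (gC x).
have hl k x y : h k x <= h k y + k%:R * `|x - y| by exact: inf_convolution_lip.
have mh k : measurable_fun setT (h k).
  by apply: continuous_measurable_cV; apply: continuous_lip (hl k).
have : (\int[nu]_x (h k x)%:E)%E @[k --> \oo] --> (\int[nu]_x (g x)%:E)%E.
  apply: (@dominated_cvg _ _ _ nu setT measurableT (fun k x => (h k x)%:E) _ (cst C%:E)) => //.
  - by move=> k; exact/measurable_EFinP.
  - move=> x _; apply: cvg_EFin; first exact: nearW.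
    by apply: inf_convolution_cvg => //; exact: cg.
  - exact: finite_measure_integrable_cst.
  - by move=> k x _; rewrite abse_EFin lee_fin ger0_norm.
have gfin : (\int[nu]_x (g x)%:E)%E \is a fin_num.
  apply: integrable_fin_num => //; apply: (bounded_integrable nu mg (C := C)) => x.
  by rewrite ger0_norm.
rewrite -(fineK gfin) => /(cvge_near_le e2) [k _ /(_ k (leqnn k)) hk].
apply: filterS (lipschitz_liminf (h0 k) (hC k) (ler0n _ k) (hl k) e2) => n hn.
have eE : e%:E = ((e / 2)%:E + (e / 2)%:E)%E :> \bar R by rewrite -EFinD; congr EFin; field.
rewrite eE addeA; apply: (le_trans hk); rewrite leeD2r//; apply: (le_trans hn).
rewrite leeD2r//; apply: ge0_le_integral => //.
- by move=> x _; rewrite lee_fin.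
- exact/measurable_EFinP.
- exact/measurable_EFinP.
- by move=> x _; rewrite lee_fin.
Qed.

Theorem cos_cvg_weak (g : V -> R) : continuous g ->
  (exists C : R, forall x, `|g x| <= C) ->
  \int[mu n]_x g x @[n --> \oo] --> \int[nu]_x g x.
Proof.
move=> cg [C gC]; apply/cvgrPdist_le => e e0.
have mg := continuous_measurable_cV cg.
have int (m : probability V R) : m.-integrable setT (EFin \o g).
  exact: (bounded_integrable m mg gC).
have gE (m : probability V R) (b : R) :
    (\int[m]_x (C + b * g x)%:E = (C + b * \int[m]_x g x)%:E)%E.
  under eq_integral => x _ do rewrite EFinD EFinM.
  rewrite integralD//; last 2 first.
  - exact: finite_measure_integrable_cst.
  - exact: (integrableZl measurableT b (int m)).
  rewrite integral_cst// [X in (_ * X)%E]probability_setT mule1.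
  rewrite (integralZl measurableT (int m)) EFinD EFinM /Rintegral fineK//.
  exact: (integrable_fin_num measurableT (int m)).
(* [C + g] and [C - g] are both nonnegative and bounded, so the one-sided estimate applied to each
   gives the two-sided limit. *)
have bound (b : R) : `|b| = 1 -> \forall n \near \oo,
    b * \int[nu]_x g x <= b * \int[mu n]_x g x + e.
  move=> b1; pose gb x := C + b * g x.
  have gb_le x : `|b * g x| <= C by rewrite normrM b1 mul1r.
  have gb0 x : 0 <= gb x by have := gb_le x; rewrite ler_norml /gb => /andP[]; lra.
  have gb2 x : gb x <= 2 * C by have := gb_le x; rewrite ler_norml /gb => /andP[]; lra.
  have cgb : continuous gb.
    move=> x; apply: (@continuous_comp _ _ _ g (fun y : R => C + b * y)); first exact: cg.
    by apply: cvgD; [exact: cvg_cst|apply: cvgM; [exact: cvg_cst|exact: cvg_id]].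
  apply: filterS (continuous_liminf cgb gb0 gb2 e0) => n.
  by rewrite /gb !gE -EFinD lee_fin -addrA lerD2l.
apply: filterS2 (bound 1 (normr1 _)) (bound (-1) (normrN1 _)) => n.
rewrite !mul1r !mulN1r ler_norml => h1 h2; apply/andP; split; lra.
Qed.

End weak_convergence.
End smoothing.

(** * The central sequence *)

Section central_limit.
Context (R : realType) (k : nat).
Notation V := 'cV[R]_k.+2.
Context (theta : V) (kappa : nat -> R) (f : R -> R).
Context (P : forall n : nat, probability (n.-tuple V) R).
Hypotheses (th1 : dot theta theta = 1) (kappa0 : forall n, 0 < kappa n).
Hypothesis koo : kappa n @[n --> \oo] --> +oo.
Hypothesis Ff : class_F f.
Hypothesis HP : forall n, hypothesis_law theta (kappa n) f (P n).

Let kap n := kappa n.+1.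
Let nv n := nu f kappa n.+1.
Let lam := concentration f kap.

Let kap_oo : kap n @[n --> \oo] --> +oo.
Proof. by rewrite /kap (cvg_shiftS kappa). Qed.

Let lam_gt0 : \forall n \near \oo, 0 < lam n.
Proof. exact: (concentration_gt0 Ff kap_oo). Qed.

Let mfk n : measurable_fun setT (fun s => f (kap n * s)).
Proof. by apply: measurable_class_F_comp => //; exact: measurable_funM. Qed.

Let fk0 n s : 0 <= f (kap n * s). Proof. exact/ltW/class_F_gt0. Qed.

Let D n (t : n.+1.-tuple V) : V := Delta f kappa theta t.

Let dot_D n (z : V) (t : n.+1.-tuple V) : dot z (D t) =
  \sum_(i < n.+1) (nv n)^-1 * n.+1%:R^-1 * dot (tnth t i) (projection theta z).
Proof. by rewrite /D /Delta dotZr dot_Gamma_mean mulrA mulr_sumr. Qed.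

Let measurable_D n : measurable_fun setT (@D n).
Proof.
apply: measurable_fun_mx => i j; rewrite (ord1 j).
rewrite (_ : (fun _ => _) = fun t : n.+1.-tuple V => dot (delta_mx i 0) (D t)).
  exact: measurable_dot_Gamma_mean.
apply/funext => t; rewrite dotE (bigD1 i)//= big1 ?addr0 => [|l li].
  by rewrite [delta_mx _ _ _ _]mxE !eqxx mul1r.
by rewrite [delta_mx _ _ _ _]mxE (negbTE li) mul0r.
Qed.

Section marginal.
Context (M : nat -> probability V R).
Hypothesis HM : forall n, has_density (M n) idfun (@surface_area R k.+2)
  (fun x => rot_const k (kap n) f * f (kap n * dot x theta)).
Context (z : V).

Let v := projection theta z.
Let thv : dot theta v = 0. Proof. exact: projection_orth. Qed.
Let Y n x := (nv n)^-1 * n.+1%:R^-1 * dot x v.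

Let c0 n : 0 <= rot_const k (kap n) f.
Proof. by apply: rot_const_ge0 => x; exact: class_F_gt0. Qed.

Let mY n : measurable_fun setT (Y n).
Proof. by apply: measurable_funM; [exact: measurable_cst|exact: measurable_dotl]. Qed.

Let symY n (F : R -> \bar R) : measurable_fun setT F -> (forall y, 0 <= F y)%E ->
  (\int[M n]_x F (Y n x) = \int[M n]_x F (- Y n x)%R)%E.
Proof.
move=> mF F0; pose F' (s y : R) := F ((nv n)^-1 * n.+1%:R^-1 * y).
have mF' : measurable_fun setT (fun w : measurableTypeR R * measurableTypeR R => F' w.1 w.2).
  apply: (measurableT_comp (g := fun w : measurableTypeR R * measurableTypeR R =>
    (nv n)^-1 * n.+1%:R^-1 * w.2) mF).
  by apply: measurable_funM; [exact: measurable_cst|exact: measurable_snd].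
have := integral_longitude_symmetric th1 (c0 n) (@fk0 n) (mfk n) (HM n) thv mF' (fun s y => F0 _).
by rewrite /F' /Y => ->; apply: eq_integral => x _; rewrite mulrN.
Qed.

(** With [N = n.+1], the second moment of [Y] is [dot v v / N] up to a factor tending to 1, and the
    fourth is of order [1 / N^2]. The cosine bounds therefore squeeze [N * (1 - E cos Y)] to
    [dot v v / 2], as [expr_cvg_expR] requires. *)
Lemma mean_cos_pow_cvg : mean_cos (M n) (Y n) ^+ n.+1 @[n --> \oo] -->
  expR (- (dot v v / 2)).
Proof.
have vv0 : 0 <= dot v v by exact: dot_ge0.
apply: expr_cvg_expR; first by rewrite divr_ge0.
  by move=> n; apply: mean_cos_norm.
pose W n := ((lam n)%:E * \int[M n]_x (`|1 - dot x theta ^+ 2|)%:E)%E.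
have /fine_cvgP[Wfin Wcvg] := deviation_cvg th1 c0 Ff kap_oo HM.
have [C HC] := sqr_deviation_bound th1 c0 Ff kap_oo HM.
pose w n := fine (W n); pose s n := dot v v / k.+1%:R * w n.
have s_cvg : s n / 2 @[n --> \oo] --> dot v v / 2.
  apply: cvgM; last exact: cvg_cst.
  rewrite -[X in _ --> X](_ : dot v v / k.+1%:R * k.+1%:R = _); last by rewrite divfK.
  by apply: cvgM; [exact: cvg_cst|exact: Wcvg].
have l_cvg : s n / 2 - dot v v ^+ 2 * C / 24 * n.+1%:R^-1 @[n --> \oo] --> dot v v / 2.
  rewrite -[X in _ --> X]subr0; apply: cvgB => //.
  by rewrite -(mulr0 (dot v v ^+ 2 * C / 24)); apply: cvgM; [exact: cvg_cst|exact: cvg_invS].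
apply: (squeeze_cvgr _ l_cvg s_cvg).
apply: filterS3 lam_gt0 Wfin HC => n l0 Wn Cn.
have [nv0 nvE] := nu_normalization l0.
have N0 : 0 < n.+1%:R :> R by [].
pose a := (nv n)^-1 * n.+1%:R^-1.
(* The scaling of the central sequence is matched to the concentration: [a^2 * N = lam], while
   [lam * E (1 - U^2)] has the limit [k.+1]. *)
have a2 : a ^+ 2 = lam n / n.+1%:R.
  rewrite /a; apply: (mulfI (x := (nv n) ^+ 2 * n.+1%:R ^+ 2)).
    by rewrite mulf_neq0// expf_neq0// lt0r_neq0.
  transitivity (1 : R).
    by rewrite -!exprMn mulrACA !divff ?lt0r_neq0// mulr1 expr1n.
  by rewrite -[LHS]nvE -/(nv n) -/kap -/lam; field; rewrite lt0r_neq0.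
have a20 : 0 <= a ^+ 2 by exact: sqr_ge0.
have I0 : (0 <= \int[M n]_x (`|1 - dot x theta ^+ 2|)%:E)%E by apply: integral_ge0 => x _; rewrite lee_fin.
have mX j : measurable_fun setT (fun x : V => (dot x v ^+ j)%:E).
  by apply/measurable_EFinP; apply: measurable_funX; exact: measurable_dotl.
have Y2 : (\int[M n]_x (Y n x ^+ 2)%:E = (s n / n.+1%:R)%:E)%E.
  transitivity (\int[M n]_x ((a ^+ 2)%:E * (dot x v ^+ 2)%:E))%E.
    by apply: eq_integral => x _; rewrite -EFinM -exprMn.
  rewrite ge0_integralZl//; last by move=> x _; rewrite lee_fin sqr_ge0.
  rewrite (second_moment th1 (c0 n) (@fk0 n) (mfk n) (HM n) thv) a2.
  rewrite muleA -EFinM (_ : lam n / n.+1%:R * (dot v v / k.+1%:R) =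
    dot v v / k.+1%:R / n.+1%:R * lam n); last by ring.
  rewrite EFinM -muleA -[((lam n)%:E * _)%E]/(W n).
  rewrite -/(W n) in Wn; rewrite -(fineK Wn) -EFinM; congr EFin.
  by rewrite /s -/(w n); ring.
have Y4 : (\int[M n]_x (Y n x ^+ 4)%:E <= (dot v v ^+ 2 * C / n.+1%:R ^+ 2)%:E)%E.
  have -> : (\int[M n]_x (Y n x ^+ 4)%:E = \int[M n]_x ((a ^+ 4)%:E * (dot x v ^+ 4)%:E))%E.
    by apply: eq_integral => x _; rewrite -EFinM -exprMn.
  have a4 : a ^+ 4 = (n.+1%:R ^+ 2)^-1 * lam n ^+ 2.
    by rewrite -[4%N]/(2 * 2)%N exprM a2 expr_div_n mulrC.
  rewrite ge0_integralZl//; last 2 first.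
  - by move=> x _; rewrite lee_fin -[4%N]/(2 * 2)%N exprM sqr_ge0.
  - by rewrite lee_fin -[4%N]/(2 * 2)%N exprM sqr_ge0.
  have n20 : 0 <= (n.+1%:R ^+ 2)^-1 :> R by rewrite invr_ge0 exprn_ge0.
  apply: (@le_trans _ _ ((a ^+ 4)%:E * ((dot v v ^+ 2)%:E *
      \int[M n]_x ((1 - dot x theta ^+ 2) ^+ 2)%:E))%E).
    apply: lee_wpmul2l; first by rewrite lee_fin -[4%N]/(2 * 2)%N exprM sqr_ge0.
    exact: (fourth_moment_le th1 (mfk n) (HM n) thv).
  rewrite a4 muleA -EFinM (_ : (n.+1%:R ^+ 2)^-1 * lam n ^+ 2 * dot v v ^+ 2 =
    dot v v ^+ 2 / n.+1%:R ^+ 2 * lam n ^+ 2); last by ring.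
  rewrite EFinM -muleA (_ : dot v v ^+ 2 * C / _ = dot v v ^+ 2 / n.+1%:R ^+ 2 * C); last by ring.
  by rewrite [leRHS]EFinM; apply: lee_wpmul2l => //; rewrite lee_fin mulr_ge0// sqr_ge0.
have /andP[h1 h2] := mean_cos_bounds (mY n) Y2 Y4.
apply/andP; split.
  rewrite -ler_pdivrMl//; apply: le_trans h1; rewrite le_eqVlt; apply/orP; left; apply/eqP.
  by field; rewrite lt0r_neq0.
rewrite -ler_pdivlMl//; apply: (le_trans h2); rewrite le_eqVlt; apply/orP; left; apply/eqP.
by field; rewrite lt0r_neq0.
Qed.

Lemma integral_sample_cos n (a : R) :
  (\int[@tuple_measure _ _ _ (M n) n.+1]_t (1 + cos (a + dot z (D t)))%:E =
   (1 + mean_cos (M n) (Y n) ^+ n.+1 * cos a)%:E)%E.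
Proof.
rewrite -(integral_tuple_cos (mY n) (@symY n)); apply: eq_integral => t _.
by rewrite dot_D.
Qed.

End marginal.

Theorem central_sequence_cvg :
  cvg_in_law P (fun n x => Delta f kappa theta x) (projected_gaussian theta).
Proof.
move=> g cg gC; rewrite -(cvg_shiftS (fun n => \int[P n]_x _)).
have [M [HM PM]] := sample_marginals HP.
pose mu n : probability V R := distribution (P n.+1) (mfun_Sub (mem_set (@measurable_D n))).
have mg := continuous_measurable_cV cg.
have -> : [sequence \int[P n.+1]_x g (Delta f kappa theta x)]_n = (fun n => \int[mu n]_x g x).
  apply/funext => n; rewrite /Rintegral; congr fine; rewrite integral_distribution//.
    exact/measurable_EFinP.
  have [C hC] := gC; apply: (bounded_integrable (P n.+1) (C := C)) => [|x]; last exact: hC.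
  by apply: (measurableT_comp mg); exact: measurable_D.
apply: (cos_cvg_weak _ cg gC) => z a.
have mcos : measurable_fun setT (fun x : V => (1 + cos (a + dot z x))%:E).
  apply/measurable_EFinP; apply: measurable_funD; first exact: measurable_cst.
  apply: (measurableT_comp (f := @cos R)); first exact: (continuous_measurable_fun (@continuous_cos R)).
  by apply: measurable_funD; [exact: measurable_cst|apply: measurable_fun_dot => //; exact: measurable_cst].
have cos0 (x : V) : (0 <= (1 + cos (a + dot z x))%:E)%E by rewrite lee_fin -lerBlDl sub0r cos_geN1.
rewrite integral_projected_gaussian_cos.
have -> : (fun n => \int[mu n]_x (1 + cos (a + dot z x))%:E)%E = (fun n =>
    (1 + mean_cos (M n) (fun x => (nv n)^-1 * n.+1%:R^-1 * dot x (projection theta z)) ^+ n.+1 * cos a)%:E).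
  apply/funext => n; rewrite ge0_integral_distribution// -(integral_sample_cos HM).
  exact: (integral_tuple_law (PM n)).
apply: cvg_EFin; first exact: nearW.
apply: cvgD; first exact: cvg_cst.
by apply: cvgM; [exact: mean_cos_pow_cvg|exact: cvg_cst].
Qed.

End central_limit.

Theorem theorem5p1 (R : realType) (p : nat) (theta : 'cV[R]_p)
    (kappa : nat -> R) (tau : nat -> 'cV[R]_p) (f : R -> R)
    (P Q : forall n : nat, probability (n.-tuple 'cV[R]_p) R) :
  (2 <= p)%N ->
  unit_sphere theta ->
  (forall n, 0 < kappa n) ->
  kappa n @[n --> \oo] --> +oo ->
  (exists M : R, forall n, cnorm (tau n) <= M) ->
  (forall n, unit_sphere (theta + nu f kappa n *: tau n)) ->
  class_F_LAN p kappa (fun n => cnorm (tau n)) f ->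
  (forall n, hypothesis_law theta (kappa n) f (P n)) ->
  (forall n,
     hypothesis_law (theta + nu f kappa n *: tau n) (kappa n) f (Q n)) ->
  cvg_prob0 P
    (fun n x => (log_lik_ratio (Q n) (P n) x
       - (dot (tau n) (Delta f kappa theta x)
          - 2^-1 * dot (tau n) (Gamma_mx theta *m tau n))%:E)%E) /\
  exists N : probability 'cV[R]_p R,
    multinormal 0 (Gamma_mx theta) N /\
    cvg_in_law P (fun n x => Delta f kappa theta x) N.
Proof.
(* Writing [p] as [k.+2] exposes the two coordinates, latitude and longitude, on which the
   tangent-normal law is built. *)
case: p theta tau P Q => [|[|k]]// theta tau P Q _ ths kappa0 koo taub taus FL HP HQ.
have th1 := unit_sphereE ths; have [Ff _ _] := FL; split.
  exact: log_lik_ratio_expansion.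
exists (projected_gaussian theta); split; first exact: multinormal_projected_gaussian.
exact: central_sequence_cvg.
Qed.
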